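(* Let $\mu,\nu$ be Borel probability measures on $\mathbb{R}$ with finite second moments and $\mu\leqslant_{\mathrm{cx}}\nu$. Let $(I_t^{(1)})_{t\in[T_0,T_1]}$ be a standard randomised arcade process satisfying the standing conditions (a)-(d) given in the context, and let $$\mathbf K_I(\pi)=\mathbb{E}\left[\int_{T_0}^{T_1}\frac{\bigl(X_1-M_t(X_0,I_t^{(1)})\bigr)^2\sqrt{H_1'(t)H_2(t)-H_1(t)H_2'(t)}}{H_1(T_1)H_2(t)-H_1(t)H_2(T_1)}\,\mathrm{d}t\right],\qquad \pi\in\mathcal M(\mu,\nu),$$ where $(X_0,X_1)\sim\pi$ and $M_t(X_0,I_t^{(1)})=\mathbb{E}_\pi[X_1\mid X_0,I_t^{(1)}]$. Then $$\sup_{\pi\in\mathcal M(\mu,\nu)}\mathbf K_I(\pi)=\max_{\pi\in\mathcal M(\mu,\nu)}\mathbf K_I(\pi),$$ i.e. the supremum is attained, and the maximiser $\pi_I^*=\operatorname{arg\,max}_{\pi\in\mathcal M(\mu,\nu)}\mathbf K_I(\pi)$ is unique.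
   Context: Fix $0\leqslant T_0<T_1<\infty$. For probability measures $\mu,\nu$ on $\mathbb{R}$ with finite first moment, $\mu\leqslant_{\mathrm{cx}}\nu$ (convex order) means $\int f\,\mathrm d\mu\leqslant\int f\,\mathrm d\nu$ for every convex $f:\mathbb{R}\to\mathbb{R}$. $\mathcal M(\mu,\nu)$ is the set of martingale couplings: Borel probability measures $\pi$ on $\mathbb{R}^2$ with finite first moment and marginals $\mu,\nu$ such that $(X_0,X_1)\sim\pi$ implies $\mathbb{E}[X_1\mid X_0]=X_0$. Interpolating coefficients on $\{T_0,T_1\}$ are continuous functions $f_0,f_1:[T_0,T_1]\to\mathbb{R}$ with $f_i(T_i)=1$ and $f_i(T_j)=0$ for $i\neq j$. Let $(D_t)_{t\in[T_0,T_1]}$ (the driver) be a sample-continuous process with $\mathbb{P}[D_t=0]<1$ for $t\in(T_0,T_1)$, and let $X=(X_0,X_1)$ be independent of $(D_t)$. An arcade process is $A_t^{(1)}=D_t-f_0(t)D_{T_0}-f_1(t)D_{T_1}$; an $X$-randomised arcade process ($X$-RAP) is $I_t^{(1)}=g_0(t)X_0+g_1(t)X_1+A_t^{(1)}$, with $f_0,f_1$ and $g_0,g_1$ interpolating coefficients. $(\mathcal F_t^I)$ is the filtration generated by $(I_t^{(1)})$. The one-arc filtered arcade martingale (FAM) is $M_t=\mathbb{E}[X_1\mid\mathcal F_t^I]$. Standing conditions on the RAP. The driver and the functions $f_0,f_1,g_0,g_1$ are fixed; only the coupling $\pi$ of $(X_0,X_1)$ varies. For every $\pi\in\mathcal M(\mu,\nu)$: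 (a) the driver is Gauss-Markov with covariance $K_D(x,y)=H_1(\min(x,y))H_2(\max(x,y))$ on $[T_0,T_1]^2$, where $H_1,H_2$ are differentiable almost everywhere (primes denote a.e. derivatives); (b) the RAP is standard: $f_0(t)=\frac{H_1(T_1)H_2(t)-H_1(t)H_2(T_1)}{H_1(T_1)H_2(T_0)-H_1(T_0)H_2(T_1)}$, $f_1(t)=\frac{H_1(t)H_2(T_0)-H_1(T_0)H_2(t)}{H_1(T_1)H_2(T_0)-H_1(T_0)H_2(T_1)}$ and $g_1=f_1$; in particular $\mathbb{E}[X_1\mid\mathcal F_t^I]=\mathbb{E}[X_1\mid X_0,I_t^{(1)}]$, so $M_t=M_t(X_0,I_t^{(1)})=\mathbb{E}_\pi[X_1\mid X_0,I_t^{(1)}]$; (c) $(I_t^{(1)})$ is a semimartingale; (d) $(t,x)\mapsto V(t,x,X_0)/K(t,x,X_0)$ is $C^2$ on $((T_0,T_1)\setminus N)\times\mathrm{Im}(I^{(1)})$ for a finite set $N\subset(T_0,T_1)$, where, with $f^{A_t^{(1)}}$ the density of $A_t^{(1)}$, $V(t,x,x_0)=\int y\,f^{A_t^{(1)}}(x-g_0(t)x_0-g_1(t)y)\,\mathrm dF^{X_1\mid X_0=x_0}(y)$ and $K(t,x,x_0)=\int f^{A_t^{(1)}}(x-g_0(t)x_0-g_1(t)y)\,\mathrm dF^{X_1\mid X_0=x_0}(y)$, so that $M_t=V(t,I_t^{(1)},X_0)/K(t,I_t^{(1)},X_0)$. Example: $D$ a Brownian motion ($H_1(t)=t$, $H_2=1$),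 $f_0(t)=g_0(t)=\frac{T_1-t}{T_1-T_0}$, $f_1(t)=g_1(t)=\frac{t-T_0}{T_1-T_0}$, in which case the weight in $\mathbf K_I$ is $1/(T_1-t)$. Known fact recalled by the paper (from earlier work): under these conditions there is a standard Brownian motion $(W_t)_{t\in[T_0,T_1]}$ on $[T_0,T_1]$, adapted to $(\mathcal F_t^I)$ (the innovations process), with $M_t=X_0+\int_{T_0}^t\frac{\operatorname{Var}[X_1\mid X_0,I_s^{(1)}]\sqrt{H_1'(s)H_2(s)-H_1(s)H_2'(s)}}{H_1(T_1)H_2(s)-H_1(s)H_2(T_1)}\,\mathrm dW_s$ for $t\in(T_0,T_1)$. *)

(* Defs.v *)
From HB Require Import structures.
From mathcomp Require Import all_boot all_order all_algebra.
From mathcomp Require Import all_classical all_reals all_analysis.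

Set Implicit Arguments.
Unset Strict Implicit.
Unset Printing Implicit Defensive.

Import Order.TTheory GRing.Theory Num.Theory.
Import numFieldNormedType.Exports.

Local Open Scope classical_set_scope.
Local Open Scope ring_scope.

Definition sigma_of d d' (T : measurableType d) (T' : measurableType d')
    (Z : T -> T') : set (set T) :=
  preimage_set_system [set: T] Z measurable.

Definition sub_measurable (R : realType) (T : Type) (G : set (set T))
    (Y : T -> R) : Prop :=
  forall B : set R, measurable B -> G (Y @^-1` B).

(* [Y] is a version of E[Z | G], for [G] a sub-sigma-algebra. *)
Definition is_cond_exp (R : realType) d (T : measurableType d)
    (P : probability T R) (G : set (set T)) (Z Y : T -> R) : Prop :=
  [/\ sub_measurable G Y,
      P.-integrable [set: T] (EFin \o Z),
      P.-integrable [set: T] (EFin \o Y) &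
      forall A, G A ->
        (\int[P]_(w in A) (Y w)%:E = \int[P]_(w in A) (Z w)%:E)%E].

Definition finite_second_moment (R : realType) (mu : probability R R) : Prop :=
  mu.-integrable [set: R] (fun x => (x ^+ 2)%:E).

(* A convex function is bounded below by an affine one, so both integrals are
   well defined in ]-oo, +oo] when the first moments are finite. *)
Definition convex_order (R : realType) (mu nu : probability R R) : Prop :=
  forall f : R^o -> R^o, convex_function [set: R^o] f ->
    (\int[mu]_x (f x)%:E <= \int[nu]_x (f x)%:E)%E.

Definition martingale_coupling (R : realType) (mu nu : probability R R)
    (pi : probability (R * R)%type R) : Prop :=
  [/\ forall A, measurable A -> pi (fst @^-1` A) = mu A,
      forall B, measurable B -> pi (snd @^-1` B) = nu B,
      pi.-integrable [set: R * R] (fun z => (`|z.1| + `|z.2|)%:E) &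
      is_cond_exp pi (sigma_of (fst : R * R -> R)) snd fst].

(** Processes indexed by the interval [T0, T1] are functions on [R]; their
    values outside of [T0, T1] are irrelevant. *)

Definition natural_filtration (R : realType) (T : Type) (T0 : R)
    (X : R -> T -> R) (t : R) : set (set T) :=
  <<s [set A | exists s B,
         [/\ T0 <= s <= t, measurable B & A = X s @^-1` B]] >>.

(* Usual augmentation: completion by the measurable null sets and
   right-continuity, i.e. the intersection over s > t of the completed F s. At
   t = T1, only F T1 occurs. *)
Definition augmentation (R : realType) d (T : measurableType d)
    (P : probability T R) (T1 : R) (F : R -> set (set T)) (t : R) :
    set (set T) :=
  [set A | measurable A /\
     forall s, t < s -> exists2 B, F (Num.min s T1) B &
       P.-negligible ((A `\` B) `|` (B `\` A))].

Definition sample_continuous (R : realType) (T : Type) (T0 T1 : R)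
    (X : R -> T -> R) : Prop :=
  forall w, {within `[T0, T1], continuous (fun t => X t w)}.

Definition cadlag (R : realType) (T0 T1 : R) (f : R -> R) : Prop :=
  (forall t, T0 <= t < T1 -> f s @[s --> t^'+] --> f t) /\
  (forall t, T0 < t <= T1 -> cvg (f s @[s --> t^'-])).

Definition adapted (R : realType) (T : Type) (T0 T1 : R)
    (F : R -> set (set T)) (X : R -> T -> R) : Prop :=
  forall t, T0 <= t <= T1 -> sub_measurable (F t) (X t).

Definition martingale (R : realType) d (T : measurableType d)
    (P : probability T R) (T0 T1 : R) (F : R -> set (set T))
    (X : R -> T -> R) : Prop :=
  forall s t, T0 <= s -> s <= t -> t <= T1 ->
    is_cond_exp P (F s) (X t) (X s).

Definition stopping_time (R : realType) (T : Type) (T0 T1 : R)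
    (F : R -> set (set T)) (tau : T -> R) : Prop :=
  (forall w, T0 <= tau w <= T1) /\
  (forall t, T0 <= t <= T1 -> F t [set w | tau w <= t]).

Definition local_martingale (R : realType) d (T : measurableType d)
    (P : probability T R) (T0 T1 : R) (F : R -> set (set T))
    (X : R -> T -> R) : Prop :=
  [/\ adapted T0 T1 F X,
      forall w, cadlag T0 T1 (fun t => X t w) &
      exists tau : nat -> T -> R,
        [/\ forall n, stopping_time T0 T1 F (tau n),
            forall w, {homo (fun n => tau n w) : m n / (m <= n)%N >-> m <= n},
            {ae P, forall w, exists n, tau n w = T1} &
            forall n, martingale P T0 T1 F
              (fun t w => X (Num.min t (tau n w)) w - X T0 w)]].

Definition finite_variation (R : realType) (T : Type) (T0 T1 : R)
    (F : R -> set (set T)) (X : R -> T -> R) : Prop :=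
  [/\ adapted T0 T1 F X,
      forall w, cadlag T0 T1 (fun t => X t w) &
      forall w, bounded_variation T0 T1 (fun t => X t w)].

(* Semimartingale on [T0, T1] with respect to the augmentation of its own
   filtration. *)
Definition semimartingale (R : realType) d (T : measurableType d)
    (P : probability T R) (T0 T1 : R) (X : R -> T -> R) : Prop :=
  let F := augmentation P T1 (natural_filtration T0 X) in
  exists L V : R -> T -> R,
    [/\ local_martingale P T0 T1 F L,
        finite_variation T0 T1 F V &
        {ae P, forall w, forall t, T0 <= t <= T1 -> X t w = L t w + V t w}].

(* Possibly degenerate normal law; [normal_prob m 0] is not [dirac m] in the
   library. *)
Definition gaussian_rv (R : realType) d (T : measurableType d)
    (P : probability T R) (X : T -> R) : Prop :=
  exists m s : R, forall B, measurable B ->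
    P (X @^-1` B) = if s == 0 then \d_m B else normal_prob m s B.

Definition gaussian_process (R : realType) d (T : measurableType d)
    (P : probability T R) (T0 T1 : R) (X : R -> T -> R) : Prop :=
  (forall t, T0 <= t <= T1 -> measurable_fun [set: T] (X t)) /\
  (forall n (c t : 'I_n -> R), (forall i, T0 <= t i <= T1) ->
    gaussian_rv P (fun w => \sum_(i < n) c i * X (t i) w)).

Definition markov_process (R : realType) d (T : measurableType d)
    (P : probability T R) (T0 T1 : R) (X : R -> T -> R) : Prop :=
  forall s t (B : set R), T0 <= s -> s <= t -> t <= T1 -> measurable B ->
    exists Y, is_cond_exp P (sigma_of (X s)) (\1_B \o X t) Y /\
              is_cond_exp P (natural_filtration T0 X s) (\1_B \o X t) Y.

Definition gauss_markov_driver (R : realType) d (T : measurableType d)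
    (P : probability T R) (T0 T1 : R) (H1 H2 : R -> R)
    (D : R -> T -> R) : Prop :=
  [/\ gaussian_process P T0 T1 D,
      markov_process P T0 T1 D,
      forall x y, T0 <= x <= T1 -> T0 <= y <= T1 ->
        covariance P (D x) (D y) =
          (H1 (Num.min x y) * H2 (Num.max x y))%:E &
      {ae lebesgue_measure, forall t : R, T0 < t < T1 ->
        derivable (H1 : R^o -> R^o) t 1 /\ derivable (H2 : R^o -> R^o) t 1}].

Definition interpolating (R : realType) (T0 T1 : R) (f0 f1 : R -> R) : Prop :=
  [/\ {within `[T0, T1], continuous f0}, {within `[T0, T1], continuous f1},
      f0 T0 = 1 /\ f0 T1 = 0 & f1 T0 = 0 /\ f1 T1 = 1].

Definition standard_coefficients (R : realType) (T0 T1 : R) (H1 H2 : R -> R)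
    (f0 f1 g1 : R -> R) : Prop :=
  forall t, T0 <= t <= T1 ->
    [/\ f0 t = (H1 T1 * H2 t - H1 t * H2 T1) /
               (H1 T1 * H2 T0 - H1 T0 * H2 T1),
        f1 t = (H1 t * H2 T0 - H1 T0 * H2 t) /
               (H1 T1 * H2 T0 - H1 T0 * H2 T1) &
        g1 t = f1 t].

Definition arcade (R : realType) (T : Type) (T0 T1 : R) (f0 f1 : R -> R)
    (D : R -> T -> R) (t : R) (w : T) : R :=
  D t w - f0 t * D T0 w - f1 t * D T1 w.

(* The randomised arcade process on the product of the sample space of the
   driver and R * R: under [(P \x pi)%E], the coordinates (X0, X1) have law
   [pi] and are independent of the driver. *)
Definition rap (R : realType) (T : Type) (T0 T1 : R) (f0 f1 g0 g1 : R -> R)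
    (D : R -> T -> R) (t : R) (w : T * (R * R)) : R :=
  g0 t * w.2.1 + g1 t * w.2.2 + arcade T0 T1 f0 f1 D t w.1.

Definition process_image (R : realType) (T : Type) (T0 T1 : R)
    (X : R -> T -> R) : set R :=
  [set x | exists t w, T0 <= t <= T1 /\ X t w = x].

(* The continuous version of the density is the one that enters V and K, which
   depend on its pointwise values. *)
Definition continuous_density (R : realType) d (T : measurableType d)
    (P : probability T R) (X : T -> R) (f : R -> R) : Prop :=
  [/\ continuous f, forall x, 0 <= f x &
      forall B, measurable B ->
        P (X @^-1` B) = (\int[lebesgue_measure]_(x in B) (f x)%:E)%E].

(* [k x0] is the conditional law of the second coordinate given that the first
   one equals [x0]. *)
Definition conditional_law (R : realType) (mu : probability R R)
    (pi : probability (R * R)%type R) (k : R.-pker R ~> R) : Prop :=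
  forall A B : set R, measurable A -> measurable B ->
    pi (A `*` B) = (\int[mu]_(x in A) k x B)%E.

Definition rap_V (R : realType) (g0 g1 : R -> R) (fA : R -> R -> R)
    (k : R.-pker R ~> R) (t x x0 : R) : R :=
  \int[k x0]_y (y * fA t (x - g0 t * x0 - g1 t * y)).

Definition rap_K (R : realType) (g0 g1 : R -> R) (fA : R -> R -> R)
    (k : R.-pker R ~> R) (t x x0 : R) : R :=
  \int[k x0]_y (fA t (x - g0 t * x0 - g1 t * y)).

Definition C1_on (R : realType) (S : set (R * R)) (F : R * R -> R^o) : Prop :=
  forall p, S p ->
    [/\ derivable F p (1, 0), derivable F p (0, 1),
        {for p, continuous ('D_(1, 0) F)} &
        {for p, continuous ('D_(0, 1) F)}].

(* Used on open sets [S] only. *)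
Definition C2_on (R : realType) (S : set (R * R)) (F : R * R -> R^o) : Prop :=
  [/\ C1_on S F, C1_on S ('D_(1, 0) F) & C1_on S ('D_(0, 1) F)].

Definition regular_posterior_mean (R : realType) (T : Type) (T0 T1 : R)
    (g0 g1 : R -> R) (fA : R -> R -> R) (I : R -> T -> R)
    (mu : probability R R) (pi : probability (R * R)%type R) : Prop :=
  exists2 k : R.-pker R ~> R, conditional_law mu pi k &
  exists N : set R,
    [/\ finite_set N, N `<=` `]T0, T1[ &
        {ae mu, forall x0 : R,
          C2_on ((`]T0, T1[ `\` N) `*` process_image T0 T1 I)
            (fun p => rap_V g0 g1 fA k p.1 p.2 x0 /
                      rap_K g0 g1 fA k p.1 p.2 x0)}].

(* [(t, x0, x) |-> M t x0 x] is a jointly measurable function such that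
   [M t X0 (I t)] is a version of E[X1 | X0, I t] when (X0, X1) has law [pi]. *)
Definition posterior_mean_version (R : realType) d (T : measurableType d)
    (P : probability T R) (T0 T1 : R) (I : R -> T * (R * R) -> R)
    (pi : probability (R * R)%type R) (M : R -> R -> R -> R) : Prop :=
  measurable_fun [set: R * (R * R)] (fun z => M z.1 z.2.1 z.2.2) /\
  (forall t, T0 <= t <= T1 ->
    is_cond_exp (P \x pi)%E (sigma_of (fun w : T * (R * R) => (w.2.1, I t w)))
      (fun w => w.2.2) (fun w => M t w.2.1 (I t w))).

Definition K_functional (R : realType) d (T : measurableType d)
    (P : probability T R) (T0 T1 : R) (H1 H2 : R -> R)
    (I : R -> T * (R * R) -> R) (M : R -> R -> R -> R)
    (pi : probability (R * R)%type R) : \bar R :=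
  (\int[(P \x pi)]_w \int[lebesgue_measure]_(t in `[T0, T1])
    (((w.2.2 - M t w.2.1 (I t w)) ^+ 2 *
      Num.sqrt (derive1 (H1 : R^o -> R^o) t * H2 t -
                H1 t * derive1 (H2 : R^o -> R^o) t) /
      (H1 T1 * H2 t - H1 t * H2 T1))%R)%:E)%E.

(* Main.v *)
(* For a fixed time t, the Bayes risk E[(X1 - M_t)^2] is the infimum over the
   estimators phi(X0, I_t) of functionals that are linear in pi, so K_I is
   concave in pi. The couplings whose value is within 1/n of the supremum form a
   decreasing sequence of sets closed under midpoints; the parallelogram identity
   for conditional distribution functions yields a maximising sequence whose
   conditional quantile functions converge almost everywhere. The limit is a
   martingale coupling, and K_I is upper semicontinuous along the sequence.
   Martingale couplings exist by Strassen's theorem, which is obtained by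
   exchanging mass between quantiles of nu.

   For two maximisers, the Bayes risk at the midpoint exceeds the average of both
   risks by mean square distances of posterior means. Given X0 = x, the posterior
   mean is the mean of the conditional law of X1 tilted by
   exp(tau y - rho(t) y^2), with rho = f1 / (2 c f0) and tau affine in I_t. At a
   time of positive weight the tilted means of the conditional laws of both
   couplings therefore agree for all tau, and determine these laws by injectivity
   of the Laplace transform. If the weight vanishes almost everywhere, the
   continuous increasing function rho has derivative 0 almost everywhere. In that
   case the regularity condition (d), applied to both maximisers and to their
   midpoint, shows that unless the conditional laws agree, rho is locally
   constant; but rho is positive and tends to 0 at T0. *)
Require Import Defs.
From HB Require Import structures.
From mathcomp Require Import all_boot all_order all_algebra.
From mathcomp Require Import all_classical all_reals all_analysis.
From mathcomp Require Import ring lra measurable_realfun.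
Set Implicit Arguments.
Unset Strict Implicit.
Unset Printing Implicit Defensive.
Import Order.TTheory GRing.Theory Num.Theory.
Import numFieldNormedType.Exports.
Local Open Scope classical_set_scope.
Local Open Scope ring_scope.

(** * Quantile functions and Strassen's theorem *)

Section finite_measures.
Context {R : realType}.

(** Weak compactness of the set of couplings is too little: estimators [phi (X0, I t)] are merely
    measurable in [X0], so the risk is only controlled along sequences whose conditional laws given
    [X0 = x] converge for almost every [x]. All couplings are therefore realised as [(x, Q (x, u))]
    on the single space [mu \x unif]; there the second coordinate always has law [nu], which settles
    uniform integrability. The weight may blow up at [T1], where [f0] vanishes. The risk is at most
    a constant times [f0 / (f0 + f1)], and the product with the weight is integrable because it is
    controlled by the square root of the derivative of a bounded monotone function. The hard case of
    uniqueness is a weight that vanishes almost everywhere, the clock [f1 / f0] being then of Cantor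
    type. Every coupling is then a maximiser, comparing values gives nothing, and uniqueness amounts
    to there being only one martingale coupling. The smoothness in (d) is what remains to constrain
    the conditional laws. *)

Lemma measure_eq_ray (m1 m2 : {measure set R -> \bar R}) :
  (m1 setT < +oo)%E -> m1 setT = m2 setT ->
  (forall y, m1 `]-oo, y]%classic = m2 `]-oo, y]%classic) ->
  forall A, measurable A -> m1 A = m2 A.
Proof.
move=> m1oo m12T m12 A mA.
have mC (m : {measure set R -> \bar R}) y : (m setT < +oo)%E ->
    m `]y, +oo[%classic = (m setT - m `]-oo, y]%classic)%E.
  move=> moo.
  rewrite -(setCitvl (BRight y)) -setTD measureD//= setTI//.
have m1le y : (m1 `]y, +oo[%classic < +oo)%E.
  by apply: le_lt_trans m1oo; apply: le_measure; rewrite ?inE.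
apply: (measure_unique (@RGenOInfty.G R) (fun n => `](- n%:R)%R, +oo[%classic)) => //.
- exact: RGenOInfty.measurableE.
- move=> _ _ [x ->] [y ->]; exists (Num.max x y).
  by apply/seteqP; split => z /=; rewrite !in_itv/= !andbT gt_max => /andP.
- by move=> n; exists (- n%:R).
- rewrite -subTset => x _; exists (Num.bound `|x|) => //=.
  rewrite in_itv/= andbT ltrNl (le_lt_trans _ (archi_boundP (normr_ge0 x)))//.
  by rewrite -normrN ler_norm.
- by move=> _ [x ->]; rewrite !mC -?m12T// m12.
Qed.

Lemma measure2_eq_rect d1 d2 (X : measurableType d1) (Y : measurableType d2)
    (m1 m2 : {measure set (X * Y) -> \bar R}) :
  (m1 setT < +oo)%E ->
  (forall A B, measurable A -> measurable B -> m1 (A `*` B) = m2 (A `*` B)) ->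
  forall C, measurable C -> m1 C = m2 C.
Proof.
move=> m1oo m12 C mC.
apply: (measure_unique [set A `*` B | A in measurable & B in measurable]
   (fun=> setT)) => //.
- exact: measurable_prod_measurableType.
- move=> _ _ [A mA [B mB <-]] [A' mA' [B' mB' <-]].
  exists (A `&` A'); first exact: measurableI.
  exists (B `&` B'); first exact: measurableI.
  by rewrite setXI.
- by move=> _; exists setT => //; exists setT => //; rewrite setXTT.
- by rewrite bigcup_const.
- by move=> _ [A mA [B mB <-]]; exact: m12.
Qed.

End finite_measures.

Section quantile.
Context {R : realType}.
Implicit Types F : R -> R.

Definition is_cdf F : Prop :=
  [/\ {homo F : x y / x <= y}, right_continuous F, (forall y, 0 <= F y <= 1),
      forall u, u < 1 -> exists y, u < F y &
      forall u, 0 < u -> exists y, F y < u].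

(** Outside []0, 1[] the set may be empty or unbounded below. The default value 0 there only
    concerns a null set of the uniform law. *)
Definition quantile F (u : R) : R :=
  if 0 < u < 1 then inf [set y | u <= F y] else 0.

(** Right continuity makes the infimum a minimum. This Galois connection between [quantile F] and
    [F] is what most later facts about quantiles come from. *)
Lemma quantile_le F u y : is_cdf F -> 0 < u < 1 ->
  (quantile F u <= y) = (u <= F y).
Proof.
move=> [Fnd Frc F01 F1 F0] /[dup] u01 /andP[u0 u1]; rewrite /quantile u01.
set S := [set y | u <= F y].
have S0 : S !=set0 by have [z uz] := F1 _ u1; exists z; rewrite /S/= ltW.
have [z0 Fz0] := F0 _ u0.
have Slb z : S z -> z0 <= z.
  by rewrite /S/= => uz; rewrite leNgt; apply/negP => /ltW/Fnd; lra.
have Shas : has_inf S by split => //; exists z0 => z /Slb.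
apply/idP/idP; last by move=> uy; apply: ge_inf => //; exists z0 => z /Slb.
move=> qy; apply: le_trans (Fnd _ _ qy).
have : F x @[x --> (inf S)^'+] --> F (inf S) by exact: Frc.
move=> /cvgr_ge cF; rewrite leNgt; apply/negP => Fq.
have /cvgr_lt : F x @[x --> (inf S)^'+] --> F (inf S) by exact: Frc.
move=> /(_ _ Fq) Fx.
have : \forall x \near (inf S)^'+, u <= F x.
  near=> x.
  have [|z Sz zx] := @inf_adherent _ S (x - inf S) _ Shas.
    by rewrite subr_gt0; near: x; exact: nbhs_right_gt.
  rewrite addrC subrK in zx.
  by apply: le_trans (Fnd _ _ (ltW zx)).
move=> uF; near ((inf S)^'+) => x.
have : u <= F x by near: x.
by rewrite leNgt => /negP; apply; near: x.
Unshelve. all: by end_near. Qed.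

Lemma quantile_nd F u v : is_cdf F -> 0 < u -> u <= v -> v < 1 ->
  quantile F u <= quantile F v.
Proof.
move=> cF u0 uv v1; rewrite quantile_le//; last by rewrite u0 (le_lt_trans uv).
apply: (le_trans uv); rewrite -quantile_le// v1 andbT; exact: lt_le_trans uv.
Qed.

(* [uniform_prob] lives on [measurableTypeR R], whose display differs from
   the one of [R]. *)
Definition unif : set R -> \bar R := uniform_prob (@ltr01 R).

Let unif0 : unif set0 = 0%E. Proof. exact: measure0. Qed.
Let unif_ge0 A : (0 <= unif A)%E. Proof. exact: measure_ge0. Qed.
Let unif_semi_sigma_additive : semi_sigma_additive unif.
Proof. exact: (@measure_semi_sigma_additive _ _ _ (uniform_prob (@ltr01 R))). Qed.
HB.instance Definition _ := isMeasure.Build _ _ _ unif unif0 unif_ge0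
  unif_semi_sigma_additive.
Let unifT : unif setT = 1%E.
Proof. exact: (@probability_setT _ _ _ (uniform_prob (@ltr01 R))). Qed.
HB.instance Definition _ := Measure_isProbability.Build _ _ _ unif unifT.

Lemma unifE A : measurable A -> unif A = lebesgue_measure (A `&` `[0%R, 1%R]).
Proof.
move=> mA.
rewrite /unif /uniform_prob integral_uniform_pdf (eq_integral (cst 1%E)).
  by rewrite integral_cst ?mul1e//; exact: measurableI.
by move=> x /[!inE] -[_ /=]; rewrite in_itv/= /uniform_pdf => ->; rewrite subr0 invr1.
Qed.

(** By the Galois connection, [quantile (F t) u > r] means [F t r < u], so joint measurability only
    needs measurability of [F] in [t] at each fixed level. *)
Lemma measurable_quantile d (T : measurableType d) (F : T -> R -> R) :
  (forall t, is_cdf (F t)) -> (forall y, measurable_fun setT (F ^~ y)) ->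
  measurable_fun setT (fun z : T * R => quantile (F z.1) z.2).
Proof.
move=> cF mF; apply: (measurability (@RGenOInfty.G R)) => [|_ [_ [r ->] <-]].
  exact: RGenOInfty.measurableE.
rewrite setTI.
have -> : (fun z : T * R => quantile (F z.1) z.2) @^-1` `]r, +oo[%classic =
   (fun z : T * R => if (0 < z.2) && (z.2 < 1) then F z.1 r < z.2 else r < 0)
     @^-1` [set true].
  apply/seteqP; split => z /=; rewrite in_itv/= andbT.
    case: ifPn => u01; first by rewrite ltNge quantile_le// -ltNge.
    by rewrite /quantile (negbTE u01).
  case: ifPn => u01; first by rewrite [X in _ -> is_true X]ltNge quantile_le// -ltNge.
  by rewrite /quantile (negbTE u01).
rewrite -[X in measurable X]setTI; apply: (_ : measurable_fun setT _) => //.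
apply: measurable_fun_ifT => //.
- by apply: measurable_and; apply: measurable_fun_ltr.
- by apply: measurable_fun_ltr => //; exact: measurableT_comp (mF r) measurable_fst.
Qed.

Lemma measurable_quantile1 F : is_cdf F -> measurable_fun setT (quantile F).
Proof.
move=> cF.
have := @measurable_quantile _ unit (fun=> F) (fun=> cF) (fun=> measurable_cst _).
move=> h; exact: (measurableT_comp h (pair1_measurable tt)).
Qed.

Lemma unif_quantile_le F y : is_cdf F ->
  measurable [set u | quantile F u <= y] /\
  unif [set u | quantile F u <= y] = (F y)%:E.
Proof.
move=> cF.
have mq : measurable_fun setT (quantile F).
  exact: measurable_quantile1.
have mS : measurable [set u | quantile F u <= y].
  by rewrite -[X in measurable X]setTI; apply: (measurable_fun_ler mq (measurable_cst y) _ (Y := [set true])).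
split => //; rewrite unifE//.
have /andP[F0 F1] : 0 <= F y <= 1 by case: cF.
apply/eqP; rewrite eq_le; apply/andP; split.
  (* At [u = 1] the quantile is the default 0, which may be below [y]; the extra point 1 is null. *)
  apply: (@le_trans _ _ (lebesgue_measure (`[0, F y]%classic `|` [set 1]))).
    apply: le_measure; rewrite ?inE//=.
    - exact: measurableI.
    - exact: measurableU.
    move=> u [/= qu]; rewrite in_itv/= => /andP[u0 u1].
    have [->|u1'] := eqVneq u 1; first by right.
    left; rewrite in_itv/= u0/=.
    move: u0; rewrite le_eqVlt => /predU1P[<-//|u0].
    by rewrite -quantile_le// u0 lt_neqAle u1'.
  apply: (le_trans (measureU2 _ _ _)) => //=.
  by rewrite lebesgue_measure_set1 adde0 lebesgue_measure_itv/= lte_fin; case: ifP; rewrite ?sube0// lee_fin.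
apply: (@le_trans _ _ (lebesgue_measure `]0, F y[%classic)).
  by rewrite lebesgue_measure_itv/= lte_fin; case: ifPn; rewrite ?sube0// -leNgt.
apply: le_measure; rewrite ?inE//=; first exact: measurableI.
move=> u /=; rewrite in_itv/= => /andP[u0 u1]; split.
  by rewrite quantile_le ?u0 ?(lt_le_trans u1)// ltW.
by rewrite /= in_itv/= ltW//= ltW// (lt_le_trans u1).
Qed.

Definition cdfr (m : probability R R) (y : R) : R := fine (m `]-oo, y]%classic).

Lemma cdfrE (m : probability R R) y : (cdfr m y)%:E = m `]-oo, y]%classic.
Proof. by rewrite fineK// fin_num_measure. Qed.

Lemma is_cdf_cdfr (m : probability R R) : is_cdf (cdfr m).
Proof.
pose X : {RV m >-> R} := HB.pack (@id R) (isMeasurableFun.Build _ _ _ _ _ (@measurable_id _ R setT)).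
have XE y : cdfr m y = fine (cdf X y) by [].
have Xfin y : cdf X y \is a fin_num by rewrite fin_num_measure.
split.
- by move=> x y xy; rewrite !XE fine_le// cdf_nondecreasing.
- move=> a; have := @cdf_right_continuous _ _ _ m X a.
  have -> : cdf X a = (cdfr m a)%:E by rewrite XE fineK.
  by move=> /fine_cvg.
- move=> y; rewrite XE; apply/andP; split; first exact: fine_ge0.
  by rewrite -lee_fin fineK// cdf_le1.
- move=> u u1.
  have /fine_cvg/cvgr_gt/(_ _ u1) h : cdf X @ +oo --> 1%:E by exact: cvg_cdfy1.
  by have [y uy] := filter_ex h; exists y; rewrite XE.
- move=> u u1.
  have /fine_cvg/cvgr_lt/(_ _ u1) h : cdf X @ -oo --> 0%:E by exact: cvg_cdfNy0.
  by have [y uy] := filter_ex h; exists y; rewrite XE.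
Qed.

Lemma law_quantile (m : probability R R) A : measurable A ->
  unif (quantile (cdfr m) @^-1` A) = m A.
Proof.
move=> mA; have cF := is_cdf_cdfr m.
have mq := measurable_quantile1 cF.
pose q : {mfun R >-> R} := HB.pack (quantile (cdfr m)) (isMeasurableFun.Build _ _ _ _ _ mq).
rewrite -/(pushforward unif q A).
apply: measure_eq_ray => //.
- by change (unif (q @^-1` setT) < +oo)%E; rewrite preimage_setT probability_setT ltry.
- by change (unif (q @^-1` setT) = m setT); rewrite preimage_setT !probability_setT.
- move=> y; change (unif (q @^-1` `]-oo, y]) = m `]-oo, y]%classic).
  rewrite -(cdfrE m y) -(unif_quantile_le y cF).2.
  by congr (unif _); apply/seteqP; split => u /=; rewrite in_itv.
Qed.

End quantile.

(** * Image measures and measures with a density *)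

Section laws.
Context d1 d2 {X : measurableType d1} {Y : measurableType d2} {R : realType}.
Variables (m : {measure set X -> \bar R}) (m' : {measure set Y -> \bar R}).
Variable Z : X -> Y.
Hypotheses (mZ : measurable_fun setT Z)
  (Zm : forall A, measurable A -> m' A = m (Z @^-1` A)).

Lemma ge0_integral_law (f : Y -> \bar R) :
  measurable_fun setT f -> (forall y, 0 <= f y)%E ->
  (\int[m']_y f y = \int[m]_x f (Z x))%E.
Proof.
move=> mf f0; rewrite (eq_measure_integral (pushforward m Z))//=.
  by rewrite ge0_integral_pushforward.
by move=> A mA _; rewrite Zm.
Qed.

Lemma integral_law (f : Y -> \bar R) : measurable_fun setT f ->
  (\int[m']_y f y = \int[m]_x f (Z x))%E.
Proof.
move=> mf; rewrite integralE -[RHS]/(\int[m]_x (f \o Z) x)%E [RHS]integralE.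
under [X in _ = (X - _)%E]eq_integral do rewrite funepos_comp/=.
under [X in _ = (_ - X)%E]eq_integral do rewrite funeneg_comp/=.
have ? := measurable_funepos mf; have ? := measurable_funeneg mf.
by rewrite ge0_integral_law// [X in (_ - X)%E = _]ge0_integral_law.
Qed.

Lemma integrable_law (f : Y -> \bar R) : measurable_fun setT f ->
  m'.-integrable setT f <-> m.-integrable setT (f \o Z).
Proof.
move=> mf; split=> /integrableP[mf' foo]; apply/integrableP; split => //.
- exact: measurableT_comp.
- move: foo; rewrite ge0_integral_law//.
  exact: measurableT_comp.
- by rewrite ge0_integral_law//; exact: measurableT_comp.
Qed.

End laws.

Section law_def.
Context d1 d2 {X : measurableType d1} {Y : measurableType d2} {R : realType}.

Definition law (P : probability X R) (Z : X -> Y) (mZ : measurable_fun setT Z) :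
    probability Y R :=
  distribution P (HB.pack Z (isMeasurableFun.Build _ _ _ _ _ mZ) : {mfun X >-> Y}).

Lemma lawE P Z mZ A : @law P Z mZ A = P (Z @^-1` A).
Proof. by []. Qed.

End law_def.

Section mdensity.
Context d {T : measurableType d} {R : realType} (m : {measure set T -> \bar R}).
Variables (f : T -> R) (mf : measurable_fun setT f) (f0 : forall x, 0 <= f x).

(** The proofs of measurability and nonnegativity are arguments so that the measure structure can be
    inferred from the term itself. *)
Definition mdensity of measurable_fun setT f & (forall x, 0 <= f x) :=
  fun A => (\int[m]_(x in A) (f x)%:E)%E.

Local Notation md := (mdensity mf f0).

Let md0 : md set0 = 0%E. Proof. exact: integral_set0. Qed.
Let md_ge0 A : (0 <= md A)%E.
Proof. by apply: integral_ge0 => x _; rewrite lee_fin. Qed.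
Let md_semi_sigma_additive : semi_sigma_additive md.
Proof.
move=> /= F mF tF mUF; rewrite /md; apply: cvg_toP.
  apply: ereal_nondecreasing_is_cvgn => i j ij.
  apply: lee_sum_nneg_natr => // k _ _.
  by apply: integral_ge0 => x _; rewrite lee_fin.
rewrite ge0_integral_bigcup//=; first exact/measurable_EFinP/measurable_funTS.
by move=> x _; rewrite lee_fin.
Qed.
HB.instance Definition _ := isMeasure.Build _ _ _ md md0 md_ge0
  md_semi_sigma_additive.

Import HBNNSimple.

Lemma ge0_integral_mdensity (h : T -> \bar R) :
  measurable_fun setT h -> (forall x, 0 <= h x)%E ->
  (\int[md]_x h x = \int[m]_x ((f x)%:E * h x))%E.
Proof.
move=> mh h0; pose g := nnsfun_approx measurableT mh.
have gh x : (EFin \o g^~ x) @ \oo --> h x by exact: cvg_nnsfun_approx.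
have mfE : measurable_fun setT (EFin \o f) by exact/measurable_EFinP.
transitivity (limn (fun n => \int[md]_x (g n x)%:E)%E).
  rewrite -monotone_convergence//.
  - by apply: eq_integral => x _; apply/esym/cvg_lim => //; exact: gh.
  - by move=> n; exact/measurable_EFinP/measurable_funTS.
  - by move=> n x _; rewrite lee_fin.
  - by move=> x _ i j ij; rewrite lee_fin; exact/lefP/nd_nnsfun_approx.
transitivity (limn (fun n => \int[m]_x ((f x)%:E * (g n x)%:E))%E); last first.
  rewrite -monotone_convergence//.
  - apply: eq_integral => x _; apply/cvg_lim => //.
    by apply: cvgeZl => //; exact: gh.
  - move=> n; apply: emeasurable_funM => //.
    exact/measurable_EFinP/measurable_funTS.
  - by move=> n x _; rewrite mule_ge0// lee_fin.
  - move=> x _ i j ij; apply: lee_wpmul2l; first by rewrite lee_fin.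
    by rewrite lee_fin; exact/lefP/nd_nnsfun_approx.
congr (limn _); apply/funext => n.
rewrite integralT_nnsfun sintegralE.
under [RHS]eq_integral => x _.
  rewrite (fimfunE (g n)) -fsumEFin// ge0_mule_fsumr; last first.
    by move=> r; rewrite EFinM nnfun_muleindic_ge0.
  over.
rewrite ge0_integral_fsum//; last 2 first.
- move=> r; apply: emeasurable_funM => //.
  by apply/measurable_EFinP/measurable_funM => //; exact: measurable_indic.
- by move=> r x _; apply: mule_ge0; [rewrite lee_fin|rewrite EFinM nnfun_muleindic_ge0].
apply: eq_fsbigr => r _.
have [r0|r0] := leP 0 r; last first.
  rewrite preimage_nnfun0// measure0 mule0.
  by rewrite integral0_eq// => x _; rewrite indic0 mulr0 mule0.
under eq_integral => x _ do rewrite EFinM muleCA.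
rewrite ge0_integralZl_EFin//; last 2 first.
- by move=> x _; rewrite mule_ge0// lee_fin.
- by apply: emeasurable_funM => //; exact/measurable_EFinP/measurable_indic.
congr (_ * _)%E; transitivity (md (g n @^-1` [set r])) => //.
rewrite /mdensity integral_mkcond; apply: eq_integral => x _.
by rewrite patchE indicE; case: ifPn => _; rewrite ?mule1 ?mule0.
Qed.

End mdensity.

(** * Changes of variables on the unit interval *)

Section increasing_transform.
Context {R : realType}.

Lemma unif_set1 (x : R) : unif [set x] = 0%E.
Proof.
rewrite unifE//; apply: (@subset_measure0 _ _ _ lebesgue_measure _ [set x]) => //.
- exact: measurableI.
- exact: lebesgue_measure_set1.
Qed.

Lemma unif_itv_oo : unif `]0%R, 1%R[%classic = 1%E :> \bar R.
Proof.
rewrite unifE// setIidl; last by apply: subset_itv; rewrite bnd_simp.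
by rewrite lebesgue_measure_itv/= lte01 sube0.
Qed.

Lemma ae_unif01 : {ae (@unif R), forall u, 0 < u < 1}.
Proof.
exists (~` `]0%R, 1%R[%classic); split.
- exact: measurableC.
- by rewrite probability_setC// [X in (1 - X)%E]unif_itv_oo subee.
- by move=> u /=; rewrite in_itv.
Qed.

(* The change of variables [s = (1/l) int_0^u p], written without derivatives:
   its inverse is a quantile function. *)
Lemma unif_transform (p : R -> R) (l : R) :
  measurable_fun setT p -> (forall u, 0 <= p u) ->
  (\int[unif]_u (p u)%:E = l%:E)%E -> 0 < l ->
  let F := fun u => l^-1 * (\int[unif]_(x in `]-oo, u]) p x) in
  [/\ is_cdf F,
      forall h, measurable_fun setT h -> (forall u, 0 <= h u)%E ->
        (\int[unif]_u ((p u)%:E * h u) = l%:E * \int[unif]_s h (quantile F s))%E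
    & forall s, 0 < s < 1 -> F (quantile F s) = s].
Proof.
move=> mp p0 pl l0 F.
pose md := mdensity unif mp p0.
have mdT : md setT = l%:E by [].
pose mm : probability R R := mnormalize md unif.
have l_neq0 : l != 0 by rewrite gt_eqF.
have mmE A : mm A = (md A * (l^-1)%:E)%E.
  by rewrite /mm/= /mnormalize/= /mdensity pl/= eqe (negbTE l_neq0).
have FE : F = cdfr mm.
  apply/funext => u; rewrite /F /cdfr mmE muleC fineM//.
  rewrite ge0_fin_numE ?measure_ge0//; apply: le_lt_trans (ltry l).
  by rewrite -mdT; apply: le_measure; rewrite ?inE.
have cF : is_cdf F by rewrite FE; exact: is_cdf_cdfr.
split => //.
- move=> h mh h0; rewrite -(ge0_integral_mdensity unif mp p0)//.
  have -> : (\int[md]_x h x = l%:E * \int[mm]_x h x)%E.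
    have mmd A : measurable A -> A `<=` setT -> md A = mscale (NngNum (ltW l0)) mm A.
      move=> mA _; rewrite /mscale/= mmE muleCA -EFinM divff// mule1//.
    by rewrite (eq_measure_integral _ mmd) ge0_integral_mscale.
  congr (_ * _)%E.
  rewrite (ge0_integral_law (m := unif) (measurable_quantile1 cF))//.
  by move=> A mA; rewrite FE; apply/esym; exact: law_quantile.
- move=> s s01; set q := quantile F s.
  apply/eqP; rewrite eq_le; apply/andP; split; last by rewrite -quantile_le.
  rewrite -lee_fin FE cdfrE.
  (* The measure has no atom at [q], so [F q] is the limit of [F (q - 1/(n+1))]. Each of these
     values is below [s], since [q] is the least point where [F] reaches [s]. *)
  have mq0 : mm [set q] = 0%E.
    rewrite mmE (_ : md [set q] = 0%E) ?mul0e//.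
    apply: null_set_integral => //; last exact: unif_set1.
    by apply/measurable_EFinP; exact: measurable_funTS.
  have -> : mm `]-oo, q]%classic = mm `]-oo, q[%classic.
    rewrite -(@setUitv1 _ _ _ _ true)// measureU//= ?mq0 ?adde0//.
    by apply/seteqP; split => x //= [/[swap] ->]; rewrite in_itv/= ltxx.
  have -> : `]-oo, q[%classic = \bigcup_n `]-oo, q - n.+1%:R^-1]%classic.
    apply/seteqP; split => [x /=|x [n _] /=]; rewrite in_itv/= => xq.
      have [n nx] := ltr_add_invr xq.
      by exists n => //=; rewrite in_itv/= lerBrDr ltW.
    by rewrite in_itv/= (le_lt_trans xq)// gtrBl.
  have := @nondecreasing_cvg_mu _ _ _ mm (fun n => `]-oo, q - n.+1%:R^-1]%classic).
  move=> /(_ _ _ _)/cvg_lim <-//; last 2 first.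
  - exact: bigcup_measurable.
  - move=> i j ij; apply/subsetPset => x /=; rewrite !in_itv/= => /le_trans; apply.
    by rewrite lerD2l lerN2 lef_pV2 ?posrE// ler_nat.
  apply: lime_le.
    apply: ereal_nondecreasing_is_cvgn => i j ij; apply: le_measure; rewrite ?inE//.
    move=> x /=; rewrite !in_itv/= => /le_trans; apply.
    by rewrite lerD2l lerN2 lef_pV2 ?posrE// ler_nat.
  apply: nearW => n /=; rewrite -(cdfrE mm) -FE lee_fin leNgt; apply/negP => /ltW.
  by rewrite -quantile_le// -/q lerBrDr gerDl leNgt invr_gt0 ltr0n.
Qed.

(** Testing the change of variables on the indicator of a null set enlarged by the zeros of [p]
    shows that [a] almost never enters that set. *)
Lemma unif_transform_ae (p a : R -> R) (l : R) :
  measurable_fun setT p -> (forall u, 0 <= p u) -> measurable_fun setT a ->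
  0 < l ->
  (forall h, measurable_fun setT h -> (forall u, 0 <= h u)%E ->
    (\int[unif]_u ((p u)%:E * h u) = l%:E * \int[unif]_s h (a s))%E) ->
  forall Q : R -> Prop, {ae (@unif R), forall u, 0 < p u -> Q u} ->
  {ae (@unif R), forall s, 0 < p (a s) /\ Q (a s)}.
Proof.
move=> mp p0 ma l0 ap Q [N [mN N0 QN]].
pose B := N `|` p @^-1` [set 0].
have mB : measurable B.
  by apply: measurableU => //; rewrite -[X in measurable X]setTI; exact: mp.
have mE (A : set R) : measurable A -> measurable_fun setT (fun u => (\1_A u)%:E : \bar R).
  by move=> mA; exact/measurable_EFinP/measurable_indic.
have := ap (fun u => (\1_B u)%:E) (mE _ mB) (fun=> _).
have -> : (\int[unif]_u ((p u)%:E * (\1_B u)%:E) = 0)%E.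
  rewrite -(null_set_integral (mu := unif) (f := EFin \o p) mN)//; last first.
    by apply/measurable_EFinP/measurable_funTS.
  rewrite integral_mkcond; apply: eq_integral => u _; rewrite patchE indicE.
  have [uN|uN] := boolP (u \in N); first by rewrite mem_set ?mule1//; left; exact: set_mem.
  have [uB|uB] := boolP (u \in B); last by rewrite mule0.
  have [/mem_set|->] := set_mem uB; last by rewrite mul0e.
  by rewrite (negbTE uN).
have maB : measurable (a @^-1` B) by rewrite -[X in measurable X]setTI; exact: ma.
rewrite (_ : (\int[unif]_s (\1_B (a s))%:E)%E = unif (a @^-1` B)); last first.
  by rewrite -[X in _ = unif X](setIT) -integral_indic//; apply: eq_integral => s _.
move=> /(_ (fun u => _))/= E.
have {}E : unif (a @^-1` B) = 0%E.
  have /eqP := E (fun u => lee_tofin (ler0n _ _)).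
  by rewrite eq_sym mule_eq0 eqe gt_eqF//= => /eqP.
exists (a @^-1` B); split => // s /= h.
apply: contrapT => nB; apply: h.
have pa : 0 < p (a s).
  by rewrite lt_neqAle p0 andbT eq_sym; apply/eqP => pas; apply: nB; right.
split=> //; apply: contrapT => nQ; apply: nB; left; apply: QN => /= /(_ pa).
exact: nQ.
Qed.

Lemma ge0_integral_eq0_ae d (T : measurableType d) (m : {measure set T -> \bar R})
    (f : T -> \bar R) : measurable_fun setT f -> (forall x, 0 <= f x)%E ->
  (\int[m]_x f x = 0)%E -> {ae m, forall x, f x = 0%E}.
Proof.
move=> mf f0 fi.
have /(_ m measurableT)[+ _] := ae_eq_integral_abs _ _ mf.
under eq_integral => u _ do rewrite gee0_abs//.
by move=> /(_ fi); apply: filterS => u /= /(_ I).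
Qed.

(** Here the exceptional null set lies on the side of [s], and nothing is known of its image under
    [a]. Hence [Q] itself is taken measurable, so that the set where it fails can be integrated. *)
Lemma unif_transform_ae_inv (p a : R -> R) (l : R) (Q : R -> bool) :
  measurable_fun setT p -> (forall u, 0 <= p u) -> measurable_fun setT Q ->
  (forall h, measurable_fun setT h -> (forall u, 0 <= h u)%E ->
    (\int[unif]_u ((p u)%:E * h u) = l%:E * \int[unif]_s h (a s))%E) ->
  {ae (@unif R), forall s, Q (a s)} -> measurable_fun setT a ->
  {ae (@unif R), forall u, 0 < p u -> Q u}.
Proof.
move=> mp p0 mQ ap Qa ma.
pose B := Q @^-1` [set false].
have mB : measurable B by rewrite -[X in measurable X]setTI; exact: mQ.
have mE : measurable_fun setT (fun u => (\1_B u)%:E : \bar R).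
  by exact/measurable_EFinP/measurable_indic.
have := ap (fun u => (\1_B u)%:E) mE (fun u => lee_tofin (ler0n _ _)).
rewrite (_ : (\int[unif]_s (\1_B (a s))%:E = 0)%E); last first.
  rewrite -(integral0 unif setT); apply: ae_eq_integral => //.
    exact: measurableT_comp mE ma.
  apply: filterS Qa => s Qas _; rewrite /= indicE.
  by case: (boolP (a s \in B)) => // /set_mem; rewrite /B/= Qas.
rewrite mule0 => /ge0_integral_eq0_ae; have mpB : measurable_fun setT (fun u => (p u)%:E * (\1_B u)%:E)%E.
  by apply: emeasurable_funM => //; exact/measurable_EFinP.
move=> /(_ mpB (fun u => mule_ge0 (lee_tofin (p0 u)) (lee_tofin (ler0n _ _)))).
apply: filterS => u /eqP; rewrite mule_eq0 eqe => /orP[/eqP ->|]; first by rewrite ltxx.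
rewrite eqe indicE => + _; case: (boolP (u \in B)) => [|/negP uB _]; first by rewrite oner_eq0.
by apply: contrapT => /negP/negbTE Qu; apply: uB; rewrite inE.
Qed.

(** The inverse is written as [x] times the real power -1 of [x ^+ 2], which also gives the value 0
    at 0. *)
Lemma measurable_invr : measurable_fun [set: R] (@GRing.inv R).
Proof.
have -> : @GRing.inv R = (fun x => x * ((x ^+ 2) `^ (-1))).
  apply/funext => x; rewrite powR_inv1 ?sqr_ge0//.
  have [->|x0] := eqVneq x 0; first by rewrite invr0 mul0r.
  by rewrite expr2 invfM mulrA divff// mul1r.
apply: measurable_funM => //.
apply: (measurableT_comp (measurable_powR _)); exact: exprn_measurable.
Qed.

Lemma unif_itv0 (z : R) : 0 <= z <= 1 -> unif `]-oo, z]%classic = z%:E.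
Proof.
move=> /andP[z0 z1]; rewrite unifE//.
have -> : `]-oo, z]%classic `&` `[0, 1]%classic = `[0, z]%classic.
  apply/seteqP; split => x /=; rewrite !in_itv/=.
    by move=> [-> /andP[->]].
  by move=> /andP[-> xz]; rewrite xz (le_trans xz).
by rewrite lebesgue_measure_itv/= lte_fin; case: ltP => [_|]; rewrite ?sube0// => z0'; congr EFin; lra.
Qed.

Lemma unif_coin (z c1 c2 : R) : 0 <= z <= 1 ->
  (\int[unif]_v (if v <= z then c1 else c2)%:E = (z * c1 + (1 - z) * c2)%:E)%E.
Proof.
move=> z01; have mA : measurable (`]-oo, z]%classic : set R) by exact: measurable_itv.
have iA : unif.-integrable setT (EFin \o (fun v => (c1 - c2) * \1_(`]-oo, z]) v)).
  have := integrableZl measurableT (c1 - c2) (integrable_indic unif mA).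
  by apply: eq_integrable => // v _ /=; rewrite EFinM.
rewrite (eq_integral (fun v => c2%:E + ((c1 - c2) * \1_(`]-oo, z]) v)%:E)%E); last first.
  move=> v _; rewrite -EFinD indicE mem_setE in_itv/=.
  by case: ifP => _; rewrite ?mulr1 ?mulr0; congr EFin; ring.
rewrite integralD_EFin//; last exact: finite_measure_integrable_cst.
rewrite integral_cst//= (@probability_setT _ _ _ unif) mule1.
under [X in (_ + X)%E]eq_integral do rewrite EFinM.
rewrite integralZl//; last exact: integrable_indic.
rewrite integral_indic//= setIT unif_itv0// -EFinM -EFinD; congr EFin; ring.
Qed.

End increasing_transform.

(** * Martingale couplings as joint laws *)

Section martingale_coupling_law.
Context {R : realType}.

Lemma integrable_dom d (T : measurableType d) (m : {measure set T -> \bar R})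
    (f g : T -> R) : measurable_fun setT f -> m.-integrable setT (EFin \o g) ->
  (forall x, `|f x| <= g x) -> m.-integrable setT (EFin \o f).
Proof.
move=> mf ig fg; apply: le_integrable ig => //; first exact/measurable_EFinP.
by move=> x _ /=; rewrite lee_fin (le_trans (fg x))// ler_norm.
Qed.

Lemma integrable_bdd d (T : measurableType d) (m : probability T R)
    (f : T -> R) (C : R) : measurable_fun setT f ->
  (forall x, `|f x| <= C) -> m.-integrable setT (EFin \o f).
Proof.
move=> mf fC; apply: (integrable_dom mf _ fC).
exact: finite_measure_integrable_cst.
Qed.

Lemma sigma_of_sub_measurable d (T : measurableType d) (X : T -> R) :
  sub_measurable (sigma_of X) X.
Proof. by move=> B mB; exists B => //; rewrite setTI. Qed.

Lemma martingale_coupling_law d (T : measurableType d) (P : probability T R)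
    (mu nu : probability R R) (X Y : T -> R) (mX : measurable_fun setT X)
    (mY : measurable_fun setT Y) (mXY : measurable_fun setT (fun w => (X w, Y w))) :
  (forall A, measurable A -> P (X @^-1` A) = mu A) ->
  (forall A, measurable A -> P (Y @^-1` A) = nu A) ->
  mu.-integrable setT (EFin \o id) -> nu.-integrable setT (EFin \o id) ->
  (forall A, measurable A ->
    (\int[P]_w (\1_A (X w) * Y w)%:E = \int[P]_w (\1_A (X w) * X w)%:E)%E) ->
  martingale_coupling mu nu (law P mXY).
Proof.
move=> Xmu Ynu imu inu XY.
have Zl A : measurable A -> law P mXY A = P ((fun w => (X w, Y w)) @^-1` A) by [].
have Xmu' A : measurable A -> mu A = P (X @^-1` A) by move=> /Xmu.
have Ynu' A : measurable A -> nu A = P (Y @^-1` A) by move=> /Ynu.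
have ifst : (law P mXY).-integrable setT (EFin \o fst).
  apply/(integrable_law mXY Zl); first exact/measurable_EFinP.
  exact/(integrable_law mX Xmu').
have isnd : (law P mXY).-integrable setT (EFin \o snd).
  apply/(integrable_law mXY Zl); first exact/measurable_EFinP.
  exact/(integrable_law mY Ynu').
split.
- by move=> A mA; rewrite -Xmu.
- by move=> A mA; rewrite -Ynu.
- have := integrableD measurableT (integrable_abse ifst) (integrable_abse isnd).
  by apply: eq_integrable => // x _.
- split => //; first exact: sigma_of_sub_measurable.
  move=> _ [B mB <-]; rewrite setTI.
  have mfB : measurable ((fst : R * R -> R) @^-1` B).
    by rewrite -[X in measurable X]setTI; exact: measurable_fst.
  have indE (h : R * R -> R) : measurable_fun setT h ->
     (\int[law P mXY]_(w in fst @^-1` B) (h w)%:E =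
      \int[P]_w (\1_B (X w) * h (X w, Y w))%:E)%E.
    move=> mh; rewrite integral_mkcond (integral_law mXY Zl); last first.
      by apply/(measurable_restrictT _ mfB)/measurable_EFinP/measurable_funTS.
    apply: eq_integral => w _; rewrite patchE indicE.
    have -> : ((X w, Y w) \in fst @^-1` B) = (X w \in B).
      by apply/idP/idP; rewrite !inE.
    by case: ifPn => _; rewrite ?mul1r ?mul0r.
  by rewrite !indE// XY.
Qed.

End martingale_coupling_law.

(** * Existence of a martingale coupling *)

Section strassen.
Context {R : realType}.

(* [qn u] is moved to [tau u] with probability [z u]: mass is exchanged between
   [a s] and [b s], at the same rate [l / (qn (b s) - qn (a s))]. *)
Lemma quantile_matching (d qn Fp Fn a b : R -> R) (l : R) :
  measurable_fun setT d -> measurable_fun setT qn -> measurable_fun setT Fp ->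
  measurable_fun setT Fn -> measurable_fun setT a -> measurable_fun setT b ->
  let p u := Num.max (d u) 0 in let n u := Num.max (- d u) 0 in
  (forall h, measurable_fun setT h -> (forall u, 0 <= h u)%E ->
    (\int[unif]_u ((p u)%:E * h u) = l%:E * \int[unif]_s h (a s))%E) ->
  (forall h, measurable_fun setT h -> (forall u, 0 <= h u)%E ->
    (\int[unif]_u ((n u)%:E * h u) = l%:E * \int[unif]_s h (b s))%E) ->
  {ae (@unif R), forall s, [/\ Fp (a s) = s /\ Fn (b s) = s, 0 < d (a s), d (b s) < 0,
    d (a s) <= qn (b s) - qn (a s) & - d (b s) <= qn (b s) - qn (a s)]} ->
  exists z tau : R -> R,
    [/\ measurable_fun setT z, measurable_fun setT tau, (forall u, 0 <= z u <= 1),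
     {ae (@unif R), forall u, z u * (tau u - qn u) = d u} &
     forall B, measurable B -> (\int[unif]_u ((z u)%:E * (\1_B (tau u))%:E) =
       \int[unif]_u ((z u)%:E * (\1_B (qn u))%:E))%E].
Proof.
move=> md mqn mFp mFn ma mb p n tp tn good.
have mp : measurable_fun setT p by apply: measurable_maxr.
have mn : measurable_fun setT n.
  by apply: measurable_maxr => //; exact: measurable_funN.
have p0 u : 0 <= p u by rewrite le_max lexx orbT.
have n0 u : 0 <= n u by rewrite le_max lexx orbT.
have mFE (f : R -> R) : measurable_fun setT f -> measurable_fun setT (EFin \o f).
  by move=> mf; exact/measurable_EFinP.
have pE u : 0 < d u -> p u = d u by move=> du; apply/max_idPl/ltW.
have nE u : d u < 0 -> n u = - d u by move=> du; apply/max_idPl; rewrite oppr_ge0 ltW.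
(* Where [d > 0], the point is [u = a s] with [s = Fp u], and its partner is [b s]. Where [d < 0],
   the roles of [a] and [b] are exchanged. *)
pose tau u := if 0 < d u then qn (b (Fp u)) else qn (a (Fn u)).
have mtau : measurable_fun setT tau.
  apply: measurable_fun_ifT; first exact: measurable_fun_ltr.
  - by apply: measurableT_comp => //; exact: measurableT_comp.
  - by apply: measurableT_comp => //; exact: measurableT_comp.
pose z0 u := d u / (tau u - qn u).
have mz0 : measurable_fun setT z0.
  apply: measurable_funM => //; apply: (measurableT_comp (@measurable_invr R)).
  exact: measurable_funB.
(* The probability [z0] makes the mean displacement [z0 u * (tau u - qn u)] equal to [d u]. The test
   keeps [z] in [0, 1] everywhere; it succeeds at all matched points. *)
pose zz u := (0 <= z0 u) && (z0 u <= 1).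
have mzz : measurable_fun setT zz by apply: measurable_and; exact: measurable_fun_ler.
pose z u := if zz u then z0 u else 0.
have mz : measurable_fun setT z by exact: measurable_fun_ifT.
(* The factor [xi] is the inverse of the gap between the two exchanged values. It is the same at
   [a s] and at [b s], which is why the exchange preserves the law of [qn]. *)
pose xi u := if zz u then `|tau u - qn u|^-1 else 0.
have mxi : measurable_fun setT xi.
  apply: measurable_fun_ifT => //; apply: (measurableT_comp (@measurable_invr R)).
  by apply: measurableT_comp => //; exact: measurable_funB.
have xi0 u : 0 <= xi u by rewrite /xi; case: ifP; rewrite ?invr_ge0.
have zxi u : z u = p u * xi u + n u * xi u.
  rewrite /z /xi; case: ifPn => [/andP[z00 _]|]; last by rewrite !mulr0 addr0.
  have [du|du|du] := ltgtP (d u) 0.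
  - rewrite nE// /p max_r ?(ltW du)// mul0r add0r /z0.
    have t0 : tau u - qn u <= 0.
      by rewrite -invr_le0 -(nmulr_rge0 _ du).
    by rewrite ler0_norm// invrN mulrNN.
  - rewrite pE// /n max_r ?oppr_le0 ?(ltW du)// mul0r addr0 /z0.
    have t0 : 0 <= tau u - qn u.
      by rewrite -invr_ge0 -(pmulr_rge0 _ du).
    by rewrite ger0_norm.
  - by rewrite /z0 /p /n du oppr0 maxxx !mul0r addr0.
have goodz s : [/\ Fp (a s) = s /\ Fn (b s) = s, 0 < d (a s), d (b s) < 0,
    d (a s) <= qn (b s) - qn (a s) & - d (b s) <= qn (b s) - qn (a s)] ->
  [/\ tau (a s) = qn (b s), tau (b s) = qn (a s), zz (a s), zz (b s) &
      xi (a s) = xi (b s)].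
  move=> [[Fas Fbs] da db dda ddb].
  have ta : tau (a s) = qn (b s) by rewrite /tau da Fas.
  have tb : tau (b s) = qn (a s) by rewrite /tau ltNge (ltW db)/= Fbs.
  have za : zz (a s).
    have D0 : 0 < qn (b s) - qn (a s) by exact: lt_le_trans da dda.
    by rewrite /zz /z0 ta divr_ge0 ?(ltW da) ?(ltW D0)//= ler_pdivrMr// mul1r.
  have zb : zz (b s).
    have D0 : 0 < qn (b s) - qn (a s) by exact: lt_le_trans da dda.
    rewrite /zz /z0 tb -mulrNN -invrN opprB divr_ge0 ?oppr_ge0 ?(ltW db) ?(ltW D0)//=.
    by rewrite ler_pdivrMr// mul1r.
  by split => //; rewrite /xi za zb ta tb distrC.
exists z, tau; split => //.
- by move=> u; rewrite /z; case: ifPn => //; rewrite lexx ler01.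
- pose Q u := z u * (tau u - qn u) == d u.
  have mQ : measurable_fun setT Q.
    apply: measurable_fun_eqr => //; apply: measurable_funM => //.
    exact: measurable_funB.
  have gp : {ae (@unif R), forall u, 0 < d u -> z u * (tau u - qn u) = d u}.
    have h : {ae (@unif R), forall s, Q (a s)}.
      apply: filterS good => s gs; have [ta tb za zb _] := goodz _ gs.
      case: gs => _ da db dda ddb; rewrite /Q /z za /z0 divfK// ta gt_eqF//.
      exact: lt_le_trans dda.
    apply: filterS (unif_transform_ae_inv mp p0 mQ tp h ma) => u pu du.
    by apply/eqP/pu; rewrite pE.
  have gn : {ae (@unif R), forall u, d u < 0 -> z u * (tau u - qn u) = d u}.
    have h : {ae (@unif R), forall s, Q (b s)}.
      apply: filterS good => s gs; have [ta tb za zb _] := goodz _ gs.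
      case: gs => _ da db dda ddb; rewrite /Q /z zb /z0 divfK// tb lt_eqF//.
      by rewrite -opprB oppr_lt0; exact: lt_le_trans dda.
    apply: filterS (unif_transform_ae_inv mn n0 mQ tn h mb) => u nu' du.
    by apply/eqP/nu'; rewrite nE// oppr_gt0.
  apply: filterS2 gp gn => u gp gn; have [/gn//|/gp//|du] := ltgtP (d u) 0.
  by rewrite /z; case: ifP; rewrite ?mul0r ?du// /z0 du !mul0r.
- move=> B mB.
  have mB1 (f : R -> R) : measurable_fun setT f ->
        measurable_fun setT (fun u => (\1_B (f u))%:E : \bar R).
    by move=> mf; apply/measurable_EFinP; exact: measurableT_comp.
  have mxB (f : R -> R) : measurable_fun setT f ->
        measurable_fun setT (fun u => (xi u)%:E * (\1_B (f u))%:E)%E.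
    by move=> mf; apply: emeasurable_funM; [exact: mFE|exact: mB1].
  have E (f : R -> R) : measurable_fun setT f ->
    (\int[unif]_u ((z u)%:E * (\1_B (f u))%:E) =
     l%:E * (\int[unif]_s ((xi (a s))%:E * (\1_B (f (a s)))%:E) +
             \int[unif]_s ((xi (b s))%:E * (\1_B (f (b s)))%:E)))%E.
    move=> mf; have x0 u : (0 <= (xi u)%:E * (\1_B (f u))%:E)%E.
      by rewrite mule_ge0// lee_fin.
    rewrite ge0_muleDr; [|exact: integral_ge0|exact: integral_ge0].
    rewrite -(tp (fun u => (xi u)%:E * (\1_B (f u))%:E)%E)//; last exact: mxB.
    rewrite -(tn (fun u => (xi u)%:E * (\1_B (f u))%:E)%E)//; last exact: mxB.
    rewrite -ge0_integralD//.
    + apply: eq_integral => u _; rewrite -!EFinM -EFinD; congr EFin.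
      by rewrite zxi; ring.
    + by move=> u _; rewrite mule_ge0// lee_fin.
    + by apply: emeasurable_funM; [exact: mFE|exact: mxB].
    + by move=> u _; rewrite mule_ge0// lee_fin.
    + by apply: emeasurable_funM; [exact: mFE|exact: mxB].
  have mc (f g : R -> R) : measurable_fun setT f -> measurable_fun setT g ->
     measurable_fun setT (fun u => (xi (g u))%:E * (\1_B (f (g u)))%:E)%E.
    by move=> mf mg; exact: measurableT_comp (mxB f mf) mg.
  (* The part of [tau] carried by [a] is the part of [qn] carried by [b], and conversely. *)
  rewrite !E//; congr (_ * _)%E; rewrite addeC; congr (_ + _)%E.
  + apply: ge0_ae_eq_integral => //; [exact: mc|exact: mc| | |].
    * by move=> s _; rewrite mule_ge0// lee_fin.
    * by move=> s _; rewrite mule_ge0// lee_fin.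
    * by apply: filterS good => s /goodz[ta tb _ _ xab] _; rewrite tb xab.
  + apply: ge0_ae_eq_integral => //; [exact: mc|exact: mc| | |].
    * by move=> s _; rewrite mule_ge0// lee_fin.
    * by move=> s _; rewrite mule_ge0// lee_fin.
    * by apply: filterS good => s /goodz[ta tb _ _ xab] _; rewrite ta xab.
Qed.

Variables mu nu : probability R R.
Hypotheses (imu : mu.-integrable setT (EFin \o id))
  (inu : nu.-integrable setT (EFin \o id)) (cx : convex_order mu nu).

Let qm := quantile (cdfr mu).
Let qn := quantile (cdfr nu).

Lemma convex_pos_part (a : R) :
  convex_function [set: R^o] (fun x : R^o => Num.max (a - x) 0 : R^o).
Proof.
move=> t x y _ _; rewrite !convRE.
have s0 : 0 <= t%:num :> R by [].
have s1 : 0 <= unstable.onem t%:num :> R by rewrite unstable.onem_ge0.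
set s := t%:num in s0 s1 *.
rewrite ge_max; apply/andP; split.
  have -> : a - (s * x + unstable.onem s * y) = s * (a - x) + unstable.onem s * (a - y).
    rewrite /unstable.onem; ring.
  by apply: lerD; apply: ler_wpM2l => //; rewrite le_max lexx.
by apply: addr_ge0; apply: mulr_ge0 => //; rewrite le_max lexx orbT.
Qed.

Let mqm : measurable_fun setT qm.
Proof. exact: measurable_quantile1 (is_cdf_cdfr mu). Qed.
Let mqn : measurable_fun setT qn.
Proof. exact: measurable_quantile1 (is_cdf_cdfr nu). Qed.

Let lqm A : measurable A -> mu A = unif (qm @^-1` A).
Proof. by move=> mA; apply/esym; exact: law_quantile. Qed.
Let lqn A : measurable A -> nu A = unif (qn @^-1` A).
Proof. by move=> mA; apply/esym; exact: law_quantile. Qed.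

Let iqm : unif.-integrable setT (EFin \o qm).
Proof. by apply/(integrable_law (m' := mu) mqm). Qed.
Let iqn : unif.-integrable setT (EFin \o qn).
Proof. by apply/(integrable_law (m' := nu) mqn). Qed.

(** The convex order is tested on [x] and on [-x]. *)
Let mean_eq : \int[unif]_u qm u = \int[unif]_u qn u :> R.
Proof.
have iN (f : R -> R) : unif.-integrable setT (EFin \o f) ->
    unif.-integrable setT (EFin \o (fun x => -1 * f x)).
  move=> fi; have := integrableZl measurableT (-1) fi.
  by apply: eq_integrable => // x _; rewrite /= EFinM.
have h (f : R^o -> R^o) : measurable_fun setT f -> convex_function [set: R^o] f ->
    unif.-integrable setT (EFin \o (f \o qm)) ->
    unif.-integrable setT (EFin \o (f \o qn)) ->
    \int[unif]_u f (qm u) <= \int[unif]_u f (qn u).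
  move=> mf /cx fc im i_n; apply: fine_le.
  - exact: integrable_fin_num im.
  - exact: integrable_fin_num i_n.
  by move: fc; rewrite (integral_law mqm lqm) ?(integral_law mqn lqn)//;
    exact/measurable_EFinP.
apply/eqP; rewrite eq_le; apply/andP; split.
  by apply: (h id) => // t x y _ _.
have := h ( *%R (-1)) (@mulrl_measurable _ _ _) _ (iN _ iqm) (iN _ iqn).
rewrite !RintegralZl// !mulN1r lerN2; apply => t x y _ _.
by rewrite !convRE mulrDr !(mulrCA (-1)).
Qed.

(** The convex order is tested on [max (a - x) 0] with [a = qn u]. On the side of [nu] this function
    vanishes exactly beyond level [u] up to null sets, so its integral is that of [a - qn] up to
    [u]; on the side of [mu] the corresponding integral of [a - qm] is only a lower bound. *)
Let cx_le (u : R) : 0 < u < 1 ->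
  \int[unif]_(x in `]-oo, u]) qn x <= \int[unif]_(x in `]-oo, u]) qm x.
Proof.
move=> u01; set S := `]-oo, u]%classic; set a := qn u.
have mS : measurable S by exact: measurable_itv.
have iS f : unif.-integrable setT (EFin \o f) -> unif.-integrable S (EFin \o f).
  by move=> fi; apply: (integrableS measurableT mS) fi.
have iac (f : R -> R) : unif.-integrable setT (EFin \o f) ->
    unif.-integrable setT (EFin \o (fun x => a - f x)).
  move=> fi; have ic := finite_measure_integrable_cst unif a (A := setT).
  have := integrableB measurableT (ic measurableT) fi.
  by apply: eq_integrable => // x _.
have imx (f : R -> R) : unif.-integrable setT (EFin \o f) ->
    unif.-integrable setT (EFin \o (fun x => Num.max (a - f x) 0)).
  move=> fi; apply: (integrable_dom _ (integrable_norm (iac _ fi))).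
    apply: measurable_maxr => //; apply: measurable_funB => //.
    by apply/measurable_EFinP; exact: measurable_int fi.
  move=> x /=; rewrite ger0_norm ?le_max ?lexx ?orbT//.
  by rewrite ge_max normr_ge0 ler_norm.
have mmx (f : R -> R) : measurable_fun setT f ->
    measurable_fun setT (EFin \o (fun x => Num.max (a - f x) 0)).
  move=> mf; apply/measurable_EFinP; apply: measurable_maxr => //.
  exact: measurable_funB.
have E12 : \int[unif]_x Num.max (a - qm x) 0 <= \int[unif]_x Num.max (a - qn x) 0.
  apply: fine_le.
  - exact: (integrable_fin_num measurableT (imx _ iqm)).
  - exact: (integrable_fin_num measurableT (imx _ iqn)).
  have := cx (convex_pos_part a).
  rewrite (integral_law mqm lqm) ?(integral_law mqn lqn)//.
    exact: (mmx _ (@measurable_id _ _ _)).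
  exact: (mmx _ (@measurable_id _ _ _)).
have E2 : \int[unif]_x Num.max (a - qn x) 0 = \int[unif]_(x in S) (a - qn x).
  rewrite [RHS]Rintegral_mkcond; congr fine; apply: ae_eq_integral => //.
  - exact: mmx.
  - apply/measurable_EFinP/(measurable_restrictT _ mS).
    by apply: measurable_funB => //; exact: measurable_funTS.
  apply: filterS (@ae_unif01 R) => x x01 _; congr EFin.
  rewrite patchE; case: ifPn => [|/negP]; rewrite inE/= /S/= in_itv/= => xu.
    apply/max_idPl; rewrite subr_ge0 /a; apply: quantile_nd => //.
    - exact: is_cdf_cdfr.
    - by case/andP: x01.
    - by case/andP: u01.
  move/negP: xu; rewrite -ltNge => ux; apply/max_idPr; rewrite subr_le0 /a.
  apply: quantile_nd; first exact: is_cdf_cdfr.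
  - by case/andP: u01.
  - exact: ltW.
  - by case/andP: x01.
have E1 : \int[unif]_(x in S) (a - qm x) <= \int[unif]_x Num.max (a - qm x) 0.
  apply: (@le_trans _ _ (\int[unif]_(x in S) Num.max (a - qm x) 0)).
    by apply: le_Rintegral => //; [exact/iS/iac|exact/iS/imx|move=> x _; rewrite le_max lexx].
  apply: fine_le.
  - exact: (integrable_fin_num _ (iS _ (imx _ iqm))).
  - exact: (integrable_fin_num measurableT (imx _ iqm)).
  apply: ge0_subset_integral => //.
    exact: mmx.
  by move=> x _; rewrite lee_fin le_max lexx orbT.
have icS : unif.-integrable S (EFin \o (fun=> a)) by exact: finite_measure_integrable_cst.
rewrite !RintegralB// in E1 E2; try exact: iS.
by have := le_trans E1 E12; rewrite E2 lerD2l lerN2.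
Qed.

(** A second uniform variable decides with probability [z u] whether the mass at [qn u] goes to
    [tau u]. The exchange identity keeps the second marginal [nu], and the mean given [u] is
    [qn u + z u * (tau u - qn u) = qm u]. *)
Let coupling_of_matching (z tau : R -> R) :
  measurable_fun setT z -> measurable_fun setT tau -> (forall u, 0 <= z u <= 1) ->
  {ae (@unif R), forall u, z u * (tau u - qn u) = qm u - qn u} ->
  (forall B, measurable B -> (\int[unif]_u ((z u)%:E * (\1_B (tau u))%:E) =
     \int[unif]_u ((z u)%:E * (\1_B (qn u))%:E))%E) ->
  exists pi, martingale_coupling mu nu pi.
Proof.
move=> mz mtau z01 zd zB.
pose U2 := (@unif R \x @unif R)%E.
pose Y w := if w.2 <= z w.1 then tau w.1 else qn w.1.
have mY : measurable_fun [set: R * R] Y.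
  apply: measurable_fun_ifT.
  - apply: measurable_fun_ler => //; exact: measurableT_comp mz measurable_fst.
  - exact: measurableT_comp mtau measurable_fst.
  - exact: measurableT_comp mqn measurable_fst.
pose X (w : R * R) := qm w.1.
have mX : measurable_fun [set: R * R] X by exact: measurableT_comp mqm measurable_fst.
have mXY : measurable_fun setT (fun w => (X w, Y w)) by exact: measurable_fun_pair.
have lfst A : measurable A -> unif A = U2 (fst @^-1` A).
  move=> mA; have -> : fst @^-1` A = A `*` [set: R].
    by apply/seteqP; split => [[u v]|[u v] []].
  by rewrite /U2 product_measure1E//= (@probability_setT _ _ _ unif) mule1.
have lX A : measurable A -> U2 (X @^-1` A) = mu A.
  move=> mA; rewrite lqm// lfst//.
  by rewrite -[X in measurable X]setTI; exact: mqm.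
have lY B : measurable B -> U2 (Y @^-1` B) = nu B.
  move=> mB; have mYB : measurable (Y @^-1` B).
    by rewrite -[X in measurable X]setTI; exact: mY.
  have mB1 (f : R -> R) : measurable_fun setT f ->
      measurable_fun setT (fun u => (\1_B (f u))%:E : \bar R).
    by move=> mf; apply/measurable_EFinP; exact: measurableT_comp.
  have -> : U2 (Y @^-1` B) =
      (\int[unif]_u \int[unif]_v (\1_(Y @^-1` B) (u, v))%:E)%E.
    rewrite -[RHS](fubini_tonelli1 (fun w => (\1_(Y @^-1` B) w)%:E))//=; last first.
      exact/measurable_EFinP/measurable_indic.
    by rewrite integral_indic ?setIT.
  under eq_integral => u _.
    rewrite (eq_integral (fun v : R => (if v <= z u then \1_B (tau u) else \1_B (qn u))%:E)); last first.
      move=> v _; have -> : \1_(Y @^-1` B) (u, v) = \1_B (Y (u, v)) :> R.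
        by rewrite !indicE; congr (_%:R); apply/idP/idP; rewrite !inE.
      by rewrite /Y/=; case: ifP.
    rewrite unif_coin// EFinD 2!EFinM.
    over.
  rewrite ge0_integralD//=; last 4 first.
  - by move=> u _; rewrite -EFinM lee_fin mulr_ge0//; case/andP: (z01 u).
  - apply: emeasurable_funM; [exact/measurable_EFinP|exact: mB1].
  - by move=> u _; rewrite -EFinM lee_fin mulr_ge0// subr_ge0; case/andP: (z01 u).
  - apply: emeasurable_funM; [exact/measurable_EFinP/measurable_funB|exact: mB1].
  rewrite zB// -ge0_integralD//=; last 4 first.
  - by move=> u _; rewrite -EFinM lee_fin mulr_ge0//; case/andP: (z01 u).
  - apply: emeasurable_funM; [exact/measurable_EFinP|exact: mB1].
  - by move=> u _; rewrite -EFinM lee_fin mulr_ge0// subr_ge0; case/andP: (z01 u).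
  - apply: emeasurable_funM; [exact/measurable_EFinP/measurable_funB|exact: mB1].
  rewrite (eq_integral (fun u => (\1_(qn @^-1` B) u)%:E)); last first.
    by move=> u _; rewrite -!EFinM -EFinD -mulrDl addrC subrK mul1r.
  have mqB : measurable (qn @^-1` B) by rewrite -[X in measurable X]setTI; exact: mqn.
  by rewrite integral_indic//= setIT lqn.
exists (law U2 mXY); apply: martingale_coupling_law => // A mA.
have iY : U2.-integrable setT (EFin \o Y).
  have lY' B : measurable B -> nu B = U2 (Y @^-1` B) by move=> /lY.
  exact/(integrable_law mY lY').
have iX : U2.-integrable setT (EFin \o X).
  have lX' B : measurable B -> mu B = U2 (X @^-1` B) by move=> /lX.
  exact/(integrable_law mX lX').
have i1 (f : R * R -> R) : measurable_fun setT f -> U2.-integrable setT (EFin \o f) ->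
    U2.-integrable setT (EFin \o (fun w => \1_A (X w) * f w)).
  move=> mf fi; apply: (integrable_dom _ (integrable_norm fi)) => [|w].
    by apply: measurable_funM => //; apply: measurableT_comp.
  rewrite normrM indicE/=.
  by case: (_ \in _); rewrite ?normr1 ?mul1r// normr0 mul0r.
rewrite -(integral12_prod_meas1 (i1 _ mY iY)) -(integral12_prod_meas1 (i1 _ mX iX)).
rewrite /fubini_F /=; apply: ae_eq_integral => //.
- exact: (measurable_fubini_F (i1 _ mY iY)).
- exact: (measurable_fubini_F (i1 _ mX iX)).
apply: filterS zd => u zdu _.
have E c1 c2 : (\int[unif]_v (\1_A (X (u, v)) * (if v <= z u then c1 else c2))%:E =
   (\1_A (qm u) * (z u * c1 + (1 - z u) * c2))%:E)%E.
  rewrite (eq_integral (fun v : R => (if v <= z u then \1_A (qm u) * c1 else \1_A (qm u) * c2)%:E)); last first.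
    by move=> v _; rewrite /X/=; case: ifP.
  by rewrite unif_coin//; congr EFin; ring.
transitivity ((\1_A (qm u) * (z u * tau u + (1 - z u) * qn u))%:E : \bar R).
  exact: (E (tau u) (qn u)).
transitivity ((\1_A (qm u) * (z u * qm u + (1 - z u) * qm u))%:E : \bar R).
  congr (_ * _)%:E; move: zdu; nra.
by rewrite -E; apply: eq_integral => v _; case: ifP.
Qed.

Theorem strassen : exists pi, martingale_coupling mu nu pi.
Proof.
pose d u := qm u - qn u.
have md : measurable_fun setT d by exact: measurable_funB.
have idd : unif.-integrable setT (EFin \o d).
  by have := integrableB measurableT iqm iqn; apply: eq_integrable.
pose p u := Num.max (d u) 0; pose n u := Num.max (- d u) 0.
have mp : measurable_fun setT p by apply: measurable_maxr.
have mn : measurable_fun setT n.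
  by apply: measurable_maxr => //; exact: measurable_funN.
have p0 u : 0 <= p u by rewrite le_max lexx orbT.
have n0 u : 0 <= n u by rewrite le_max lexx orbT.
have pnd u : d u = p u - n u.
  by rewrite /p /n; case: (leP (d u) 0) => h; case: (leP (- d u) 0) => h'; lra.
have ip : unif.-integrable setT (EFin \o p).
  apply: (integrable_dom mp (integrable_norm idd)) => u /=.
  by rewrite ger0_norm// ge_max normr_ge0 ler_norm.
have i_n : unif.-integrable setT (EFin \o n).
  apply: (integrable_dom mn (integrable_norm idd)) => u /=.
  by rewrite ger0_norm// ge_max normr_ge0 -normrN ler_norm.
pose l := \int[unif]_u p u.
have lp : (\int[unif]_u (p u)%:E = l%:E)%E.
  by rewrite /l /Rintegral fineK//; exact: integrable_fin_num ip.
have ln : (\int[unif]_u (n u)%:E = l%:E)%E.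
  rewrite -[LHS]fineK; last exact: integrable_fin_num i_n.
  congr EFin; apply/esym/eqP; rewrite -subr_eq0 -[X in _ - X]/(\int[unif]_u n u) -RintegralB//.
  have -> : \int[unif]_x (p x - n x) = \int[unif]_x d x.
    by apply: eq_Rintegral => u _; rewrite pnd.
  by rewrite RintegralB// mean_eq subrr.
have l0 : 0 <= l by exact: Rintegral_ge0.
(* If [l = 0] the two quantile functions agree almost everywhere and nothing has to be moved. *)
move: l0; rewrite le_eqVlt => /predU1P[l0|l0].
  apply: (@coupling_of_matching (cst 0) qn) => //.
  - by move=> u; rewrite lexx ler01.
  - rewrite -l0 in lp ln.
    have /ge0_integral_eq0_ae pz := lp; have /ge0_integral_eq0_ae nz := ln.
    apply: filterS2 (pz _ _) (nz _ _).
    + by move=> u [pu] [nu']; rewrite -/(d u) pnd pu nu' mul0r subrr.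
    + exact/measurable_EFinP.
    + by move=> u; rewrite lee_fin.
    + exact/measurable_EFinP.
    + by move=> u; rewrite lee_fin.
have [cp tp Fap] := unif_transform mp p0 lp l0.
have [cn tn Fbn] := unif_transform mn n0 ln l0.
set Fp := (fun u => _) in cp tp Fap; set Fn := (fun u => _) in cn tn Fbn.
pose a := quantile Fp; pose b := quantile Fn.
have ma : measurable_fun setT a by exact: measurable_quantile1.
have mb : measurable_fun setT b by exact: measurable_quantile1.
have mFp : measurable_fun setT Fp by case: cp => nd _ _ _ _; exact: nondecreasing_measurable.
have mFn : measurable_fun setT Fn by case: cn => nd _ _ _ _; exact: nondecreasing_measurable.
(* By [cx_le], [p - n] has a nonnegative integral up to every level: the excess of [qm] over [qn]
   accumulates before the deficit does. This yields [a s <= b s]. *)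
have Fnp u : 0 < u < 1 -> Fn u <= Fp u.
  move=> u01; rewrite /Fn /Fp ler_pM2l ?invr_gt0// -subr_ge0.
  have mS : measurable (`]-oo, u]%classic : set R) by exact: measurable_itv.
  have iS (f : R -> R) : unif.-integrable setT (EFin \o f) ->
      unif.-integrable `]-oo, u]%classic (EFin \o f).
    by move=> fi; apply: (integrableS measurableT mS) fi.
  rewrite -RintegralB//; [|exact: iS|exact: iS].
  have -> : \int[unif]_(x in `]-oo, u]) (p x - n x) = \int[unif]_(x in `]-oo, u]) (qm x - qn x).
    by apply: eq_Rintegral => x _; rewrite -pnd.
  by rewrite RintegralB//; [rewrite subr_ge0; exact: cx_le|exact: iS|exact: iS].
have good : {ae (@unif R), forall s, [/\ Fp (a s) = s /\ Fn (b s) = s, 0 < d (a s), d (b s) < 0,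
    d (a s) <= qn (b s) - qn (a s) & - d (b s) <= qn (b s) - qn (a s)]}.
  have ga := unif_transform_ae mp p0 ma l0 tp (Q := fun u => 0 < u < 1).
  have gb := unif_transform_ae mn n0 mb l0 tn (Q := fun u => 0 < u < 1).
  have h1 : {ae (@unif R), forall u, 0 < p u -> 0 < u < 1}.
    by apply: filterS (@ae_unif01 R) => u u01 _.
  have h2 : {ae (@unif R), forall u, 0 < n u -> 0 < u < 1}.
    by apply: filterS (@ae_unif01 R) => u u01 _.
  apply: filterS3 (ga h1) (gb h2) (@ae_unif01 R) => s [pa a01] [nb b01] s01.
  have da : 0 < d (a s) by move: pa; rewrite /p lt_max ltxx orbF.
  have db : d (b s) < 0 by move: nb; rewrite /n lt_max ltxx orbF oppr_gt0.
  (* The chain [qn (a s) < qm (a s) <= qm (b s) < qn (b s)] bounds both [d (a s)] and [- d (b s)] by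
     the gap [qn (b s) - qn (a s)], so that the moving probabilities are at most 1. *)
  have ab : a s <= b s.
    by rewrite quantile_le// (le_trans _ (Fnp _ b01))// -[X in X <= _](Fbn _ s01).
  have qab : qm (a s) <= qm (b s).
    by apply: quantile_nd; [exact: is_cdf_cdfr|case/andP: a01| |case/andP: b01].
  have qb : qm (b s) < qn (b s) by rewrite -subr_lt0.
  have qa : qn (a s) < qm (a s) by rewrite -subr_gt0.
  split; [by split; [exact: Fap|exact: Fbn]|exact: da|exact: db| |].
    by rewrite lerD2r (le_trans qab)// ltW.
  by rewrite opprB lerD2l lerN2 (le_trans (ltW qa)).
have [z [tau [mz mtau z01 zd zB]]] := quantile_matching md mqn mFp mFn ma mb tp tn good.
exact: coupling_of_matching zd zB.
Qed.

End strassen.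

(** * Maximising sequences of couplings *)

Section hilbert_selection.
Context d (T : measurableType d) {R : realType} (m : probability T R).

Lemma Rintegral_prob_cst (c : R) : \int[m]_x c = c.
Proof. by rewrite Rintegral_cst//= (@probability_setT _ _ _ m) mulr1. Qed.

(* Near-minimisers of the norm on a decreasing sequence of midpoint-convex sets
   form a Cauchy sequence, by the parallelogram identity. *)
Lemma midpoint_convex_cauchy (S : nat -> set (T -> R)) :
  (forall n f, S n f -> measurable_fun setT f /\ forall x, 0 <= f x <= 1) ->
  (forall n, S n !=set0) ->
  (forall i j, (i <= j)%N -> S j `<=` S i) ->
  (forall n f g, S n f -> S n g -> exists2 h, S n h &
     {ae m, forall x, h x = (f x + g x) / 2}) ->
  exists2 f : nat -> T -> R, (forall j, S j (f j)) &
    forall j, (\int[m]_x (`|f j x - f j.+1 x|)%:E <= (5 * 4^-1 ^+ j)%:E)%E.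
Proof.
move=> S01 S0 Sd Smid.
pose N f := \int[m]_x (f x ^+ 2).
have sq01 (f : T -> R) : (forall x, 0 <= f x <= 1) -> forall x, 0 <= f x ^+ 2 <= 1.
  by move=> f01 x; have := f01 x; nra.
have ibd (f : T -> R) (C : R) := @integrable_bdd R _ _ m f C.
have N01 n f : S n f -> 0 <= N f <= 1.
  move=> Sf; have [mf f01] := S01 _ _ Sf; apply/andP; split.
    by apply: Rintegral_ge0 => x _; rewrite sqr_ge0.
  have -> : 1 = \int[m]_x (1 : R) :> R.
    by rewrite Rintegral_prob_cst.
  apply: le_Rintegral => //.
  - apply: (ibd _ 1); first exact: measurable_funX.
    by move=> x /=; rewrite ger0_norm ?sqr_ge0//; case/andP: (sq01 _ f01 x).
  - exact: finite_measure_integrable_cst.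
  - by move=> x _; case/andP: (sq01 _ f01 x).
pose D n := inf (N @` S n).
have Dhas n : has_inf (N @` S n).
  split; first by have [f Sf] := S0 n; exists (N f), f.
  by exists 0 => _ [f Sf <-]; case/andP: (N01 _ _ Sf).
have DN n f : S n f -> D n <= N f.
  by move=> Sf; apply: ge_inf; [exact: (Dhas n).2|exists f].
have D1 n : D n <= 1.
  by have [f Sf] := S0 n; apply: le_trans (DN _ _ Sf) _; case/andP: (N01 _ _ Sf).
have Dnd i j : (i <= j)%N -> D i <= D j.
  move=> ij; apply: lb_le_inf; first exact: (Dhas j).1.
  by move=> _ [f Sf <-]; apply: DN; exact: Sd Sf.
pose E := sup (range D).
have Ehas : has_sup (range D).
  by split; [exists (D 0%N), 0%N|exists 1 => _ [n _ <-]].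
have DE n : D n <= E by apply: ub_le_sup; [exact: Ehas.2|exists n].
(* With errors [16^-j], consecutive choices have squared distance at most [8 * 16^-j], hence an L1
   distance of order [4^-j], which is summable. *)
pose eps j : R := 4^-1 ^+ j * 4^-1 ^+ j.
have eps0 j : 0 < eps j by rewrite mulr_gt0// exprn_gt0.
have epsS j : eps j.+1 <= eps j.
  by rewrite /eps !exprS; have : 0 < 4^-1 ^+ j :> R by [rewrite exprn_gt0]; nra.
(* The index is at least [j], so that the choice lies in [S j], and so large that the increasing
   infima are within [eps j] of their supremum [E]. *)
have ex j : exists nf : nat * (T -> R), [/\ (j <= nf.1)%N, S nf.1 nf.2,
    E - eps j <= D nf.1 & N nf.2 <= D nf.1 + eps j].
  have [_ [n _ <-] nE] := sup_adherent (eps0 j) Ehas.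
  have [_ [f Sf <-] fD] := inf_adherent (eps0 j) (Dhas (maxn j n)).
  exists (maxn j n, f); split => //=; [exact: leq_maxl| |exact: ltW].
  by apply: le_trans (ltW nE) _; apply: Dnd; exact: leq_maxr.
have {ex} [nf nfP] := choice ex.
exists (fun j => (nf j).2) => j.
  by have [jn Snf _ _] := nfP j; exact: Sd Snf.
have [_ Sj Dj Nj] := nfP j; have [_ Sj1 Dj1 Nj1] := nfP j.+1.
set f := (nf j).2 in Sj Nj *; set g := (nf j.+1).2 in Sj1 Nj1 *.
(* Both functions lie in [S n] for the smaller index, and so does their midpoint up to a null set.
   Its squared norm is thus at least [D n], still within [eps j] of [E]. *)
set n := minn (nf j).1 (nf j.+1).1.
have Sf : S n f by apply: Sd Sj; exact: geq_minl.
have Sg : S n g by apply: Sd Sj1; exact: geq_minr.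
have [h Sh hfg] := Smid _ _ _ Sf Sg.
have [mf f01] := S01 _ _ Sf; have [mg g01] := S01 _ _ Sg; have [mh h01] := S01 _ _ Sh.
have nD : E - eps j <= D n.
  rewrite /n; case: (leqP (nf j).1 (nf j.+1).1) => _ //.
  by apply: le_trans Dj1; rewrite lerD2l lerN2.
have NhD : E - eps j <= N h by apply: le_trans nD _; exact: DN.
have i2 (k : T -> R) : measurable_fun setT k -> (forall x, -1 <= k x <= 1) ->
    m.-integrable setT (EFin \o (fun x => k x ^+ 2)).
  move=> mk k1; apply: (ibd _ 1); first exact: measurable_funX.
  by move=> x /=; rewrite ger0_norm ?sqr_ge0//; have := k1 x; nra.
have if2 : m.-integrable setT (EFin \o (fun x => f x ^+ 2)).
  by apply: i2 => // x; have := f01 x; lra.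
have ig2 : m.-integrable setT (EFin \o (fun x => g x ^+ 2)).
  by apply: i2 => // x; have := g01 x; lra.
have ifg2 : m.-integrable setT (EFin \o (fun x => (f x - g x) ^+ 2)).
  by apply: i2 => [|x]; [exact: measurable_funB|have := f01 x; have := g01 x; lra].
have NhE : N h = \int[m]_x (((f x + g x) / 2) ^+ 2).
  congr fine; apply: ae_eq_integral => //.
  - exact/measurable_EFinP/measurable_funX.
  - apply/measurable_EFinP/measurable_funX/measurable_funM => //.
    exact: measurable_funD.
  - by apply: filterS hfg => x hx _; rewrite hx.
have fgE : \int[m]_x ((f x - g x) ^+ 2) = 2 * N f + 2 * N g - 4 * N h.
  have iZ (c : R) k : m.-integrable setT (EFin \o k) ->
      m.-integrable setT (EFin \o (fun x => c * k x)).
    by move=> ik; have := integrableZl measurableT c ik; apply: eq_integrable.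
  rewrite NhE /N -!RintegralZl//; last first.
    by apply: i2 => [|x]; [apply: measurable_funM => //; exact: measurable_funD
                          |have := f01 x; have := g01 x; lra].
  have iD : m.-integrable setT (EFin \o (fun x => 2 * f x ^+ 2 + 2 * g x ^+ 2)).
    have := integrableD measurableT (iZ 2 _ if2) (iZ 2 _ ig2).
    by apply: eq_integrable.
  rewrite -RintegralD//; [|exact: iZ|exact: iZ].
  rewrite -RintegralB//.
    by apply: eq_Rintegral => x _; field.
  apply: iZ; apply: i2 => [|x]; last by have := f01 x; have := g01 x; lra.
  by apply: measurable_funM => //; exact: measurable_funD.
have fg2 : \int[m]_x ((f x - g x) ^+ 2) <= 8 * eps j.
  rewrite fgE; have := DE (nf j).1; have := DE (nf j.+1).1.
  have := epsS j; lra.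
have c0 : 0 < 4 ^+ j :> R by rewrite exprn_gt0.
have iabs : m.-integrable setT (EFin \o (fun x => `|f x - g x|)).
  apply: (ibd _ 1) => [|x]; first by apply: measurableT_comp => //; exact: measurable_funB.
  by rewrite normr_id ler_norml; have := f01 x; have := g01 x; lra.
rewrite -[X in (X <= _)%E]fineK; last exact: integrable_fin_num iabs.
rewrite lee_fin -[X in X <= _]/(\int[m]_x `|f x - g x|).
have iD : m.-integrable setT (EFin \o (fun x => (2^-1 * 4 ^+ j) * ((f x - g x) ^+ 2))).
  have := integrableZl measurableT (2^-1 * 4 ^+ j) ifg2.
  by apply: eq_integrable.
have ic : m.-integrable setT (EFin \o (fun=> 2^-1 * 4^-1 ^+ j)).
  exact: finite_measure_integrable_cst.
apply: (@le_trans _ _ (\int[m]_x ((2^-1 * 4 ^+ j) * ((f x - g x) ^+ 2) + 2^-1 * 4^-1 ^+ j))).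
  apply: le_Rintegral => //.
    by have := integrableD measurableT iD ic; apply: eq_integrable.
  (* AM-GM *)
  move=> x _; set z := f x - g x; rewrite -(real_normK (num_real z)).
  rewrite exprVn; set c := 4 ^+ j in c0 *; set y := `|z|.
  have cc : c * c^-1 = 1 by rewrite divff// gt_eqF.
  have : 0 <= c^-1 * (c * y - 1) ^+ 2 by rewrite mulr_ge0 ?sqr_ge0// invr_ge0 ltW.
  have -> : c^-1 * (c * y - 1) ^+ 2 = (c * c^-1) * (c * y ^+ 2 - 2 * y) + c^-1 by ring.
  by rewrite cc; lra.
rewrite RintegralD// RintegralZl// Rintegral_prob_cst.
(* The square contributes [4 * 4^-j] and the constant [4^-j / 2], together below [5 * 4^-j]. *)
have : 2^-1 * 4 ^+ j * \int[m]_x ((f x - g x) ^+ 2) <= 2^-1 * 4 ^+ j * (8 * eps j).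
  by apply: ler_wpM2l => //; rewrite mulr_ge0// ltW.
rewrite /eps !exprVn; set c := 4 ^+ j in c0 *.
have -> : 2^-1 * c * (8 * (c^-1 * c^-1)) = 4 * c^-1.
  by field; rewrite gt_eqF.
by have : 0 < c^-1 by [rewrite invr_gt0]; lra.
Qed.

End hilbert_selection.

(** * Conditional distribution functions and quantiles *)

Section kernel_quantile.
Context {R : realType}.

Lemma measure2_eq_ray (m1 m2 : {measure set (R * R) -> \bar R}) :
  (m1 setT < +oo)%E ->
  (forall A, measurable A -> m1 (A `*` setT) = m2 (A `*` setT)) ->
  (forall A y, measurable A -> m1 (A `*` `]-oo, y]%classic) = m2 (A `*` `]-oo, y]%classic)) ->
  forall C, measurable C -> m1 C = m2 C.
Proof.
move=> m1oo m12T m12; apply: measure2_eq_rect => // A B mA mB.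
have mAT : measurable (A `*` setT : set (R * R)) by exact: measurableX.
have msnd := @measurable_snd _ _ R R.
have E (m : {measure set (R * R) -> \bar R}) C : measurable C ->
    m (A `*` C) = pushforward (mrestr m mAT) snd C.
  move=> mC; rewrite /pushforward /mrestr; congr (m _).
  by apply/seteqP; split => [[x y] [/= ? ?]|[x y] [/= ? []]].
rewrite E// [RHS]E//; apply: measure_eq_ray => //.
- change (mrestr m1 mAT (snd @^-1` setT) < +oo)%E.
  rewrite /mrestr preimage_setT setTI; apply: le_lt_trans m1oo.
  by apply: le_measure; rewrite ?inE.
- by have := m12T _ mA; rewrite E// [X in _ = X]E.
- by move=> y; have := m12 _ y mA; rewrite E// [X in _ = X]E.
Qed.

Lemma is_cdf_measure (m : {measure set R -> \bar R}) : m setT = 1%E ->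
  is_cdf (fun y => fine (m `]-oo, y]%classic)).
Proof.
move=> m1; have -> : (fun y => fine (m `]-oo, y]%classic)) = cdfr (mnormalize m unif).
  apply/funext => y; rewrite /cdfr/= /mnormalize m1 onee_eq0/=.
  by rewrite invr1 mule1.
exact: is_cdf_cdfr.
Qed.

(** A genuine distribution function is required at every [x], not only almost every one, so that
    quantiles can be taken without exceptional sets. *)
Definition has_cdf (mu : probability R R) (pi : probability (R * R)%type R)
    (F : R -> R -> R) : Prop :=
  [/\ forall x, is_cdf (F x), forall y, measurable_fun setT (F ^~ y) &
      forall A y, measurable A ->
        pi (A `*` `]-oo, y]%classic) = (\int[mu]_(x in A) (F x y)%:E)%E].

Lemma conditional_law_cdf mu pi (k : R.-pker R ~> R) :
  conditional_law mu pi k -> has_cdf mu pi (fun x y => fine (k x `]-oo, y]%classic)).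
Proof.
move=> kpi; have kfin x y : k x `]-oo, y]%classic \is a fin_num.
  rewrite ge0_fin_numE ?measure_ge0//; apply: (@le_lt_trans _ _ (k x setT)).
    by apply: le_measure; rewrite ?inE.
  by rewrite prob_kernel ltry.
split.
- by move=> x; apply: is_cdf_measure; exact: prob_kernel.
- move=> y; apply/measurable_EFinP.
  have -> : EFin \o (fun x => fine (k x `]-oo, y]%classic)) = k ^~ `]-oo, y]%classic.
    by apply/funext => x /=; rewrite fineK.
  exact: measurable_kernel.
- move=> A y mA; rewrite kpi//; apply: eq_integral => x _; rewrite fineK//.
Qed.

Variables (mu : probability R R) (pi : probability (R * R)%type R).
Variable F : R -> R -> R.
Hypothesis hF : has_cdf mu pi F.

Let Q (w : R * R) := quantile (F w.1) w.2.

Lemma measurable_cdf_quantile : measurable_fun setT Q.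
Proof. by have [cF mF _] := hF; exact: measurable_quantile. Qed.

Lemma measurable_pair_quantile : measurable_fun setT (fun w => (w.1, Q w)).
Proof. by apply: measurable_fun_pair => //; exact: measurable_cdf_quantile. Qed.

(** The value [F x y] is the uniform measure of the levels [u] with [Q (x, u) <= y]; joint
    measurability then passes from [Q] to [F] by Tonelli. *)
Lemma measurable_cdf2 : measurable_fun setT (fun w : R * R => F w.1 w.2).
Proof.
have [cF mF _] := hF.
pose f (z : (R * R) * R) : \bar R := (\1_[set z : (R * R) * R | Q (z.1.1, z.2) <= z.1.2] z)%:E.
have mS : measurable [set z : (R * R) * R | Q (z.1.1, z.2) <= z.1.2].
  rewrite -[X in measurable X]setTI.
  apply: (measurable_fun_ler _ _ _ (Y := [set true])) => //.
  - apply: (measurableT_comp measurable_cdf_quantile); apply: measurable_fun_pair => //.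
    exact: measurableT_comp measurable_fst measurable_fst.
  - exact: measurableT_comp measurable_snd measurable_fst.
have mf : measurable_fun setT f by exact/measurable_EFinP/measurable_indic.
have f0 z : (0 <= f z)%E by rewrite lee_fin.
have := measurable_fun_fubini_tonelli_F (m2 := unif) f mf f0.
have -> : fubini_F unif f = EFin \o (fun w : R * R => F w.1 w.2).
  apply/funext => w; rewrite /fubini_F.
  have [mq /= <-] := unif_quantile_le w.2 (cF w.1).
  transitivity (\int[unif]_u (\1_[set u | (quantile (F w.1) u <= w.2)%R] u)%:E)%E.
    apply: eq_integral => u _; rewrite /f !indicE.
    have -> : ((w, u) \in [set z | Q (z.1.1, z.2) <= z.1.2]) = (quantile (F w.1) u <= w.2).
      by apply/idP/idP; rewrite !inE.
    have -> : (u \in [set u | quantile (F w.1) u <= w.2]) = (quantile (F w.1) u <= w.2).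
      by apply/idP/idP; rewrite !inE.
    by [].
  by rewrite integral_indic//= setIT.
by move/measurable_EFinP.
Qed.

(** The conditional quantile transform: a coupling is the law of [(x, Q (x, u))] under [mu \x unif].
    It puts all couplings with first marginal [mu] on one probability space. *)
Lemma law_cdf_quantile C : measurable C ->
  pi C = (mu \x unif)%E ((fun w => (w.1, Q w)) @^-1` C).
Proof.
have [cF mF piF] := hF.
have mZ := measurable_pair_quantile.
pose m2 := law (mu \x unif)%E mZ.
have E A y : measurable A ->
    m2 (A `*` `]-oo, y]%classic) = (\int[mu]_(x in A) (F x y)%:E)%E.
  move=> mA; rewrite /m2 lawE.
  have mS : measurable ((fun w => (w.1, Q w)) @^-1` (A `*` `]-oo, y]%classic)).
    have h := measurable_pair_quantile.
    by rewrite -[X in measurable X]setTI; apply: h => //; exact: measurableX.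
  rewrite integral_mkcond; apply: eq_integral => x _.
  rewrite patchE /=; have [xA|xA] := boolP (x \in A).
    rewrite -(unif_quantile_le y (cF x)).2; congr (unif _).
    apply/seteqP; split => u; rewrite /xsection/= inE/= in_itv/=.
      by case.
    by move=> qy; split => //; exact: set_mem.
  rewrite [X in unif X](_ : _ = set0) ?measure0// -subset0 => u.
  by rewrite /xsection/= inE/= => -[/mem_set xA' _]; rewrite xA' in xA.
have F01 x y : 0 <= F x y <= 1 by case: (cF x).
apply: (@measure2_eq_ray pi m2).
- by apply: (@le_lt_trans _ _ 1%E); [exact: probability_le1|exact: ltry].
- move=> A mA.
  have AT : A `*` [set: R] = \bigcup_n (A `*` `]-oo, n%:R : R]%classic).
    apply/seteqP; split => [[x y] [/= Ax _]|[x y] [n _ [/= Ax _]]] //.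
    exists (Num.bound `|y|) => //; split => //=; rewrite in_itv/=.
    by rewrite (le_trans (ler_norm _))// ltW// archi_boundP.
  rewrite AT.
  have h (m : {measure set (R * R) -> \bar R}) :
     m (A `*` `]-oo, n%:R : R]%classic) @[n --> \oo] --> m (\bigcup_n (A `*` `]-oo, n%:R : R]%classic)).
    apply: nondecreasing_cvg_mu.
    - by move=> n; exact: measurableX.
    - by apply: bigcup_measurable => n _; exact: measurableX.
    - move=> i j ij; apply/subsetPset => -[x y] [/= Ax]; rewrite in_itv/= => yi.
      by split => //=; rewrite in_itv/= (le_trans yi)// ler_nat.
  have hpi := h pi; have hm2 := h m2.
  have e : (fun n : nat => pi (A `*` `]-oo, n%:R : R]%classic)) =
      (fun n : nat => m2 (A `*` `]-oo, n%:R : R]%classic)).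
    by apply/funext => n; rewrite piF// E.
  rewrite e in hpi.
  exact: cvg_unique hpi hm2.
- by move=> A y mA; exact: etrans (piF A y mA) (esym (E A y mA)).
Qed.

End kernel_quantile.

(** * The logistic map and distances between quantile functions *)

Section logistic.
Context {R : realType}.

Definition logistic (q : R) := (1 + expR (- q))^-1.
Definition logit (u : R) := ln (u / (1 - u)).

Lemma logistic_itv q : 0 < logistic q < 1.
Proof.
have e0 := expR_gt0 (- q); rewrite /logistic invr_gt0 addr_gt0//=.
by rewrite invf_lt1 ?addr_gt0// ltrDl.
Qed.

Lemma logistic_lt q r : (logistic q < logistic r) = (q < r).
Proof.
rewrite /logistic ltf_pV2 ?posrE ?addr_gt0 ?expR_gt0//.
by rewrite ltrD2l ltr_expR ltrN2.
Qed.

Lemma logitK u : 0 < u < 1 -> logistic (logit u) = u.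
Proof.
move=> /andP[u0 u1]; have v0 : 0 < 1 - u by rewrite subr_gt0.
rewrite /logistic /logit expRN lnK ?posrE ?divr_gt0// invf_div.
by field; rewrite !gt_eqF// addrC subrK.
Qed.

Lemma logisticK q : logit (logistic q) = q.
Proof.
have E := logitK (logistic_itv q); apply/eqP.
by case: (ltgtP (logit (logistic q)) q) => //; rewrite -logistic_lt E ltxx.
Qed.

Lemma logit_lt u q : 0 < u < 1 -> (logit u < q) = (u < logistic q).
Proof. by move=> u01; rewrite -logistic_lt logitK. Qed.

Lemma measurable_logit : measurable_fun setT logit.
Proof.
apply: (measurableT_comp (@measurable_ln R)); apply: measurable_funM => //.
apply: (measurableT_comp (@measurable_invr R)); exact: measurable_funB.
Qed.

Lemma measurable_logistic : measurable_fun setT logistic.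
Proof.
apply: (measurableT_comp (@measurable_invr R)); apply: measurable_funD => //.
by apply: (measurableT_comp (@measurable_expR R)); exact: oppr_measurable.
Qed.

Lemma continuous_logit u : 0 < u < 1 -> {for u, continuous logit}.
Proof.
move=> /andP[u0 u1]; have v0 : 0 < 1 - u by rewrite subr_gt0.
apply: continuous_comp; last by apply: continuous_ln; rewrite divr_gt0.
apply: cvgM; first exact: cvg_id.
apply: cvgV; first by rewrite gt_eqF.
by apply: cvgB; [exact: cvg_cst|exact: cvg_id].
Qed.

End logistic.

Section quantile_distance.
Context {R : realType}.

Lemma unif_itv_bd (b1 b2 : bool) (c d : R) : 0 <= c -> c <= d -> d <= 1 ->
  unif [set` Interval (BSide b1 c) (BSide b2 d)] = (d - c)%:E.
Proof.
move=> c0 cd d1; rewrite unifE//.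
have mI b b' : measurable ([set` Interval (BSide b c) (BSide b' d)] : set R).
  exact: measurable_itv.
have -> : [set` Interval (BSide b1 c) (BSide b2 d)] `&` `[0, 1]%classic =
    [set` Interval (BSide b1 c) (BSide b2 d)].
  apply/setIidPl => x /=; rewrite !itv_boundlr/= => /andP[xc xd].
  rewrite !bnd_simp; apply/andP; split.
    by case: b1 xc; rewrite bnd_simp => h; rewrite (le_trans c0)// ?ltW.
  by case: b2 xd; rewrite bnd_simp => h; apply: le_trans d1; first exact: ltW.
rewrite lebesgue_measure_itv/= lte_fin; case: ltP => // dc.
by rewrite (le_anti (introT andP (conj cd dc))) subrr.
Qed.

Lemma unif_dist_lt (c d : R) : 0 <= c <= 1 -> 0 <= d <= 1 ->
  (\int[unif]_v (`|(v < c)%R%:R - (v < d)%R%:R|)%:E = `|c - d|%:E)%E.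
Proof.
wlog cd : c d / c <= d.
  move=> h c01 d01; case: (leP c d) => [cd|/ltW dc]; first exact: h.
  by rewrite distrC -h//; apply: eq_integral => v _; rewrite distrC.
move=> /andP[c0 c1] /andP[d0 d1].
rewrite (eq_integral (fun v => (\1_(`[c, d[) v)%:E)); last first.
  move=> v _; rewrite indicE mem_setE in_itv/=; congr EFin.
  case: (ltP v c) => vc; case: (ltP v d) => vd /=; rewrite ?subrr ?normr0 ?sub0r ?normrN1 ?normr1//.
  by have := lt_le_trans vc (le_trans cd vd); rewrite ltxx.
rewrite integral_indic//= setIT unif_itv_bd//.
by rewrite ler0_norm ?subr_le0// opprB.
Qed.

Lemma unif_dist_gt (c d : R) : 0 <= c <= 1 -> 0 <= d <= 1 ->
  (\int[unif]_u (`|(c < u)%R%:R - (d < u)%R%:R|)%:E = `|c - d|%:E)%E.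
Proof.
wlog cd : c d / c <= d.
  move=> h c01 d01; case: (leP c d) => [cd|/ltW dc]; first exact: h.
  by rewrite distrC -h//; apply: eq_integral => v _; rewrite distrC.
move=> /andP[c0 c1] /andP[d0 d1].
rewrite (eq_integral (fun v => (\1_(`]c, d]) v)%:E)); last first.
  move=> v _; rewrite indicE mem_setE in_itv/=; congr EFin.
  case: (ltP c v) => vc; case: (ltP d v) => vd /=; rewrite ?subrr ?normr0 ?subr0 ?sub0r ?normrN1 ?normr1//.
  by have := lt_le_trans vd (le_trans vc cd); rewrite ltxx.
rewrite integral_indic//= setIT unif_itv_bd//.
by rewrite ler0_norm ?subr_le0// opprB.
Qed.

Lemma is_cdf_measurable (F : R -> R) : is_cdf F -> measurable_fun setT F.
Proof. by case=> nd _ _ _ _; exact: nondecreasing_measurable. Qed.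

(* The logistic map makes both distances finite. *)
Lemma quantile_dist (F G : R -> R) : is_cdf F -> is_cdf G ->
  (\int[unif]_u (`|logistic (quantile F u) - logistic (quantile G u)|)%:E =
   \int[unif]_v (`|F (logit v) - G (logit v)|)%:E)%E.
Proof.
move=> cF cG; have mF := is_cdf_measurable cF; have mG := is_cdf_measurable cG.
have mqF := measurable_quantile1 cF; have mqG := measurable_quantile1 cG.
have ml := @measurable_logistic R; have mh := @measurable_logit R.
(* The indicator of the region between the two graphs. Its area is the left side when sliced along
   [u] and the right side when sliced along [v]. *)
pose g (w : R * R) : \bar R := (`|(w.2 < logistic (quantile F w.1))%R%:R -
  (w.2 < logistic (quantile G w.1))%R%:R|)%:E.
have mb (b : R * R -> bool) : measurable_fun setT b ->
    measurable_fun setT (fun w => (b w)%:R : R).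
  move=> mb; have -> : (fun w => (b w)%:R) = (fun w => if b w then 1 else 0 : R).
    by apply/funext => w; case: (b w).
  exact: measurable_fun_ifT.
have mg : measurable_fun setT g.
  apply/measurable_EFinP; apply: measurableT_comp => //.
  apply: measurable_funB; apply: mb; apply: measurable_fun_ltr => //.
  - by apply: measurableT_comp ml _; exact: measurableT_comp mqF measurable_fst.
  - by apply: measurableT_comp ml _; exact: measurableT_comp mqG measurable_fst.
have l01 (q : R) : 0 <= logistic q <= 1.
  by have /andP[/ltW -> /ltW ->] := logistic_itv q.
transitivity (\int[unif]_u \int[unif]_v g (u, v))%E.
  by apply: eq_integral => u _; rewrite -unif_dist_lt.
rewrite fubini_tonelli//; last by move=> w; rewrite lee_fin.
have mFh : measurable_fun setT (fun v => `|F (logit v) - G (logit v)|).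
  apply: measurableT_comp => //; apply: measurable_funB; exact: measurableT_comp.
apply: ge0_ae_eq_integral => //.
- apply: (measurable_fun_fubini_tonelli_G g) => // w; rewrite lee_fin//.
- exact/measurable_EFinP.
- by move=> v _; apply: integral_ge0 => u _; rewrite lee_fin.
apply: filterS (@ae_unif01 R) => v v01 _.
have [[_ _ F01 _ _] [_ _ G01 _ _]] := (cF, cG).
rewrite -unif_dist_gt//.
have mF1 (c : R) : measurable_fun setT (fun u : R => (c < u)%R%:R : R).
  have -> : (fun u : R => (c < u)%R%:R) = (fun u => if c < u then 1 else 0 : R).
    by apply/funext => w; case: (c < w).
  by apply: measurable_fun_ifT => //; exact: measurable_fun_ltr.
apply: ge0_ae_eq_integral => //.
- by apply: measurableT_comp mg _; apply: measurable_fun_pair.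
- apply/measurable_EFinP; apply: measurableT_comp => //.
  by apply: measurable_funB; exact: mF1.
- by move=> u _; rewrite lee_fin.
apply: filterS (@ae_unif01 R) => u u01 _; rewrite /g/=.
have E H : is_cdf H -> (v < logistic (quantile H u)) = (H (logit v) < u).
  by move=> cH; rewrite -logit_lt// !ltNge quantile_le.
by rewrite !E.
Qed.

End quantile_distance.

(** * Almost everywhere convergence from summable steps *)

Section summable.
Context d (T : measurableType d) {R : realType} (m : {measure set T -> \bar R}).

Lemma cvg_of_summable_steps (v : R ^nat) :
  (\sum_(0 <= j <oo) (`|v j - v j.+1|)%:E < +oo)%E -> cvgn v.
Proof.
set S := (\sum_(0 <= j <oo) _)%E => Soo.
have Sge n : ((\sum_(0 <= j < n) `|v j - v j.+1|)%:E <= S)%E.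
  by rewrite -sumEFin; apply: nneseries_lim_ge => j _; rewrite lee_fin.
have S0 : S \is a fin_num by rewrite ge0_fin_numE//; apply: nneseries_ge0 => j _ _; rewrite lee_fin.
have nc : cvgn [normed series (telescope v)].
  apply: nondecreasing_is_cvgn.
    apply/nondecreasing_seqP => n.
    by rewrite -subr_ge0 /= /series/= big_nat_recr//= addrAC subrr add0r.
  exists (fine S) => _ [n _ <-]; rewrite -lee_fin fineK//.
  apply: le_trans (Sge n); rewrite lee_fin /series/= ler_sum// => j _.
  by rewrite /telescope distrC.
have := normed_cvg nc; rewrite telescopeK => c.
have -> : v = (fun n => (v n - v 0%N) + v 0%N) by apply/funext => n; rewrite subrK.
by apply: is_cvgD => //; exact: is_cvg_cst.
Qed.

Lemma ae_cvg_of_L1_steps (u : nat -> T -> R) :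
  (forall j, measurable_fun setT (u j)) ->
  (forall j, (\int[m]_x (`|u j x - u j.+1 x|)%:E <= (5 * 4^-1 ^+ j)%:E)%E) ->
  {ae m, forall x, cvgn (u ^~ x)}.
Proof.
move=> mu uE.
pose f j x := (`|u j x - u j.+1 x|)%:E.
have mf j : measurable_fun setT (f j).
  by apply/measurable_EFinP; apply: measurableT_comp => //; exact: measurable_funB.
have f0 j x : (0 <= f j x)%E by rewrite lee_fin.
have mS : measurable_fun setT (fun x => \sum_(0 <= j <oo) f j x)%E.
  by apply: ge0_emeasurable_sum => // j x _ _.
have S0 x : (0 <= \sum_(0 <= j <oo) f j x)%E by apply: nneseries_ge0 => j _ _.
have iS : m.-integrable setT (fun x => \sum_(0 <= j <oo) f j x)%E.
  apply/integrableP; split => //.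
  under eq_integral do rewrite gee0_abs//.
  rewrite integral_nneseries//.
  (* The sum of the series [5 * 4^-j] is 20/3. *)
  apply: (@le_lt_trans _ _ (20 / 3)%:E); last exact: ltry.
  apply: lime_le; first by apply: is_cvg_nneseries => n _ _; exact: integral_ge0.
  apply: nearW => n.
  apply: (@le_trans _ _ (\sum_(0 <= j < n) (5 * 4^-1 ^+ j)%:E)%E).
    by apply: lee_sum => j _; exact: uE.
  rewrite sumEFin lee_fin.
  have -> : \sum_(0 <= j < n) (5 * 4^-1 ^+ j) = 20 / 3 * (1 - 4^-1 ^+ n) :> R.
    elim: n => [|n IH]; first by rewrite big_geq// expr0 subrr mulr0.
    by rewrite big_nat_recr//= IH exprS; field.
  have : 0 <= 4^-1 ^+ n :> R by rewrite exprn_ge0.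
  by lra.
apply: filterS (integrable_ae measurableT iS) => x /(_ Logic.I) Sx.
apply: cvg_of_summable_steps; move: Sx; rewrite ge0_fin_numE//.
Qed.

End summable.

(** * Couplings as functions on the unit square *)

Section compactness.
Context {R : realType} (mu nu : probability R R).

Let m : probability (R * R)%type R := (mu \x unif)%E.

(** Reparametrising the level by [logit] makes conditional distribution functions elements of the
    unit ball of L2 of the probability [mu \x unif], where midpoints of couplings become midpoints
    of functions. *)
Definition graph_cdf (F : R -> R -> R) (w : R * R) := F w.1 (logit w.2).

Lemma measurable_graph_cdf pi F : has_cdf mu pi F -> measurable_fun setT (graph_cdf F).
Proof.
move=> hF; rewrite /graph_cdf.
apply: (@measurableT_comp _ _ _ _ _ _ (fun w : R * R => F w.1 w.2) _ (fun w => (w.1, logit w.2))).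
  exact: measurable_cdf2 hF.
apply: measurable_fun_pair => //; exact: measurableT_comp measurable_logit measurable_snd.
Qed.

Lemma graph_cdf01 pi F w : has_cdf mu pi F -> 0 <= graph_cdf F w <= 1.
Proof. by case=> cF _ _; have [_ _ /(_ (logit w.2))] := cF w.1. Qed.

(** At a fixed level both sides have the same integral over every measurable set of [x], hence agree
    for [mu]-almost all [x]. Integrating the absolute difference over the levels last gives the
    statement on the product. *)
Lemma graph_cdf_midpoint p q r F G H : has_cdf mu p F -> has_cdf mu q G ->
  has_cdf mu r H -> (forall C, measurable C -> r C = 2^-1%:E * p C + 2^-1%:E * q C)%E ->
  {ae m, forall w, graph_cdf H w = (graph_cdf F w + graph_cdf G w) / 2}.
Proof.
move=> hF hG hH rE.
have [[mgF mgG] mgH] := (measurable_graph_cdf hF, measurable_graph_cdf hG, measurable_graph_cdf hH).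
pose g w := (`|graph_cdf H w - (graph_cdf F w + graph_cdf G w) / 2|)%:E.
have mg : measurable_fun setT g.
  apply/measurable_EFinP; apply: measurableT_comp => //; apply: measurable_funB => //.
  by apply: measurable_funM => //; exact: measurable_funD.
have g0 w : (0 <= g w)%E by rewrite lee_fin.
have aeg : {ae m, forall w, g w = 0%E}.
  apply: ge0_integral_eq0_ae => //.
  rewrite /m fubini_tonelli2//.
  apply: integral0_eq => v _; rewrite /fubini_G /=.
  have [[cF mF pF] [cG mG pG] [cH mH pH]] := And3 hF hG hH.
  have bF c K L : has_cdf mu K L -> mu.-integrable setT (EFin \o L^~ c).
    move=> [cL mL _]; apply: (@integrable_bdd _ _ _ _ _ 1) => // x.
    by rewrite ger0_norm; case: (cL x) => _ _ /(_ c) /andP[].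
  have E : ae_eq mu setT (EFin \o H^~ (logit v)) (EFin \o (fun x => (F x (logit v) + G x (logit v)) / 2)).
    apply: ae_eq_sym; apply: integral_ae_eq => //.
    - have := integrableZr measurableT (2^-1) (integrableD measurableT (bF (logit v) _ _ hF) (bF (logit v) _ _ hG)).
      by apply: eq_integrable.
    - exact/measurable_EFinP.
    - move=> A _ mA; rewrite -pH// rE; last exact: measurableX.
      rewrite pF// pG//.
      have iS K L : has_cdf mu K L -> mu.-integrable A (EFin \o L^~ (logit v)).
        by move=> h; exact: integrableS measurableT mA _ (bF _ _ _ h).
      rewrite -!integralZl//; [|exact: iS hG|exact: iS hF].
      rewrite -integralD//; [|exact: integrableZl (iS _ _ hF)|exact: integrableZl (iS _ _ hG)].
      apply: eq_integral => x _ /=; rewrite -!EFinM -EFinD; congr EFin; lra.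
  rewrite (ae_eq_integral (cst 0%E))//; first by rewrite integral0.
  - by apply: measurableT_comp mg _; apply: measurable_fun_pair.
  - apply: filterS E => x Ex _; rewrite /g /graph_cdf /=.
    by have /= [->] := Ex Logic.I; rewrite subrr normr0.
apply: filterS aeg => w; rewrite /g => -[/eqP].
by rewrite normr_eq0 subr_eq0 => /eqP.
Qed.

Lemma graph_cdf_dist p q F G : has_cdf mu p F -> has_cdf mu q G ->
  (\int[m]_w (`|logistic (quantile (F w.1) w.2) - logistic (quantile (G w.1) w.2)|)%:E
   = \int[m]_w (`|graph_cdf F w - graph_cdf G w|)%:E)%E.
Proof.
move=> hF hG.
have mq p' F' (h : has_cdf mu p' F') : measurable_fun setT (fun w => logistic (quantile (F' w.1) w.2)).
  exact: measurableT_comp measurable_logistic (measurable_cdf_quantile h).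
have ma (f g : R * R -> R) : measurable_fun setT f -> measurable_fun setT g ->
    measurable_fun setT (fun w => (`|f w - g w|)%:E).
  by move=> mf mg; apply/measurable_EFinP; apply: measurableT_comp => //; exact: measurable_funB.
have e (f g : R * R -> R) : measurable_fun setT f -> measurable_fun setT g ->
    (\int[m]_w (`|f w - g w|)%:E = \int[mu]_x \int[unif]_u (`|f (x, u) - g (x, u)|)%:E)%E.
  by move=> mf mg; rewrite /m fubini_tonelli1//; exact: ma.
rewrite (e (graph_cdf F))//; [|exact: measurable_graph_cdf hF|exact: measurable_graph_cdf hG].
rewrite e; [|exact: mq hF|exact: mq hG].
apply: eq_integral => x _.
by case: hF hG => cF _ _ [cG _ _]; exact: (quantile_dist (cF x) (cG x)).
Qed.

End compactness.

(** * Dominated convergence with varying bounds *)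

Section pratt.
Context d (T : measurableType d) {R : realType} (m : {measure set T -> \bar R}).

Lemma measurable_limn_einf (f : nat -> T -> \bar R) :
  (forall j, measurable_fun setT (f j)) ->
  measurable_fun setT (fun x => limn_einf (f ^~ x)).
Proof.
move=> mf; have -> : (fun x => limn_einf (f ^~ x)) =
    (fun x => - limn_esup (fun j => - f j x))%E.
  by apply/funext => x; rewrite -[LHS]oppeK -limn_esupN.
apply: measurableT_comp => //; apply: measurable_fun_limn_esup => j.
exact: measurableT_comp.
Qed.

(** Fatou's lemma for [g_ j + g - |f_ j - f|], which is nonnegative and tends to [2 g]. The bounds
    may vary with [j] because their integrals do not; this fits functions of the [Q_ j], all of law
    [nu]. *)
Lemma pratt (f_ g_ : nat -> T -> R) (f g : T -> R) :
  (forall j, measurable_fun setT (f_ j)) -> measurable_fun setT f ->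
  (forall j, m.-integrable setT (EFin \o g_ j)) -> m.-integrable setT (EFin \o g) ->
  (forall j x, `|f_ j x| <= g_ j x) -> (forall x, `|f x| <= g x) ->
  {ae m, forall x, f_ j x @[j --> \oo] --> f x} ->
  {ae m, forall x, g_ j x @[j --> \oo] --> g x} ->
  (forall j, \int[m]_x g_ j x = \int[m]_x g x) ->
  (\int[m]_x f_ j x) @[j --> \oo] --> \int[m]_x f x.
Proof.
move=> mf_ mf ig_ ig fg_ fg fcvg gcvg intg.
have if_ j := integrable_dom (mf_ j) (ig_ j) (fg_ j).
have if0 := integrable_dom mf ig fg.
have ifB j : m.-integrable setT (EFin \o (fun x => f_ j x - f x)).
  by have := integrableB measurableT (if_ j) if0; apply: eq_integrable.
have iabs j : m.-integrable setT (EFin \o (fun x => `|f_ j x - f x|)).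
  exact: integrable_abse (ifB j).
pose a j := \int[m]_x `|f_ j x - f x|.
have igg j : m.-integrable setT (EFin \o (fun x => g_ j x + g x)).
  by have := integrableD measurableT (ig_ j) ig; apply: eq_integrable.
pose h j x := g_ j x + g x - `|f_ j x - f x|.
have ih j : m.-integrable setT (EFin \o h j).
  by have := integrableB measurableT (igg j) (iabs j); apply: eq_integrable.
have hE j : (\int[m]_x (h j x)%:E = (2 * \int[m]_x g x)%:E + - (a j)%:E)%E.
  have -> : (\int[m]_x (h j x)%:E = (\int[m]_x h j x)%:E)%E.
    by rewrite fineK//; exact: integrable_fin_num (ih j).
  rewrite -EFinB; congr EFin; rewrite RintegralB// RintegralD// intg /a.
  by congr (_ - _); ring.
have h0 j x : 0 <= h j x.
  rewrite /h subr_ge0 (le_trans (ler_normB _ _))//; apply: lerD => //; exact: fg_.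
have mh j : measurable_fun setT (EFin \o h j) by have /integrableP[] := ih j.
have hlim : {ae m, forall x, limn_einf (fun j => (h j x)%:E) = (2 * g x)%:E}.
  apply: filterS2 fcvg gcvg => x fx gx.
  apply: (fst (cvg_limn_einf_sup _)); apply: cvg_EFin; first exact: nearW.
  have -> : 2 * g x = g x + g x - `|f x - f x| by rewrite subrr normr0 subr0; ring.
  apply: cvgB; first by apply: cvgD => //; exact: cvg_cst.
  by apply: cvg_norm; apply: cvgB => //; exact: cvg_cst.
have i2g : m.-integrable setT (EFin \o (fun x => 2 * g x)).
  by have := integrableZl measurableT 2 ig; apply: eq_integrable.
have := fatou m measurableT (f := fun j x => (h j x)%:E) mh (fun j x _ => h0 j x).
rewrite (@ae_eq_integral _ _ _ m _ (EFin \o (fun x => 2 * g x)))//; first last.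
- by apply: filterS hlim => x hx _.
- exact: measurable_int i2g.
- by apply: measurable_limn_einf => j; exact: mh.
have -> : (fun n => \int[m]_x (h n x)%:E)%E = (fun n => (2 * \int[m]_x g x)%:E + - (a n)%:E)%E.
  by apply/funext => n; exact: hE.
rewrite limn_einf_shift//.
have -> : (fun j => (- (a j)%:E)%E) = -%E \o (fun j => (a j)%:E) by [].
rewrite limn_einfN.
have -> : (\int[m]_x (2 * g x)%:E = (2 * \int[m]_x g x)%:E)%E.
  rewrite -(RintegralZl _ _ ig)// /Rintegral fineK//; exact: integrable_fin_num i2g.
move=> le2.
have ae0 : (limn_esup (fun j => (a j)%:E) <= 0)%E.
  move: le2; case: (limn_esup _) => [r| |]//=; rewrite ?leeNy_eq ?addeNy//.
  by rewrite -EFinD !lee_fin; lra.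
have a0 j : 0 <= a j by apply: Rintegral_ge0.
have : (a j)%:E @[j --> \oo] --> 0%E.
  by apply: limn_esup_le_cvg ae0 _ => j; rewrite lee_fin.
move/fine_cvgP => [_ acvg].
apply/cvgrPdist_le => e e0.
have /cvgrPdist_le/(_ _ e0) := acvg; apply: filterS => j /=.
rewrite sub0r normrN ger0_norm//; apply: le_trans.
rewrite distrC -RintegralB//; exact: le_normr_Rintegral.
Qed.

End pratt.

(** * Limits of couplings *)

Section compactness_limit.
Context {R : realType} (mu nu : probability R R).

Let m : probability (R * R)%type R := (mu \x unif)%E.

Lemma fst_graph A : measurable A -> m (fst @^-1` A) = mu A.
Proof.
move=> mA; have -> : fst @^-1` A = A `*` [set: R] by apply/seteqP; split => [[x y]|[x y] []].
apply: etrans (product_measure1E _ _ mA measurableT) _.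
by have := @probability_setT _ _ _ (@unif R) => /= ->; rewrite mule1.
Qed.

Lemma martingale_coupling_test pi : martingale_coupling mu nu pi ->
  forall A, measurable A ->
  (\int[pi]_w (\1_A w.1 * w.2)%:E = \int[pi]_w (\1_A w.1 * w.1)%:E)%E.
Proof.
move=> [_ _ _ [_ _ _ piE]] A mA.
have mA' : measurable (fst @^-1` A : set (R * R)).
  by rewrite -[X in measurable X]setTI; exact: measurable_fst.
have E (f : R * R -> R) : (\int[pi]_w (\1_A w.1 * f w)%:E = \int[pi]_(w in fst @^-1` A) (f w)%:E)%E.
  rewrite [RHS]integral_mkcond; apply: eq_integral => w _; rewrite patchE indicE.
  have -> : (w \in fst @^-1` A) = (w.1 \in A) by apply/idP/idP; rewrite !inE.
  by case: (w.1 \in A); rewrite ?mul1r ?mul0r.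
by rewrite !E; symmetry; apply: piE; exists A => //; rewrite setTI.
Qed.

Variables (p : nat -> probability (R * R)%type R) (Q_ : nat -> R * R -> R) (Q : R * R -> R).
Hypothesis inu : nu.-integrable setT (EFin \o id).
Hypothesis imu : mu.-integrable setT (EFin \o id).
Hypothesis mQ_ : forall j, measurable_fun setT (Q_ j).
Hypothesis mQ : measurable_fun setT Q.
Hypothesis pM : forall j, martingale_coupling mu nu (p j).
Hypothesis pE : forall j C, measurable C -> p j C = m ((fun w => (w.1, Q_ j w)) @^-1` C).
Hypothesis Qcvg : {ae m, forall w, Q_ j w @[j --> \oo] --> Q w}.

Let mXQ_ j : measurable_fun setT (fun w => (w.1, Q_ j w)).
Proof. by apply: measurable_fun_pair. Qed.

Lemma snd_graph j A : measurable A -> m (Q_ j @^-1` A) = nu A.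
Proof.
move=> mA; have [_ <- //] := pM j.
by rewrite pE// -[X in measurable X]setTI; exact: measurable_snd.
Qed.

(** Bounded continuous functions have the same integral along the sequence and in the limit; ramps
    of increasing slope then recover the half-lines. *)
Lemma snd_graph_limit A : measurable A -> m (Q @^-1` A) = nu A.
Proof.
have E (f : R -> R) : continuous f -> (forall y, `|f y| <= 1) ->
    \int[m]_w f (Q w) = \int[nu]_y f y.
  move=> cf f1; have mf : measurable_fun setT f := continuous_measurable_fun cf.
  have mfQ_ j : measurable_fun setT (f \o Q_ j) by exact: measurableT_comp.
  have i1 : m.-integrable setT (EFin \o (fun=> 1)) by exact: finite_measure_integrable_cst.
  have := @pratt _ _ _ m (fun j w => f (Q_ j w)) (fun _ _ => 1) (fun w => f (Q w)) (fun=> 1)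
     mfQ_ (measurableT_comp mf mQ) (fun=> i1) i1 (fun j w => f1 _) (fun w => f1 _) _ _ (fun=> erefl).
  have h : {ae m, forall x, f (Q_ j x) @[j --> \oo] --> f (Q x)}.
    by apply: filterS Qcvg => w /(cvg_comp _ _); apply; exact: cf.
  have a1 : {ae m, forall x : R * R, (fun=> 1 : R) j @[j --> \oo] --> (1 : R)}.
    by apply: aeW => x; exact: cvg_cst.
  move=> /(_ h a1).
  have -> : (fun j => \int[m]_w f (Q_ j w)) = (fun j => \int[nu]_y f y).
    apply/funext => j; rewrite /Rintegral.
    have nuE B : measurable B -> nu B = m (Q_ j @^-1` B) by move=> mB; rewrite snd_graph.
    by rewrite (integral_law (mQ_ j) nuE (f := fun y => (f y)%:E))//; exact/measurable_EFinP.
  by move=> /cvg_lim <-//; rewrite lim_cst.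
(* This is the truncation of [z] to [0, 1], written with absolute values so that continuity and
   bounds are immediate. *)
pose clamp (z : R) : R := (1 + `|z| - `|z - 1|) / 2.
pose ramp (y : R) n (x : R) : R := clamp (1 - n%:R * (x - y)).
have ramp01 y n x : 0 <= ramp y n x <= 1.
  rewrite /ramp; set z := (X in clamp X); rewrite /clamp.
  by case: (ger0P z) => hz; case: (ger0P (z - 1)) => hz1; lra.
have cramp y n : continuous (ramp y n).
  have cz : continuous (fun x : R => 1 - n%:R * (x - y)).
    move=> x; apply: cvgB; first exact: cvg_cst.
    by apply: cvgM; [exact: cvg_cst|apply: cvgB; [exact: cvg_id|exact: cvg_cst]].
  move=> x; apply: cvgM; last exact: cvg_cst.
  apply: cvgB; last by apply: cvg_norm; apply: cvgB; [exact: cz|exact: cvg_cst].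
  by apply: cvgD; [exact: cvg_cst|apply: cvg_norm; exact: cz].
have rampcvg y x : ramp y n x @[n --> \oo] --> (\1_`]-oo, y]%classic x : R).
  rewrite indicE mem_setE in_itv/=; case: leP => xy.
    apply: cvg_near_cst; apply: nearW => n; rewrite /ramp.
    have : n%:R * (x - y) <= 0 by rewrite mulr_ge0_le0// subr_le0.
    by move=> h; rewrite /clamp !ger0_norm/=; lra.
  apply: cvg_near_cst; near=> n; rewrite /ramp.
  have xy0 : 0 < x - y by rewrite subr_gt0.
  have : (x - y)^-1 <= n%:R by near: n; exact: nbhs_infty_ger.
  rewrite -(ler_pM2r xy0) mulVf ?gt_eqF// => h.
  by rewrite /clamp !ler0_norm/=; lra.
have rayE (k : probability R R) y : \int[k]_x ramp y n x @[n --> \oo] --> fine (k `]-oo, y]%classic).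
  have -> : fine (k `]-oo, y]%classic) = \int[k]_x \1_(`]-oo, y]%classic) x.
    by rewrite /Rintegral integral_indic//= setIT.
  have i1 : k.-integrable setT (EFin \o (fun=> 1)) by exact: finite_measure_integrable_cst.
  apply: (@pratt _ _ _ k (ramp y) (fun _ _ => 1) _ (fun=> 1)) => //.
  - by move=> j; exact: continuous_measurable_fun.
  - by move=> j x; rewrite ger0_norm; case/andP: (ramp01 y j x).
  - by move=> x; rewrite indicE; case: (_ \in _); rewrite ?normr1 ?normr0.
  - by apply: aeW => x; exact: rampcvg.
  - by apply: aeW => x; exact: cvg_cst.
pose n1 : probability R R := law m mQ.
suff e y : n1 `]-oo, y]%classic = nu `]-oo, y]%classic.
  move=> mA; have := @measure_eq_ray R n1 nu _ _ e A mA; apply => //.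
  - by rewrite (le_lt_trans (probability_le1 n1 measurableT))// ltry.
  - exact: etrans (probability_setT n1) (esym (probability_setT nu)).
have := rayE n1 y; have -> : (fun n => \int[n1]_x ramp y n x) = (fun n => \int[nu]_x ramp y n x).
  apply/funext => n; rewrite -E//; last first.
    by move=> x; rewrite ger0_norm; case/andP: (ramp01 y n x).
  have mr : measurable_fun setT (fun x => (ramp y n x)%:E).
    by apply/measurable_EFinP; exact: continuous_measurable_fun.
  have n1E B : measurable B -> n1 B = m (Q @^-1` B) by [].
  by rewrite /Rintegral (integral_law mQ n1E mr).
move=> h; have := cvg_unique _ h (rayE nu y) => /(_ (@norm_hausdorff _ _)) e.
rewrite -[LHS]fineK ?e ?fineK//; exact: fin_num_measure.
Unshelve. all: by end_near. Qed.

(** The functions [|Q_ j|] all have the integral of [|y|] under [nu], as does [|Q|]. They can thus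
    serve as varying bounds, and the martingale identity passes to the limit. *)
Lemma martingale_coupling_limit (mXQ : measurable_fun setT (fun w => (w.1, Q w))) :
  martingale_coupling mu nu (law m mXQ).
Proof.
apply: (martingale_coupling_law (X := fst)) => //.
- exact: fst_graph.
- exact: snd_graph_limit.
move=> A mA.
have iX : m.-integrable setT (EFin \o (fun w => w.1)).
  have muE B : measurable B -> mu B = m (fst @^-1` B) by move=> mB; rewrite fst_graph.
  have mE : measurable_fun setT (EFin \o @id R) by exact/measurable_EFinP.
  by have [+ _] := integrable_law measurable_fst muE mE; apply.
have iA (Z : R * R -> R) : measurable_fun setT Z -> m.-integrable setT (EFin \o Z) ->
    m.-integrable setT (EFin \o (fun w => \1_A w.1 * Z w)).
  move=> mZ iZ; have ia := integrable_abse iZ.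
  apply: (integrable_dom _ ia).
    by apply: measurable_funM => //; apply: measurableT_comp => //; exact: measurable_indic.
  by move=> w; rewrite indicE; case: (_ \in _); rewrite ?mul1r ?mul0r ?normr0.
have mabs : measurable_fun setT (fun y : R => `|y|) by exact: measurableT_comp.
have iQabs (Z : R * R -> R) (mZ : measurable_fun setT Z) : (forall B, measurable B -> m (Z @^-1` B) = nu B) ->
    m.-integrable setT (EFin \o Z) /\ \int[m]_w `|Z w| = \int[nu]_y `|y|.
  move=> h; have h' B : measurable B -> nu B = m (Z @^-1` B) by move=> /h.
  split.
    have mE : measurable_fun setT (EFin \o @id R) by exact/measurable_EFinP.
    by have [+ _] := integrable_law mZ h' mE; apply.
  by rewrite /Rintegral (integral_law mZ h' (f := fun y => (`|y|)%:E))//; exact/measurable_EFinP.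
have [iQ EQ] := iQabs _ mQ snd_graph_limit.
have mi (Z : R * R -> R) : measurable_fun setT Z -> measurable_fun setT (fun w : R * R => \1_A w.1 * Z w).
  by move=> mZ; apply: measurable_funM => //; apply: measurableT_comp => //; exact: measurable_indic.
have ineq (Z : R * R -> R) w : `|\1_A w.1 * Z w| <= `|Z w|.
  by rewrite indicE; case: (_ \in _); rewrite ?mul1r ?mul0r ?normr0.
have := @pratt _ _ _ m (fun j w => \1_A w.1 * Q_ j w) (fun j w => `|Q_ j w|)
  (fun w => \1_A w.1 * Q w) (fun w => `|Q w|) (fun j => mi _ (mQ_ j)) (mi _ mQ)
  (fun j => integrable_abse (iQabs _ (mQ_ j) (@snd_graph j)).1) (integrable_abse iQ)
  (fun j w => ineq (Q_ j) w) (ineq Q).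
have h1 : {ae m, forall x, \1_A x.1 * Q_ j x @[j --> \oo] --> \1_A x.1 * Q x}.
  by apply: filterS Qcvg => w Qw; apply: cvgM => //; exact: cvg_cst.
have h2 : {ae m, forall x, `|Q_ j x| @[j --> \oo] --> `|Q x|}.
  by apply: filterS Qcvg => w Qw; exact: cvg_norm.
move=> /(_ h1 h2) h; have {}h := h (fun j => etrans (iQabs _ (mQ_ j) (@snd_graph j)).2 (esym EQ)).
have mh (g : R * R -> R) : measurable_fun setT g -> measurable_fun setT (EFin \o (fun w : R * R => \1_A w.1 * g w)).
  by move=> mg; apply/measurable_EFinP; exact: mi.
have E j : \int[m]_w (\1_A w.1 * Q_ j w) = \int[m]_w (\1_A w.1 * w.1).
  have := martingale_coupling_test (pM j) mA => e.
  rewrite /Rintegral; congr fine; move: e.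
  rewrite (integral_law (mXQ_ j) (pE j) (f := EFin \o (fun w => \1_A w.1 * w.2))) /=; last exact: mh.
  by rewrite (integral_law (mXQ_ j) (pE j) (f := EFin \o (fun w => \1_A w.1 * w.1))) /=; last exact: mh.
have e : \int[m]_w (\1_A w.1 * Q w) = \int[m]_w (\1_A w.1 * w.1).
  move: h; have -> : (fun j => \int[m]_x (\1_A x.1 * Q_ j x)) = (fun j => \int[m]_w (\1_A w.1 * w.1)).
    by apply/funext => j; exact: E.
  by move=> /cvg_lim <-//; rewrite lim_cst.
have f1 := integrable_fin_num measurableT (iA _ mQ iQ).
have f2 := integrable_fin_num measurableT (iA _ measurable_fst iX).
exact: etrans (esym (fineK f1)) (etrans (congr1 EFin e) (fineK f2)).
Qed.

End compactness_limit.

Section compactness_main.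
Context {R : realType} (mu nu : probability R R).

Let m : probability (R * R)%type R := (mu \x unif)%E.

Lemma coupling_compactness (S : nat -> set (probability (R * R)%type R)) :
  mu.-integrable setT (EFin \o id) -> nu.-integrable setT (EFin \o id) ->
  (forall n p, S n p -> martingale_coupling mu nu p /\ exists F, has_cdf mu p F) ->
  (forall n, S n !=set0) ->
  (forall i j, (i <= j)%N -> S j `<=` S i) ->
  (forall n p q, S n p -> S n q -> exists2 r, S n r &
    forall C, measurable C -> (r C = 2^-1%:E * p C + 2^-1%:E * q C)%E) ->
  exists (p : nat -> probability (R * R)%type R) (Q_ : nat -> R * R -> R) (Q : R * R -> R),
    [/\ forall j, S j (p j),
        forall j, measurable_fun setT (Q_ j),
        forall j C, measurable C -> p j C = m ((fun w => (w.1, Q_ j w)) @^-1` C),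
        {ae m, forall w, Q_ j w @[j --> \oo] --> Q w} &
        exists mXQ : measurable_fun setT (fun w => (w.1, Q w)),
          martingale_coupling mu nu (law m mXQ)].
Proof.
move=> imu inu SM S0 Sd Smid.
pose S' n : set (R * R -> R) := [set f | exists p F,
  [/\ S n p, has_cdf mu p F & f = graph_cdf F]].
have [] := @midpoint_convex_cauchy _ _ _ m S'.
- move=> n _ [p [F [Sp hF ->]]]; split; first exact: measurable_graph_cdf hF.
  by move=> w; exact: graph_cdf01 hF.
- move=> n; have [p Sp] := S0 n; have [_ [F hF]] := SM _ _ Sp.
  by exists (graph_cdf F), p, F.
- move=> i j ij f [p [F [Sp hF fE]]]; exists p, F; split => //; exact: Sd ij _ Sp.
- move=> n _ _ [p [F [Sp hF ->]]] [q [G [Sq hG ->]]].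
  have [r Sr rE] := Smid _ _ _ Sp Sq; have [_ [H hH]] := SM _ _ Sr.
  exists (graph_cdf H); first by exists r, H.
  exact: graph_cdf_midpoint hF hG hH rE.
move=> f_ f_S f_cauchy.
have /choice[pF pFP] : forall j, exists pF : probability (R * R)%type R * (R -> R -> R),
    [/\ S j pF.1, has_cdf mu pF.1 pF.2 & f_ j = graph_cdf pF.2].
  by move=> j; have [p [F]] := f_S j; exists (p, F).
pose p j := (pF j).1; pose F j := (pF j).2.
have Sp j : S j (p j) by case: (pFP j).
have hF j : has_cdf mu (p j) (F j) by case: (pFP j).
have fE j : f_ j = graph_cdf (F j) by case: (pFP j).
pose Q_ j (w : R * R) := quantile (F j w.1) w.2.
have mQ_ j : measurable_fun setT (Q_ j) by exact: measurable_cdf_quantile (hF j).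
have pE j C : measurable C -> p j C = m ((fun w => (w.1, Q_ j w)) @^-1` C).
  by move=> mC; exact: law_cdf_quantile (hF j) _ mC.
have pM j : martingale_coupling mu nu (p j) by case: (SM _ _ (Sp j)).
pose L_ j w := logistic (Q_ j w).
have mL_ j : measurable_fun setT (L_ j) by exact: measurableT_comp measurable_logistic (mQ_ j).
have L01 j w : 0 < L_ j w < 1 by exact: logistic_itv.
have Lcvg : {ae m, forall w, cvgn (L_ ^~ w)}.
  apply: ae_cvg_of_L1_steps => // j.
  apply: le_trans (f_cauchy j); rewrite !fE.
  by rewrite (graph_cdf_dist (hF j) (hF j.+1)).
(* All [|Q_ j|] have the same finite integral, so by Fatou they almost surely do not tend to
   infinity. The limit of the logistic quantiles is then neither 0 nor 1, and [logit] can be applied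
   to it. *)
have Qfin : {ae m, forall w, (limn_einf (fun j => (`|Q_ j w|)%:E) < +oo)%E}.
  have mE j : measurable_fun setT (fun w => (`|Q_ j w|)%:E).
    by apply/measurable_EFinP; exact: measurableT_comp.
  have nuE j B : measurable B -> nu B = m (Q_ j @^-1` B).
    by move=> mB; symmetry; exact: (snd_graph pM pE).
  have mabs : measurable_fun setT (fun y : R => (`|y|)%:E).
    have mabs : measurable_fun setT (fun y : R => `|y|) by exact: measurableT_comp.
    exact/measurable_EFinP.
  have E j : (\int[m]_w (`|Q_ j w|)%:E = \int[nu]_y (`|y|)%:E)%E.
    by rewrite (integral_law (mQ_ j) (nuE j) mabs).
  have e0 j w : setT w -> (0 <= (`|Q_ j w|)%:E)%E by rewrite lee_fin.
  have := fatou m measurableT mE e0.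
  have -> : (fun j => \int[m]_w (`|Q_ j w|)%:E)%E = (fun=> \int[nu]_y (`|y|)%:E)%E.
    by apply/funext => j; exact: E.
  rewrite (fst (cvg_limn_einf_sup (@cvg_cst _ _ _ _ _))) => le1.
  have l0 w : (0 <= limn_einf (fun j => (`|Q_ j w|)%:E))%E.
    rewrite limn_einf_lim; apply: lime_ge; first exact: is_cvg_einfs.
    apply: nearW => n; apply: le_ereal_inf_tmp => _ [k _ <-].
    by rewrite lee_fin.
  have il : m.-integrable setT (fun w => limn_einf (fun j => (`|Q_ j w|)%:E)).
    apply/integrableP; split; first exact: measurable_limn_einf.
    under eq_integral do rewrite gee0_abs//.
    apply: le_lt_trans le1 _.
    by have /integrableP[_] := inu.
  apply: filterS (integrable_ae measurableT il) => w /(_ Logic.I).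
  by rewrite ge0_fin_numE.
(* The upper limit is measurable and defined everywhere, and equals the limit where that exists. *)
pose L w := limn_sup (L_ ^~ w).
have mL : measurable_fun setT L.
  apply: measurable_fun_limn_sup => //.
  - by move=> w _; exists 1 => _ [j _ <-]; case/andP: (L01 j w) => _ /ltW.
  - by move=> w _; exists 0 => _ [j _ <-]; case/andP: (L01 j w) => /ltW.
pose Q w := logit (L w).
have mQ : measurable_fun setT Q by exact: measurableT_comp measurable_logit mL.
have Qcvg : {ae m, forall w, Q_ j w @[j --> \oo] --> Q w}.
  apply: filterS2 Lcvg Qfin => w Lw Qw.
  have Llim : L_ j w @[j --> \oo] --> L w by rewrite /L cvg_limn_supE.
  have big : (forall A : R, \forall j \near \oo, A < `|Q_ j w|) -> False.
    move=> h; move: Qw; rewrite (fst (cvg_limn_einf_sup (l := +oo%E) _)) ?ltxx//.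
    by apply/cvgeyPge => A; apply: filterS (h A) => j /ltW; rewrite lee_fin.
  have L0 : 0 < L w.
    rewrite lt_neqAle; apply/andP; split; last first.
      by rewrite -(cvg_lim _ Llim)//; apply: limr_ge => //; apply: nearW => j; case/andP: (L01 j w) => /ltW.
    apply/negP => /eqP L0; apply: big => // A.
    have h : 0 < logistic (- A) by case/andP: (logistic_itv (- A)).
    rewrite L0 in h; have hn : \forall j \near \oo, L_ j w < logistic (- A) by exact: (cvgr_lt _ Llim).
    apply: filterS hn => j; rewrite logistic_lt => QA.
    by rewrite ltr_normr ltrNr QA orbT.
  have L1 : L w < 1.
    rewrite lt_neqAle; apply/andP; split; last first.
      by rewrite -(cvg_lim _ Llim)//; apply: limr_le => //; apply: nearW => j; case/andP: (L01 j w) => _ /ltW.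
    apply/negP => /eqP L1; apply: big => // A.
    have h : logistic A < 1 by case/andP: (logistic_itv A).
    rewrite -L1 in h; have hn : \forall j \near \oo, logistic A < L_ j w by exact: (cvgr_gt _ Llim).
    by apply: filterS hn => j; rewrite logistic_lt => QA; rewrite (lt_le_trans QA)// ler_norm.
  have L01w : 0 < L w < 1 by rewrite L0.
  have -> : Q_ ^~ w = logit \o (L_ ^~ w) by apply/funext => j; rewrite /= /L_ logisticK.
  exact: cvg_comp Llim (continuous_logit L01w).
have mXQ : measurable_fun setT (fun w => (w.1, Q w)) by apply: measurable_fun_pair.
exists p, Q_, Q; split => //; exists mXQ.
exact: (martingale_coupling_limit inu imu mQ_ mQ pM pE Qcvg).
Qed.

End compactness_main.

(** * Tilted moments *)

Section weighted_moments.
Context {R : realType}.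

(** The power is absorbed in [exp (n |y|)], and completing the square in [|y|] gives the
    constant. *)
Lemma gauss_dom n (A a b : R) : 0 <= A -> b < a ->
  exists2 C, 0 <= C & forall y : R, `|y| ^+ n * expR (A * `|y| + b * y ^+ 2) <= C * expR (a * y ^+ 2).
Proof.
move=> A0 ba; have e0 : 0 < a - b by rewrite subr_gt0.
exists (expR ((n%:R + A) ^+ 2 / (4 * (a - b)))); first exact: expR_ge0.
move=> y; rewrite -expRD.
have yn : `|y| ^+ n <= expR (n%:R * `|y|).
  rewrite expRM_natl lerXn2r ?nnegrE ?expR_ge0//.
  by apply: le_trans (expR_ge1Dx _); rewrite lerDr.
apply: (@le_trans _ _ (expR (n%:R * `|y|) * expR (A * `|y| + b * y ^+ 2))).
  by rewrite ler_wpM2r ?expR_ge0.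
rewrite -expRD ler_expR -[y ^+ 2]real_normK ?num_real//.
set z := `|y|; set K := n%:R + A.
have -> : n%:R * z + (A * z + b * z ^+ 2) = K * z + b * z ^+ 2 by rewrite /K; ring.
have : 0 <= (K - 2 * (a - b) * z) ^+ 2 / (4 * (a - b)).
  by rewrite divr_ge0 ?sqr_ge0// mulr_ge0// ltW.
have -> : (K - 2 * (a - b) * z) ^+ 2 / (4 * (a - b)) =
    K ^+ 2 / (4 * (a - b)) - K * z + (a - b) * z ^+ 2.
  by field; rewrite gt_eqF.
by lra.
Qed.

(** The measure with density [g] against [k] integrates [exp (a y^2)], so its Laplace transform is
    finite and smooth on the whole line. *)
Definition gauss_tail (k : {measure set R -> \bar R}) (g : R -> R) (a : R) : Prop :=
  [/\ 0 < a, measurable_fun setT g, forall y, 0 <= g y &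
      k.-integrable setT (EFin \o (fun y => expR (a * y ^+ 2) * g y))].

(** The [n]-th derivative at [t] of the Laplace transform of the measure with density [g]. *)
Definition wmom (k : {measure set R -> \bar R}) (g : R -> R) n (t : R) : R :=
  \int[k]_y (y ^+ n * expR (t * y) * g y).

Let mexp (t b : R) : measurable_fun setT (fun y => expR (t * y + b * y ^+ 2)).
Proof.
apply: measurableT_comp; first exact: measurable_expR.
apply: measurable_funD; first exact: measurable_funM.
by apply: measurable_funM => //; exact: measurable_funX.
Qed.

Let mexp1 (t : R) : measurable_fun setT (fun y => expR (t * y)).
Proof. by apply: measurableT_comp; [exact: measurable_expR|exact: measurable_funM]. Qed.

Lemma gauss_tail_integrable k g a n (A b : R) (f : R -> R) : gauss_tail k g a ->
  0 <= A -> b < a -> measurable_fun setT f ->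
  (forall y, `|f y| <= `|y| ^+ n * expR (A * `|y| + b * y ^+ 2) * g y) ->
  k.-integrable setT (EFin \o f).
Proof.
move=> [a0 mg g0 ig] A0 ba mf fle; have [C C0 hC] := gauss_dom n A0 ba.
have ig' : k.-integrable setT (EFin \o (fun y => C * (expR (a * y ^+ 2) * g y))).
  by have := integrableZl measurableT C ig; apply: eq_integrable.
apply: (integrable_dom mf ig') => y; apply: le_trans (fle y) _.
by rewrite [leRHS]mulrA ler_wpM2r.
Qed.

Lemma wmom_integrable k g a n t : gauss_tail k g a ->
  k.-integrable setT (EFin \o (fun y => y ^+ n * expR (t * y) * g y)).
Proof.
move=> T; have [a0 mg g0 _] := T; apply: (gauss_tail_integrable (n := n) T (normr_ge0 t) a0).
  apply: measurable_funM => //; apply: measurable_funM; last exact: mexp1.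
  exact: measurable_funX.
move=> y; rewrite mul0r addr0 !normrM normrX (ger0_norm (g0 y)) (ger0_norm (expR_ge0 _)).
by rewrite ler_wpM2r// ler_wpM2l ?exprn_ge0// ler_expR -normrM ler_norm.
Qed.

Lemma is_derive_wmom k g a n (t : R) : gauss_tail k g a ->
  is_derive t 1 (wmom k g n) (wmom k g n.+1 t).
Proof.
move=> T; have [a0 mg g0 ig] := T.
pose f t y := y ^+ n * expR (t * y) * g y.
have dfE (s y : R) : is_derive s 1 (f ^~ y) (y ^+ n.+1 * expR (s * y) * g y).
  rewrite /f; have -> : (fun s => y ^+ n * expR (s * y) * g y) =
     (fun s => (y ^+ n * g y) * expR (y * s)).
    by apply/funext => s'; rewrite mulrAC [y * s']mulrC.
  apply: is_derive_eq; rewrite /GRing.scale/= exprS [y * s]mulrC; ring.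
have d1 (s y : R) : partial1of2 f s y = y ^+ n.+1 * expR (s * y) * g y.
  by rewrite partial1of2E; apply: derive_val.
(* A bound for the derivative that is uniform over []t - 1, t + 1[]. *)
pose G y := `|y| ^+ n.+1 * expR ((`|t| + 1) * `|y|) * g y.
have A0 : 0 <= `|t| + 1 by rewrite addr_ge0.
have G0 y : 0 <= G y by rewrite !mulr_ge0 ?exprn_ge0 ?expR_ge0.
have iG : k.-integrable setT (EFin \o G).
  apply: (gauss_tail_integrable (n := n.+1) T A0 a0).
    rewrite /G; apply: measurable_funM => //; apply: measurable_funM.
      have mabs : measurable_fun setT (fun y : R => `|y|) by exact: measurableT_comp.
      exact: measurable_funX.
    apply: measurableT_comp; first exact: measurable_expR.
    by apply: measurable_funM => //; exact: measurableT_comp.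
  by move=> y; rewrite mul0r addr0 ger0_norm.
have It : `]t - 1, t + 1[%classic t by rewrite /= in_itv/= gtrBl ltrDl ltr01.
have If s : `]t - 1, t + 1[%classic s -> k.-integrable setT (EFin \o f s).
  by move=> _; exact: wmom_integrable T.
have Df s y : `]t - 1, t + 1[%classic s -> setT y -> derivable (f ^~ y) s 1.
  by move=> _ _; exact: ex_derive.
have ub s y : `]t - 1, t + 1[%classic s -> setT y -> `|partial1of2 f s y| <= G y.
  rewrite /= in_itv/= => /andP[s1 s2] _; rewrite d1 /G.
  rewrite !normrM normrX (ger0_norm (g0 y)) (ger0_norm (expR_ge0 _)).
  rewrite ler_wpM2r// ler_wpM2l ?exprn_ge0// ler_expR.
  rewrite (le_trans (ler_norm _))// normrM ler_wpM2r//.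
  by rewrite ler_norml; have := ler_norm t; have := ler_norm (- t); rewrite normrN => ? ?; lra.
have dF := derivable_under_integral measurableT It If Df G0 iG ub.
have vF := differentiation_under_integral measurableT It If Df G0 iG ub.
apply: DeriveDef; first exact: dF.
rewrite -derive1E; apply: etrans vF _.
by rewrite /wmom; apply: eq_Rintegral => y _; exact: d1.
Qed.

Variables (k0 k1 : {measure set R -> \bar R}).

Lemma wmom_eq_interval g0 g1 a0 a1 (u v : R) :
  gauss_tail k0 g0 a0 -> gauss_tail k1 g1 a1 ->
  (forall t, u < t < v -> wmom k0 g0 0 t = wmom k1 g1 0 t) ->
  forall n t, u < t < v -> wmom k0 g0 n t = wmom k1 g1 n t.
Proof.
move=> T0 T1 h0; elim=> [//|n IH] t tuv.
have [D0 <-] := is_derive_wmom n t T0; have [D1 <-] := is_derive_wmom n t T1.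
apply: near_eq_derive.
have : t \in `]u, v[ by rewrite in_itv.
move/near_in_itvoo; apply: filterS => s; rewrite in_itv/=; exact: IH.
Qed.

Lemma wmom_poly k g a t (p : {poly R}) : gauss_tail k g a ->
  \int[k]_y (p.[y] * expR (t * y) * g y) = \sum_(i < size p) p`_i * wmom k g i t.
Proof.
move=> T.
have -> : (fun y => p.[y] * expR (t * y) * g y) =
    (fun y => \sum_(i < size p) p`_i * (y ^+ i * expR (t * y) * g y)).
  apply/funext => y; rewrite horner_coef -mulrA mulr_suml; apply: eq_bigr => i _.
  by rewrite !mulrA.
have ii (i : nat) (c : R) : k.-integrable setT (EFin \o (fun y => c * (y ^+ i * expR (t * y) * g y))).
  by have := integrableZl measurableT c (wmom_integrable i t T); apply: eq_integrable.
have : forall n, k.-integrable setT (EFin \o (fun y => \sum_(i < n) p`_i * (y ^+ i * expR (t * y) * g y))) /\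
   \int[k]_y (\sum_(i < n) p`_i * (y ^+ i * expR (t * y) * g y)) = \sum_(i < n) p`_i * wmom k g i t.
  elim=> [|n [iS IH]].
    under eq_fun do rewrite big_ord0; rewrite big_ord0; split.
      have -> : EFin \o (fun=> 0 : R) = cst 0%E by [].
      exact: integrable0.
    by rewrite /Rintegral integral0.
  under eq_fun do rewrite big_ord_recr/=; rewrite big_ord_recr/=; split.
    by have := integrableD measurableT iS (ii n p`_n); apply: eq_integrable.
  by rewrite RintegralD// IH RintegralZl//; exact: wmom_integrable T.
by move=> /(_ (size p))[].
Qed.

Lemma expR_series_le (x : R) n : `|series (exp_coeff x) n| <= expR `|x|.
Proof.
apply: le_trans (ler_norm_sum _ _ _) _.
apply: (@le_trans _ _ (series (exp_coeff `|x|) n)).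
  by rewrite /series/= ler_sum// => i _; rewrite /exp_coeff/= normrM normrX normfV normr_nat.
apply: nondecreasing_cvgn_le; last exact: is_cvg_series_exp_coeff.
apply/nondecreasing_seqP => i; rewrite -subr_ge0 /series/= big_nat_recr//= addrAC subrr add0r.
by rewrite /exp_coeff/= divr_ge0// exprn_ge0.
Qed.

(** The Taylor polynomials of [exp ((t - s) y - b y^2)] are polynomials in [y], so both measures
    integrate them equally against [exp (s y)]. They are dominated by the exponential of the
    absolute value, which is integrable because [b < a]. *)
Lemma wmom_eq_gauss g0 g1 a (s b : R) : gauss_tail k0 g0 a -> gauss_tail k1 g1 a ->
  0 <= b < a ->
  (forall n, wmom k0 g0 n s = wmom k1 g1 n s) ->
  forall t, \int[k0]_y (expR (t * y - b * y ^+ 2) * g0 y) =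
            \int[k1]_y (expR (t * y - b * y ^+ 2) * g1 y).
Proof.
move=> T0 T1 /andP[b0 ba] h t.
pose q : {poly R} := (t - s) *: 'X - b *: 'X^2.
have qE y : q.[y] = (t - s) * y - b * y ^+ 2 by rewrite !hornerE.
pose p n : {poly R} := \sum_(0 <= i < n) (i`!%:R)^-1 *: q ^+ i.
have pE n y : (p n).[y] = series (exp_coeff ((t - s) * y - b * y ^+ 2)) n.
  rewrite /p horner_sum /series/=; apply: eq_bigr => i _.
  by rewrite hornerZ horner_exp qE exp_coeffE mulrC.
have cv (k : {measure set R -> \bar R}) g : gauss_tail k g a ->
    \int[k]_y ((p n).[y] * expR (s * y) * g y) @[n --> \oo] -->
    \int[k]_y (expR (t * y - b * y ^+ 2) * g y).
  move=> T; have [a0 mg g0' ig] := T.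
  pose G y := expR ((`|t - s| + `|s|) * `|y| + b * y ^+ 2) * g y.
  have mG : measurable_fun setT G.
    apply: measurable_funM => //; apply: measurableT_comp; first exact: measurable_expR.
    apply: measurable_funD; first by apply: measurable_funM => //; exact: measurableT_comp.
    by apply: measurable_funM => //; exact: measurable_funX.
  have A0 : 0 <= `|t - s| + `|s| by rewrite addr_ge0.
  have iG : k.-integrable setT (EFin \o G).
    apply: (gauss_tail_integrable (n := 0) T A0 ba mG) => y.
    by rewrite expr0 mul1r ger0_norm// mulr_ge0// expR_ge0.
  have bnd y z : `|z| <= expR `|(t - s) * y - b * y ^+ 2| -> `|z * expR (s * y) * g y| <= G y.
    move=> hz; rewrite !normrM (ger0_norm (g0' y)) (ger0_norm (expR_ge0 _)) /G ler_wpM2r//.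
    apply: (@le_trans _ _ (expR `|(t - s) * y - b * y ^+ 2| * expR (s * y))).
      by rewrite ler_wpM2r ?expR_ge0.
    rewrite -expRD ler_expR [(`|t - s| + `|s|) * _]mulrDl [leRHS]addrAC.
    apply: lerD; last by rewrite -normrM ler_norm.
    apply: le_trans (ler_normB _ _) _; rewrite normrM lerD2l normrM (ger0_norm b0).
    by rewrite ger0_norm ?sqr_ge0.
  have mh (z : R -> R) : measurable_fun setT z -> measurable_fun setT (fun y => z y * expR (s * y) * g y).
    by move=> mz; apply: measurable_funM => //; apply: measurable_funM.
  have eE : (fun y => expR (t * y - b * y ^+ 2) * g y) =
      (fun y => expR ((t - s) * y - b * y ^+ 2) * expR (s * y) * g y).
    by apply/funext => y; rewrite -expRD; congr (expR _ * _); ring.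
  rewrite eE; apply: (@pratt _ _ _ k _ (fun=> G) _ G) => //.
  - move=> n; apply: mh; apply: continuous_measurable_fun.
    exact: continuous_horner.
  - apply: mh; have -> : (fun y => expR ((t - s) * y - b * y ^+ 2)) =
       (fun y => expR ((t - s) * y + (- b) * y ^+ 2)) by apply/funext => y; rewrite mulNr.
    exact: mexp.
  - by move=> n y; apply: bnd; rewrite pE; exact: expR_series_le.
  - by move=> y; apply: bnd; rewrite ger0_norm ?expR_ge0// ler_expR ler_norm.
  - apply: aeW => y; apply: cvgM; last exact: cvg_cst.
    apply: cvgM; last exact: cvg_cst.
    under eq_fun do rewrite pE; exact: is_cvg_series_exp_coeff.
  - by apply: aeW => y; exact: cvg_cst.
have E n : \int[k0]_y ((p n).[y] * expR (s * y) * g0 y) = \int[k1]_y ((p n).[y] * expR (s * y) * g1 y).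
  by rewrite (wmom_poly _ _ T0) (wmom_poly _ _ T1); apply: eq_bigr => i _; rewrite h.
have c0 := cv _ _ T0; have c1 := cv _ _ T1.
have e : (fun n => \int[k0]_y ((p n).[y] * expR (s * y) * g0 y)) =
         (fun n => \int[k1]_y ((p n).[y] * expR (s * y) * g1 y)) by apply/funext.
rewrite e in c0; exact: cvg_unique c0 c1.
Qed.

Lemma gauss_tailM k g a b : 0 <= b -> gauss_tail k g a ->
  gauss_tail k (fun y => expR (- b * y ^+ 2) * g y) a.
Proof.
move=> b0 [a0 mg g0 ig]; split => //.
- apply: measurable_funM => //.
  have := mexp 0 (- b); apply: eq_measurable_fun => y _; by rewrite mul0r add0r.
- by move=> y; rewrite mulr_ge0 ?expR_ge0.
- apply: (integrable_dom _ ig).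
    apply: measurable_funM.
      have := mexp 0 a; apply: eq_measurable_fun => y _; by rewrite mul0r add0r.
    apply: measurable_funM => //.
    have := mexp 0 (- b); apply: eq_measurable_fun => y _; by rewrite mul0r add0r.
  move=> y; rewrite ger0_norm; last by rewrite !mulr_ge0 ?expR_ge0.
  rewrite ler_wpM2l ?expR_ge0// ler_piMl// expR_le1 mulNr oppr_le0.
  by rewrite mulr_ge0 ?sqr_ge0.
Qed.

(** The previous lemma only reaches Gaussian factors of rate below [a]. A factor of rate [a / 2]
    preserves the tail rate [a], so the gain can be repeated, which gives arbitrarily narrow
    Gaussians. *)
Lemma wmom_eq_iter g0 g1 a (u v : R) : u < v ->
  gauss_tail k0 g0 a -> gauss_tail k1 g1 a ->
  (forall t, u < t < v -> wmom k0 g0 0 t = wmom k1 g1 0 t) ->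
  forall n t, \int[k0]_y (expR (t * y - n%:R * (a / 2) * y ^+ 2) * g0 y) =
              \int[k1]_y (expR (t * y - n%:R * (a / 2) * y ^+ 2) * g1 y).
Proof.
move=> uv T0 T1 h n; have a0 : 0 < a by case: T0.
elim: n => [|n IH] t.
  have b0a : (0 : R) <= 0 < a by rewrite lexx.
  have st : u < (u + v) / 2 < v by apply/andP; split; lra.
  have := wmom_eq_gauss T0 T1 b0a (fun n => wmom_eq_interval T0 T1 h n st) t.
  have -> : 0%:R * (a / 2) = 0 :> R by rewrite mul0r.
  by [].
have nb0 : 0 <= n%:R * (a / 2) by rewrite mulr_ge0// divr_ge0// ltW.
have T0n := gauss_tailM nb0 T0; have T1n := gauss_tailM nb0 T1.
have b0a : 0 <= a / 2 < a by apply/andP; split; lra.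
have IH' (s : R) : -1 < s < 1 -> wmom k0 (fun y => expR (- (n%:R * (a / 2)) * y ^+ 2) * g0 y) 0 s =
   wmom k1 (fun y => expR (- (n%:R * (a / 2)) * y ^+ 2) * g1 y) 0 s.
  move=> _; have := IH s; rewrite /wmom.
  under eq_Rintegral do rewrite -mulNr expRD -mulrA.
  under [X in _ = X -> _]eq_Rintegral do rewrite -mulNr expRD -mulrA.
  under [X in _ -> X = _]eq_Rintegral do rewrite expr0 mul1r.
  by under [X in _ -> _ = X]eq_Rintegral do rewrite expr0 mul1r.
have s0 : -1 < (0 : R) < 1 by apply/andP; split; lra.
have := wmom_eq_gauss T0n T1n b0a (fun n => wmom_eq_interval T0n T1n IH' n s0) t.
have e y : t * y - n.+1%:R * (a / 2) * y ^+ 2 = t * y - a / 2 * y ^+ 2 + - (n%:R * (a / 2)) * y ^+ 2.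
  by rewrite -natr1; ring.
under [X in _ -> X = _]eq_Rintegral do rewrite e expRD -mulrA.
by under [X in _ -> _ = X]eq_Rintegral do rewrite e expRD -mulrA.
Qed.

End weighted_moments.

(** * Injectivity of the Laplace transform by Gaussian smoothing *)

Section laplace.
Context {R : realType}.

(** Beyond distance [d] from the mean, the density of deviation [s] is at most [e] times the density
    of deviation 1. *)
Lemma normal_tail (y s d : R) (A : set R) : 0 < s -> s <= 1 -> 0 < d ->
  measurable A -> (forall q, A q -> d <= `|q - y|) ->
  (normal_prob y s A <= (s^-1 * expR (- (d ^+ 2 * (s ^- 2 - 1) / 2)))%:E)%E.
Proof.
move=> s0 s1 d0 mA hA; set e := s^-1 * _.
have s'0 : s != 0 by rewrite gt_eqF.
have e0 : 0 <= e by rewrite mulr_ge0 ?expR_ge0// invr_ge0 ltW.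
have s21 : 1 <= s ^- 2 by rewrite invf_ge1 ?exprn_gt0// expr_le1// ltW.
apply: (@le_trans _ _ (\int[lebesgue_measure]_(q in A) (e * normal_pdf y 1 q)%:E)%E).
  apply: ge0_le_integral => //.
  - by move=> q _; rewrite lee_fin normal_pdf_ge0.
  - by apply/measurable_funTS/measurable_EFinP; exact: measurable_normal_pdf.
  - apply/measurable_funTS/measurable_EFinP; apply: measurable_funM => //.
    exact: measurable_normal_pdf.
  move=> q Aq; rewrite lee_fin !normal_pdfE// ?oner_neq0//.
  have pE : normal_peak s = s^-1 * normal_peak (1 : R).
    rewrite /normal_peak expr1n mul1r -invfM; congr (_^-1).
    by rewrite -mulrnAr sqrtrM ?sqr_ge0// sqrtr_sqr gtr0_norm.
  rewrite pE /e -!mulrA ler_wpM2l ?invr_ge0 ?(ltW s0)//.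
  rewrite mulrCA ler_wpM2l ?normal_peak_ge0//.
  rewrite /normal_fun -expRD ler_expR expr1n.
  have dq : d ^+ 2 <= (q - y) ^+ 2.
    by rewrite -[X in _ <= X]real_normK ?num_real// lerXn2r ?nnegrE ?(ltW d0)//; exact: hA.
  set z := (q - y) ^+ 2 in dq *; set w := (s ^+ 2)^-1 in s21 *.
  have -> : - z / (s ^+ 2 *+ 2) = - (z * w) / 2.
    by rewrite -mulr_natr invfM mulrA mulNr.
  have : 0 <= (z - d ^+ 2) * (w - 1) by rewrite mulr_ge0 ?subr_ge0.
  by lra.
under eq_integral do rewrite EFinM.
rewrite ge0_integralZl//.
- apply: (@le_trans _ _ (e%:E * normal_prob y 1 setT)%E).
    apply: lee_wpmul2l; first by rewrite lee_fin.
    by apply: le_measure; rewrite ?inE.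
  by have -> := @probability_setT _ _ _ (normal_prob y 1); rewrite mule1.
- by apply/measurable_funTS/measurable_EFinP; exact: measurable_normal_pdf.
- by move=> q _; rewrite lee_fin normal_pdf_ge0.
Qed.

(** The deviations [1 / sqrt (n a)] are those whose exponent [n (a / 2)] is reached by
    [wmom_eq_iter]. With [u = n a], the constant [B] ensures [1 <= u] and [2 exp c / (c^2 e) <= u],
    and [exp (c u)] is bounded below by [(c u)^2 / 2]. *)
Lemma normal_tail_small (a d e : R) : 0 < a -> 0 < d -> 0 < e ->
  exists2 n : nat, (0 < n)%N & let s := Num.sqrt (n%:R * a)^-1 in
   s <= 1 /\ s^-1 * expR (- (d ^+ 2 * (s ^- 2 - 1) / 2)) <= e.
Proof.
move=> a0 d0 e0; pose c := d ^+ 2 / 2; have c0 : 0 < c by rewrite divr_gt0// exprn_gt0.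
pose B := 1 + a^-1 + (2 * expR c / (c ^+ 2 * e)) / a.
have B0 : 0 < 2 * expR c / (c ^+ 2 * e) by rewrite divr_gt0 ?mulr_gt0 ?expR_gt0 ?exprn_gt0.
have B'0 : 0 <= B.
  rewrite /B; apply: addr_ge0; last by rewrite divr_ge0 ?(ltW B0) ?(ltW a0).
  by rewrite addr_ge0 ?invr_ge0 ?(ltW a0).
exists (Num.bound B).
  by rewrite -(ltr_nat R) (le_lt_trans _ (archi_boundP B'0)).
set n := Num.bound B; move=> s.
have Bn : B < n%:R by exact: archi_boundP.
set u := n%:R * a in s *.
have uB : B * a < u by rewrite /u ltr_pM2r.
have BaE : B * a = a + 1 + 2 * expR c / (c ^+ 2 * e).
  by rewrite /B; field; rewrite !gt_eqF.
have u1 : 1 <= u by move: uB; rewrite BaE; lra.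
have u0 : 0 < u by lra.
have s2 : s ^- 2 = u by rewrite /s sqr_sqrtr ?invr_ge0 ?(ltW u0)// invrK.
have sV : s^-1 = Num.sqrt u by rewrite /s sqrtrV ?invrK// ltW.
split.
  by rewrite /s -sqrtr1 ler_wsqrtr// invf_le1.
rewrite s2 sV.
have su : Num.sqrt u <= u.
  rewrite -[leRHS]sqr_sqrtr ?(ltW u0)// expr2 ler_peMr ?sqrtr_ge0//.
  by rewrite -sqrtr1 ler_wsqrtr.
have -> : - (d ^+ 2 * (u - 1) / 2) = c - c * u by rewrite /c; field.
rewrite expRB.
have cu : (c * u) ^+ 2 / 2 <= expR (c * u).
  have := expR_ge1Dxn 1 (ltW (mulr_gt0 c0 u0)); rewrite (_ : 2`!%:R = 2)//.
  by apply: le_trans; rewrite lerDr.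
have cu0 : 0 < (c * u) ^+ 2 / 2 by rewrite divr_gt0 ?exprn_gt0 ?mulr_gt0.
apply: (@le_trans _ _ (u * (expR c / ((c * u) ^+ 2 / 2)))).
  apply: ler_pM; rewrite ?sqrtr_ge0 ?divr_ge0 ?expR_ge0//.
  by rewrite ler_wpM2l ?expR_ge0// lef_pV2 ?posrE ?expR_gt0.
have -> : u * (expR c / ((c * u) ^+ 2 / 2)) = 2 * expR c / c ^+ 2 / u.
  by field; rewrite !gt_eqF.
have -> : 2 * expR c / c ^+ 2 / u = (2 * expR c / (c ^+ 2 * e)) * e / u.
  by field; rewrite !gt_eqF.
rewrite ler_pdivrMr// mulrC ler_pM2l//.
by move: uB; rewrite BaE; lra.
Qed.

Lemma measurable_normal_pdf2 (s : R) : s != 0 ->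
  measurable_fun setT (fun w : R * R => normal_pdf w.1 s w.2).
Proof.
move=> s0; have -> : (fun w : R * R => normal_pdf w.1 s w.2) =
    (fun w => normal_peak s * expR (- (w.2 - w.1) ^+ 2 / (s ^+ 2 *+ 2))).
  by apply/funext => w; rewrite normal_pdfE.
apply: measurable_funM => //; apply: measurableT_comp; first exact: measurable_expR.
apply: measurable_funM => //; apply: measurableT_comp => //.
by apply: measurable_funX; exact: measurable_funB.
Qed.

Variables (k0 k1 : probability R R) (g0 g1 : R -> R) (a u v : R).
Hypothesis uv : u < v.
Hypothesis T0 : gauss_tail k0 g0 a.
Hypothesis T1 : gauss_tail k1 g1 a.
Hypothesis g01 : forall t, u < t < v -> wmom k0 g0 0 t = wmom k1 g1 0 t.

Let smooth (k : probability R R) (g : R -> R) (s c : R) : \bar R :=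
  (\int[k]_y ((g y)%:E * normal_prob y s `]-oo, c]%classic))%E.

Lemma smooth_swap (k : probability R R) g s c : s != 0 -> gauss_tail k g a ->
  smooth k g s c = (\int[lebesgue_measure]_(q in `]-oo, c]%classic)
    \int[k]_y (g y * normal_pdf y s q)%:E)%E.
Proof.
move=> s0 [a0 mg g0' ig]; rewrite /smooth.
pose f (w : R * R) : \bar R :=
  ((g w.1 * normal_pdf w.1 s w.2) * \1_(`]-oo, c]%classic) w.2)%:E.
have mf : measurable_fun setT f.
  apply/measurable_EFinP; apply: measurable_funM.
    apply: measurable_funM; first exact: measurableT_comp.
    exact: measurable_normal_pdf2.
  by apply: measurableT_comp => //; exact: measurable_indic.
have f0 w : (0 <= f w)%E by rewrite lee_fin !mulr_ge0 ?normal_pdf_ge0.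
transitivity (\int[k]_y \int[lebesgue_measure]_q f (y, q))%E.
  apply: eq_integral => y _; rewrite /normal_prob -ge0_integralZl//.
  - rewrite integral_mkcond; apply: eq_integral => q _.
    rewrite /f patchE /= indicE; case: (_ \in _); rewrite ?mulr1 ?mulr0//.
  - by apply/measurable_funTS/measurable_EFinP; exact: measurable_normal_pdf.
  - by move=> q _; rewrite lee_fin normal_pdf_ge0.
  - by rewrite lee_fin.
rewrite (fubini_tonelli (m1 := k) (m2 := lebesgue_measure) f mf f0).
rewrite [RHS]integral_mkcond; apply: eq_integral => q _.
rewrite patchE /f /= indicE; case: (_ \in _).
  by apply: eq_integral => y _; rewrite mulr1.
by rewrite integral0_eq// => y _; rewrite mulr0.
Qed.

(** Expanding the square in the normal density leaves in [y] the factor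
    [exp (n a q y - n (a / 2) y^2)], to which [wmom_eq_iter] applies at each [q]. *)
Lemma smooth_eq n c : (0 < n)%N -> let s := Num.sqrt (n%:R * a)^-1 in
  smooth k0 g0 s c = smooth k1 g1 s c.
Proof.
move=> n0 s; have a0 : 0 < a by case: T0.
have na0 : 0 < n%:R * a by rewrite mulr_gt0 ?ltr0n.
have s0 : s != 0 by rewrite sqrtr_eq0 -ltNge invr_gt0.
have s2 : (s ^+ 2 *+ 2)^-1 = n%:R * (a / 2).
  by rewrite /s sqr_sqrtr ?invr_ge0 ?(ltW na0)// -mulr_natr invfM invrK mulrA.
rewrite !smooth_swap//; apply: eq_integral => q _.
have E (k : probability R R) g : gauss_tail k g a ->
   (\int[k]_y (g y * normal_pdf y s q)%:E = (normal_peak s * expR (- (n%:R * (a / 2)) * q ^+ 2) *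
   \int[k]_y (expR ((n%:R * a * q) * y - n%:R * (a / 2) * y ^+ 2) * g y))%:E)%E.
  move=> T.
  have ik : k.-integrable setT (EFin \o (fun y => expR ((n%:R * a * q) * y - n%:R * (a / 2) * y ^+ 2) * g y)).
    have [_ mg g0' _] := T.
    apply: (gauss_tail_integrable (n := 0) T (normr_ge0 (n%:R * a * q)) a0).
      apply: measurable_funM => //; apply: measurableT_comp; first exact: measurable_expR.
      apply: measurable_funB; first exact: measurable_funM.
      by apply: measurable_funM => //; exact: measurable_funX.
    move=> y; rewrite expr0 mul1r mul0r addr0 ger0_norm ?mulr_ge0 ?expR_ge0// ler_wpM2r//.
    rewrite ler_expR -normrM; apply: le_trans (ler_norm _).
    by rewrite lerBlDr lerDl mulr_ge0 ?sqr_ge0// mulr_ge0// divr_ge0// ltW.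
  rewrite EFinM [X in (_ * X)%E]fineK; last exact: integrable_fin_num ik.
  rewrite -integralZl//; apply: eq_integral => y _; rewrite /= -EFinM; congr EFin.
  rewrite normal_pdfE// /normal_fun s2.
  have -> : - (q - y) ^+ 2 * (n%:R * (a / 2)) = - (n%:R * (a / 2)) * q ^+ 2 +
     (n%:R * a * q * y - n%:R * (a / 2) * y ^+ 2) by field.
  by rewrite expRD; ring.
by rewrite (E _ _ T0) (E _ _ T1) (wmom_eq_iter uv T0 T1 g01).
Qed.

End laplace.

Section laplace_injectivity.
Context {R : realType}.

Let smooth (k : probability R R) (g : R -> R) (s c : R) : \bar R :=
  (\int[k]_y ((g y)%:E * normal_prob y s `]-oo, c]%classic))%E.

Let mass (k : probability R R) (g : R -> R) (A : set R) : \bar R :=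
  (\int[k]_(y in A) (g y)%:E)%E.

Lemma measurable_normal_prob_ray (s c : R) : s != 0 ->
  measurable_fun setT (fun y => normal_prob y s `]-oo, c]%classic).
Proof.
move=> s0; pose f (w : R * R) : \bar R := (normal_pdf w.1 s w.2 * \1_(`]-oo, c]%classic) w.2)%:E.
have mf : measurable_fun setT f.
  apply/measurable_EFinP; apply: measurable_funM; first exact: measurable_normal_pdf2.
  by apply: measurableT_comp => //; exact: measurable_indic.
have f0 w : (0 <= f w)%E by rewrite lee_fin mulr_ge0 ?normal_pdf_ge0.
have := measurable_fun_fubini_tonelli_F (m2 := lebesgue_measure) f mf f0.
apply: eq_measurable_fun => y _; rewrite /fubini_F /normal_prob [RHS]integral_mkcond.
apply: eq_integral => q _; rewrite patchE /f /= indicE.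
by case: (_ \in _); rewrite ?mulr1 ?mulr0.
Qed.

Lemma normal_prob_le1 (y s : R) (A : set R) : measurable A -> (normal_prob y s A <= 1)%E.
Proof. by move=> mA; exact: (probability_le1 (normal_prob y s)). Qed.

(** A point left of [c] remains left of [c + d] after smoothing with probability at least
    [1 - e]. *)
Lemma smooth_ge (k : probability R R) g a s c d e : gauss_tail k g a -> 0 < s -> s <= 1 -> 0 < d ->
  s^-1 * expR (- (d ^+ 2 * (s ^- 2 - 1) / 2)) <= e -> e < 1 ->
  ((1 - e)%:E * mass k g `]-oo, c]%classic <= smooth k g s (c + d))%E.
Proof.
move=> [_ mg g0 ig] s0 s1 d0 he e1; rewrite /mass /smooth.
have s'0 : s != 0 by rewrite gt_eqF.
have mN := @measurable_normal_prob_ray s (c + d) s'0.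
have mge : measurable_fun setT (fun y => (g y)%:E) by exact/measurable_EFinP.
rewrite -ge0_integralZl//; first last.
- by rewrite lee_fin subr_ge0 ltW.
- by move=> y _; rewrite lee_fin.
- exact: measurable_funTS.
apply: (@le_trans _ _ (\int[k]_(y in `]-oo, c]%classic) ((g y)%:E * normal_prob y s `]-oo, (c + d)%R]%classic))%E).
  apply: ge0_le_integral => //.
  - by move=> y _; rewrite mule_ge0// lee_fin// subr_ge0 ltW.
  - by apply: measurable_funTS; apply: emeasurable_funM.
  - by apply: measurable_funTS; exact: emeasurable_funM.
  move=> y; rewrite /= in_itv/= => yc; rewrite muleC lee_wpmul2l ?lee_fin//.
  have mI : measurable (`]-oo, (c + d)%R]%classic : set (measurableTypeR R)) by [].
  have hC := normal_tail (y := y) s0 s1 d0 (measurableC mI).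
  have {}hC : (normal_prob y s (~` `]-oo, (c + d)%R]%classic) <= e%:E)%E.
    apply: le_trans (hC _) _; last by rewrite lee_fin.
    move=> q /=; rewrite in_itv/= => /negP; rewrite -ltNge => cq.
    by rewrite ger0_norm; lra.
  have fN : normal_prob y s `]-oo, (c + d)%R]%classic \is a fin_num.
    by rewrite ge0_fin_numE ?measure_ge0// (le_lt_trans (normal_prob_le1 y s mI))// ltry.
  have CE : normal_prob y s (~` `]-oo, (c + d)%R]%classic) =
      (1 - normal_prob y s `]-oo, (c + d)%R]%classic)%E := probability_setC (normal_prob y s) mI.
  move: hC; rewrite CE.
  by rewrite -(fineK fN) -EFinB !lee_fin; lra.
by apply: ge0_subset_integral => //; [exact: emeasurable_funM|move=> y _; rewrite mule_ge0// lee_fin].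
Qed.

(** A point right of [c + d] enters the ray after smoothing with probability at most [e]. *)
Lemma smooth_le (k : probability R R) g a s c d e : gauss_tail k g a -> 0 < s -> s <= 1 -> 0 < d ->
  s^-1 * expR (- (d ^+ 2 * (s ^- 2 - 1) / 2)) <= e ->
  (smooth k g s c <= mass k g `]-oo, (c + d)%R]%classic + e%:E * mass k g setT)%E.
Proof.
move=> [_ mg g0 ig] s0 s1 d0 he; rewrite /mass /smooth.
have s'0 : s != 0 by rewrite gt_eqF.
have e0 : 0 <= e by apply: le_trans he; rewrite mulr_ge0 ?expR_ge0// invr_ge0 ltW.
have mN := @measurable_normal_prob_ray s c s'0.
have mge : measurable_fun setT (fun y => (g y)%:E) by exact/measurable_EFinP.
rewrite -ge0_integralZl//; last by move=> y _; rewrite lee_fin.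
have mr : measurable_fun setT ((fun y => (g y)%:E) \_ `]-oo, (c + d)%R]%classic).
  by apply/(measurable_restrictT _ (measurable_itv _))/measurable_funTS.
rewrite [X in (X + _)%E]integral_mkcond -ge0_integralD//; first last.
- by apply: emeasurable_funM.
- by move=> y _; rewrite mule_ge0// lee_fin.
- by move=> y _; rewrite patchE; case: ifP => // _; rewrite lee_fin.
apply: ge0_le_integral => //.
- by move=> y _; rewrite mule_ge0// lee_fin.
- exact: emeasurable_funM.
- apply: emeasurable_funD; last exact: emeasurable_funM.
  exact: mr.
move=> y _; rewrite patchE mem_setE in_itv/=; have [yc|yc] := leP y (c + d).
  apply: (@le_trans _ _ (g y)%:E).
    by rewrite -[leRHS]mule1 lee_wpmul2l ?lee_fin// normal_prob_le1.
  by rewrite leeDl// mule_ge0// lee_fin.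
rewrite add0e muleC lee_wpmul2r ?lee_fin//.
apply: le_trans (normal_tail (y := y) s0 s1 d0 _ _) _ => //.
by move=> q /=; rewrite in_itv/= => qc; rewrite ler0_norm; lra.
Qed.

Lemma mass_fin (k : probability R R) g a A : gauss_tail k g a -> measurable A -> mass k g A \is a fin_num.
Proof.
move=> T mA; have [a0 mg g0 ig] := T.
have i0 : k.-integrable setT (EFin \o g).
  apply: (gauss_tail_integrable (n := 0) T (lexx 0) a0) => // y.
  by rewrite expr0 mul1r !mul0r addr0 expR0 mul1r ger0_norm.
by apply: integrable_fin_num => //; exact: integrableS measurableT mA _ i0.
Qed.

(** The two sandwich bounds compare rays at distance [d]; the smoothing error is sent to 0, then [d]
    by continuity from above. One inequality suffices, as the hypotheses are symmetric. *)
Lemma mass_ray_le (k0 k1 : probability R R) g0 g1 a u v c : u < v ->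
  gauss_tail k0 g0 a -> gauss_tail k1 g1 a ->
  (forall t, u < t < v -> wmom k0 g0 0 t = wmom k1 g1 0 t) ->
  (mass k0 g0 `]-oo, c]%classic <= mass k1 g1 `]-oo, c]%classic)%E.
Proof.
move=> uv T0 T1 g01; have a0 : 0 < a by case: T0.
have mI (b : R) : measurable (`]-oo, b]%classic : set R) by [].
have ray d : 0 < d -> (mass k0 g0 `]-oo, c]%classic <= mass k1 g1 `]-oo, (c + d)%R]%classic)%E.
  move=> d0; pose d' := d / 2; have d'0 : 0 < d' by rewrite divr_gt0.
  set m0 := mass k0 g0 _; set m1 := mass k1 g1 _.
  have f0 : m0 \is a fin_num by exact: mass_fin T0 _.
  have f1 : m1 \is a fin_num by exact: mass_fin T1 _.
  have fT : mass k1 g1 setT \is a fin_num by exact: mass_fin T1 _.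
  rewrite -(fineK f0) -(fineK f1) lee_fin; apply/ler_addgt0Pr => e e0.
  pose t := fine (mass k1 g1 setT).
  have t0 : 0 <= t by rewrite fine_ge0// integral_ge0// => y _; case: T1 => _ _ h _; rewrite lee_fin.
  have m00 : 0 <= fine m0 by rewrite fine_ge0// integral_ge0// => y _; case: T0 => _ _ h _; rewrite lee_fin.
  (* With smoothing error [e'] the sandwich reads [(1 - e') m0 <= m1 + e' t]. The choice makes
     [e' (t + m0) <= e], and [e' < 1] as [smooth_ge] requires. *)
  pose e' := Num.min 2^-1 (e / (1 + t + fine m0)).
  have den : 0 < 1 + t + fine m0 by lra.
  have e'0 : 0 < e' by rewrite /e' lt_min divr_gt0// andbT.
  have e'1 : e' < 1 by rewrite /e' gt_min; apply/orP; left; lra.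
  have e'e : e' * (1 + t + fine m0) <= e by rewrite -ler_pdivlMr// /e' ge_min lexx orbT.
  have [n n0 [s1 hs]] := normal_tail_small a0 d'0 e'0.
  set s := Num.sqrt _ in s1 hs.
  have s0 : 0 < s by rewrite sqrtr_gt0 invr_gt0 mulr_gt0 ?ltr0n.
  have h1 := @smooth_ge k0 g0 a s c d' e' T0 s0 s1 d'0 hs e'1.
  have h2 := @smooth_le k1 g1 a s (c + d') d' e' T1 s0 s1 d'0 hs.
  have h3 : smooth k0 g0 s (c + d') = smooth k1 g1 s (c + d') := smooth_eq uv T0 T1 g01 (c + d') n0.
  have cd : c + d' + d' = c + d by rewrite /d'; lra.
  rewrite cd -h3 in h2; have {h1 h2} := le_trans h1 h2.
  rewrite -/m0 -/m1 -(fineK f0) -(fineK f1) -(fineK fT) -/t -!EFinM -EFinD lee_fin => h.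
  nra.
have f1 : mass k1 g1 `]-oo, c]%classic \is a fin_num by exact: mass_fin T1 _.
have [a0' mg1 g1_ge0 ig1] := T1.
have : mass k1 g1 (`]-oo, (c + n.+1%:R^-1)%R]%classic) @[n --> \oo] --> mass k1 g1 `]-oo, c]%classic.
  rewrite -[X in _ --> X]/(mdensity k1 mg1 g1_ge0 `]-oo, c]%classic).
  have -> : `]-oo, c]%classic = \bigcap_n (`]-oo, (c + n.+1%:R^-1)%R]%classic : set R).
    by rewrite -itvNycEbigcap.
  apply: (@nonincreasing_cvg_mu _ _ _ (mdensity k1 mg1 g1_ge0) (fun n => `]-oo, (c + n.+1%:R^-1)%R]%classic)) => //.
  - rewrite -ge0_fin_numE ?measure_ge0//; exact: mass_fin T1 _.
  - by apply: bigcap_measurable.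
  - move=> i j ij; apply/subsetPset => x /=; rewrite !in_itv/= => /le_trans; apply.
    by rewrite lerD2l lef_pV2 ?posrE ?ltr0n// ler_nat ltnS.
move=> cvg1; rewrite -(cvg_lim _ cvg1)//; apply: lime_ge; first by apply/cvg_ex; eexists; exact: cvg1.
by apply: nearW => n; apply: ray; rewrite invr_gt0.
Qed.

Lemma laplace_injective (k0 k1 : probability R R) g0 g1 a u v : u < v ->
  gauss_tail k0 g0 a -> gauss_tail k1 g1 a ->
  (forall t, u < t < v -> wmom k0 g0 0 t = wmom k1 g1 0 t) ->
  forall A, measurable A -> (\int[k0]_(y in A) (g0 y)%:E = \int[k1]_(y in A) (g1 y)%:E)%E.
Proof.
move=> uv T0 T1 g01 A mA.
have [a0 mg0 g0_ge0 ig0] := T0; have [_ mg1 g1_ge0 ig1] := T1.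
have m0E B : mass k0 g0 B = mdensity k0 mg0 g0_ge0 B by [].
apply: (@measure_eq_ray R (mdensity k0 mg0 g0_ge0) (mdensity k1 mg1 g1_ge0)) => //.
- rewrite -ge0_fin_numE ?measure_ge0//; exact: mass_fin T0 _.
- have := wmom_eq_iter uv T0 T1 g01 0 0.
  have e y : expR (0 * y - 0 * (a / 2) * y ^+ 2) = 1 :> R by rewrite !mul0r subr0 expR0.
  under eq_Rintegral do rewrite e mul1r.
  under [X in _ = X -> _]eq_Rintegral do rewrite e mul1r.
  have f0 := mass_fin T0 (@measurableT _ R); have f1 := mass_fin T1 (@measurableT _ R).
  by move=> h; exact: etrans (esym (fineK f0)) (etrans (congr1 EFin h) (fineK f1)).
- move=> c; apply/eqP; rewrite eq_le; apply/andP; split.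
    exact: (mass_ray_le c uv T0 T1 g01).
  by apply: (mass_ray_le c uv T1 T0) => t /g01 ->.
Qed.

End laplace_injectivity.

(** * Functions driven by a singular clock *)

Section balls.
Context {R : realFieldType}.

Lemma half_ball (x y : R) : `|x - y| <= x / 2 -> x / 2 <= y <= 2 * x.
Proof.
move=> h; have := le_trans (normr_ge0 _) h; move: h.
by rewrite ler_norml => /andP[h1 h2] h0; apply/andP; split; lra.
Qed.

Lemma ball_itv (x m p r y : R) : r <= x - m -> r <= p - x -> `|y - x| <= r -> m <= y <= p.
Proof. by move=> h1 h2; rewrite ler_distl => /andP[h3 h4]; apply/andP; split; lra. Qed.

Lemma ballU_itv (x a b y r : R) : `|a - x| <= r -> `|b - x| <= r -> a <= y <= b -> `|y - x| <= r.
Proof.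
by rewrite !ler_distl => /andP[? ?] /andP[? ?] /andP[? ?]; apply/andP; split; lra.
Qed.

Lemma open_ballU_itv (x a b y r : R) : `|a - x| < r -> `|b - x| < r -> a <= y <= b -> `|y - x| < r.
Proof.
by rewrite !ltr_distl => /andP[? ?] /andP[? ?] /andP[? ?]; apply/andP; split; lra.
Qed.

Lemma itv_dist (a b x y : R) : a <= x <= b -> a <= y <= b -> `|x - y| <= `|b - a|.
Proof.
move=> /andP[? ?] /andP[? ?]; rewrite (ger0_norm (_ : 0 <= b - a)); last by lra.
by rewrite ler_distl; apply/andP; split; lra.
Qed.

Lemma itv_of_increments (p h q a m y : R) : 0 <= a -> a <= p - h -> a <= h - q ->
  `|h - m| <= a / 2 -> `|y - m| <= a / 2 -> q <= p /\ q <= y <= p.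
Proof.
rewrite !ler_distl => a0 h1 h2 /andP[h3 h4] /andP[h5 h6].
by split; [lra|apply/andP; split; lra].
Qed.

Lemma dist_perturb (p q p' q' r : R) : `|p - p'| <= r -> `|q - q'| <= r ->
  `|p' - q'| - 2 * r <= `|p - q|.
Proof.
move=> hp hq; have -> : p' - q' = (p - q) - (p - p') + (q - q') by ring.
have := ler_normD ((p - q) - (p - p')) (q - q'); have := ler_normB (p - q) (p - p').
by lra.
Qed.

Lemma lt_half_scale (L x e : R) : x * (2 * L) < e -> L * x < e / 2.
Proof. by move=> h; rewrite ltr_pdivlMr// (_ : L * x * 2 = x * (2 * L)); [|ring]. Qed.

Lemma lt_half_scaleS (C x e : R) : 0 <= x -> x * (2 * (C + 1)) < e -> C * x < e / 2.
Proof.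
move=> x0 /lt_half_scale; apply: le_lt_trans.
by rewrite mulrDl mul1r lerDl.
Qed.

Lemma le_halfB (x y : R) : y <= x / 2 -> x / 2 <= x - y.
Proof. by move=> h; lra. Qed.

End balls.

(** * Difference quotients and Lipschitz functions *)

Section difference_quotients.
Context {R : realType}.
Local Notation lambda := (@lebesgue_measure R).

Lemma ae_lebesgue_filter : Filter (T := R) (nbhs (almost_everywhere lambda)).
Proof. exact: (ae_filter_ringOfSetsType lambda). Qed.

Lemma ae_lebesgueS (P Q : R -> Prop) : (forall t, P t -> Q t) ->
  {ae lambda, forall t, P t} -> {ae lambda, forall t, Q t}.
Proof. by move=> PQ; exact: (@filterS _ _ ae_lebesgue_filter). Qed.

Lemma ae_lebesgueI (P Q : R -> Prop) : {ae lambda, forall t, P t} ->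
  {ae lambda, forall t, Q t} -> {ae lambda, forall t, P t /\ Q t}.
Proof. by move=> aP aQ; exact: (@filterI _ _ ae_lebesgue_filter _ _ aP aQ). Qed.

Lemma ae_lebesgue_neq (a : R) : {ae lambda, forall t, t != a}.
Proof.
exists [set a]; split; [exact: measurable_set1|exact: lebesgue_measure_set1|].
by move=> t /= /negP; rewrite negbK => /eqP.
Qed.

Lemma ex_antiderivative (f : R -> R) (a b : R) : continuous f -> a < b ->
  exists F : R -> R, forall x, a < x < b -> is_derive x 1 F (f x).
Proof.
move=> cf ab; exists (fun x => \int[lambda]_(t in `]a, x]) f t) => x /andP[ax xb].
have fi : lambda.-integrable `]a, b] (EFin \o f).
  have fi' : lambda.-integrable `[a, b] (EFin \o f).
    apply: continuous_compact_integrable; first exact: segment_compact.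
    by move=> y; apply: continuous_subspaceT.
  by apply: integrableS fi' => //; apply: subset_itvr; rewrite bnd_simp.
have [dF F'] := @continuous_FTC1 R f (BRight a) x b xb fi ax (cf x).
by apply: (DeriveDef dF); rewrite -derive1E; exact: F'.
Qed.

Lemma integral_increment (f F : R -> R) (a b h : R) : continuous f -> a < b -> 0 < h ->
  (forall x, a - 1 < x < b + h + 1 -> is_derive x 1 F (f x)) ->
  \int[lambda]_(t in `[a, b]) (f (t + h) - f t) = (F (b + h) - F b) - (F (a + h) - F a).
Proof.
move=> cf ab h0 dF.
pose G x := F (x + h) - F x.
have dG x : a - 1 < x < b + 1 -> is_derive x 1 G (f (x + h) - f x).
  move=> /andP[ax xb].
  have d1 : is_derive (x + h) 1 F (f (x + h)) by apply: dF; apply/andP; split; lra.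
  have d2 : is_derive x 1 F (f x) by apply: dF; apply/andP; split; lra.
  have d3 : is_derive x 1 (F \o (fun y => y + h)) (f (x + h)).
    by apply: is_derive_eq; rewrite addr0 mulr1.
  rewrite /G; exact: is_deriveB.
have cg : continuous (fun t => f (t + h) - f t).
  move=> t; apply: cvgB; last exact: cf.
  apply: (@cvg_comp _ _ _ (fun t => t + h) f); last exact: cf.
  by apply: cvgD; [exact: cvg_id|exact: cvg_cst].
have cG x : a - 1 < x < b + 1 -> {for x, continuous G}.
  by move=> hx; apply: differentiable_continuous; apply/derivable1_diffP; have [] := dG x hx.
have aa : a - 1 < a < b + 1 by apply/andP; split; lra.
have bb : a - 1 < b < b + 1 by apply/andP; split; lra.
have := @continuous_FTC2 R (fun t => f (t + h) - f t) G a b ab.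
rewrite /Rintegral => -> //=.
- by move=> x; apply: continuous_subspaceT.
- split.
  + by move=> x; rewrite in_itv/= => /andP[ax xb]; have [] := dG x; first by apply/andP; split; lra.
  + exact: cvg_at_right_filter (cG _ aa).
  + exact: cvg_at_left_filter (cG _ bb).
- move=> x; rewrite in_itv/= => /andP[ax xb]; rewrite derive1E.
  by have [] := dG x; first by apply/andP; split; lra.
Qed.

Lemma cvg_increment (F : R -> R) (x l : R) : is_derive x 1 F l ->
  n.+1%:R * (F (x + n.+1%:R^-1) - F x) @[n --> \oo] --> l.
Proof.
move=> [dF <-].
have h0 : (fun n => n.+1%:R^-1 : R) n @[n --> \oo] --> (0 : R)^'.
  move=> A hA; have [m _ hm] := @cvg_harmonic R _ hA; exists m => // n mn.
  by apply: (hm n mn); rewrite /= gt_eqF// invr_gt0.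
have := cvg_comp _ _ h0 dF; apply: cvg_trans; apply: near_eq_cvg.
by apply: nearW => n; rewrite /= invrK /GRing.scale/= mulr1 [_ + x]addrC.
Qed.

(** The projection onto [a, b]. Composing with it extends a function from the segment to the line
    while keeping continuity, monotonicity and Lipschitz bounds. *)
Definition clamp (a b t : R) : R := Num.max a (Num.min b t).

Lemma clamp_itv a b t : a <= b -> a <= clamp a b t <= b.
Proof. by move=> ab; rewrite /clamp le_max lexx/= ge_max ab/= ge_min lexx. Qed.

Lemma clamp_id a b t : a <= t <= b -> clamp a b t = t.
Proof. by move=> /andP[ta tb]; rewrite /clamp min_r// max_r. Qed.

Lemma clamp_lip a b s t : a <= b -> `|clamp a b s - clamp a b t| <= `|s - t|.
Proof.
move=> ab; wlog st : s t / s <= t.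
  by move=> h; case: (leP s t) => [/h//|/ltW /h]; rewrite distrC [leRHS]distrC.
rewrite [leRHS]ler0_norm ?subr_le0// opprB /clamp.
have [bs|sb] := leP b s; have [bt|tb] := leP b t; try lra.
all: have [h1|h1] := leP a b; try lra.
all: try (have [h2|h2] := leP a s); try (have [h3|h3] := leP a t); rewrite ler_norml; lra.
Qed.

Lemma lip_continuous (f : R -> R) (C : R) : (forall s t, `|f s - f t| <= C * `|s - t|) -> continuous f.
Proof.
move=> fC x; apply/cvgrPdist_le => e e0.
have C0 : 0 < `|C| + 1 by rewrite ltr_wpDl.
near=> y; apply: le_trans (fC _ _) _.
apply: (@le_trans _ _ ((`|C| + 1) * `|x - y|)).
  by rewrite ler_wpM2r// (le_trans (ler_norm C))// lerDl.
rewrite mulrC -ler_pdivlMr//; near: y.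
by apply: cvgr_dist_le; [exact: cvg_id|rewrite divr_gt0].
Unshelve. all: by end_near. Qed.

(* Almost everywhere [u] inherits the zero derivative of [r], and a Lipschitz
   function is the integral of its derivative. *)
Lemma lip_singular_cst (u r : R -> R) (a b C : R) : a < b ->
  (forall s t, a <= s <= b -> a <= t <= b -> `|u s - u t| <= C * `|s - t|) ->
  (forall s t, a <= s <= b -> a <= t <= b -> `|u s - u t| <= C * `|r s - r t|) ->
  {ae lambda, forall t, a < t < b -> is_derive t 1 r 0} ->
  u a = u b.
Proof.
move=> ab uC ur r0; have ab' := ltW ab.
pose f t := u (clamp a b t).
have fC s t : `|f s - f t| <= C * `|s - t|.
  apply: le_trans (uC _ _ (clamp_itv _ ab') (clamp_itv _ ab')) _.
  have [C0|C0] := leP 0 C; first by rewrite ler_wpM2l// clamp_lip.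
  have ha : a <= a <= b by rewrite lexx.
  have hb : a <= b <= b by rewrite lexx andbT.
  have := uC a b ha hb; have := normr_ge0 (u a - u b) => h1 h2.
  have : 0 < `|a - b| by rewrite normr_gt0 subr_eq0 lt_eqF.
  nra.
have cf := lip_continuous fC.
have [F dF] := @ex_antiderivative f (a - 1) (b + 3) cf ltac:(lra).
pose q n t := n.+1%:R * (f (t + n.+1%:R^-1) - f t).
have C0 : 0 <= C.
  have := fC 0 1; rewrite sub0r normrN normr1 mulr1; exact: le_trans.
have qC n t : `|q n t| <= C.
  rewrite /q normrM ger0_norm// mulrC -ler_pdivlMr ?ltr0n//.
  apply: le_trans (fC _ _) _; rewrite addrC addKr ger0_norm ?invr_ge0//.
have cq n : continuous (q n).
  move=> t; apply: cvgM; first exact: cvg_cst.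
  apply: cvgB; last exact: cf.
  apply: (@cvg_comp _ _ _ (fun t => t + n.+1%:R^-1) f); last exact: cf.
  by apply: cvgD; [exact: cvg_id|exact: cvg_cst].
have mq n : measurable_fun `[a, b] (q n).
  by apply: measurable_funTS; exact: continuous_measurable_fun.
have dF' (z : R) : z <= 1 -> forall x, a - 1 < x < b + z + 1 -> is_derive x 1 F (f x).
  by move=> z1 x /andP[xa xb]; apply: dF; apply/andP; split; lra.
have i0 n : \int[lambda]_(t in `[a, b]) q n t =
    n.+1%:R * (F (b + n.+1%:R^-1) - F b) - n.+1%:R * (F (a + n.+1%:R^-1) - F a).
  have n1 : (n.+1%:R : R)^-1 <= 1 by rewrite invf_le1// ler1n.
  have hn0 : 0 < (n.+1%:R : R)^-1 by rewrite invr_gt0.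
  rewrite -mulrBr -(integral_increment cf ab hn0 (dF' _ n1)).
  rewrite -RintegralZl//.
  apply: continuous_compact_integrable; first exact: segment_compact.
  move=> y; apply: continuous_subspaceT => t; apply: cvgB; last exact: cf.
  apply: (@cvg_comp _ _ _ (fun t => t + n.+1%:R^-1) f); last exact: cf.
  by apply: cvgD; [exact: cvg_id|exact: cvg_cst].
(* The integrals of the difference quotients tend to the increment of [f], by the fundamental
   theorem for an antiderivative of the continuous [f]. Dominated convergence, with the constant [C]
   as bound, gives the limit 0 instead. *)
have cvi : \int[lambda]_(t in `[a, b]) q n t @[n --> \oo] --> f b - f a.
  under eq_fun do rewrite i0.
  by apply: cvgB; apply: cvg_increment; apply: dF; apply/andP; split; lra.
have q0 : {ae lambda, forall t, `[a, b]%classic t -> q n t @[n --> \oo] --> 0}.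
  apply: ae_lebesgueS (ae_lebesgueI r0 (ae_lebesgueI (ae_lebesgue_neq a) (ae_lebesgue_neq b))).
  move=> t [rt [ta tb]] /=; rewrite in_itv/= => /andP[at' tb'].
  have {}at' : a < t by rewrite lt_neqAle eq_sym ta.
  have {}tb' : t < b by rewrite lt_neqAle tb.
  have dr := rt (introT andP (conj at' tb')).
  have cr := cvg_increment dr.
  apply/cvgrPdist_le => e e0.
  have C1 : 0 < C + 1 by rewrite ltr_wpDl.
  have hn : \forall n \near \oo, (n.+1%:R : R)^-1 < b - t.
    have bt0 : 0 < b - t by rewrite subr_gt0.
    have := @cvg_harmonic R => /cvgrPdist_lt/(_ _ bt0); apply: filterS => n.
    by rewrite sub0r normrN ger0_norm// invr_ge0.
  have e1 : 0 < e / (C + 1) by rewrite divr_gt0.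
  have /cvgrPdist_le/(_ _ e1) := cr; apply: filterS2 hn => n hn.
  rewrite !sub0r !normrN /q !normrM => h.
  have n0 : 0 < (n.+1%:R : R)^-1 by rewrite invr_gt0.
  have tab : a <= t <= b by rewrite !ltW.
  have tzab : a <= t + n.+1%:R^-1 <= b.
    by rewrite (ltW (lt_trans at' _)) ?ltrDl//= addrC -lerBrDr ltW.
  rewrite /f !clamp_id//.
  have hh : `|u (t + n.+1%:R^-1) - u t| <= C * `|r (t + n.+1%:R^-1) - r t|.
    exact: ur.
  apply: (@le_trans _ _ (C * (`|n.+1%:R| * `|r (t + n.+1%:R^-1) - r t|))).
    by rewrite mulrCA ler_wpM2l.
  apply: (@le_trans _ _ (C * (e / (C + 1)))); first by rewrite ler_wpM2l.
  by rewrite mulrA ler_pdivrMr// mulrC ler_wpM2l ?(ltW e0)// lerDl.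
have : \int[lambda]_(t in `[a, b]) q n t @[n --> \oo] --> (0 : R).
  have mI : measurable (`[a, b]%classic : set (measurableTypeR R)) by [].
  have iC : lambda.-integrable `[a, b] (EFin \o (fun=> C)).
    apply: continuous_compact_integrable; first exact: segment_compact.
    by move=> y; apply: continuous_subspaceT => t; exact: cvg_cst.
  have m0 : measurable_fun `[a, b] (fun=> 0%E : \bar R) by exact: measurable_cst.
  have mq' n : measurable_fun `[a, b] (EFin \o q n) by exact/measurable_EFinP.
  have q0' : {ae lambda, forall t, `[a, b]%classic t -> (EFin \o q n) t @[n --> \oo] --> 0%E}.
    apply: ae_lebesgueS q0 => t h tab; apply: cvg_EFin; [exact: nearW|exact: h tab].
  have qC' : {ae lambda, forall t n, `[a, b]%classic t -> (`|(EFin \o q n) t| <= (EFin \o (fun=> C)) t)%E}.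
    by apply: aeW => t n _ /=; rewrite lee_fin.
  have [_ _] := dominated_convergence mI mq' m0 q0' iC qC'.
  rewrite integral0 => h.
  exact: (fine_cvg h).
move=> cv0; have E : f b - f a = 0 by exact: cvg_unique cvi cv0.
by move/eqP: E; rewrite subr_eq0 /f !clamp_id ?lexx ?ab'// => /eqP ->.
Qed.

End difference_quotients.

(** * Tilted means *)

Section tilted_moments.
Context {R : realType}.

Definition tmom (k : probability R R) (r : R) (n : nat) (t : R) : R :=
  wmom k (fun y => expR (- r * y ^+ 2)) n t.

Definition tmean (k : probability R R) (r t : R) : R := tmom k r 1 t / tmom k r 0 t.

Lemma measurable_gauss (r : R) : measurable_fun setT (fun y : R => expR (- r * y ^+ 2)).
Proof.
apply: measurableT_comp; first exact: measurable_expR.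
by apply: measurable_funM => //; exact: measurable_funX.
Qed.

Lemma tail_gauss (k : probability R R) (r : R) : 0 < r ->
  gauss_tail k (fun y => expR (- r * y ^+ 2)) r.
Proof.
move=> r0; split => //; first exact: measurable_gauss.
have -> : (fun y : R => expR (r * y ^+ 2) * expR (- r * y ^+ 2)) = fun=> 1.
  by apply/funext => y; rewrite -expRD mulNr subrr expR0.
exact: finite_measure_integrable_cst.
Qed.

Lemma tail_gauss_scale (k : probability R R) (r C : R) : 0 < r -> 0 <= C ->
  gauss_tail k (fun y => C * expR (- r * y ^+ 2)) r.
Proof.
move=> r0 C0; have [_ mg g0 ig] := tail_gauss k r0; split => //.
- exact: measurable_funM.
- by move=> y; rewrite mulr_ge0 ?expR_ge0.
- have := integrableZl measurableT C ig; apply: eq_integrable => // y _.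
  by rewrite /= -EFinM; congr EFin; ring.
Qed.

Lemma Rintegral_gt0 (k : probability R R) (f : R -> R) : measurable_fun setT f ->
  k.-integrable setT (EFin \o f) -> (forall y, 0 < f y) -> 0 < \int[k]_y f y.
Proof.
move=> mf fi f0; rewrite lt_neqAle Rintegral_ge0 ?andbT//; last by move=> y _; exact: ltW.
apply/negP => /eqP /esym h.
have h' : (\int[k]_y (f y)%:E = 0)%E.
  have ff := integrable_fin_num measurableT fi.
  exact: etrans (esym (fineK ff)) (congr1 EFin h).
have mfE : measurable_fun setT (EFin \o f) by exact/measurable_EFinP.
have [N [mN N0 hN]] := ge0_integral_eq0_ae mfE (fun y => ltW (f0 y) : (0 <= (f y)%:E)%E) h'.
have NT : N = setT.
  apply/seteqP; split => // y _; apply: hN => /= -[] /eqP.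
  by rewrite gt_eqF.
by move: N0; rewrite NT => /(etrans (esym (probability_setT k)))/eqP; rewrite onee_eq0.
Qed.

Lemma tmom0_gt0 k r (t : R) : 0 < r -> 0 < tmom k r 0 t.
Proof.
move=> r0; have T := tail_gauss k r0; apply: Rintegral_gt0.
- by have /measurable_int/measurable_EFinP := wmom_integrable 0 t T.
- exact: wmom_integrable T.
- by move=> y; rewrite expr0 mul1r mulr_gt0 ?expR_gt0.
Qed.

Lemma is_derive_tmom k r n (t : R) : 0 < r -> is_derive t 1 (tmom k r n) (tmom k r n.+1 t).
Proof. by move=> r0; exact: is_derive_wmom (tail_gauss k r0). Qed.

(** With [h] the inverse of a common Gaussian factor times an indicator, this strips the factor from
    an equality of measures. *)
Lemma density_cancel (k0 k1 : probability R R) (g0 g1 h : R -> R) :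
  measurable_fun setT g0 -> (forall y, 0 <= g0 y) ->
  measurable_fun setT g1 -> (forall y, 0 <= g1 y) ->
  measurable_fun setT h -> (forall y, 0 <= h y) ->
  (forall A, measurable A -> \int[k0]_(y in A) (g0 y)%:E = \int[k1]_(y in A) (g1 y)%:E)%E ->
  (\int[k0]_y (g0 y * h y)%:E = \int[k1]_y (g1 y * h y)%:E)%E.
Proof.
move=> mg0 g00 mg1 g10 mh h0 E.
have mhE : measurable_fun setT (EFin \o h) by exact/measurable_EFinP.
have E' : (\int[mdensity k0 mg0 g00]_y (EFin \o h) y = \int[mdensity k1 mg1 g10]_y (EFin \o h) y)%E.
  by apply: eq_measure_integral => A mA _; exact: E.
have h0' y : (0 <= (EFin \o h) y)%E by rewrite lee_fin.
by have := E'; rewrite !ge0_integral_mdensity.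
Qed.

(** The tilted mean is the logarithmic derivative of [tmom k r 0]. Equal means make these functions
    proportional; injectivity of the Laplace transform makes the laws proportional, and both have
    mass 1. *)
Lemma tmean_injective (k0 k1 : probability R R) r : 0 < r ->
  (forall t, tmom k0 r 1 t * tmom k1 r 0 t = tmom k1 r 1 t * tmom k0 r 0 t) ->
  forall A, measurable A -> k0 A = k1 A.
Proof.
move=> r0 h.
have z0 t := tmom0_gt0 k0 t r0; have z1 t := tmom0_gt0 k1 t r0.
pose q t := tmom k0 r 0 t / tmom k1 r 0 t.
have dq (t : R) : is_derive t 1 q 0.
  have d0 := is_derive_tmom k0 0 t r0; have d1 := is_derive_tmom k1 0 t r0.
  have z1' : tmom k1 r 0 t != 0 by rewrite gt_eqF.
  have dV := is_deriveV z1' d1.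
  apply: (@is_derive_eq _ _ _ _ _ _ _ _ (is_deriveM d0 dV)).
  rewrite /GRing.scale/=.
  have -> : tmom k0 r 0 t * (- (tmom k1 r 0 t ^+ 2)^-1 * tmom k1 r 1 t) + (tmom k1 r 0 t)^-1 * tmom k0 r 1 t =
     (tmom k0 r 1 t * tmom k1 r 0 t - tmom k1 r 1 t * tmom k0 r 0 t) / tmom k1 r 0 t ^+ 2 by field.
  by rewrite h subrr mul0r.
pose C := q 0.
have C0 : 0 < C by rewrite divr_gt0.
have qC t : tmom k0 r 0 t = C * tmom k1 r 0 t.
  by rewrite /C -(is_derive_0_is_cst t 0 dq) /q divfK// gt_eqF.
have T0 := tail_gauss k0 r0; have T1 := tail_gauss_scale k1 r0 (ltW C0).
have uv : (0 : R) < 1 by [].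
have E := laplace_injective uv T0 T1 (fun t _ => _).
have {}E : forall A, measurable A -> (\int[k0]_(y in A) (expR (- r * y ^+ 2))%:E = \int[k1]_(y in A) (C * expR (- r * y ^+ 2))%:E)%E.
  apply: E => t; have := qC t; rewrite /tmom => ->; rewrite /wmom -RintegralZl//.
    by apply: eq_Rintegral => y _; ring.
  exact: wmom_integrable (tail_gauss k1 r0).
have mg := measurable_gauss r.
have KE A : measurable A -> (k0 A = C%:E * k1 A)%E.
  clear h.
  move=> mA; pose h y := expR (r * y ^+ 2) * \1_A y.
  have mh : measurable_fun setT h.
    apply: measurable_funM; last exact: measurable_indic.
    by have := measurable_gauss (- r); rewrite opprK.
  have h0 y : 0 <= h y by rewrite mulr_ge0 ?expR_ge0.
  have e y : expR (- r * y ^+ 2) * expR (r * y ^+ 2) = 1.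
    by rewrite -expRD mulNr addNr expR0.
  have Cg y : 0 <= C * expR (- r * y ^+ 2) by rewrite mulr_ge0 ?expR_ge0// ltW.
  have mCg : measurable_fun setT (fun y : R => C * expR (- r * y ^+ 2)) by exact: measurable_funM.
  have := density_cancel mg (fun y => expR_ge0 _) mCg Cg mh h0 E.
  under eq_integral do rewrite /h mulrA e mul1r.
  rewrite integral_indic// setIT => ->.
  under eq_integral do rewrite /h -mulrA (mulrA (expR _)) e mul1r EFinM.
  rewrite ge0_integralZl//; last by rewrite lee_fin ltW.
    by rewrite integral_indic// setIT.
  by apply/measurable_EFinP; exact: measurable_indic.
have C1 : C = 1.
  have := KE setT measurableT; rewrite !probability_setT mule1 => /eqP.
  by rewrite eqe => /eqP.
by move=> A mA; rewrite KE// C1 mul1e.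
Qed.

(** On two points every indicator coincides with an affine function, whose integral is determined by
    the mean. *)
Lemma two_point_law (k0 k1 : probability R R) (y1 y2 : R) : y1 != y2 ->
  k0.-integrable setT (EFin \o id) -> k1.-integrable setT (EFin \o id) ->
  \int[k0]_y y = \int[k1]_y y ->
  {ae k0, forall y, y = y1 \/ y = y2} -> {ae k1, forall y, y = y1 \/ y = y2} ->
  forall A, measurable A -> k0 A = k1 A.
Proof.
move=> y12 i0 i1 m01 a0 a1 A mA.
have y0 : y1 - y2 != 0 by rewrite subr_eq0.
pose s := (\1_A y1 - \1_A y2) / (y1 - y2).
pose c := \1_A y1 - s * y1.
have E (k : probability R R) : k.-integrable setT (EFin \o id) ->
   {ae k, forall y, y = y1 \/ y = y2} -> k A = (s * \int[k]_y y + c)%:E.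
  move=> ik ak.
  have isk : k.-integrable setT (EFin \o (fun y => s * y)).
    by have := integrableZl measurableT s ik; apply: eq_integrable.
  have ic : k.-integrable setT (EFin \o (fun=> c)) by exact: finite_measure_integrable_cst.
  rewrite -(Rintegral_prob_cst k c) -RintegralZl// -RintegralD// fineK; last first.
    apply: integrable_fin_num => //.
    by have := integrableD measurableT isk ic; apply: eq_integrable.
  transitivity (\int[k]_y (\1_A y)%:E)%E; first by rewrite integral_indic// setIT.
  apply: ae_eq_integral => //.
  - by apply/measurable_EFinP; exact: measurable_indic.
  - by apply/measurable_EFinP; apply: measurable_funD => //; exact: measurable_funM.
  - apply: filterS ak => y [->|->] _ /=; congr EFin; rewrite /c /s.
      by rewrite addrC subrK.
    by field.
by rewrite (E _ i0 a0) (E _ i1 a1) m01.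
Qed.

(** Two distinct points are returned in all cases, with arbitrary ones filling in for missing or
    double roots, to fit [two_point_law]. *)
Lemma quadratic_roots (a b c : R) : a != 0 ->
  exists y1 y2, y1 != y2 /\ forall y, a * y ^+ 2 + b * y + c = 0 -> y = y1 \/ y = y2.
Proof.
move=> a0; have [[y1 e1]|no] := pselect (exists y, a * y ^+ 2 + b * y + c = 0); last first.
  by exists 0, 1; split; [rewrite eq_sym oner_neq0|move=> y e; case: no; exists y].
pose z := - b / a - y1.
have F y : a * y ^+ 2 + b * y + c = 0 -> y = y1 \/ y = z.
  move=> e; have : a * ((y - y1) * (y - z)) = 0.
    have -> : a * ((y - y1) * (y - z)) = (a * y ^+ 2 + b * y + c) - (a * y1 ^+ 2 + b * y1 + c).
      by rewrite /z; field.
    by rewrite e e1 subrr.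
  move/eqP; rewrite !mulf_eq0 (negbTE a0)/= !subr_eq0 => /orP[/eqP|/eqP]; by [left|right].
have [zy|zy] := eqVneq y1 z; last by exists y1, z.
exists y1, (y1 + 1); split; first by rewrite -subr_eq0 opprD addNKr oppr_eq0 oner_neq0.
by move=> y /F [->|->]; left.
Qed.

(** Both sides are Laplace transforms of measures with densities [exp (c y - r2 y^2)] and
    [C exp (- r1 y^2)] against the same [k]. Injectivity equates the densities almost everywhere,
    and logarithms give the quadratic equation. *)
Lemma tilted_proportional (k : probability R R) (r1 r2 c C u v : R) : u < v ->
  0 < r1 -> 0 < r2 -> 0 < C ->
  (forall t, u < t < v -> tmom k r2 0 (t + c) = C * tmom k r1 0 t) ->
  {ae k, forall y, (r1 - r2) * y ^+ 2 + c * y - ln C = 0}.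
Proof.
move=> uv r10 r20 C0 h.
pose g y := expR (c * y) * expR (- r2 * y ^+ 2).
have mexp : measurable_fun setT (fun y : R => expR (c * y)).
  by apply: measurableT_comp; [exact: measurable_expR|exact: measurable_funM].
have mg : measurable_fun setT g by apply: measurable_funM => //; exact: measurable_gauss.
have T2 := tail_gauss k r20.
(* A tail rate valid for both densities: strictly below [r2] to absorb [exp (c y)], and at most
   [r1]. *)
pose a := Num.min (r2 / 2) r1.
have a0 : 0 < a by rewrite lt_min r10 divr_gt0.
have Tg : gauss_tail k g a.
  split => //; first by move=> y; rewrite mulr_ge0 ?expR_ge0.
  have ar : a < r2 by rewrite /a gt_min; apply/orP; left; lra.
  apply: (gauss_tail_integrable (n := 0) T2 (normr_ge0 c) ar).
    apply: measurable_funM => //; by have := measurable_gauss (- a); rewrite opprK.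
  move=> y; rewrite expr0 mul1r ger0_norm ?mulr_ge0 ?expR_ge0//.
  rewrite mulrA ler_wpM2r ?expR_ge0// -expRD ler_expR addrC lerD2r -normrM.
  exact: ler_norm.
have T1 : gauss_tail k (fun y => C * expR (- r1 * y ^+ 2)) a.
  have [_ m1 p1 i1] := tail_gauss_scale k r10 (ltW C0); split => //.
  apply: (integrable_dom _ i1).
    apply: measurable_funM => //; by have := measurable_gauss (- a); rewrite opprK.
  move=> y; rewrite ger0_norm ?mulr_ge0 ?expR_ge0 ?(ltW C0)//.
  rewrite ler_wpM2r// ler_expR ler_wpM2r ?sqr_ge0// /a ge_min lexx orbT//.
have E : forall A, measurable A -> (\int[k]_(y in A) (g y)%:E = \int[k]_(y in A) (C * expR (- r1 * y ^+ 2))%:E)%E.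
  apply: (laplace_injective uv Tg T1) => t tuv.
  have := h t tuv; rewrite /tmom /wmom => e.
  transitivity (C * \int[k]_y (y ^+ 0 * expR (t * y) * expR (- r1 * y ^+ 2))).
    rewrite -e; apply: eq_Rintegral => y _; rewrite /g mulrDl expRD; ring.
  rewrite -RintegralZl//; last exact: wmom_integrable (tail_gauss k r10).
  by apply: eq_Rintegral => y _; ring.
have ig : k.-integrable setT (EFin \o g).
  apply: (gauss_tail_integrable (n := 0) Tg (lexx 0) a0) => // y.
  by rewrite expr0 mul1r !mul0r addr0 expR0 mul1r ger0_norm// mulr_ge0 ?expR_ge0.
have m1 : measurable_fun setT (EFin \o (fun y => C * expR (- r1 * y ^+ 2))).
  by apply/measurable_EFinP; apply: measurable_funM => //; exact: measurable_gauss.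
have := integral_ae_eq measurableT ig m1 (fun A _ mA => E A mA).
apply: filterS => y /(_ Logic.I) [] e.
have lnC : expR (ln C) = C by rewrite lnK ?posrE.
have : expR (c * y + - r2 * y ^+ 2) = expR (ln C + - r1 * y ^+ 2) by rewrite !expRD lnC.
move/expR_inj; lra.
Qed.

End tilted_moments.

Lemma ratio_lip {R : realFieldType} (a b a' b' C0 C1 U0 U1 z e : R) :
  0 <= U0 -> 0 <= U1 -> 0 <= C0 -> 0 <= C1 -> 0 < z -> 0 <= e -> z <= b -> z <= b' ->
  `|a - a'| <= C1 * e -> `|b - b'| <= C0 * e -> `|a'| <= U1 -> `|b'| <= U0 ->
  `|a / b - a' / b'| <= (C1 * U0 + U1 * C0 + 1) / z ^+ 2 * e.
Proof.
move=> U00 U10 C00 C10 z0 e0 zb zb' ha hb hU1 hU0.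
have b0 : 0 < b := lt_le_trans z0 zb; have b0' : 0 < b' := lt_le_trans z0 zb'.
have -> : a / b - a' / b' = ((a - a') * b' - a' * (b - b')) / (b * b').
  by field; rewrite !gt_eqF.
rewrite normrM normfV (gtr0_norm (mulr_gt0 b0 b0')) ler_pdivrMr ?mulr_gt0//.
have K0 : 0 <= (C1 * U0 + U1 * C0 + 1) * e by rewrite mulr_ge0// addr_ge0// addr_ge0// mulr_ge0.
apply: (@le_trans _ _ ((C1 * U0 + U1 * C0 + 1) * e)); last first.
  set K := (_ + 1) in K0 *.
  have -> : K / z ^+ 2 * e * (b * b') = (K * e) * ((b * b') / z ^+ 2) by field; rewrite gt_eqF.
  rewrite ler_peMr// ler_pdivlMr ?exprn_gt0// mul1r expr2.
  exact: (ler_pM (ltW z0) (ltW z0) zb zb').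
apply: le_trans (ler_normB _ _) _; rewrite !normrM.
have e1 : `|a - a'| * `|b'| <= (C1 * e) * U0 by apply: ler_pM.
have e2 : `|a'| * `|b - b'| <= U1 * (C0 * e) by apply: ler_pM.
by lra.
Qed.

(** * Bounds on tilted moments, uniform in tilt and rate *)

Section tilted_bounds.
Context {R : realType} (k : probability R R).
Variables (A rm rp : R).
Hypothesis A0 : 0 <= A.
Hypothesis rm0 : 0 < rm.
Hypothesis rmp : rm <= rp.

Let reg (t r : R) := `|t| <= A /\ rm <= r <= rp.

Lemma expR_dist (a b c : R) : a <= c -> b <= c -> `|expR a - expR b| <= `|a - b| * expR c.
Proof.
wlog ab : a b / a <= b.
  by move=> h ac bc; case: (leP a b) => [/h->//|/ltW /h]; rewrite distrC [`|b - a|]distrC => ->.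
move=> _ bc; rewrite ler0_norm ?subr_le0 ?ler_expR// ler0_norm ?subr_le0// !opprB.
apply: (@le_trans _ _ ((b - a) * expR b)); last by rewrite ler_wpM2l ?subr_ge0// ler_expR.
have := expR_ge1Dx (a - b); rewrite expRB => h.
have e0 := expR_gt0 b.
have : (1 + (a - b)) * expR b <= expR a.
  by rewrite -ler_pdivlMr.
lra.
Qed.

Let maj (y : R) := expR (A * `|y|) * expR (- rm * y ^+ 2).

Lemma maj_integrable n : k.-integrable setT (EFin \o (fun y => `|y| ^+ n * maj y)).
Proof.
have mabs : measurable_fun setT (fun y : R => `|y|) by exact: measurableT_comp.
apply: (gauss_tail_integrable (n := n) (tail_gauss k rm0) A0 rm0).
  apply: measurable_funM; first exact: measurable_funX.
  apply: measurable_funM; last exact: measurable_gauss.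
  by apply: measurableT_comp; [exact: measurable_expR|exact: measurable_funM].
move=> y; rewrite mul0r addr0 /maj ger0_norm ?mulrA//.
Qed.

Let tint r n t : 0 < r -> k.-integrable setT (EFin \o (fun y => y ^+ n * expR (t * y) * expR (- r * y ^+ 2))).
Proof. by move=> r0; exact: wmom_integrable (tail_gauss k r0). Qed.

(** All exponents [t y - r y^2] of the region lie below [A |y| - rm y^2], so a difference of
    exponentials is at most the difference of exponents times one integrable function. *)
Lemma tmom_lip n : exists2 C, 0 <= C & forall t r t' r', reg t r -> reg t' r' ->
  `|tmom k r n t - tmom k r' n t'| <= C * (`|t - t'| + `|r - r'|).
Proof.
pose M y := `|y| ^+ n.+1 * maj y + `|y| ^+ n.+2 * maj y.
have iM : k.-integrable setT (EFin \o M).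
  by have := integrableD measurableT (maj_integrable n.+1) (maj_integrable n.+2); apply: eq_integrable.
have M0 y : 0 <= M y.
  by rewrite addr_ge0// mulr_ge0 ?exprn_ge0// mulr_ge0 ?expR_ge0.
exists (\int[k]_y M y); first by apply: Rintegral_ge0.
move=> t r t' r' [tA /andP[r1 r2]] [tA' /andP[r1' r2']].
have r0 : 0 < r := lt_le_trans rm0 r1.
have r0' : 0 < r' := lt_le_trans rm0 r1'.
have it := tint n t r0; have it' := tint n t' r0'.
rewrite /tmom /wmom -RintegralB//.
pose f y := y ^+ n * expR (t * y) * expR (- r * y ^+ 2) - y ^+ n * expR (t' * y) * expR (- r' * y ^+ 2).
have idf : k.-integrable setT (EFin \o f).
  by have := integrableB measurableT it it'; apply: eq_integrable.
apply: le_trans (le_normr_Rintegral measurableT idf) _.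
set d := `|t - t'| + `|r - r'|.
have d0 : 0 <= d by rewrite addr_ge0.
rewrite mulrC -RintegralZl//.
apply: le_Rintegral => //; first exact: integrable_abse idf.
  by have := integrableZl measurableT d iM; apply: eq_integrable.
move=> y _; rewrite /f -!mulrA -mulrBr -!expRD normrM normrX.
have aux (s q : R) : `|s| <= A -> rm <= q -> s * y + - q * y ^+ 2 <= A * `|y| + - rm * y ^+ 2.
  move=> sA rq; apply: lerD.
    by rewrite (le_trans (ler_norm _))// normrM ler_wpM2r.
  by rewrite ler_wpM2r ?sqr_ge0// lerN2.
apply: (@le_trans _ _ (`|y| ^+ n * ((d * (`|y| + `|y| ^+ 2)) * maj y))); last first.
  by rewrite /M !exprS -!mulrA; set z := `|y|; set w := z ^+ n; lra.
rewrite ler_wpM2l ?exprn_ge0//.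
apply: le_trans (expR_dist (aux _ _ tA r1) (aux _ _ tA' r1')) _.
rewrite /maj -expRD ler_wpM2r ?expR_ge0//.
have -> : t * y + - r * y ^+ 2 - (t' * y + - r' * y ^+ 2) = (t - t') * y - (r - r') * y ^+ 2 by ring.
apply: le_trans (ler_normB _ _) _; rewrite [`|_ * y|]normrM [`|_ * y ^+ 2|]normrM normrX /d.
set z := `|y|; have := normr_ge0 (t - t'); have := normr_ge0 (r - r'); have z0 : 0 <= z by exact: normr_ge0.
by move=> h1 h2; rewrite mulrDr !mulrDl; have := mulr_ge0 h1 z0; have := mulr_ge0 h2 (sqr_ge0 z); lra.
Qed.

Lemma tmom0_lb : exists2 z, 0 < z & forall t r, reg t r -> z <= tmom k r 0 t.
Proof.
pose f (y : R) := expR (- A * `|y|) * expR (- rp * y ^+ 2).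
have rp0 : 0 < rp := lt_le_trans rm0 rmp.
have mabs : measurable_fun setT (fun y : R => `|y|) by exact: measurableT_comp.
have mf : measurable_fun setT f.
  apply: measurable_funM; last exact: measurable_gauss.
  by apply: measurableT_comp; [exact: measurable_expR|exact: measurable_funM].
have fi : k.-integrable setT (EFin \o f).
  apply: (gauss_tail_integrable (n := 0) (tail_gauss k rp0) (lexx 0) rp0) => // y.
  rewrite expr0 mul1r !mul0r addr0 expR0 mul1r ger0_norm ?mulr_ge0 ?expR_ge0//.
  by rewrite ler_piMl ?expR_ge0// expR_le1 mulNr oppr_le0 mulr_ge0.
exists (\int[k]_y f y); first by apply: Rintegral_gt0 => // y; rewrite mulr_gt0 ?expR_gt0.
move=> t r [tA /andP[r1 r2]]; have r0 : 0 < r := lt_le_trans rm0 r1.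
apply: le_Rintegral => //; first exact: tint.
move=> y _; rewrite expr0 mul1r /f -!expRD ler_expR; apply: lerD.
  rewrite mulNr lerNl -mulNr (le_trans (ler_norm _))// normrM normrN ler_wpM2r//.
by rewrite ler_wpM2r ?sqr_ge0// lerN2.
Qed.

Let reg0 : reg 0 rm. Proof. by rewrite /reg normr0 lexx. Qed.

Lemma tmom_ub n : exists2 C, 0 < C & forall t r, reg t r -> `|tmom k r n t| <= C.
Proof.
have [C C0 hC] := tmom_lip n.
have D0 : 0 <= C * (A + (rp - rm)) by rewrite mulr_ge0// addr_ge0// subr_ge0.
exists (`|tmom k rm n 0| + C * (A + (rp - rm)) + 1); first by rewrite ltr_wpDl ?addr_ge0.
move=> t r tr; have := hC _ _ _ _ tr reg0; have [tA /andP[r1 r2]] := tr.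
rewrite subr0 (ger0_norm (_ : 0 <= r - rm)) ?subr_ge0// => h.
have h1 : C * (`|t| + (r - rm)) <= C * (A + (rp - rm)) by rewrite ler_wpM2l// lerD// lerB.
have := ler_normD (tmom k r n t - tmom k rm n 0) (tmom k rm n 0); rewrite subrK => h2.
apply: le_trans h2 _; rewrite addrC -addrA lerD2l; apply: le_trans h _; apply: le_trans h1 _.
by rewrite lerDl.
Qed.

Lemma tmean_lip : exists2 L, 0 < L & forall t r t' r', reg t r -> reg t' r' ->
  `|tmean k r t - tmean k r' t'| <= L * (`|t - t'| + `|r - r'|).
Proof.
have [C0 C00 h0] := tmom_lip 0; have [C1 C10 h1] := tmom_lip 1.
have [z z0 hz] := tmom0_lb; have [U1 U10 hU1] := tmom_ub 1; have [U0 U00 hU0] := tmom_ub 0.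
exists ((C1 * U0 + U1 * C0 + 1) / z ^+ 2).
  by rewrite divr_gt0 ?exprn_gt0// ltr_wpDl// addr_ge0 ?mulr_ge0 ?(ltW U00) ?(ltW U10).
move=> t r t' r' tr tr'.
exact: (ratio_lip (ltW U00) (ltW U10) C00 C10 z0 (addr_ge0 (normr_ge0 _) (normr_ge0 _))
  (hz _ _ tr) (hz _ _ tr') (h1 _ _ _ _ tr tr') (h0 _ _ _ _ tr tr') (hU1 _ _ tr') (hU0 _ _ tr')).
Qed.

Lemma is_derive_tmean r (t : R) : 0 < r ->
  is_derive t 1 (tmean k r) ((tmom k r 2 t * tmom k r 0 t - tmom k r 1 t ^+ 2) / tmom k r 0 t ^+ 2).
Proof.
move=> r0; have z0 := tmom0_gt0 k t r0.
have d0 := is_derive_tmom k 0 t r0; have d1 := is_derive_tmom k 1 t r0.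
have z0' : tmom k r 0 t != 0 by rewrite gt_eqF.
have dV := is_deriveV z0' d0.
apply: (@is_derive_eq _ _ _ _ _ _ _ _ (is_deriveM d1 dV)).
by rewrite /GRing.scale/=; field.
Qed.

Hypothesis nd : forall c, ~ {ae k, forall y, y = c}.

(** The quotient is the derivative of the tilted mean, that is the tilted variance. All weights of
    the region dominate [w], and the integral of [(y - c)^2 w] is least at the mean [c0] of [w],
    where it is positive because [k] is not a point mass. *)
Lemma tvar_lb : exists2 D, 0 < D & forall t r, reg t r ->
  D <= (tmom k r 2 t * tmom k r 0 t - tmom k r 1 t ^+ 2) / tmom k r 0 t ^+ 2.
Proof.
have rp0 : 0 < rp := lt_le_trans rm0 rmp.
pose w (y : R) := expR (- A * `|y|) * expR (- rp * y ^+ 2).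
have mabs : measurable_fun setT (fun y : R => `|y|) by exact: measurableT_comp.
have mw : measurable_fun setT w.
  apply: measurable_funM; last exact: measurable_gauss.
  by apply: measurableT_comp; [exact: measurable_expR|exact: measurable_funM].
have w0 y : 0 < w y by rewrite mulr_gt0 ?expR_gt0.
have iw n : k.-integrable setT (EFin \o (fun y => y ^+ n * w y)).
  apply: (gauss_tail_integrable (n := n) (tail_gauss k rp0) (lexx 0) rp0).
    by apply: measurable_funM => //; exact: measurable_funX.
  move=> y; rewrite !mul0r addr0 expR0 mulr1 normrM normrX ler_wpM2l ?exprn_ge0//.
  rewrite ger0_norm ?(ltW (w0 _))// /w.
  by rewrite ler_piMl ?expR_ge0// expR_le1 mulNr oppr_le0 mulr_ge0.
pose v n := \int[k]_y (y ^+ n * w y).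
have v00 : 0 < v 0%N.
  apply: Rintegral_gt0 => //; last by move=> y; rewrite expr0 mul1r.
  by apply: measurable_funM => //; exact: measurable_funX.
have sqE (c : R) (p : nat -> R) (f : R -> R) :
   (forall n, k.-integrable setT (EFin \o (fun y => y ^+ n * f y))) ->
   (forall n, p n = \int[k]_y (y ^+ n * f y)) ->
   k.-integrable setT (EFin \o (fun y => (y - c) ^+ 2 * f y)) /\
   \int[k]_y ((y - c) ^+ 2 * f y) = p 2%N - 2 * c * p 1%N + c ^+ 2 * p 0%N.
  move=> ifn pE.
  have iZ (a : R) n : k.-integrable setT (EFin \o (fun y => a * (y ^+ n * f y))).
    by have := integrableZl measurableT a (ifn n); apply: eq_integrable.
  have iB : k.-integrable setT (EFin \o (fun y => y ^+ 2 * f y - (2 * c) * (y ^+ 1 * f y))).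
    by have := integrableB measurableT (ifn 2%N) (iZ (2 * c) 1%N); apply: eq_integrable.
  have iD : k.-integrable setT (EFin \o (fun y => (y ^+ 2 * f y - (2 * c) * (y ^+ 1 * f y)) + c ^+ 2 * (y ^+ 0 * f y))).
    by have := integrableD measurableT iB (iZ (c ^+ 2) 0%N); apply: eq_integrable.
  have E y : (y - c) ^+ 2 * f y = (y ^+ 2 * f y - (2 * c) * (y ^+ 1 * f y)) + c ^+ 2 * (y ^+ 0 * f y).
    by rewrite expr1 expr0; ring.
  split; first by apply: eq_integrable iD => // y _; rewrite /= E.
  under eq_Rintegral do rewrite E.
  have Z (a : R) n : \int[k]_y (a * (y ^+ n * f y)) = a * p n by rewrite pE RintegralZl.
  by rewrite RintegralD// RintegralB// !Z -pE.
pose c0 := v 1%N / v 0%N.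
have Vpos : 0 < \int[k]_y ((y - c0) ^+ 2 * w y).
  have [ii _] := sqE c0 v w iw (fun=> erefl).
  rewrite lt_neqAle Rintegral_ge0 ?andbT; last by move=> y _; rewrite mulr_ge0 ?sqr_ge0// ltW.
  apply/negP => /eqP /esym V0; suff : {ae k, forall y, y = c0} by exact: nd.
  have ff := integrable_fin_num measurableT ii.
  have V0' : (\int[k]_y ((y - c0) ^+ 2 * w y)%:E = 0)%E := etrans (esym (fineK ff)) (congr1 EFin V0).
  have h0 y : (0 <= ((y - c0) ^+ 2 * w y)%:E)%E by rewrite lee_fin mulr_ge0 ?sqr_ge0// ltW.
  have := ge0_integral_eq0_ae (measurable_int _ ii) h0 V0'.
  apply: filterS => y [] /eqP; rewrite mulf_eq0 (gt_eqF (w0 y)) orbF sqrf_eq0 subr_eq0.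
  by move/eqP.
have vmin c : \int[k]_y ((y - c0) ^+ 2 * w y) <= \int[k]_y ((y - c) ^+ 2 * w y).
  rewrite (sqE c0 v w iw (fun=> erefl)).2 (sqE c v w iw (fun=> erefl)).2.
  have : 0 <= v 0%N * (c - c0) ^+ 2 by rewrite mulr_ge0 ?sqr_ge0// ltW.
  have : v 1%N = c0 * v 0%N by rewrite /c0 divfK// gt_eqF.
  move=> -> h; nra.
have [U U0 hU] := tmom_ub 0.
exists ((\int[k]_y ((y - c0) ^+ 2 * w y)) / U); first by rewrite divr_gt0.
move=> t r tr; have [tA /andP[r1 r2]] := tr; have r0 : 0 < r := lt_le_trans rm0 r1.
have z0 := tmom0_gt0 k t r0; have zU : tmom k r 0 t <= U by rewrite (le_trans (ler_norm _))// hU.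
set c := tmom k r 1 t / tmom k r 0 t.
pose f y := expR (t * y) * expR (- r * y ^+ 2).
have if' n : k.-integrable setT (EFin \o (fun y => y ^+ n * f y)).
  by apply: eq_integrable (tint n t r0) => // y _; rewrite /= /f mulrA.
have pE n : tmom k r n t = \int[k]_y (y ^+ n * f y).
  by apply: eq_Rintegral => y _; rewrite /f mulrA.
have [isq sq] := sqE c (fun n => tmom k r n t) f if' pE.
have -> : (tmom k r 2 t * tmom k r 0 t - tmom k r 1 t ^+ 2) / tmom k r 0 t ^+ 2 =
   (\int[k]_y ((y - c) ^+ 2 * f y)) / tmom k r 0 t.
  by rewrite sq /c; field; rewrite gt_eqF.
have V1 : \int[k]_y ((y - c0) ^+ 2 * w y) <= \int[k]_y ((y - c) ^+ 2 * f y).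
  apply: le_trans (vmin c) _; apply: le_Rintegral => //.
    by have [] := sqE c v w iw (fun=> erefl).
  move=> y _; rewrite ler_wpM2l ?sqr_ge0// /w /f -!expRD ler_expR; apply: lerD.
    by rewrite mulNr lerNl -mulNr (le_trans (ler_norm _))// normrM normrN ler_wpM2r.
  by rewrite ler_wpM2r ?sqr_ge0// lerN2.
have iU : U^-1 <= (tmom k r 0 t)^-1 by rewrite lef_pV2 ?posrE.
have iU0 : 0 <= U^-1 by rewrite invr_ge0 ltW.
exact: ler_pM (ltW Vpos) iU0 V1 iU.
Qed.

Lemma tmean_incr : exists2 D, 0 < D & forall t t' r, reg t r -> reg t' r -> t <= t' ->
  D * (t' - t) <= tmean k r t' - tmean k r t.
Proof.
have [D D0 hD] := tvar_lb; exists D => // t t' r tr tr' tt'.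
have [tA /andP[r1 r2]] := tr; have [tA' _] := tr'; have r0 : 0 < r := lt_le_trans rm0 r1.
have dm s := is_derive_tmean s r0.
have [x|c + ->] := MVT_segment tt' (fun s _ => dm s).
  by apply: derivable_within_continuous => s _; have [] := dm s.
rewrite in_itv/= => /andP[tc ct]; rewrite ler_wpM2r ?subr_ge0//; apply: hD.
split; last by rewrite r1.
by move: tA tA'; rewrite !ler_norml => /andP[? ?] /andP[? ?]; apply/andP; split; lra.
Qed.

End tilted_bounds.

(** * Singular clocks *)

Section lipschitz_segment.
Context {R : realType}.

Lemma lip_within_continuous (f : R -> R) (a b L : R) :
  (forall u v, a <= u <= b -> a <= v <= b -> `|f u - f v| <= L * `|u - v|) ->
  {within `[a, b], continuous f}.
Proof.
move=> fL; have [ab|ba] := leP a b; last first.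
  by rewrite set_itv_ge ?bnd_simp -?ltNge//; apply: continuous_subspace0.
have L0 : forall u v, a <= u <= b -> a <= v <= b -> `|f u - f v| <= `|L| * `|u - v|.
  by move=> u v hu hv; apply: le_trans (fL _ _ hu hv) _; rewrite ler_wpM2r// ler_norm.
have cg : continuous (fun t => f (clamp a b t)).
  apply: (@lip_continuous _ _ `|L|) => s t.
  apply: le_trans (L0 _ _ (clamp_itv _ ab) (clamp_itv _ ab)) _.
  by rewrite ler_wpM2l// clamp_lip.
apply: (@subspace_eq_continuous _ _ _ (fun t => f (clamp a b t))); last first.
  by move=> x; apply: continuous_subspaceT.
by move=> x; rewrite inE/= in_itv/= => xab; rewrite /from_subspace/= clamp_id.
Qed.

End lipschitz_segment.

(** * Transport along level sets of the tilted mean *)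

Section clock_transport.
Context {R : realType} (I : Type).
Local Notation lambda := (@lebesgue_measure R).
Variables (mh : R -> R -> R) (m : I -> R -> R -> R) (s b rho : R -> R).
Variables (t0 e0 th rm rp L D : R).
Hypothesis e00 : 0 < e0.
Hypothesis L0 : 0 < L.
Hypothesis D0 : 0 < D.

Let reg (t r : R) := `|t - th| <= 1 /\ rm <= r <= rp.

Hypothesis mh_lip : forall t r t' r', reg t r -> reg t' r' ->
  `|mh r t - mh r' t'| <= L * (`|t - t'| + `|r - r'|).
Hypothesis m_lip : forall i t r t' r', reg t r -> reg t' r' ->
  `|m i r t - m i r' t'| <= L * (`|t - t'| + `|r - r'|).
Hypothesis mh_incr : forall t t' r, reg t r -> reg t' r -> t <= t' ->
  D * (t' - t) <= mh r t' - mh r t.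
Hypothesis s0 : 0 < s t0.
Hypothesis cs : {for t0, continuous s}.
Hypothesis cb : {for t0, continuous b}.
Hypothesis crho : {for t0, continuous rho}.
Hypothesis rho0 : rm < rho t0 < rp.
Hypothesis drho : {ae lambda, forall t, `|t - t0| < e0 -> is_derive t 1 rho 0}.
Hypothesis reg_lip : forall x, exists eta C, [/\ 0 < eta, 0 <= C,
  forall t t' y, `|t - t0| < eta -> `|t' - t0| < eta -> `|y - x| < eta ->
    `|mh (rho t) (s t * y - b t) - mh (rho t') (s t' * y - b t')| <= C * `|t - t'| &
  forall i t t' y, `|t - t0| < eta -> `|t' - t0| < eta -> `|y - x| < eta ->
    `|m i (rho t) (s t * y - b t) - m i (rho t') (s t' * y - b t')| <= C * `|t - t'|].

Let mh_dist t t' r : reg t r -> reg t' r -> D * `|t - t'| <= `|mh r t - mh r t'|.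
Proof.
move=> h h'; wlog tt' : t t' h h' / t <= t'.
  by move=> w; case: (leP t t') => [/w->//|/ltW /w]; rewrite distrC [`|_ - mh _ _|]distrC => ->.
rewrite distrC [`|_ - mh _ _|]distrC ger0_norm ?subr_ge0//.
by apply: le_trans (ler_norm _); exact: mh_incr.
Qed.

(* Follow the level set of [mh] through a point as [t] moves. Along it [m i] is
   Lipschitz in [t] by regularity, and moves at most as much as [rho], which has
   derivative 0 almost everywhere; hence [m i] is constant along it. *)
Lemma clock_transport : exists e sg : R, [/\ 0 < e, 0 < sg <= 1 &
  forall t1, `|t1 - t0| < e ->
  [/\ rm <= rho t1 <= rp,
      forall y, `|y - mh (rho t0) th| <= D * sg / 2 ->
        exists2 u, `|u - th| <= sg & mh (rho t1) u = y &
      forall u0 u1, `|u0 - th| <= sg -> `|u1 - th| <= sg ->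
        mh (rho t0) u0 = mh (rho t1) u1 ->
        `|mh (rho t0) u0 - mh (rho t0) th| <= D * sg / 2 ->
        forall i, m i (rho t0) u0 = m i (rho t1) u1]].
Proof.
have s0' := s0; have rho0' := rho0.
set s1 := s t0 in s0' *; set b1 := b t0; set r1 := rho t0 in rho0' *.
(* The observation whose tilt at time [t0] is [th]. *)
pose x0 := (th + b1) / s1.
have [eta [C [eta0 C0 lip_h lip_m]]] := reg_lip x0.
pose eta' := Num.min eta (1 / (4 * s1)).
have eta'0 : 0 < eta' by rewrite lt_min eta0/= divr_gt0// mulr_gt0.
have eta's : s1 * eta' <= 1 / 4.
  have : eta' <= 1 / (4 * s1) by rewrite ge_min lexx orbT.
  rewrite ler_pdivlMr ?mulr_gt0//; lra.
have eta'e : eta' <= eta by rewrite ge_min lexx.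
(* With this radius, tilts within [sg] of [th] come from observations within [eta' / 2] of [x0] at
   every time near [t0], and the same observation has at every such time a tilt within 1 of [th],
   where the bounds hold. *)
pose sg := s1 * eta' / 8.
have sg0 : 0 < sg by rewrite divr_gt0// mulr_gt0.
have sg1 : sg <= 1 / 32 by rewrite /sg; lra.
have sg_le1 : sg <= 1 by apply: le_trans sg1 _; lra.
have s10 : 0 < s1 / 2 by rewrite divr_gt0.
have eta'2 : eta' / 2 < eta' by rewrite ltr_pdivrMr// ltr_pMr// ltr1n.
have sg_small : 2 * s1 * (eta' / 2) + sg <= 1 by rewrite /sg; lra.
have x0E : s1 * x0 - b1 = th by rewrite /x0 mulrC divfK ?gt_eqF// addrK.
have sgE : sg + sg = s1 / 2 * (eta' / 2) by rewrite /sg; field.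
clearbody sg eta' x0.
(* Keeps [rho] between [rm] and [rp], and the change of [mh] at [th] below [D * sg / 2]. *)
pose rr := Num.min (Num.min (r1 - rm) (rp - r1)) (D * sg / (2 * L)).
have [rm1 r1p] := andP rho0'.
have rr0 : 0 < rr by rewrite !lt_min !subr_gt0 rm1 r1p divr_gt0 ?mulr_gt0.
have [e e_gt0 eP] : exists2 e : R, 0 < e & forall t, `|t - t0| < e ->
   [/\ `|t - t0| < e0, `|t - t0| < eta, s1 / 2 <= s t <= 2 * s1, `|s t * x0 - b t - th| <= sg
     & `|rho t - r1| <= rr].
  have h1 : \forall t \near t0, `|t - t0| < e0.
    by near=> t; rewrite distrC; near: t; exact: (@cvgr_dist_lt _ _ _ _ _ id).
  have h2 : \forall t \near t0, `|t - t0| < eta.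
    by near=> t; rewrite distrC; near: t; exact: (@cvgr_dist_lt _ _ _ _ _ id).
  have s12 : 0 < s1 / 2 by rewrite divr_gt0.
  have h3 : \forall t \near t0, `|s1 - s t| <= s1 / 2.
    by have /cvgrPdist_le/(_ _ s12) := cs.
  have h4 : \forall t \near t0, `|th - (s t * x0 - b t)| <= sg.
    have c4 : (fun t => s t * x0 - b t) t @[t --> t0] --> s1 * x0 - b1.
      by apply: cvgB; [apply: cvgM; [exact: cs|exact: cvg_cst]|exact: cb].
    by have /cvgrPdist_le/(_ _ sg0) := c4; rewrite x0E.
  have h5 : \forall t \near t0, `|r1 - rho t| <= rr by have /cvgrPdist_le/(_ _ rr0) := crho.
  have : \forall t \near t0, [/\ `|t - t0| < e0, `|t - t0| < eta, s1 / 2 <= s t <= 2 * s1,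
      `|s t * x0 - b t - th| <= sg & `|rho t - r1| <= rr].
    near=> t; split.
    - by near: t.
    - by near: t.
    - have : `|s1 - s t| <= s1 / 2 by near: t.
      exact: half_ball.
    - by rewrite distrC; near: t.
    - by rewrite distrC; near: t.
  move=> [e /= e_gt0 eP]; exists e => // t te; apply: eP.
  by rewrite /ball/= distrC.
have regr t : `|t - t0| < e -> rm <= rho t <= rp.
  move=> /eP[_ _ _ _ h].
  have h1 : rr <= r1 - rm by rewrite !ge_min lexx.
  have h2 : rr <= rp - r1 by rewrite !ge_min lexx orbT.
  exact: ball_itv h1 h2 h.
have regu t u : `|t - t0| < e -> `|u - th| <= sg -> reg u (rho t).
  by move=> te ut; split; [exact: le_trans ut sg_le1|exact: regr].
have rr_D t : `|t - t0| < e -> L * `|rho t - r1| <= D * sg / 2.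
  move=> /eP[_ _ _ _ h].
  have -> : D * sg / 2 = L * (D * sg / (2 * L)) by field; rewrite gt_eqF.
  by rewrite ler_wpM2l ?(ltW L0)// (le_trans h)// ge_min lexx orbT.
have t0e : `|t0 - t0| < e by rewrite subrr normr0.
have thth : `|th - th| <= sg by rewrite subrr normr0 ltW.
(* From [th] to [th + sg] or down to [th - sg], [mh (rho t)] changes by at least [D * sg], while its
   value at [th] has moved by at most half of that since [t0]. The intermediate value theorem
   therefore reaches every [y] within the other half. *)
have ex t y : `|t - t0| < e -> `|y - mh r1 th| <= D * sg / 2 ->
    exists2 u, `|u - th| <= sg & mh (rho t) u = y.
  move=> te hy.
  have hth := mh_lip (regu _ _ te thth) (regu _ _ t0e thth).
  rewrite subrr normr0 add0r -/r1 in hth.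
  have h := le_trans hth (rr_D t te).
  have up : `|th + sg - th| <= sg by rewrite addrC addKr ger0_norm// ltW.
  have um : `|th - sg - th| <= sg by rewrite addrC addKr normrN ger0_norm// ltW.
  have ru := regu _ _ te up; have rmi := regu _ _ te um; have rt := regu _ _ te thth.
  have i1 : D * sg <= mh (rho t) (th + sg) - mh (rho t) th.
    have -> : D * sg = D * (th + sg - th) by congr (_ * _); ring.
    by apply: mh_incr => //; rewrite lerDl ltW.
  have i2 : D * sg <= mh (rho t) th - mh (rho t) (th - sg).
    have -> : D * sg = D * (th - (th - sg)) by congr (_ * _); ring.
    by apply: mh_incr => //; rewrite gerBl ltW.
  have ab : th - sg <= th + sg by rewrite lerBlDr -addrA lerDl addr_ge0 ?(ltW sg0).
  have cf : {within `[th - sg, th + sg], continuous (mh (rho t))}.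
    apply: (@lip_within_continuous _ (mh (rho t)) (th - sg) (th + sg) L) => u v.
    move=> hu hv; apply: le_trans (mh_lip (regu _ _ te _) (regu _ _ te _)) _.
    - by rewrite ler_distl.
    - by rewrite ler_distl.
    - by rewrite subrr normr0 addr0.
  have := IVT ab cf; move=> /(_ y) [].
    have Dsg : 0 <= D * sg by rewrite mulr_ge0 ?(ltW D0) ?(ltW sg0).
    have [mm my] := itv_of_increments Dsg i1 i2 h hy.
    by rewrite min_l// max_r.
  move=> u; rewrite in_itv/= => hu uy; exists u => //.
  by rewrite ler_distl.
(* Comparison at equal level: a change of [rho] displaces the point of the level set by at most
   [L / D] times that change. *)
have regB t t' u u' : `|t - t0| < e -> `|t' - t0| < e -> `|u - th| <= sg -> `|u' - th| <= sg ->
    mh (rho t) u = mh (rho t') u' -> forall i,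
    `|m i (rho t) u - m i (rho t') u'| <= (L * (L / D + 1)) * `|rho t - rho t'|.
  move=> te te' ut ut' E i.
  have h1 := mh_dist (regu _ _ te' ut) (regu _ _ te' ut').
  rewrite -E in h1.
  have h2 := mh_lip (regu _ _ te' ut) (regu _ _ te ut).
  rewrite subrr normr0 add0r [`|rho t' - _|]distrC in h2.
  have h3 := m_lip i (regu _ _ te ut) (regu _ _ te' ut').
  have h4 : `|u - u'| <= L / D * `|rho t - rho t'|.
    rewrite mulrAC ler_pdivlMr// mulrC; exact: le_trans h1 h2.
  apply: le_trans h3 _; rewrite -mulrA ler_wpM2l ?(ltW L0)//.
  by rewrite [leRHS]mulrDl mul1r lerD2r.
(* Comparison through the same observation [x]: regularity bounds the change of both means by
   [C |t - t'|], and the growth of [mh] converts this into a bound on the displacement. *)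
have timeB t t' u u' : `|t - t0| < e -> `|t' - t0| < e -> `|u - th| <= sg -> `|u' - th| <= sg ->
    mh (rho t) u = mh (rho t') u' -> forall i,
    `|m i (rho t) u - m i (rho t') u'| <= (L * (C / D) + C) * `|t - t'|.
  move=> te te' ut ut' E i.
  have [_ t_eta /andP[st1 st2] xt _] := eP _ te.
  have [_ t_eta' /andP[st1' st2'] xt' _] := eP _ te'.
  have st0 : 0 < s t := lt_le_trans s10 st1.
  pose x := (u + b t) / s t.
  have uE : s t * x - b t = u by rewrite /x mulrC divfK ?gt_eqF// addrK.
  clearbody x.
  have xx : `|x - x0| <= eta' / 2.
    have e1 : s t * (x - x0) = (u - th) - (s t * x0 - b t - th).
      by rewrite mulrBr -{1}[s t * x](subrK (b t)) uE; ring.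
    have e2 : s t * `|x - x0| <= sg + sg.
      rewrite -[X in X * _](gtr0_norm st0) -normrM e1.
      by apply: le_trans (ler_normB _ _) _; apply: lerD.
    have e3 : s1 / 2 * `|x - x0| <= s1 / 2 * (eta' / 2).
      apply: (@le_trans _ _ (s t * `|x - x0|)); first by rewrite ler_wpM2r.
      by rewrite -sgE.
    by move: e3; rewrite ler_pM2l// divr_gt0.
  have x_eta : `|x - x0| < eta := le_lt_trans xx (lt_le_trans eta'2 eta'e).
  pose v := s t' * x - b t'.
  have vth : `|v - th| <= 1.
    have -> : v - th = s t' * (x - x0) + (s t' * x0 - b t' - th) by rewrite /v; ring.
    have st0' : 0 < s t' := lt_le_trans s10 st1'.
    apply: le_trans (ler_normD _ _) _; rewrite normrM (gtr0_norm st0').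
    apply: le_trans (lerD _ xt') sg_small.
    exact: ler_pM (ltW st0') (normr_ge0 _) st2' xx.
  have regv : reg v (rho t') by split => //; exact: regr.
  have h1 := lip_h _ _ _ t_eta t_eta' x_eta.
  have h2 := lip_m i _ _ _ t_eta t_eta' x_eta.
  rewrite uE -/v in h1 h2.
  have h3 := mh_dist regv (regu _ _ te' ut').
  rewrite -E distrC in h3; rewrite distrC in h1.
  have h4 : `|u' - v| <= C / D * `|t - t'|.
    rewrite mulrAC ler_pdivlMr// mulrC; exact: le_trans h3 h1.
  have h5 := m_lip i regv (regu _ _ te' ut').
  rewrite subrr normr0 addr0 in h5.
  have -> : m i (rho t) u - m i (rho t') u' = (m i (rho t) u - m i (rho t') v) + (m i (rho t') v - m i (rho t') u').
    by ring.
  apply: le_trans (ler_normD _ _) _; rewrite addrC mulrDl lerD//.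
  apply: le_trans h5 _; rewrite -mulrA ler_wpM2l ?(ltW L0)// distrC//.
exists e, sg; split => //; first by rewrite sg0.
move=> t1 t1e; split; [exact: regr|by move=> y; exact: ex|].
move=> u0 u1 hu0 hu1 E hy i.
pose y := mh r1 u0.
have /choice[U UP] : forall t, exists u, `|t - t0| < e -> `|u - th| <= sg /\ mh (rho t) u = y.
  move=> t; have [te|te] := pselect (`|t - t0| < e); last by exists 0.
  by have [u ? ?] := ex t y te hy; exists u.
pose Cm := Num.max (L * (L / D + 1)) (L * (C / D) + C).
pose f t := m i (rho t) (U t).
have fC t t' : `|t - t0| < e -> `|t' - t0| < e -> `|f t - f t'| <= Cm * `|t - t'| /\ `|f t - f t'| <= Cm * `|rho t - rho t'|.
  move=> te te'; have [h1 h2] := UP _ te; have [h1' h2'] := UP _ te'.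
  have EE : mh (rho t) (U t) = mh (rho t') (U t') by rewrite h2 h2'.
  split.
    by apply: le_trans (timeB _ _ _ _ te te' h1 h1' EE i) _; rewrite ler_wpM2r// le_max lexx orbT.
  by apply: le_trans (regB _ _ _ _ te te' h1 h1' EE i) _; rewrite ler_wpM2r// le_max lexx.
have fcst a c : a < c -> `|a - t0| < e -> `|c - t0| < e -> f a = f c.
  move=> ac ae ce.
  have sub t : a <= t <= c -> `|t - t0| < e.
    exact: open_ballU_itv ae ce.
  apply: (@lip_singular_cst R f rho a c Cm ac).
  - by move=> t t' /sub h /sub h'; have [] := fC _ _ h h'.
  - by move=> t t' /sub h /sub h'; have [] := fC _ _ h h'.
  - apply: ae_lebesgueS drho => t h /andP[h1 h2]; apply: h.
    by have [] := eP t; first by apply: sub; rewrite !ltW.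
have f01 : f t0 = f t1.
  case: (ltgtP t0 t1) => [h|h|->//]; [exact: fcst|by symmetry; exact: fcst].
have uniq t u : `|t - t0| < e -> `|u - th| <= sg -> mh (rho t) u = y -> m i (rho t) u = f t.
  move=> te hu uy; have [h1 h2] := UP _ te; rewrite /f; congr (m i (rho t) _).
  have := mh_dist (regu _ _ te hu) (regu _ _ te h1); rewrite uy h2 subrr normr0.
  by rewrite pmulr_rle0// normr_le0 subr_eq0 => /eqP.
by rewrite (uniq t0 u0)// (uniq t1 u1)// -E.
Unshelve. all: by end_near. Qed.

End clock_transport.

(** * Midpoints of probability measures *)

Section mixture.
Context d (T : measurableType d) {R : realType}.

Definition half_mixture (m0 m1 mh : probability T R) : Prop :=
  forall A, measurable A -> (mh A = 2^-1%:E * m0 A + 2^-1%:E * m1 A)%E.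

Variables (m0 m1 mh : probability T R).
Hypothesis hmix : half_mixture m0 m1 mh.

Lemma half_mixture_ge0_integral (f : T -> \bar R) : measurable_fun setT f ->
  (forall x, 0 <= f x)%E ->
  (\int[mh]_x f x = 2^-1%:E * \int[m0]_x f x + 2^-1%:E * \int[m1]_x f x)%E.
Proof.
move=> mf f0; have h20 : (0 : R) <= 2^-1 by rewrite invr_ge0.
pose c : {nonneg R} := NngNum h20.
rewrite (eq_measure_integral (measure_add (mscale c m0) (mscale c m1))); last first.
  move=> A mA _; apply: etrans (hmix mA) _.
  by symmetry; exact: (measure_addE (mscale c m0) (mscale c m1) A).
by rewrite ge0_integral_measure_add// !ge0_integral_mscale.
Qed.

Lemma half_mixture_integrable (f : T -> R) :
  m0.-integrable setT (EFin \o f) -> m1.-integrable setT (EFin \o f) ->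
  mh.-integrable setT (EFin \o f) /\
  \int[mh]_x f x = (\int[m0]_x f x + \int[m1]_x f x) / 2.
Proof.
move=> i0 i1; have mf := measurable_int _ i0.
have ih : mh.-integrable setT (EFin \o f).
  apply/integrableP; split => //.
  rewrite half_mixture_ge0_integral//; last exact: measurableT_comp.
  have /integrableP[_ b0] := i0; have /integrableP[_ b1] := i1.
  by rewrite lte_add_pinfty// lte_mul_pinfty.
split => //.
have e (m : probability T R) : m.-integrable setT (EFin \o f) ->
    \int[m]_x f x = fine (\int[m]_x (EFin \o f)^\+ x)%E - fine (\int[m]_x (EFin \o f)^\- x)%E.
  move=> im; rewrite /Rintegral integralE fineB//.
    exact: integrable_pos_fin_num.
  exact: integrable_neg_fin_num.
rewrite !e//.
have mp := measurable_funepos mf; have mn := measurable_funeneg mf.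
rewrite (half_mixture_ge0_integral mp)// (half_mixture_ge0_integral mn)//.
have fp (m : probability T R) : m.-integrable setT (EFin \o f) ->
    (\int[m]_x (EFin \o f)^\+ x)%E \is a fin_num by exact: integrable_pos_fin_num.
have fn (m : probability T R) : m.-integrable setT (EFin \o f) ->
    (\int[m]_x (EFin \o f)^\- x)%E \is a fin_num by exact: integrable_neg_fin_num.
rewrite -(fineK (fp _ i0)) -(fineK (fp _ i1)) -(fineK (fn _ i0)) -(fineK (fn _ i1)) /=.
by field.
Qed.

Lemma half_mixture_ae (P : T -> Prop) : {ae mh, forall x, P x} ->
  {ae m0, forall x, P x} /\ {ae m1, forall x, P x}.
Proof.
move=> [N [mN N0 hN]]; move: N0; rewrite hmix// => /eqP.
have p0 : (0 <= 2^-1%:E * m0 N)%E by rewrite mule_ge0// lee_fin invr_ge0.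
have p1 : (0 <= 2^-1%:E * m1 N)%E by rewrite mule_ge0// lee_fin invr_ge0.
rewrite padde_eq0// !mule_eq0 !eqe !invr_eq0 pnatr_eq0/= => /andP[/eqP n0 /eqP n1].
by split; exists N.
Qed.

End mixture.

(** * Equal tilted means at two values of the clock *)

Section two_clocks.
Context {R : realType}.

Lemma quadratic_modulus_cst (g : R -> R) (a b K : R) :
  (forall s t, a <= s <= b -> a <= t <= b -> `|g s - g t| <= K * `|s - t| ^+ 2) ->
  forall s t, a <= s <= b -> a <= t <= b -> g s = g t.
Proof.
move=> gK s t sab tab; have ab : a <= b by move/andP: sab => [? ?]; lra.
pose f x := g (clamp a b x).
have fK x y : `|f x - f y| <= `|K| * `|x - y| ^+ 2.
  apply: le_trans (gK _ _ (clamp_itv _ ab) (clamp_itv _ ab)) _.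
  apply: (@le_trans _ _ (`|K| * `|clamp a b x - clamp a b y| ^+ 2)).
    by rewrite ler_wpM2r ?exprn_ge0// ler_norm.
  by rewrite ler_wpM2l// lerXn2r ?nnegrE// clamp_lip.
have d0 (x : R) : is_derive x 1 f 0.
  have c0 : h^-1 *: (f (h + x) - f x) @[h --> 0^'] --> (0 : R).
    apply/cvgrPdist_le => e e0.
    have K1 : 0 < `|K| + 1 by rewrite ltr_wpDl.
    near=> h.
    rewrite sub0r normrN normrM normfV.
    have h0 : h != 0 by near: h; exact: nbhs_dnbhs_neq.
    have hp : 0 < `|h| by rewrite normr_gt0.
    rewrite mulrC ler_pdivrMr//.
    have := fK (h + x) x; rewrite addrK => /le_trans; apply.
    rewrite expr2 mulrA ler_wpM2r//.
    apply: (@le_trans _ _ ((`|K| + 1) * `|h|)); first by rewrite ler_wpM2r// lerDl.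
    rewrite mulrC -ler_pdivlMr//; near: h.
    have e1 : 0 < e / (`|K| + 1) by rewrite divr_gt0.
    apply: dnbhs0_le; exact: e1.
  apply: DeriveDef.
    apply/cvg_ex; exists 0; apply: cvg_trans c0; apply: near_eq_cvg.
    by apply: nearW => h /=; rewrite /GRing.scale/= mulr1.
  apply: cvg_lim => //; apply: cvg_trans c0; apply: near_eq_cvg.
  by apply: nearW => h /=; rewrite /GRing.scale/= mulr1.
by have := is_derive_0_is_cst s t d0; rewrite /f !clamp_id.
Unshelve. all: by end_near. Qed.

(* The point [tau u] where the three means at [r1] equal those at [u] for [r0]
   also transports [ln (Z1 r / Z0 r)], by the balance of the mixture. As its
   derivative [m1 - m0] is bounded away from 0, Taylor expansions show that
   [tau u - u] has a quadratic modulus of continuity, so [tau] is a translation. *)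
Lemma two_clocks_ratio (Z0 Z1 Zh m0 m1 mh : R -> R -> R) (th sg sg2 r0 r1 D L : R) :
  0 < r0 -> 0 < r1 -> 0 < sg2 -> 0 < D -> 0 < L ->
  (forall r u, 0 < r -> 0 < Z0 r u) -> (forall r u, 0 < r -> 0 < Z1 r u) ->
  (forall r u, 0 < r -> 0 < Zh r u) ->
  (forall r u : R, 0 < r -> is_derive u (1 : R) (Z0 r) (m0 r u * Z0 r u)) ->
  (forall r u : R, 0 < r -> is_derive u (1 : R) (Z1 r) (m1 r u * Z1 r u)) ->
  (forall r u : R, 0 < r -> is_derive u (1 : R) (Zh r) (mh r u * Zh r u)) ->
  (forall r v, 0 < r -> Z1 r v * (m1 r v - mh r v) = Z0 r v * (mh r v - m0 r v)) ->
  (forall r u u', r = r0 \/ r = r1 -> `|u - th| <= sg -> `|u' - th| <= sg ->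
     `|m0 r u - m0 r u'| <= L * `|u - u'|) ->
  (forall r u u', r = r0 \/ r = r1 -> `|u - th| <= sg -> `|u' - th| <= sg ->
     `|m1 r u - m1 r u'| <= L * `|u - u'|) ->
  (forall r u u', r = r0 \/ r = r1 -> `|u - th| <= sg -> `|u' - th| <= sg ->
     `|mh r u - mh r u'| <= L * `|u - u'|) ->
  (forall u u', `|u - th| <= sg -> `|u' - th| <= sg ->
     D * `|u - u'| <= `|mh r1 u - mh r1 u'|) ->
  sg2 <= sg ->
  (forall u, `|u - th| <= sg2 -> exists v, [/\ `|v - th| <= sg,
    m0 r1 v = m0 r0 u, m1 r1 v = m1 r0 u & mh r1 v = mh r0 u]) ->
  (forall u, `|u - th| <= sg2 -> D <= `|m1 r0 u - m0 r0 u|) ->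
  exists c C, 0 < C /\ forall u, th - sg2 < u < th + sg2 -> Zh r1 (u + c) = C * Zh r0 u.
Proof.
move=> r00 r10 sg20 D0 L0 z0 z1 zh dZ0 dZ1 dZh wt mlip0 mlip1 mliph mdist sg2le exv mD.
have /choice[tau tauP] : forall u, exists v, `|u - th| <= sg2 -> [/\ `|v - th| <= sg,
    m0 r1 v = m0 r0 u, m1 r1 v = m1 r0 u & mh r1 v = mh r0 u].
  move=> u; have [h|h] := pselect (`|u - th| <= sg2); last by exists 0.
  by have [v ?] := exv u h; exists v.
have lnD (a b : R) : 0 < a -> 0 < b -> ln a - ln b = ln (a / b).
  by move=> a0 b0; rewrite ln_div ?posrE.
pose G r u := ln (Z1 r u) - ln (Z0 r u).
have dln (Z m : R -> R -> R) (r u : R) : 0 < r -> (forall r u, 0 < r -> 0 < Z r u) ->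
    (forall r u : R, 0 < r -> is_derive u (1 : R) (Z r) (m r u * Z r u)) ->
    is_derive u (1 : R) (fun u => ln (Z r u)) (m r u).
  move=> r' Z0' dZ; have dl := is_derive1_ln (Z0' r u r').
  have dZu := dZ r u r'.
  apply: (@is_derive_eq _ _ _ _ _ _ _ _ (is_derive1_comp (f := @ln R) dl dZu)).
  by rewrite mulrC mulfK// gt_eqF// Z0'.
have dlnh (r u : R) : 0 < r -> is_derive u (1 : R) (fun u => ln (Zh r u)) (mh r u).
  by move=> r'; exact: dln.
have dG r (u : R) : 0 < r -> is_derive u 1 (G r) (m1 r u - m0 r u).
  by move=> r'; apply: is_deriveB; exact: dln.
(* The balance reads [Z1 / Z0 = (mh - m0) / (m1 - mh)]. The right side depends on the three means
   alone, which are the same at [(r0, u)] and [(r1, tau u)]. *)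
have GE u : `|u - th| <= sg2 -> G r1 (tau u) = G r0 u.
  move=> hu; have [hv E0 E1 Eh] := tauP _ hu.
  have w0 := wt _ u r00; have w1 := wt _ (tau u) r10.
  rewrite E0 E1 Eh in w1.
  have z00 := z0 r0 u r00; have z10 := z1 r0 u r00.
  have z01 := z0 r1 (tau u) r10; have z11 := z1 r1 (tau u) r10.
  have ne : m1 r0 u - mh r0 u != 0.
    apply/eqP => e; move: w0; rewrite e mulr0 => /esym/eqP; rewrite mulf_eq0 gt_eqF//= => /eqP e'.
    have := mD u hu; rewrite -(subrKA (mh r0 u)) e e' addr0 normr0.
    by rewrite leNgt D0.
  have R0 : Z1 r0 u / Z0 r0 u = (mh r0 u - m0 r0 u) / (m1 r0 u - mh r0 u).
    by apply/eqP; rewrite eqr_div//; [rewrite w0 mulrC|rewrite gt_eqF].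
  have R1 : Z1 r1 (tau u) / Z0 r1 (tau u) = (mh r0 u - m0 r0 u) / (m1 r0 u - mh r0 u).
    by apply/eqP; rewrite eqr_div//; [rewrite w1 mulrC|rewrite gt_eqF].
  by rewrite /G (lnD _ _ z11 z01) (lnD _ _ z10 z00) R0 R1.
have seg (a c : R) u : `|a - th| <= sg -> `|c - th| <= sg -> a <= u <= c -> `|u - th| <= sg.
  exact: ballU_itv.
(* The derivative [m1 - m0] of [G r] is Lipschitz with constant [2 * L]. *)
have taylor r u u' : r = r0 \/ r = r1 -> `|u - th| <= sg -> `|u' - th| <= sg ->
    `|G r u' - G r u - (m1 r u - m0 r u) * (u' - u)| <= 2 * L * `|u' - u| ^+ 2.
  move=> hr; have r' : 0 < r by case: hr => ->.
  have aux a c x : `|a - th| <= sg -> `|c - th| <= sg -> a <= c -> a <= x <= c ->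
     `|G r c - G r a - (m1 r x - m0 r x) * (c - a)| <= 2 * L * `|c - a| ^+ 2.
    move=> ha hc ac hx.
    have [y yac ->] := MVT_segment ac (fun y _ => dG r y r')
      (derivable_within_continuous (fun y _ => @ex_derive _ _ _ _ _ _ _ (dG r y r'))).
    move: yac; rewrite in_itv/= => yac.
    rewrite -mulrBl normrM expr2 mulrA ler_wpM2r//.
    have hy' := seg _ _ _ ha hc yac; have hx' := seg _ _ _ ha hc hx.
    have -> : m1 r y - m0 r y - (m1 r x - m0 r x) =
      (m1 r y - m1 r x) - (m0 r y - m0 r x) by ring.
    apply: le_trans (ler_normB _ _) _.
    have yx : `|y - x| <= `|c - a|.
      exact: itv_dist yac hx.
    have h1 := mlip1 _ _ _ hr hy' hx'; have h0 := mlip0 _ _ _ hr hy' hx'.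
    have h : L * `|y - x| <= L * `|c - a| by rewrite ler_wpM2l// ltW.
    rewrite mulr_natl mulr2n mulrDl; exact: lerD (le_trans h1 h) (le_trans h0 h).
  move=> hu hu'; have [uu'|u'u] := leP u u'; first by apply: aux => //; rewrite lexx.
  have h := aux u' u u hu' hu (ltW u'u) (introT andP (conj (ltW u'u) (lexx u))).
  rewrite [`|u' - u|]distrC.
  have -> : G r u' - G r u - (m1 r u - m0 r u) * (u' - u) =
    - (G r u - G r u' - (m1 r u - m0 r u) * (u - u')) by ring.
  by rewrite normrN.
have sg_of u : `|u - th| <= sg2 -> `|u - th| <= sg by move=> h; exact: le_trans h sg2le.
have tau_lip u u' : `|u - th| <= sg2 -> `|u' - th| <= sg2 -> `|tau u' - tau u| <= L / D * `|u' - u|.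
  move=> hu hu'; have [h _ _ E] := tauP _ hu; have [h' _ _ E'] := tauP _ hu'.
  rewrite mulrAC ler_pdivlMr// mulrC; apply: le_trans (mdist _ _ h' h) _.
  rewrite E E'; apply: mliph => //; [by left|exact: sg_of|exact: sg_of].
pose Kc := (2 * L + 2 * L * (L / D) ^+ 2) / D.
(* The expansions at [r0] and at [r1] have equal increments and the same slope [dl]. Their
   difference bounds [dl] times the increment of [tau u - u] by quadratic remainders, and [|dl|] is
   at least [D]. *)
have tq u u' : `|u - th| <= sg2 -> `|u' - th| <= sg2 ->
    `|(tau u' - u') - (tau u - u)| <= Kc * `|u' - u| ^+ 2.
  move=> hu hu'; have [h E0 E1 _] := tauP _ hu; have [h' _ _ _] := tauP _ hu'.
  have t0 := taylor r0 u u' (or_introl erefl) (sg_of _ hu) (sg_of _ hu').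
  have t1 := taylor r1 (tau u) (tau u') (or_intror erefl) h h'.
  rewrite !GE// E0 E1 in t1.
  set dl := m1 r0 u - m0 r0 u in t0 t1.
  have dlD : D <= `|dl| := mD u hu.
  have tl := tau_lip _ _ hu hu'.
  have tl2 : `|tau u' - tau u| ^+ 2 <= (L / D) ^+ 2 * `|u' - u| ^+ 2.
    by rewrite -exprMn lerXn2r ?nnegrE// mulr_ge0// divr_ge0// ltW.
  rewrite /Kc mulrAC ler_pdivlMr// mulrC.
  apply: (@le_trans _ _ (`|dl| * `|(tau u' - u') - (tau u - u)|)); first by rewrite ler_wpM2r.
  rewrite -normrM.
  have -> : dl * (tau u' - u' - (tau u - u)) =
     (G r0 u' - G r0 u - dl * (u' - u)) - (G r0 u' - G r0 u - dl * (tau u' - tau u)) by ring.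
  apply: le_trans (ler_normB _ _) _; rewrite [leRHS]mulrDl; apply: lerD => //.
  apply: le_trans t1 _; rewrite -[leRHS]mulrA; apply: ler_wpM2l => //.
  by rewrite mulr_ge0// ltW.
have hball u : th - sg2 <= u <= th + sg2 -> `|u - th| <= sg2.
  by rewrite ler_distl.
have tau_cst u : th - sg2 <= u <= th + sg2 -> tau u = u + (tau th - th).
  move=> hu; have hth : th - sg2 <= th <= th + sg2 by rewrite gerBl lerDl ltW.
  have key := @quadratic_modulus_cst (fun u => tau u - u) (th - sg2) (th + sg2) Kc
    (fun s t hs ht => tq t s (hball t ht) (hball s hs)) u th hu hth.
  by rewrite -[LHS](subrK u) key addrC.
set c := tau th - th in tau_cst.
(* Now that [tau] is a translation by [c], the two logarithmic derivatives [mh r1 (u + c)] and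
   [mh r0 u] coincide on the interval. *)
pose g u := ln (Zh r1 (u + c)) - ln (Zh r0 u).
have dg (u : R) : is_derive u 1 g (mh r1 (u + c) - mh r0 u).
  apply: is_deriveB; last exact: dlnh.
  have d1 := dlnh r1 (u + c) r10.
  have d3 : is_derive u 1 ((fun u => ln (Zh r1 u)) \o (fun u => u + c)) (mh r1 (u + c)).
    by apply: is_derive_eq; rewrite addr0 mulr1.
  exact: d3.
have gcst u : th - sg2 < u < th + sg2 -> g u = g th.
  move=> /andP[hu1 hu2].
  have aux a e : a <= e -> th - sg2 <= a -> e <= th + sg2 -> g e = g a.
    move=> ae a1 e1.
    have [y yae] := MVT_segment ae (fun y _ => dg y)
      (derivable_within_continuous (fun y _ => @ex_derive _ _ _ _ _ _ _ (dg y))).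
    move: yae; rewrite in_itv/= => /andP[ya ye].
    have hy : th - sg2 <= y <= th + sg2 by rewrite (le_trans a1 ya) (le_trans ye e1).
    have [_ _ _ E] := tauP _ (hball _ hy).
    rewrite -(tau_cst _ hy) E subrr mul0r => /eqP; rewrite subr_eq0 => /eqP//.
  have th1 : th - sg2 <= th by rewrite gerBl ltW.
  have th2 : th <= th + sg2 by rewrite lerDl ltW.
  have [uth|thu] := leP u th; last exact: aux (ltW thu) th1 (ltW hu2).
  by symmetry; exact: aux uth (ltW hu1) th2.
pose C := expR (g th).
exists c, C; split; first exact: expR_gt0.
move=> u hu; have z1' := zh r1 (u + c) r10; have z0' := zh r0 u r00.
by rewrite /C -(gcst u hu) /g expRB !lnK ?posrE// divfK// gt_eqF.
Qed.

Variables (k0 k1 kh : probability R R).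
Hypothesis hmix : half_mixture k0 k1 kh.
Hypothesis i0 : k0.-integrable setT (EFin \o id).
Hypothesis i1 : k1.-integrable setT (EFin \o id).
Hypothesis mean01 : \int[k0]_y y = \int[k1]_y y.

Lemma tmom_mix r n t : 0 < r -> tmom kh r n t = (tmom k0 r n t + tmom k1 r n t) / 2.
Proof.
move=> r0.
by have [_] := half_mixture_integrable hmix (wmom_integrable n t (tail_gauss k0 r0))
  (wmom_integrable n t (tail_gauss k1 r0)).
Qed.

Lemma tmean_lip3 (A rm rp : R) : 0 <= A -> 0 < rm -> rm <= rp ->
  exists2 L, 0 < L & forall (k : probability R R), k = k0 \/ k = k1 \/ k = kh ->
  forall t r t' r', `|t| <= A /\ rm <= r <= rp -> `|t'| <= A /\ rm <= r' <= rp ->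
  `|tmean k r t - tmean k r' t'| <= L * (`|t - t'| + `|r - r'|).
Proof.
move=> A0 rm0 rmp.
have [L0 L00 h0] := tmean_lip k0 A0 rm0 rmp.
have [L1 L10 h1] := tmean_lip k1 A0 rm0 rmp.
have [Lh Lh0 hh] := tmean_lip kh A0 rm0 rmp.
exists (L0 + L1 + Lh); first by rewrite !addr_gt0.
move=> k kE t r t' r' tr tr'.
have p : 0 <= `|t - t'| + `|r - r'| by rewrite addr_ge0.
have q (L : R) : L <= L0 + L1 + Lh -> L * (`|t - t'| + `|r - r'|) <= (L0 + L1 + Lh) * (`|t - t'| + `|r - r'|).
  by move=> ?; rewrite ler_wpM2r.
by case: kE => [->|[->|->]]; [apply: le_trans (h0 _ _ _ _ tr tr') _|
  apply: le_trans (h1 _ _ _ _ tr tr') _|apply: le_trans (hh _ _ _ _ tr tr') _]; apply: q; lra.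
Qed.

(** The leading coefficient [r0 - r1] is not 0, so [kh] lives on two points, and with it [k0] and
    [k1]. Having equal means they coincide. *)
Lemma two_clocks_proportional (r0 r1 c C u v : R) : u < v ->
  0 < r0 -> 0 < r1 -> r0 != r1 -> 0 < C ->
  (forall t, u < t < v -> tmom kh r1 0 (t + c) = C * tmom kh r0 0 t) ->
  forall A, measurable A -> k0 A = k1 A.
Proof.
move=> uv r00 r10 r01 C0 ratio.
have aeq := tilted_proportional uv r00 r10 C0 ratio.
have r01' : r0 - r1 != 0 by rewrite subr_eq0.
have [y1 [y2 [y12 hy]]] := quadratic_roots c (- ln C) r01'.
have aey : {ae kh, forall y, y = y1 \/ y = y2} by apply: filterS aeq => y; exact: hy.
have [ae0 ae1] := half_mixture_ae hmix aey.
exact: two_point_law y12 i0 i1 mean01 ae0 ae1.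
Qed.

End two_clocks.

(** * Local constancy of a singular clock *)

Section singular_clock.
Context {R : realType}.
Local Notation lambda := (@lebesgue_measure R).
Variables (k0 k1 kh : probability R R).
Hypothesis hmix : half_mixture k0 k1 kh.
Hypothesis i0 : k0.-integrable setT (EFin \o id).
Hypothesis i1 : k1.-integrable setT (EFin \o id).
Hypothesis mean01 : \int[k0]_y y = \int[k1]_y y.
Hypothesis k01 : ~ forall A, measurable A -> k0 A = k1 A.

Variables (s b rho : R -> R) (t0 e0 : R).
Hypothesis e00 : 0 < e0.
Hypothesis s0 : 0 < s t0.
Hypothesis cs : {for t0, continuous s}.
Hypothesis cb : {for t0, continuous b}.
Hypothesis crho : {for t0, continuous rho}.
Hypothesis rho0 : 0 < rho t0.
Hypothesis drho : {ae lambda, forall t, `|t - t0| < e0 -> is_derive t 1 rho 0}.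
Hypothesis reg_lip : forall k : probability R R, k = k0 \/ k = k1 \/ k = kh ->
  forall x, exists eta C, [/\ 0 < eta, 0 <= C &
  forall t t' y, `|t - t0| < eta -> `|t' - t0| < eta -> `|y - x| < eta ->
    `|tmean k (rho t) (s t * y - b t) - tmean k (rho t') (s t' * y - b t')| <= C * `|t - t'|].

Let in0 : k0 = k0 \/ k0 = k1 \/ k0 = kh. Proof. by left. Qed.
Let in1 : k1 = k0 \/ k1 = k1 \/ k1 = kh. Proof. by right; left. Qed.
Let inh : kh = k0 \/ kh = k1 \/ kh = kh. Proof. by right; right. Qed.

Lemma mixture_not_dirac c : ~ {ae kh, forall y, y = c}.
Proof.
move=> hc; apply: k01; have [h0 h1] := half_mixture_ae hmix hc.
apply: (@two_point_law R k0 k1 c (c + 1)) => //.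
- by rewrite -subr_eq0 opprD addNKr oppr_eq0 oner_neq0.
- by apply: filterS h0 => y; left.
- by apply: filterS h1 => y; left.
Qed.

Lemma tmean_separated r : 0 < r -> exists u, tmean k0 r u != tmean k1 r u.
Proof.
move=> r0; apply: contrapT => /forallNP h; apply: k01; apply: (tmean_injective r0) => t.
have /negP := h t; rewrite negbK /tmean => /eqP.
have z0 := tmom0_gt0 k0 t r0; have z1 := tmom0_gt0 k1 t r0.
by move/eqP; rewrite (eqr_div _ _ (lt0r_neq0 z0) (lt0r_neq0 z1)) => /eqP.
Qed.

(** The tilted mean of the midpoint is the average of the two tilted means weighted by the
    normalisations [tmom k0 r 0] and [tmom k1 r 0]. *)
Lemma tmean_mixture_balance r v : 0 < r ->
  tmom k1 r 0 v * (tmean k1 r v - tmean kh r v) = tmom k0 r 0 v * (tmean kh r v - tmean k0 r v).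
Proof.
move=> r'; rewrite /tmean !(tmom_mix hmix)//.
have := tmom0_gt0 k0 v r'; have := tmom0_gt0 k1 v r'.
set a := tmom k1 r 0 v; set c := tmom k0 r 0 v => a0 c0.
by field; rewrite !gt_eqF// addr_gt0.
Qed.

Lemma is_derive_tmom0 (k : probability R R) (r u : R) : 0 < r ->
  is_derive u (1 : R) (fun u => tmom k r 0 u) (tmean k r u * tmom k r 0 u).
Proof.
move=> r'; have z := tmom0_gt0 k u r'.
by rewrite /tmean divfK ?gt_eqF//; exact: is_derive_tmom.
Qed.

(** The argument is centred at a tilt [th] where the means of [k0] and [k1] differ, which exists
    since the laws do. A nearby time with another value of [rho] would give two clocks with
    transported means, forcing [k0 = k1]. *)
Lemma singular_clock_local : exists2 e, 0 < e & forall t1, `|t1 - t0| < e -> rho t1 = rho t0.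
Proof.
have [th th01] := tmean_separated rho0.
have r0' := rho0; set r0 := rho t0 in th01 r0'.
pose A := `|th| + 1; have A0 : 0 <= A by rewrite addr_ge0.
have rm0 : 0 < r0 / 2 by rewrite divr_gt0.
have regr0 : r0 / 2 <= r0 <= 2 * r0 by apply: half_ball; rewrite subrr normr0 ltW.
have rmp : r0 / 2 <= 2 * r0 by have /andP[a1 a2] := regr0; exact: le_trans a1 a2.
have [L L0 mlip] := tmean_lip3 k0 k1 kh A0 rm0 rmp.
have [D D0 mincr] := tmean_incr A0 rm0 rmp mixture_not_dirac.
have regA u : `|u - th| <= 1 -> `|u| <= A.
  by move=> h; have := ler_normD (u - th) th; rewrite subrK /A; lra.
have [] := @clock_transport R bool (tmean kh) (fun i => tmean (if i then k1 else k0)) s b rho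
  t0 e0 th (r0 / 2) (2 * r0) L D e00 L0 D0.
- by move=> t r t' r' [h1 h2] [h1' h2']; apply: mlip inh _ _ _ _ _ _; split => //; exact: regA.
- move=> i t r t' r' [h1 h2] [h1' h2'].
  by case: i; [apply: mlip in1 _ _ _ _ _ _|apply: mlip in0 _ _ _ _ _ _]; split => //; exact: regA.
- by move=> t t' r [h1 h2] [h1' h2']; apply: mincr; split => //; exact: regA.
- exact: s0.
- exact: cs.
- exact: cb.
- exact: crho.
- by rewrite -/r0 ltr_pdivrMr// ltr_pMr// ltr1n ltr_pMl// ltr1n.
- exact: drho.
- move=> x; have [eta0 [C0 [p0 q0 h0]]] := reg_lip in0 x.
  have [eta1 [C1 [p1 q1 h1]]] := reg_lip in1 x.
  have [etah [Ch [ph qh hh]]] := reg_lip inh x.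
  pose eta := Num.min (Num.min eta0 eta1) etah.
  have l0 (z : R) : z < eta -> z < eta0 by move=> h; rewrite (lt_le_trans h)// !ge_min lexx.
  have l1 (z : R) : z < eta -> z < eta1 by move=> h; rewrite (lt_le_trans h)// !ge_min lexx orbT.
  have lh (z : R) : z < eta -> z < etah by move=> h; rewrite (lt_le_trans h)// ge_min lexx orbT.
  exists eta, (C0 + C1 + Ch); split.
  + by rewrite !lt_min p0 p1.
  + by rewrite !addr_ge0.
  + move=> t t' y /lh ht /lh ht' /lh hy; apply: le_trans (hh _ _ _ ht ht' hy) _.
    by rewrite ler_wpM2r// lerDr addr_ge0.
  + move=> [] t t' y ht ht' hy.
      apply: le_trans (h1 _ _ _ (l1 _ ht) (l1 _ ht') (l1 _ hy)) _.
      by rewrite ler_wpM2r// -addrA addrCA lerDl addr_ge0.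
    apply: le_trans (h0 _ _ _ (l0 _ ht) (l0 _ ht') (l0 _ hy)) _.
    by rewrite ler_wpM2r// -addrA lerDl addr_ge0.
move=> e [sg [e_gt0 /andP[sg0 sg1] H]]; exists e => // t1 t1e.
apply/eqP/negPn/negP => r10; apply: k01.
have [/andP[r1m r1p] ex tr] := H t1 t1e.
have r1_gt0 : 0 < rho t1 := lt_le_trans rm0 r1m.
set r1 := rho t1 in r10 r1m r1p ex tr r1_gt0.
pose dl := `|tmean k1 r0 th - tmean k0 r0 th|.
have dl0 : 0 < dl by rewrite normr_gt0 subr_eq0 eq_sym.
(* Within [sg2] of [th], the mean of [kh] stays in the range that [clock_transport] reaches, and the
   means of [k0] and [k1] stay at least [dl / 2] apart. *)
pose sg2 := Num.min sg (Num.min (D * sg / (2 * L)) (dl / (4 * L))).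
have sg20 : 0 < sg2 by rewrite !lt_min sg0 !divr_gt0 ?mulr_gt0.
have sg2sg : sg2 <= sg by rewrite ge_min lexx.
have sg2D : L * sg2 <= D * sg / 2.
  have -> : D * sg / 2 = L * (D * sg / (2 * L)) by field; rewrite gt_eqF.
  by rewrite ler_wpM2l ?(ltW L0)// !ge_min lexx orbT.
have sg2d : 2 * L * sg2 <= dl / 2.
  have -> : dl / 2 = 2 * L * (dl / (4 * L)) by field; rewrite gt_eqF.
  by rewrite ler_wpM2l ?mulr_ge0 ?(ltW L0)// !ge_min lexx !orbT.
pose D' := Num.min D (dl / 2).
have D'0 : 0 < D' by rewrite lt_min D0 divr_gt0.
have regr1 : r0 / 2 <= r1 <= 2 * r0 by rewrite r1m.
have ml (k : probability R R) : k = k0 \/ k = k1 \/ k = kh ->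
   forall r u u', r = r0 \/ r = r1 -> `|u - th| <= sg -> `|u' - th| <= sg ->
     `|tmean k r u - tmean k r u'| <= L * `|u - u'|.
  move=> kE r u u' hr hu hu'.
  have hr' : r0 / 2 <= r <= 2 * r0 by case: hr => ->.
  have := mlip k kE u r u' r (conj (regA _ (le_trans hu sg1)) hr') (conj (regA _ (le_trans hu' sg1)) hr').
  by have -> : `|r - r| = 0 by [rewrite subrr normr0]; rewrite addr0.
have th0 : `|th - th| <= sg by rewrite subrr normr0 ltW.
have dA1 : forall u u', `|u - th| <= sg -> `|u' - th| <= sg ->
     D' * `|u - u'| <= `|tmean kh r1 u - tmean kh r1 u'|.
  have aux u u' : u <= u' -> `|u - th| <= sg -> `|u' - th| <= sg ->
     D' * (u' - u) <= `|tmean kh r1 u' - tmean kh r1 u|.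
    move=> uu' hu hu'; apply: (@le_trans _ _ (D * (u' - u))).
      by rewrite ler_wpM2r ?subr_ge0// ge_min lexx.
    apply: le_trans (ler_norm _).
    exact: mincr (conj (regA _ (le_trans hu sg1)) regr1) (conj (regA _ (le_trans hu' sg1)) regr1) uu'.
  move=> u u' hu hu'; have [uu'|/ltW u'u] := leP u u'.
    by rewrite distrC [`|tmean _ _ _ - _|]distrC ger0_norm ?subr_ge0//; exact: aux.
  by rewrite ger0_norm ?subr_ge0//; exact: aux.
have exv : forall u, `|u - th| <= sg2 -> exists v, [/\ `|v - th| <= sg,
    tmean k0 r1 v = tmean k0 r0 u, tmean k1 r1 v = tmean k1 r0 u & tmean kh r1 v = tmean kh r0 u].
  move=> u hu; have hu' := le_trans hu sg2sg.
  have hy : `|tmean kh r0 u - tmean kh r0 th| <= D * sg / 2.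
    apply: le_trans (ml _ inh r0 u th (or_introl erefl) hu' th0) _.
    by apply: le_trans sg2D; rewrite ler_wpM2l// ltW.
  have [v hv vE] := ex _ hy; exists v.
  have tE := tr u v hu' hv (esym vE) hy.
  by split; [exact: hv|exact: esym (tE false)|exact: esym (tE true)|exact: vE].
have mD : forall u, `|u - th| <= sg2 -> D' <= `|tmean k1 r0 u - tmean k0 r0 u|.
  move=> u hu; have hu' := le_trans hu sg2sg.
  have h1 := ml _ in1 r0 u th (or_introl erefl) hu' th0.
  have h0 := ml _ in0 r0 u th (or_introl erefl) hu' th0.
  have hL : L * `|u - th| <= L * sg2 by rewrite ler_wpM2l// ltW.
  apply: (@le_trans _ _ (dl / 2)); first by rewrite ge_min lexx orbT.
  apply: le_trans (dist_perturb h1 h0); apply: le_halfB.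
  by apply: le_trans sg2d; rewrite -mulrA ler_wpM2l.
have [c [C [C0 ratio]]] := @two_clocks_ratio R (fun r => tmom k0 r 0) (fun r => tmom k1 r 0)
  (fun r => tmom kh r 0) (tmean k0) (tmean k1) (tmean kh) th sg sg2 r0 r1 D' L
  r0' r1_gt0 sg20 D'0 L0 (fun r u => @tmom0_gt0 R k0 r u) (fun r u => @tmom0_gt0 R k1 r u)
  (fun r u => @tmom0_gt0 R kh r u) (@is_derive_tmom0 k0) (@is_derive_tmom0 k1)
  (@is_derive_tmom0 kh) tmean_mixture_balance (ml _ in0) (ml _ in1) (ml _ inh)
  dA1 sg2sg exv mD.
have r01 : r0 != r1 by rewrite eq_sym.
have uv : th - sg2 < th + sg2 by rewrite (@lt_trans _ _ th) ?gtrBl ?ltrDl.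
exact: (two_clocks_proportional hmix i0 i1 mean01 uv r0' r1_gt0 r01 C0 ratio).
Qed.

End singular_clock.

(** * The arcade process *)

Section square_integrable.
Context d {T : measurableType d} {R : realType} (P : probability T R).

Definition sqint (X : T -> R) : Prop :=
  measurable_fun setT X /\ P.-integrable setT (EFin \o (fun w => X w ^+ 2)).

Lemma sqintM X Y : sqint X -> sqint Y -> P.-integrable setT (EFin \o (fun w => X w * Y w)).
Proof.
move=> [mX iX] [mY iY]; apply: (integrable_dom (g := fun w => X w ^+ 2 + Y w ^+ 2)).
- exact: measurable_funM.
- by have := integrableD measurableT iX iY; apply: eq_integrable.
- move=> w; rewrite normrM -(real_normK (num_real (X w))) -(real_normK (num_real (Y w))).
  have := sqr_ge0 (`|X w| - `|Y w|); have := sqr_ge0 (`|X w|); have := sqr_ge0 (`|Y w|); nra.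
Qed.

Lemma sqint_cst c : sqint (cst c).
Proof.
split; first exact: measurable_cst.
by apply: (@integrable_bdd _ _ _ P _ (c ^+ 2)) => [|w]; [by apply: measurable_funX; exact: measurable_cst|rewrite ger0_norm ?sqr_ge0].
Qed.

Lemma sqint_integrable X : sqint X -> P.-integrable setT (EFin \o X).
Proof. by move=> sX; have := sqintM sX (sqint_cst 1); apply: eq_integrable => // w _ /=; rewrite mulr1. Qed.

Lemma sqintZ c X : sqint X -> sqint (fun w => c * X w).
Proof.
move=> [mX iX]; split; first exact: measurable_funM.
have := integrableZl measurableT (c ^+ 2) iX; apply: eq_integrable => // w _ /=.
by rewrite exprMn.
Qed.

Lemma sqintD X Y : sqint X -> sqint Y -> sqint (fun w => X w + Y w).
Proof.
move=> sX sY; have [mX iX] := sX; have [mY iY] := sY; split; first exact: measurable_funD.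
have i2 := integrableZl measurableT 2 (sqintM sX sY).
have := integrableD measurableT (integrableD measurableT iX iY) i2.
by apply: eq_integrable => // w _ /=; congr EFin; ring.
Qed.

Lemma sqintB X Y : sqint X -> sqint Y -> sqint (fun w => X w - Y w).
Proof.
move=> sX sY; have := sqintD sX (sqintZ (-1) sY).
by congr sqint; apply/funext => w; rewrite mulN1r.
Qed.

Lemma Rintegral_lin3 (X Y Z : T -> R) (a b : R) : P.-integrable setT (EFin \o X) ->
  P.-integrable setT (EFin \o Y) -> P.-integrable setT (EFin \o Z) ->
  \int[P]_w (X w - a * Y w - b * Z w) = \int[P]_w X w - a * \int[P]_w Y w - b * \int[P]_w Z w.
Proof.
move=> iX iY iZ.
have iaY : P.-integrable setT (EFin \o (fun w => a * Y w)) by have := integrableZl measurableT a iY; apply: eq_integrable.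
have ibZ : P.-integrable setT (EFin \o (fun w => b * Z w)) by have := integrableZl measurableT b iZ; apply: eq_integrable.
rewrite RintegralB//; last by have := integrableB measurableT iX iaY; apply: eq_integrable.
by rewrite RintegralB// !RintegralZl.
Qed.

End square_integrable.

(** * Moments of the normal law *)

Section normal_moments.
Context {R : realType}.

Lemma lebesgue_measure_shift (A : set R) (c : R) : measurable A ->
  lebesgue_measure A = lebesgue_measure ((fun x : R => x + c) @^-1` A).
Proof.
move=> mA.
have ms : measurable_fun setT ((fun x : R => x + c) : measurableTypeR R -> measurableTypeR R).
  by apply: measurable_funD.
have E : lebesgue_measure A = pushforward lebesgue_measure ((fun x : R => x + c) : _ -> measurableTypeR R) A.
  pose h : {mfun measurableTypeR R >-> measurableTypeR R} := HB.pack ((fun x : R => x + c) : measurableTypeR R -> measurableTypeR R) (isMeasurableFun.Build _ _ _ _ _ ms).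
  apply: (@lebesgue_measure_unique R (pushforward lebesgue_measure h)) => //= _ [[a b]] _ <-.
  rewrite /pushforward/=.
  have -> : (fun x : R => x + c) @^-1` `]a, b] = `]a - c, b - c]%classic.
    by apply/seteqP; split=> x /=; rewrite !in_itv/= ltrBlDr lerBrDr.
  rewrite lebesgue_measure_itv/= lebesgue_measure_itv/= !lte_fin ltrD2r.
  by case: ifP => // _; rewrite -!EFinB; congr EFin; ring.
exact: E.
Qed.

Lemma ge0_integral_shift (f : R -> \bar R) (c : R) : measurable_fun setT f ->
  (forall x, 0 <= f x)%E ->
  (\int[lebesgue_measure]_x f (x + c)%R = \int[lebesgue_measure]_x f x)%E.
Proof.
move=> mf f0.
have ms : measurable_fun setT ((fun x : R => x + c) : measurableTypeR R -> measurableTypeR R).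
  by apply: measurable_funD.
rewrite -(ge0_integral_law (m := lebesgue_measure) (m' := lebesgue_measure) ms)// => A mA.
exact: lebesgue_measure_shift.
Qed.

Variables (m s : R) (k : probability R R).
Hypothesis s0 : s != 0.
Hypothesis hk : forall B, measurable B -> k B = normal_prob m s B.

Lemma ge0_integral_normal (h : R -> \bar R) : measurable_fun setT h -> (forall x, 0 <= h x)%E ->
  (\int[k]_x h x = \int[lebesgue_measure]_x ((normal_pdf m s x)%:E * h x))%E.
Proof.
move=> mh h0.
have mid : measurable_fun setT (fun x : measurableTypeR R => x : R) by exact: measurable_id.
rewrite (ge0_integral_law (m := mdensity lebesgue_measure (measurable_normal_pdf m s) (normal_pdf_ge0 m s)) mid)//.
exact: ge0_integral_mdensity.
Qed.

Lemma normal_mgf (t : R) :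
  (\int[lebesgue_measure]_x (normal_pdf m s x * expR (t * x))%:E = (expR (t * m + s ^+ 2 * t ^+ 2 / 2))%:E)%E.
Proof.
rewrite -[RHS]mule1 -(integral_normal_pdf (m + s ^+ 2 * t) s) -ge0_integralZl//.
- apply: eq_integral => x _; rewrite -EFinM; congr EFin; rewrite !normal_pdfE// /normal_fun.
  rewrite [RHS]mulrCA -[LHS]mulrA -!expRD; congr (_ * expR _).
  by field.
- by apply/measurable_EFinP; exact: measurable_normal_pdf.
- by move=> x _; rewrite lee_fin normal_pdf_ge0.
Qed.

(** The product of [exp (y^2 / (4 s^2))] with the normal density is a multiple of the normal density
    of mean [2 m] and deviation [sqrt 2 * s]. *)
Lemma normal_gauss_tail : gauss_tail k (fun=> 1) (s ^+ 2 *+ 4)^-1.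
Proof.
have s2 : 0 < s ^+ 2 by rewrite exprn_even_gt0.
have me : measurable_fun setT (fun y : R => expR ((s ^+ 2 *+ 4)^-1 * y ^+ 2)).
  apply: measurableT_comp; first exact: measurable_expR.
  by apply: measurable_funM => //; exact: measurable_funX.
split=> //; first by rewrite invr_gt0 mulrn_wgt0.
apply/integrableP; split; first by apply/measurable_EFinP; apply: measurable_funM.
under eq_integral do rewrite /= mulr1 ger0_norm ?expR_ge0//.
rewrite ge0_integral_normal//; last by apply/measurable_EFinP.
have s20 : Num.sqrt 2 != 0 :> R by rewrite sqrtr_eq0 -ltNge ltr0n.
have q0 : Num.sqrt 2 * s != 0 by rewrite mulf_neq0.
have p0 := normal_peak_gt0 q0.
pose C := normal_peak s / normal_peak (Num.sqrt 2 * s) * expR (m ^+ 2 / (s ^+ 2 *+ 2)).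
rewrite (eq_integral (fun x : measurableTypeR R => C%:E * (normal_pdf (2 * m) (Num.sqrt 2 * s) x)%:E)%E).
  rewrite ge0_integralZl//.
  - by rewrite integral_normal_pdf mule1 ltry.
  - by apply/measurable_EFinP; exact: measurable_normal_pdf.
  - by move=> x _; rewrite lee_fin normal_pdf_ge0.
  - by rewrite lee_fin mulr_ge0 ?expR_ge0// divr_ge0// normal_peak_ge0.
move=> x _; rewrite -!EFinM; congr EFin; rewrite !normal_pdfE// /normal_fun /C.
rewrite exprMn sqr_sqrtr//.
set p := normal_peak s; set q := normal_peak _.
have -> : forall e1 e2 : R, p / q * e1 * (q * e2) = p * (e1 * e2).
  by move=> e1 e2; rewrite mulrACA mulrA divfK ?gt_eqF// mulrA.
rewrite -mulrA -!expRD; congr (_ * expR _).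
by field.
Qed.

Lemma wmom_normal t : wmom k (fun=> 1) 0 t = expR (t * m + s ^+ 2 * t ^+ 2 / 2).
Proof.
apply: EFin_inj; rewrite -normal_mgf /wmom /Rintegral fineK; last first.
  exact: (integrable_fin_num measurableT (wmom_integrable 0 t normal_gauss_tail)).
rewrite ge0_integral_normal//.
- by apply: eq_integral => x _; rewrite -EFinM expr0 mul1r mulr1.
- apply/measurable_EFinP; apply: measurable_funM => //; apply: measurable_funM => //.
  by apply: measurableT_comp; [exact: measurable_expR|exact: measurable_funM].
- by move=> x; rewrite lee_fin expr0 mul1r mulr1 expR_ge0.
Qed.

(** The moments are the derivatives at 0 of the moment generating function. *)
Lemma normal_mean_var :
  [/\ sqint k id, \int[k]_x x = m & \int[k]_x x ^+ 2 = m ^+ 2 + s ^+ 2].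
Proof.
pose E t := expR (t * m + s ^+ 2 * t ^+ 2 / 2).
have dE (t : R) : is_derive t 1 E ((m + s ^+ 2 * t) * E t).
  rewrite /E; apply: is_derive_eq; rewrite !scaler0 ?add0r ?addr0 /GRing.scale/=.
  by field.
have w1 t : wmom k (fun=> 1) 1 t = (m + s ^+ 2 * t) * E t.
  have := is_derive_wmom 0 t normal_gauss_tail.
  have -> : wmom k (fun=> 1) 0 = E by apply/funext => u; exact: wmom_normal.
  by move=> h; rewrite -(@derive_val _ _ _ _ _ _ _ h) (@derive_val _ _ _ _ _ _ _ (dE t)).
have dE1 (t : R) : is_derive t 1 (fun t => (m + s ^+ 2 * t) * E t) ((s ^+ 2 + (m + s ^+ 2 * t) ^+ 2) * E t).
  have d1 : is_derive t 1 (fun t => m + s ^+ 2 * t) (s ^+ 2).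
    rewrite [X in is_derive _ _ _ X](_ : s ^+ 2 = 0 + s ^+ 2 *: (1 : R)); last by rewrite /GRing.scale/= mulr1 add0r.
    exact: is_deriveD (is_derive_cst m t 1) (is_deriveZ (s ^+ 2) (is_derive_id t (1 : R))).
  rewrite [X in is_derive _ _ _ X](_ : _ = (m + s ^+ 2 * t) *: ((m + s ^+ 2 * t) * E t) + E t *: s ^+ 2).
    exact: is_deriveM d1 (dE t).
  by rewrite /GRing.scale/=; ring.
have w2 t : wmom k (fun=> 1) 2 t = (s ^+ 2 + (m + s ^+ 2 * t) ^+ 2) * E t.
  have := is_derive_wmom 1 t normal_gauss_tail.
  have -> : wmom k (fun=> 1) 1 = (fun t => (m + s ^+ 2 * t) * E t) by apply/funext => u; exact: w1.
  by move=> h; rewrite -(@derive_val _ _ _ _ _ _ _ h) (@derive_val _ _ _ _ _ _ _ (dE1 t)).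
have E0 : E 0 = 1 by rewrite /E mul0r expr0n/= mulr0 mul0r addr0 expR0.
split.
- split; first exact: measurable_id.
  have := wmom_integrable 2 0 normal_gauss_tail.
  by apply: eq_integrable => // x _ /=; rewrite mul0r expR0 !mulr1.
- have := w1 0; rewrite E0 mulr1 mulr0 addr0 => <-.
  by apply: eq_Rintegral => x _; rewrite mul0r expR0 !mulr1 expr1.
- have := w2 0; rewrite E0 mulr1 mulr0 addr0 addrC => <-.
  by apply: eq_Rintegral => x _; rewrite mul0r expR0 !mulr1.
Qed.

End normal_moments.
Section continuous_densities.
Context {R : realType}.

Lemma continuous_eq_of_ae (f g : R -> R) : continuous f -> continuous g ->
  {ae lebesgue_measure, forall t, f t = g t} -> forall t, f t = g t.
Proof.
move=> cf cg [N [mN N0 sub]] t; apply: contrapT => /eqP fg.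
have e0 : 0 < `|f t - g t| by rewrite normr_gt0 subr_eq0.
have c : {for t, continuous (fun u => f u - g u)} by apply: cvgB; [exact: cf|exact: cg].
have : \forall u \near t, f u - g u != 0.
  have /cvgrPdist_lt/(_ _ e0) := c; apply: filterS => u h; apply: contraTN h => /eqP ->.
  by rewrite subr0 ltxx.
move=> /nbhs_ballP [r /= r0 hr].
have : (lebesgue_measure `](t - r)%R, (t + r)%R[%classic <= lebesgue_measure N)%E.
  apply: le_measure; rewrite ?inE//.
  move=> u; rewrite /= in_itv/= => /andP[u1 u2]; apply: sub => /= fgu.
  have := hr u; rewrite /ball/= fgu subrr eqxx => H; suff : false by []; apply: H.
  by rewrite distrC ltr_distl u1 u2.
rewrite N0 lebesgue_measure_itv/= lte_fin ltrD2l gtrN// -EFinB lee_fin.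
by apply/negP; rewrite -ltNge; lra.
Qed.

Lemma normal_pdf_sqrt (m s : R) : normal_pdf m s = normal_pdf m (Num.sqrt (s ^+ 2)).
Proof.
rewrite sqrtr_sqr; apply/funext => x; rewrite /normal_pdf normr_eq0; case: ifP => // _.
by rewrite /normal_fun /normal_peak (real_normK (num_real s)).
Qed.

End continuous_densities.

(** * Law of the arcade process *)

Section arcade_law.
Context {R : realType} (T0 T1 : R) (hT01 : T0 < T1).
Context d (Omega : measurableType d) (P : probability Omega R).
Variables (D : R -> Omega -> R) (f0 f1 g1 H1 H2 : R -> R) (fA : R -> R -> R).
Hypothesis hf : interpolating T0 T1 f0 f1.
Hypothesis ha : gauss_markov_driver P T0 T1 H1 H2 D.
Hypothesis hb : standard_coefficients T0 T1 H1 H2 f0 f1 g1.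
Hypothesis hfA : forall t, T0 < t < T1 ->
  continuous_density P (arcade T0 T1 f0 f1 D t) (fA t).

Definition bridge_det : R := H1 T1 * H2 T0 - H1 T0 * H2 T1.
Let c := bridge_det.

Let in0 : T0 <= T0 <= T1. Proof. by rewrite lexx ltW. Qed.
Let in1 : T0 <= T1 <= T1. Proof. by rewrite lexx ltW. Qed.

Lemma bridge_det_neq0 : c != 0.
Proof.
have [_ _ [f00 _] _] := hf; have [e _ _] := hb in0.
by apply/eqP => c0; move: e; rewrite f00 -/bridge_det -/c c0 invr0 mulr0 => /eqP; rewrite oner_eq0.
Qed.

(** The standard coefficients are an invertible linear combination of [H1] and [H2]; this and the
    next lemma invert it. *)
Lemma driver_H1 t : T0 <= t <= T1 -> H1 t = H1 T0 * f0 t + H1 T1 * f1 t.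
Proof.
move=> tT; have [-> -> _] := hb tT; have := bridge_det_neq0; rewrite /c /bridge_det => c0.
by field.
Qed.

Lemma driver_H2 t : T0 <= t <= T1 -> H2 t = H2 T0 * f0 t + H2 T1 * f1 t.
Proof.
move=> tT; have [-> -> _] := hb tT; have := bridge_det_neq0; rewrite /c /bridge_det => c0.
by field.
Qed.

Let cen t w := D t w - fine 'E_P[D t].
(** The centred arcade process. It is uncorrelated with both end values of the driver. *)
Let bri t w := cen t w - f0 t * cen T0 w - f1 t * cen T1 w.

Let mD t : T0 <= t <= T1 -> measurable_fun setT (D t).
Proof. by have [[mD _] _ _ _] := ha => /mD. Qed.

Let mcen t : T0 <= t <= T1 -> measurable_fun setT (cen t).
Proof. by move=> tT; apply: measurable_funB => //; exact: mD. Qed.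

Let cen_cov s t : T0 <= s <= T1 -> T0 <= t <= T1 ->
  (\int[P]_w (cen s w * cen t w)%:E = (H1 (Num.min s t) * H2 (Num.max s t))%:E)%E.
Proof.
move=> sT tT; have [_ _ h _] := ha; rewrite -h// covariance.unlock /= expectation.unlock.
by apply: eq_integral => w _; rewrite /cen expectation.unlock.
Qed.

Let sq_cen t : T0 <= t <= T1 -> sqint P (cen t).
Proof.
move=> tT; split; first exact: mcen.
apply/integrableP; split.
  by apply/measurable_EFinP; apply: measurable_funX; exact: mcen.
under eq_integral do rewrite /= ger0_norm ?sqr_ge0// expr2.
by rewrite cen_cov// ltry.
Qed.

Let sq_D t : T0 <= t <= T1 -> sqint P (D t).
Proof.
move=> tT; have := sqintD (sq_cen tT) (sqint_cst P (fine 'E_P[D t])).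
by congr sqint; apply/funext => w; rewrite /cen subrK.
Qed.

Let cen_ip s t : T0 <= s -> s <= t -> t <= T1 -> \int[P]_w (cen s w * cen t w) = H1 s * H2 t.
Proof.
move=> s0 st t1; rewrite /Rintegral cen_cov ?s0 ?(le_trans st t1) ?(le_trans s0 st)//=.
by rewrite (min_idPl st) (max_idPr st).
Qed.

Let cen_ipC s t : \int[P]_w (cen s w * cen t w) = \int[P]_w (cen t w * cen s w).
Proof. by apply: eq_Rintegral => w _; rewrite mulrC. Qed.

Let sq_bri t : T0 <= t <= T1 -> sqint P (bri t).
Proof.
by move=> tT; apply: sqintB; [apply: sqintB|]; [exact: sq_cen|exact: sqintZ (sq_cen in0)|exact: sqintZ (sq_cen in1)].
Qed.

Let bri_ip s X : T0 <= s <= T1 -> sqint P X -> \int[P]_w (bri s w * X w) =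
  \int[P]_w (cen s w * X w) - f0 s * \int[P]_w (cen T0 w * X w) - f1 s * \int[P]_w (cen T1 w * X w).
Proof.
move=> sT sX; rewrite -Rintegral_lin3; [|exact: sqintM (sq_cen _) sX..].
by apply: eq_Rintegral => w _; rewrite /bri; ring.
Qed.

Let bri_cen0 t : T0 <= t <= T1 -> \int[P]_w (bri t w * cen T0 w) = 0.
Proof.
move=> tT; have /andP[t0 t1] := tT; rewrite bri_ip//; last exact: sq_cen.
rewrite (cen_ipC t T0) (cen_ip (lexx _) t0 t1) (cen_ip (lexx T0) (lexx T0) (ltW hT01)) (cen_ipC T1 T0).
by rewrite (cen_ip (lexx T0) (ltW hT01) (lexx T1)) (driver_H2 tT); ring.
Qed.

Let bri_cen1 t : T0 <= t <= T1 -> \int[P]_w (bri t w * cen T1 w) = 0.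
Proof.
move=> tT; have /andP[t0 t1] := tT; rewrite bri_ip//; last exact: sq_cen.
rewrite (cen_ip t0 t1 (lexx _)) (cen_ip (lexx T0) (ltW hT01) (lexx T1)) (cen_ip (ltW hT01) (lexx T1) (lexx T1)).
by rewrite (driver_H1 tT); ring.
Qed.

(** Orthogonality of the bridge at [s] to both end values replaces the bridge at [t] by the centred
    driver at [t], after which only driver covariances remain. *)
Lemma bridge_cov s t : T0 <= s -> s <= t -> t <= T1 ->
  \int[P]_w (bri s w * bri t w) = c * f1 s * f0 t.
Proof.
move=> s0 st t1.
have sT : T0 <= s <= T1 by rewrite s0 (le_trans st t1).
have tT : T0 <= t <= T1 by rewrite t1 (le_trans s0 st).
have E w : bri s w * bri t w = bri t w * bri s w by rewrite mulrC.
transitivity (\int[P]_w (cen t w * bri s w)).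
  have -> : \int[P]_w (bri s w * bri t w) = \int[P]_w (bri t w * bri s w) by apply: eq_Rintegral => w _; rewrite mulrC.
  rewrite bri_ip//; last exact: sq_bri.
  have -> : \int[P]_w (cen T0 w * bri s w) = 0.
    by rewrite -(bri_cen0 sT); apply: eq_Rintegral => w _; rewrite mulrC.
  have -> : \int[P]_w (cen T1 w * bri s w) = 0.
    by rewrite -(bri_cen1 sT); apply: eq_Rintegral => w _; rewrite mulrC.
  by rewrite !mulr0 !subr0.
have -> : \int[P]_w (cen t w * bri s w) = \int[P]_w (bri s w * cen t w) by apply: eq_Rintegral => w _; rewrite mulrC.
rewrite bri_ip//; last exact: sq_cen.
rewrite (cen_ip s0 st t1) (cen_ip (lexx T0) (le_trans s0 st) t1) (cen_ipC T1 t) (cen_ip (le_trans s0 st) t1 (lexx _)).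
rewrite (driver_H1 sT) (driver_H2 tT) (driver_H1 tT) /c /bridge_det; ring.
Qed.

Definition arcade_mean t : R := \int[P]_w arcade T0 T1 f0 f1 D t w.

Lemma sqint_arcade t : T0 <= t <= T1 -> sqint P (arcade T0 T1 f0 f1 D t).
Proof.
by move=> tT; apply: sqintB; [apply: sqintB|]; [exact: sq_D|exact: sqintZ (sq_D in0)|exact: sqintZ (sq_D in1)].
Qed.

Lemma arcade_centered t w : T0 <= t <= T1 -> arcade T0 T1 f0 f1 D t w - arcade_mean t = bri t w.
Proof.
move=> tT; have E u : T0 <= u <= T1 -> fine 'E_P[D u] = \int[P]_w D u w by rewrite expectation.unlock.
rewrite /arcade_mean /arcade Rintegral_lin3; [|exact: sqint_integrable (sq_D _)..].
by rewrite /bri /cen !E//; ring.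
Qed.

Lemma arcade_variance t : T0 <= t <= T1 ->
  \int[P]_w (arcade T0 T1 f0 f1 D t w - arcade_mean t) ^+ 2 = c * f0 t * f1 t.
Proof.
move=> tT; have /andP[t0 t1] := tT.
have -> : c * f0 t * f1 t = c * f1 t * f0 t by ring.
by rewrite -bridge_cov//; apply: eq_Rintegral => w _; rewrite arcade_centered// expr2.
Qed.

Definition arcade_sd t : R := Num.sqrt (c * f0 t * f1 t).

(** The arcade process is a linear combination of three values of a Gaussian process, so mean and
    variance determine its law. Uniqueness of continuous densities then identifies [fA t]
    pointwise. *)
Lemma arcade_normal t : T0 < t < T1 -> [/\ 0 < c * f0 t * f1 t,
  forall B, measurable B -> P (arcade T0 T1 f0 f1 D t @^-1` B) = normal_prob (arcade_mean t) (arcade_sd t) B &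
  fA t = normal_pdf (arcade_mean t) (arcade_sd t)].
Proof.
move=> tT; have tT' : T0 <= t <= T1 by case/andP: tT => /ltW-> /ltW->.
have [[_ hG] _ _ _] := ha; have [cfA fA0 PfA] := hfA tT.
have mA : measurable_fun setT (arcade T0 T1 f0 f1 D t) by have [] := sqint_arcade tT'.
have := hG 3%N (fun i => if val i == 0%N then 1 else if val i == 1%N then - f0 t else - f1 t)
  (fun i => if val i == 0%N then t else if val i == 1%N then T0 else T1).
have -> : (fun w => \sum_(i < 3) (if val i == 0%N then 1 else if val i == 1%N then - f0 t else - f1 t) *
   D (if val i == 0%N then t else if val i == 1%N then T0 else T1) w) = arcade T0 T1 f0 f1 D t.
  by apply/funext => w; rewrite !big_ord_recl big_ord0 /= /arcade; ring.
have h i : T0 <= (if val (i : 'I_3) == 0%N then t else if val i == 1%N then T0 else T1) <= T1.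
  by case: ifP => // _; case: ifP.
move=> /(_ h) [m [s hs]].
have s0 : s != 0.
  apply/eqP => s0; have := hs [set m] (measurable_set1 _); rewrite s0 eqxx diracE mem_set//.
  rewrite PfA//= (@integral_Sset1 _ _ _ m)//.
  by move=> /esym/eqP; rewrite onee_eq0.
have {}hs B : measurable B -> P (arcade T0 T1 f0 f1 D t @^-1` B) = normal_prob m s B.
  by move=> mB; rewrite hs// (negbTE s0).
pose k := law P mA.
have hk B : measurable B -> k B = normal_prob m s B by move=> mB; rewrite /k lawE hs.
have [sk mk vk] := normal_mean_var s0 hk.
have me : arcade_mean t = m.
  rewrite -mk /arcade_mean /Rintegral; congr fine.
  by rewrite (integral_law (m := P) mA)//; apply/measurable_EFinP; exact: measurable_id.
have ve : c * f0 t * f1 t = s ^+ 2.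
  rewrite -arcade_variance// me.
  have -> : s ^+ 2 = \int[k]_x x ^+ 2 - m ^+ 2 by rewrite vk addrAC subrr add0r.
  rewrite /Rintegral (integral_law (m := P) (m' := k) mA)//; last first.
    by apply/measurable_EFinP; exact: measurable_funX.
  rewrite -!/(Rintegral _ _ _).
  have sA := sqint_arcade tT'; have [_ iA] := sA.
  have := @Rintegral_lin3 _ _ _ P (fun w => arcade T0 T1 f0 f1 D t w ^+ 2) (arcade T0 T1 f0 f1 D t) (cst 1) (2 * m) (- m ^+ 2) iA (sqint_integrable sA) (sqint_integrable (sqint_cst P 1)).
  rewrite Rintegral_prob_cst -/(arcade_mean t) me => e.
  transitivity (\int[P]_w (arcade T0 T1 f0 f1 D t w ^+ 2 - 2 * m * arcade T0 T1 f0 f1 D t w - (- m ^+ 2) * cst 1 w)).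
    by apply: eq_Rintegral => w _ /=; ring.
  by rewrite e; ring.
have sE : normal_pdf m s = normal_pdf (arcade_mean t) (arcade_sd t).
  by rewrite /arcade_sd ve me -normal_pdf_sqrt.
split; first by rewrite ve exprn_even_gt0.
  by move=> B mB; rewrite (hs _ mB) /normal_prob sE.
apply/funext; rewrite -sE; apply: continuous_eq_of_ae => //; first exact: continuous_normal_pdf.
have ifA : lebesgue_measure.-integrable setT (EFin \o fA t).
  apply/integrableP; split; first by apply/measurable_EFinP; exact: continuous_measurable_fun.
  under eq_integral do rewrite /= ger0_norm//.
  by rewrite -(PfA _ measurableT) preimage_setT probability_setT ltry.
have : ae_eq lebesgue_measure setT (EFin \o fA t) (EFin \o normal_pdf m s).
  apply: integral_ae_eq => //; first by apply/measurable_EFinP; exact: measurable_normal_pdf.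
  by move=> E _ mE; rewrite -[LHS]PfA// hs.
by apply: ae_lebesgueS => x /(_ I) [].
Qed.

(** The variance [c * f0 t * f1 t] is positive, so [f0] and [f1] have no zero inside the interval.
    Both are continuous and equal 1 at one end, hence positive, and then so is [c]. *)
Lemma coefficients_gt0 t : T0 < t < T1 -> [/\ 0 < f0 t, 0 < f1 t & 0 < c].
Proof.
have [cf0 cf1 [f00 f01] [f10 f11]] := hf.
have nz u : T0 < u < T1 -> f0 u != 0 /\ f1 u != 0.
  move=> /arcade_normal[+ _ _] => h; split; apply: contraTneq h => ->.
    by rewrite mulr0 mul0r ltxx.
  by rewrite mulr0 ltxx.
move=> tT; have /andP[t0 t1] := tT.
have p0 : 0 < f0 t.
  rewrite ltNge; apply/negP => le0.
  have cw : {within `[T0, t], continuous f0}.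
    by apply: continuous_subspaceW cf0 => u /=; rewrite !in_itv/= => /andP[-> /le_trans->]//; exact: ltW.
  have := @IVT R f0 T0 t 0 (ltW t0) cw; rewrite f00.
  have -> : Num.min 1 (f0 t) <= 0 <= Num.max 1 (f0 t) by rewrite ge_min le0 orbT le_max ler01.
  move=> /(_ isT) [u]; rewrite in_itv/= => /andP[u0 u1] fu.
  have u0' : T0 < u by rewrite lt_neqAle u0 andbT; apply: contra_eq_neq fu => <-; rewrite f00 oner_neq0.
  have /nz[] : T0 < u < T1 by rewrite u0' (le_lt_trans u1).
  by rewrite fu eqxx.
have p1 : 0 < f1 t.
  rewrite ltNge; apply/negP => le0.
  have cw : {within `[t, T1], continuous f1}.
    by apply: continuous_subspaceW cf1 => u /=; rewrite !in_itv/= => /andP[/(le_trans (ltW t0))-> ->].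
  have := @IVT R f1 t T1 0 (ltW t1) cw; rewrite f11.
  have -> : Num.min (f1 t) 1 <= 0 <= Num.max (f1 t) 1 by rewrite ge_min le0 le_max ler01 orbT.
  move=> /(_ isT) [u]; rewrite in_itv/= => /andP[u0 u1] fu.
  have u1' : u < T1 by rewrite lt_neqAle u1 andbT; apply: contra_eq_neq fu => ->; rewrite f11 oner_neq0.
  have /nz[] : T0 < u < T1 by rewrite u1' (lt_le_trans t0).
  by rewrite fu eqxx.
split=> //; have [+ _ _] := arcade_normal tT.
by rewrite -mulrA pmulr_lgt0// mulr_gt0.
Qed.

Lemma bridge_det_gt0 : 0 < c.
Proof.
have /coefficients_gt0[] // : T0 < (T0 + T1) / 2 < T1 by have := hT01; lra.
Qed.

(** The second moment of [f0 t] times the bridge at [s] minus [f0 s] times the bridge at [t] is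
    nonnegative. Thus [f1 / f0] does not decrease wherever it is defined; the product form covers
    the end [T1]. *)
Lemma clock_le s t : T0 <= s -> s <= t -> t <= T1 -> f1 s * f0 t <= f1 t * f0 s.
Proof.
have [_ _ [f00 f01] [f10 f11]] := hf.
have ge0 u : T0 <= u <= T1 -> 0 <= f0 u /\ 0 <= f1 u.
  move=> /andP[]; rewrite le_eqVlt => /predU1P[<- _|u0]; first by rewrite f00 f10.
  rewrite le_eqVlt => /predU1P[->|u1]; first by rewrite f01 f11.
  by have /coefficients_gt0[/ltW ? /ltW ?] : T0 < u < T1 by rewrite u0.
move=> s0 st t1.
have sT : T0 <= s <= T1 by rewrite s0 (le_trans st t1).
have tT : T0 <= t <= T1 by rewrite t1 (le_trans s0 st).
have [a0 a1] := ge0 _ sT; have [b0 b1] := ge0 _ tT.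
have Q (a b : R) : 0 <= a ^+ 2 * (c * f1 s * f0 s) + 2 * a * b * (c * f1 s * f0 t) + b ^+ 2 * (c * f1 t * f0 t).
  have <- : \int[P]_w (a * bri s w + b * bri t w) ^+ 2 = a ^+ 2 * (c * f1 s * f0 s) + 2 * a * b * (c * f1 s * f0 t) + b ^+ 2 * (c * f1 t * f0 t).
    rewrite -!bridge_cov//; try by [case/andP: sT|case/andP: tT].
    have := @Rintegral_lin3 _ _ _ P (fun w => a ^+ 2 * (bri s w * bri s w)) (fun w => bri s w * bri t w) (fun w => bri t w * bri t w) (- (2 * a * b)) (- b ^+ 2).
    have i1 := sqintM (sq_bri sT) (sq_bri sT).
    have i1' : P.-integrable setT (EFin \o (fun w => a ^+ 2 * (bri s w * bri s w))).
      by have := integrableZl measurableT (a ^+ 2) i1; apply: eq_integrable.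
    move=> /(_ i1' (sqintM (sq_bri sT) (sq_bri tT)) (sqintM (sq_bri tT) (sq_bri tT))).
    rewrite RintegralZl// !mulNr !opprK => <-.
    by apply: eq_Rintegral => w _; ring.
  by apply: Rintegral_ge0 => // w _; exact: sqr_ge0.
have c0 := bridge_det_gt0.
case: (ltgtP 0 (f1 s)) a1 => // [p1|<-] _; last by rewrite mul0r mulr_ge0.
case: (ltgtP 0 (f0 t)) b0 => // [q0|<-] _; last by rewrite mulr0 mulr_ge0.
have := Q (f0 t) (- f0 s).
have -> : f0 t ^+ 2 * (c * f1 s * f0 s) + 2 * f0 t * - f0 s * (c * f1 s * f0 t) + (- f0 s) ^+ 2 * (c * f1 t * f0 t) =
  (c * f0 t * f0 s) * (f1 t * f0 s - f1 s * f0 t) by ring.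
case: (ltgtP 0 (f0 s)) a0 => // [p0|s00] _.
  by rewrite pmulr_rge0 ?subr_ge0// !mulr_gt0.
move=> _; have s1 : s = T1.
  apply: contra_eq s00 => s1; have s1' : s < T1 by rewrite lt_neqAle s1 (le_trans st t1).
  move: s0; rewrite le_eqVlt => /predU1P[<-|s0']; first by rewrite f00 eq_sym oner_neq0.
  by have /coefficients_gt0[+ _ _] : T0 < s < T1 by [rewrite s0']; rewrite lt_neqAle => /andP[].
by have -> : t = s by apply/le_anti; rewrite st s1 t1.
Qed.

End arcade_law.

(** * Extension from the segment and derivatives of monotone functions *)

Section clamped_functions.
Context {R : realType}.

Lemma clamp_nd (a b s t : R) : s <= t -> clamp a b s <= clamp a b t.
Proof.
move=> st; have h : Num.min b s <= Num.min b t by rewrite le_min !ge_min lexx st orbT.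
by rewrite ge_max !le_max lexx h orbT.
Qed.

Lemma continuous_clamp (f : R -> R) (a b : R) : a <= b -> {within `[a, b], continuous f} ->
  continuous (fun t => f (clamp a b t)).
Proof.
move=> ab /subspace_continuousP cf t.
have ct : `[a, b]%classic (clamp a b t) by rewrite /= in_itv/= clamp_itv.
move=> U /(cf _ ct); rewrite /nbhs/= /within/= => hU.
have cc : continuous (clamp a b).
  by apply: (@lip_continuous _ _ 1) => u v; rewrite mul1r; exact: clamp_lip.
have := cc t _ hU; rewrite nbhs_simpl/=; apply: filterS => u; apply.
by rewrite in_itv/= clamp_itv.
Qed.

(** The lower limit of difference quotients is measurable and defined everywhere, and is the
    derivative where there is one. Fatou's lemma bounds its integral, the integral of each quotient
    being at most 1 because [phi] takes values in [0, 1]. *)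
Lemma monotone_derivative (phi : R -> R) (a b : R) : a < b -> continuous phi ->
  (forall s t, s <= t -> phi s <= phi t) -> (forall t, 0 <= phi t <= 1) ->
  exists g : R -> R, [/\ measurable_fun setT g, forall t, 0 <= g t,
    forall t l : R, is_derive t 1 phi l -> g t = l &
    (\int[lebesgue_measure]_(t in `[a, b]) (g t)%:E < +oo)%E].
Proof.
move=> ab cphi nd b01.
pose Dq (j : nat) (t : R) := j.+1%:R * (phi (t + j.+1%:R^-1) - phi t).
have mphi : measurable_fun setT phi by exact: continuous_measurable_fun.
have mDq j : measurable_fun setT (Dq j).
  apply: measurable_funM => //; apply: measurable_funB => //.
  by apply: measurableT_comp => //; exact: measurable_funD.
have Dq0 j t : 0 <= Dq j t by rewrite mulr_ge0// subr_ge0 nd// lerDl invr_ge0.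
pose gE t := limn_einf (fun j => (Dq j t)%:E).
have mDqE j : measurable_fun setT (EFin \o Dq j : measurableTypeR R -> _) by apply/measurable_EFinP; exact: mDq.
have mgE : measurable_fun setT (gE : measurableTypeR R -> _) by exact: (measurable_limn_einf mDqE).
have gE0 t : (0 <= gE t)%E.
  rewrite /gE limn_einf_lim; apply: lime_ge; first exact: is_cvg_einfs.
  by apply: nearW => n; apply: le_ereal_inf_tmp => _ [k _ <-]; rewrite lee_fin.
exists (fine \o gE); split.
- by apply: measurableT_comp.
- by move=> t; exact: fine_ge0.
- move=> t l dl; have := cvg_increment dl => h; rewrite /= /gE.
  rewrite (fst (cvg_limn_einf_sup (l := l%:E) _))//.
  by apply: cvg_EFin; [exact: nearW|exact: h].
apply: (@le_lt_trans _ _ 1%E); last exact: ltry.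
apply: (@le_trans _ _ (\int[lebesgue_measure]_(t in `[a, b]) gE t)%E).
  apply: ge0_le_integral => //.
  - by move=> t _; rewrite lee_fin fine_ge0.
  - by apply/measurable_funTS/measurable_EFinP; apply: measurableT_comp.
  - exact: measurable_funTS.
  - by move=> t _ /=; have := gE0 t; case: (gE t) => // _; exact: leey.
apply: le_trans (fatou lebesgue_measure (D := `[a, b]%classic) _ _ _) _ => //.
- by move=> j; apply: measurable_funTS; exact: mDqE.
- by move=> j t _; rewrite lee_fin.
have int1 j : (\int[lebesgue_measure]_(t in `[a, b]) (Dq j t)%:E <= 1)%E.
  have h0 : 0 < (j.+1%:R^-1 : R) by rewrite invr_gt0 ltr0n.
  set h := (j.+1%:R^-1 : R) in h0 *.
  have [F dF] := @ex_antiderivative R phi (a - 1) (b + h + 1) cphi ltac:(lra).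
  have dFI u v : a - 1 < u -> u < v -> v < b + h + 1 -> 0 <= F v - F u <= v - u.
    move=> au uv vb.
    have d x : x \in `]u, v[ -> is_derive x 1 F (phi x).
      by rewrite in_itv/= => /andP[ux xv]; apply: dF; apply/andP; split; lra.
    have cF : {within `[u, v], continuous F}.
      apply: derivable_within_continuous => x; rewrite in_itv/= => /andP[ux xv].
      have dx : is_derive x 1 F (phi x) by apply: dF; apply/andP; split; lra.
      exact: (@ex_derive _ _ _ _ _ _ _ dx).
    have [x _ ->] := MVT uv d cF.
    have /andP[p0 p1] := b01 x.
    by rewrite mulr_ge0 ?subr_ge0 ?(ltW uv)//= ler_piMl// subr_ge0 ltW.
  have I := integral_increment cphi ab h0 dF.
  have ip : lebesgue_measure.-integrable `[a, b] (EFin \o (fun t : R => phi (t + h) - phi t)).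
    apply: continuous_compact_integrable; first exact: segment_compact.
    apply: continuous_subspaceT => t; apply: cvgB; last exact: cphi.
    apply: (@cvg_comp _ _ _ (fun t => t + h) phi); last exact: cphi.
    by apply: cvgD; [exact: cvg_id|exact: cvg_cst].
  rewrite (eq_integral (fun t : measurableTypeR R => (j.+1%:R)%:E * (phi (t + h) - phi t)%:E)%E)//.
  rewrite integralZl//.
  have -> : (\int[lebesgue_measure]_(x in `[a, b]) (phi (x + h) - phi x)%:E =
     (\int[lebesgue_measure]_(x in `[a, b]) (phi (x + h) - phi x))%:E)%E.
    rewrite /Rintegral fineK//; exact: (integrable_fin_num _ ip).
  rewrite I -EFinM lee_fin [leRHS](_ : 1 = j.+1%:R * h); last by rewrite mulfV// pnatr_eq0.
  apply: ler_wpM2l => //.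
  have /andP[_ h1] := dFI b (b + h) ltac:(lra) ltac:(lra) ltac:(lra).
  have /andP[h2 _] := dFI a (a + h) ltac:(lra) ltac:(lra) ltac:(lra).
  by rewrite -/h; lra.
rewrite limn_einf_lim; apply: lime_le; first exact: is_cvg_einfs.
apply: nearW => n; apply: le_trans (int1 n); apply: ereal_inf_lbound; exists n => //=.
Qed.

End clamped_functions.

(** * The weight of the functional *)

Section clock_weight.
Context {R : realType} (T0 T1 : R) (hT01 : T0 < T1).
Context d (Omega : measurableType d) (P : probability Omega R).
Variables (D : R -> Omega -> R) (f0 f1 g1 H1 H2 : R -> R) (fA : R -> R -> R).
Hypothesis hf : interpolating T0 T1 f0 f1.
Hypothesis ha : gauss_markov_driver P T0 T1 H1 H2 D.
Hypothesis hb : standard_coefficients T0 T1 H1 H2 f0 f1 g1.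
Hypothesis hfA : forall t, T0 < t < T1 ->
  continuous_density P (arcade T0 T1 f0 f1 D t) (fA t).
Let c := bridge_det T0 T1 H1 H2.

Definition clock_weight t : R :=
  Num.sqrt (derive1 (H1 : R^o -> R^o) t * H2 t - H1 t * derive1 (H2 : R^o -> R^o) t) /
  (H1 T1 * H2 t - H1 t * H2 T1).

Let F0 t := f0 (clamp T0 T1 t).
Let F1 t := f1 (clamp T0 T1 t).
(** A bounded form of the clock [f1 / f0], which has no finite value at [T1]. *)
Let phi t := F1 t / (F0 t + F1 t).

Let cl t : T0 <= clamp T0 T1 t <= T1. Proof. by rewrite clamp_itv// ltW. Qed.

Lemma coefficients_ge0 t : T0 <= t <= T1 -> [/\ 0 <= f0 t, 0 <= f1 t & 0 < f0 t + f1 t].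
Proof.
have [_ _ [f00 f01] [f10 f11]] := hf.
move=> /andP[]; rewrite le_eqVlt => /predU1P[<- _|u0]; first by rewrite f00 f10 addr0.
rewrite le_eqVlt => /predU1P[->|u1]; first by rewrite f01 f11 add0r.
have [] : [/\ 0 < f0 t, 0 < f1 t & 0 < c] by apply: (coefficients_gt0 hT01 hf ha hb hfA); rewrite u0.
by move=> p q _; rewrite !ltW// addr_gt0.
Qed.

Let c0 : 0 < c. Proof. by apply: bridge_det_gt0; eassumption. Qed.

Let F0_ge0 t : 0 <= F0 t. Proof. by have [] := coefficients_ge0 (cl t). Qed.
Let F1_ge0 t : 0 <= F1 t. Proof. by have [] := coefficients_ge0 (cl t). Qed.
Let F01 t : 0 < F0 t + F1 t. Proof. by have [] := coefficients_ge0 (cl t). Qed.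

Let cF0 : continuous F0.
Proof. by have [h _ _ _] := hf; exact: continuous_clamp (ltW hT01) h. Qed.
Let cF1 : continuous F1.
Proof. by have [_ h _ _] := hf; exact: continuous_clamp (ltW hT01) h. Qed.

Let cphi : continuous phi.
Proof.
move=> t; apply: cvgM; first exact: cF1.
by apply: cvgV; [rewrite gt_eqF|apply: cvgD; [exact: cF0|exact: cF1]].
Qed.

Let phi_nd s t : s <= t -> phi s <= phi t.
Proof.
move=> st; rewrite /phi ler_pdivrMr// mulrAC ler_pdivlMr// !mulrDr [F1 t * F1 s]mulrC lerD2r.
have /andP[s0 _] := cl s; have /andP[_ t1] := cl t.
exact: (clock_le hT01 hf ha hb hfA s0 (clamp_nd _ _ st) t1).
Qed.

Let phi01 t : 0 <= phi t <= 1.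
Proof. by rewrite divr_ge0 ?(ltW (F01 t))//= ler_pdivrMr// mul1r lerDr. Qed.

(* The Wronskian of [H1] and [H2] is a multiple of the derivative of the
   monotone function [f1 / (f0 + f1)], and of that of the clock [f1 / f0]. *)
Lemma clock_wronskian t : T0 < t < T1 ->
  derivable (H1 : R^o -> R^o) t 1 -> derivable (H2 : R^o -> R^o) t 1 ->
  let W := derive1 (H1 : R^o -> R^o) t * H2 t - H1 t * derive1 (H2 : R^o -> R^o) t in
  is_derive t (1 : R) phi (W / (c * (F0 t + F1 t) ^+ 2)) /\
  is_derive t (1 : R) (fun t => f1 t / (2 * c * f0 t)) (W / (2 * c ^+ 2 * f0 t ^+ 2)).
Proof.
move=> tT d1 d2; set a := derive1 (H1 : R^o -> R^o) t; set b := derive1 (H2 : R^o -> R^o) t => /=.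
have e1 : is_derive t (1 : R) H1 (a : R) by rewrite /a derive1E; exact: derivableP d1.
have e2 : is_derive t (1 : R) H2 (b : R) by rewrite /b derive1E; exact: derivableP d2.
move: (a : R) (b : R) e1 e2 => {}a {}b e1 e2.
have tT' : T0 <= t <= T1 by case/andP: tT => /ltW-> /ltW->.
have nt : \forall u \near t, T0 <= u <= T1.
  have := @near_in_itvoo R T0 T1 t; rewrite in_itv/= => /(_ tT).
  by apply: filterS => u; rewrite in_itv/= => /andP[/ltW-> /ltW->].
have c1 := c0; rewrite /c /bridge_det in c1.
have cn : H1 T1 * H2 T0 - H1 T0 * H2 T1 != 0 by rewrite gt_eqF.
have [f00 f10 _] := coefficients_gt0 hT01 hf ha hb hfA tT.
have df0 : is_derive t (1 : R) f0 ((H1 T1 / c) *: b - (H2 T1 / c) *: a).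
  apply: near_eq_is_derive (is_deriveB (is_deriveZ (H1 T1 / c) e2) (is_deriveZ (H2 T1 / c) e1)).
  apply: filterS nt => u /hb[e _ _]; rewrite -[LHS]/(H1 T1 / c * H2 u - H2 T1 / c * H1 u) e /c /bridge_det; by field.
have df1 : is_derive t (1 : R) f1 ((H2 T0 / c) *: a - (H1 T0 / c) *: b).
  apply: near_eq_is_derive (is_deriveB (is_deriveZ (H2 T0 / c) e1) (is_deriveZ (H1 T0 / c) e2)).
  apply: filterS nt => u /hb[_ e _]; rewrite -[LHS]/(H2 T0 / c * H1 u - H1 T0 / c * H2 u) e /c /bridge_det; by field.
have Ft0 : F0 t = f0 t by rewrite /F0 clamp_id.
have Ft1 : F1 t = f1 t by rewrite /F1 clamp_id.
have dF0 : is_derive t (1 : R) F0 ((H1 T1 / c) *: b - (H2 T1 / c) *: a).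
  by apply: near_eq_is_derive df0; apply: filterS nt => u uT; rewrite /F0 clamp_id.
have dF1 : is_derive t (1 : R) F1 ((H2 T0 / c) *: a - (H1 T0 / c) *: b).
  by apply: near_eq_is_derive df1; apply: filterS nt => u uT; rewrite /F1 clamp_id.
have H1t := driver_H1 hT01 hf hb tT'; have H2t := driver_H2 hT01 hf hb tT'.
have cne : c != 0 by rewrite gt_eqF.
pose S u := F0 u + F1 u.
have Sn : S t != 0 by rewrite gt_eqF// /S.
have dS : is_derive t (1 : R) S _ := is_deriveD dF0 dF1.
have F01n : F0 t + F1 t != 0 := Sn.
have key : (H2 T0 / c * a - H1 T0 / c * b) * f0 t - f1 t * (H1 T1 / c * b - H2 T1 / c * a) =
  (a * H2 t - H1 t * b) / c by rewrite H1t H2t; field.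
split.
  apply: (@is_derive_eq _ _ _ _ _ _ _ _ (is_deriveM dF1 (is_deriveV Sn dS))).
  rewrite [RHS](_ : _ = (a * H2 t - H1 t * b) / c / (F0 t + F1 t) ^+ 2); last by rewrite invfM mulrA.
  rewrite -key /GRing.scale/= -Ft0 -Ft1 /S.
  set p := _ * b - _; set q := _ * a - _; by field.
have f0n : 2 * c * f0 t != 0 by rewrite gt_eqF// !mulr_gt0.
have f0n' : f0 t != 0 by rewrite gt_eqF.
pose V u := 2 * c * f0 u.
have dV : is_derive t (1 : R) V _ := is_deriveZ (2 * c) df0.
have Vn : V t != 0 := f0n.
apply: (@is_derive_eq _ _ _ _ _ _ _ _ (is_deriveM df1 (is_deriveV Vn dV))).
have -> : (a * H2 t - H1 t * b) / (2 * c ^+ 2 * f0 t ^+ 2) = (a * H2 t - H1 t * b) / c / (2 * c * f0 t ^+ 2).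
  by field; rewrite cne f0n'.
rewrite -key /GRing.scale/= /V.
by set p := _ * b - _; set q := _ * a - _; field; rewrite cne f0n'.
Qed.

(** The weight involves derivatives that exist only almost everywhere. Here [om] is an everywhere
    defined measurable version of it, which vanishes only where the clock has derivative 0, up to a
    null set of times. *)
Lemma clock_weight_measurable : exists om : R -> R,
  [/\ measurable_fun setT om, forall t, 0 <= om t,
      {ae lebesgue_measure, forall t : R, T0 < t < T1 -> clock_weight t = om t},
      {ae lebesgue_measure, forall t : R, T0 < t < T1 -> om t = 0 ->
        is_derive t (1 : R) (fun t => f1 t / (2 * c * f0 t)) 0} &
      lebesgue_measure.-integrable `[T0, T1] (EFin \o (fun t => om t * (F0 t / (F0 t + F1 t))))].
Proof.
have [g [mg g0 dg ig]] := monotone_derivative hT01 cphi phi_nd phi01.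
(* The Wronskian equals [c * g t * (F0 t + F1 t) ^+ 2] almost everywhere, and the denominator of the
   weight is [c * F0 t]. *)
pose om t := Num.sqrt (c * g t) * ((F0 t + F1 t) / (c * F0 t)).
have mF0 : measurable_fun setT F0 by exact: continuous_measurable_fun.
have mF1 : measurable_fun setT F1 by exact: continuous_measurable_fun.
have msq : measurable_fun setT (fun t => Num.sqrt (c * g t)).
  apply: (@measurableT_comp _ _ _ _ _ _ (@Num.sqrt R)); last exact: measurable_funM.
  exact: (continuous_measurable_fun (@sqrt_continuous R)).
have mom : measurable_fun setT om.
  apply: measurable_funM => //; apply: measurable_funM; first exact: measurable_funD.
  by apply: measurableT_comp; [exact: measurable_invr|exact: measurable_funM].
have aed : {ae lebesgue_measure, forall t : R, T0 < t < T1 ->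
   derivable (H1 : R^o -> R^o) t 1 /\ derivable (H2 : R^o -> R^o) t 1} by have [] := ha.
have ge t : T0 < t < T1 -> derivable (H1 : R^o -> R^o) t 1 /\ derivable (H2 : R^o -> R^o) t 1 ->
    derive1 (H1 : R^o -> R^o) t * H2 t - H1 t * derive1 (H2 : R^o -> R^o) t = c * g t * (F0 t + F1 t) ^+ 2.
  move=> tT [d1 d2]; have [dp _] := clock_wronskian tT d1 d2; rewrite (dg _ _ dp).
  have := F01 t; have := c0; move: (F0 t + F1 t) => x c1 x0.
  by field; rewrite !gt_eqF.
have den t : T0 < t < T1 -> H1 T1 * H2 t - H1 t * H2 T1 = c * F0 t.
  move=> tT; have tT' : T0 <= t <= T1 by case/andP: tT => /ltW-> /ltW->.
  rewrite /F0 clamp_id//; have [-> _ _] := hb tT'; rewrite /c /bridge_det.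
  by have := c0; rewrite /c /bridge_det => c1; field; rewrite gt_eqF.
exists om; split.
- exact: mom.
- by move=> t; rewrite /om mulr_ge0 ?sqrtr_ge0//; apply: divr_ge0; [exact: ltW|apply: mulr_ge0; [exact: ltW|exact: F0_ge0]].
- apply: ae_lebesgueS aed => t h tT; rewrite /clock_weight (ge _ tT (h tT)) den// /om.
  rewrite sqrtrM; last exact: mulr_ge0 (ltW c0) (g0 t).
  by rewrite sqrtr_sqr ger0_norm; [rewrite mulrA|exact: ltW].
- apply: ae_lebesgueS aed => t h tT om0; have [d1 d2] := h tT.
  have [_] := clock_wronskian tT d1 d2; rewrite (ge _ tT (h tT)).
  suff -> : g t = 0 by rewrite mulr0 !mul0r.
  have tT' : T0 <= t <= T1 by case/andP: tT => /ltW-> /ltW->.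
  have [f00 _ _] := coefficients_gt0 hT01 hf ha hb hfA tT.
  have : (F0 t + F1 t) / (c * F0 t) != 0.
    by rewrite gt_eqF// divr_gt0// mulr_gt0// /F0 clamp_id.
  move: om0; rewrite /om => /eqP; rewrite mulf_eq0 => /orP[|/eqP->]; last by rewrite eqxx.
  rewrite sqrtr_eq0 => h1 _; apply/eqP; rewrite eq_le g0 andbT.
  by move: h1; rewrite pmulr_rle0.
have ig' : lebesgue_measure.-integrable `[T0, T1] (EFin \o g).
  apply/integrableP; split; first by apply/measurable_funTS/measurable_EFinP.
  by under eq_integral do rewrite /= ger0_norm//.
have i1 : lebesgue_measure.-integrable `[T0, T1] (EFin \o cst (1 : R)).
  apply: continuous_compact_integrable; first exact: segment_compact.
  by apply: continuous_subspaceT => t; exact: cvg_cst.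
have ib : lebesgue_measure.-integrable `[T0, T1] (EFin \o (fun t => g t + c^-1 * cst 1 t)).
  have mI : measurable (`[T0, T1]%classic : set (measurableTypeR R)) by exact: measurable_itv.
  by have := integrableD mI ig' (integrableZl mI c^-1 i1); apply: eq_integrable.
apply: (le_integrable _ _ _ ib) => //.
  apply/measurable_funTS/measurable_EFinP; apply: measurable_funM => //.
  by apply: measurable_funM => //; apply: measurableT_comp; [exact: measurable_invr|exact: measurable_funD].
move=> t _; rewrite lee_fin; apply: le_trans (ler_norm _); rewrite mulr1.
(* The factor [F0 / (F0 + F1)] cancels the pole of the weight and leaves [sqrt (c g) / c], which is
   at most [g + 1 / c]. *)
have E : `|om t * (F0 t / (F0 t + F1 t))| <= Num.sqrt (c * g t) / c.
  have [z|nz] := eqVneq (F0 t) 0.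
    by rewrite z mul0r mulr0 normr0 divr_ge0 ?sqrtr_ge0 ?ltW.
  have [c1 x1 x2 x3] := And4 (ltW c0) (F0_ge0 t) (F1_ge0 t) (ltW (F01 t)).
  rewrite /om ger0_norm; last by rewrite !mulr_ge0// ?invr_ge0 ?mulr_ge0// sqrtr_ge0.
  have n1 : F0 t + F1 t != 0 by rewrite gt_eqF.
  have n2 : c != 0 by rewrite gt_eqF.
  by rewrite -mulrA ler_wpM2l ?sqrtr_ge0// le_eqVlt; apply/orP; left; apply/eqP; field; rewrite ?nz ?n1 ?n2.
apply: le_trans E _; rewrite ler_pdivrMr//.
have -> : (g t + c^-1) * c = c * g t + 1 by rewrite mulrDl mulVf 1?mulrC//; rewrite gt_eqF.
have := sqr_sqrtr (mulr_ge0 (ltW c0) (g0 t)); move: (sqrtr_ge0 (c * g t)).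
by set s := Num.sqrt _ => s0 <-; have := sqr_ge0 (s - 1); nra.
Qed.

End clock_weight.

(** * Conditional laws *)

Section kernel_laws.
Context {R : realType}.

(** Conditional laws are compared for almost every [x] at each level; countably many levels are
    needed to exchange the quantifiers. *)
Lemma measure_eq_rat_ray (m1 m2 : probability R R) :
  (forall q : rat, m1 `]-oo, ratr q]%classic = m2 `]-oo, ratr q]%classic) ->
  forall A, measurable A -> m1 A = m2 A.
Proof.
move=> h; have p1 (p : probability R R) : p setT = 1%E by exact: probability_setT.
have l1 : (m1 setT < +oo)%E by rewrite p1 ltry.
have e12 : m1 setT = m2 setT by rewrite !p1.
apply: (measure_eq_ray l1 e12).
have H (p q : probability R R) y : (forall r : rat, p `]-oo, ratr r]%classic = q `]-oo, ratr r]%classic) ->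
    cdfr q y <= cdfr p y.
  move=> pq; rewrite leNgt; apply/negP => lt.
  have [_ rcp _ _ _] := is_cdf_cdfr p; have [ndq _ _ _ _] := is_cdf_cdfr q.
  have e0 : 0 < cdfr q y - cdfr p y by rewrite subr_gt0.
  have /cvgrPdist_lt/(_ _ e0) := rcp y.
  rewrite near_withinE => /nbhs_ballP[r /= r0 hr].
  have [a] : exists a : rat, ratr a \in `]y, y + r[ by apply: rat_in_itvoo; rewrite ltrDl.
  rewrite in_itv/= => /andP[ya ay].
  have := hr (ratr a); rewrite /ball/= => /(_ _ ya).
  have -> : cdfr p (ratr a) = cdfr q (ratr a) by rewrite /cdfr pq.
  have := ndq _ _ (ltW ya) => le1.
  have b : `|y - ratr a| < r by rewrite distrC gtr0_norm ?subr_gt0// ltrBlDl.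
  by move=> /(_ b); rewrite ltr_norml => /andP[+ _]; lra.
move=> y; apply: etrans (esym (cdfrE m1 y)) (etrans (congr1 EFin _) (cdfrE m2 y)).
by apply/le_anti/andP; split; apply: H => // r; rewrite h.
Qed.

(** The measure [k x] already has mass 1, so normalising changes nothing; it only supplies the
    [probability] structure. *)
Definition klaw (k : R.-pker R ~> R) (x : R) : probability R R := mnormalize (k x) unif.

Lemma klawE (k : R.-pker R ~> R) x A : klaw k x A = k x A.
Proof. by rewrite /klaw /= /mnormalize /= prob_kernel onee_eq0/= invr1 mule1. Qed.

Lemma klaw_Rintegral (k : R.-pker R ~> R) x (f : R -> R) : \int[k x]_y f y = \int[klaw k x]_y f y.
Proof. by congr fine; apply: eq_measure_integral => A _ _; exact/esym/klawE. Qed.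

Variables (mu nu : probability R R).
Implicit Types (pi : probability (R * R)%type R) (k : R.-pker R ~> R).

Let Q k (w : R * R) := quantile (fun y => fine (k w.1 `]-oo, y]%classic)) w.2.

Lemma klaw_quantile k x A : measurable A -> klaw k x A = unif ((fun u => Q k (x, u)) @^-1` A).
Proof.
move=> mA; rewrite -(law_quantile (klaw k x) mA); congr unif.
have -> : cdfr (klaw k x) = (fun y => fine (k x `]-oo, y]%classic)).
  by apply/funext => y; rewrite /cdfr klawE.
by [].
Qed.

Lemma measurable_klaw_quantile pi k : conditional_law mu pi k -> measurable_fun setT (Q k).
Proof. by move=> /conditional_law_cdf; exact: measurable_cdf_quantile. Qed.

Lemma ge0_disintegration pi k (F : R * R -> \bar R) : conditional_law mu pi k ->
  measurable_fun setT F -> (forall w, 0 <= F w)%E ->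
  (\int[pi]_w F w = \int[mu]_x \int[klaw k x]_y F (x, y))%E.
Proof.
move=> hk mF F0; have mQ := measurable_klaw_quantile hk.
have hF := conditional_law_cdf hk.
rewrite (ge0_integral_law (m := (mu \x @unif R)%E) (m' := pi) (measurable_pair_quantile hF))//; last first.
  by move=> C mC; exact: law_cdf_quantile hF _ mC.
have mG : measurable_fun setT (fun w => F (w.1, Q k w)).
  by apply: measurableT_comp => //; exact: measurable_fun_pair.
rewrite (fubini_tonelli1 (m1 := mu) (m2 := @unif R) (fun w => F (w.1, Q k w)) mG)//.
apply: eq_integral => x _; rewrite /fubini_F /=.
rewrite (ge0_integral_law (m := unif) (m' := klaw k x) (Z := fun u => Q k (x, u)))//.
- by apply: measurableT_comp mQ _; exact: measurable_fun_pair.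
- by move=> A mA; exact: klaw_quantile.
- by apply: measurableT_comp mF _; exact: measurable_fun_pair.
Qed.

(** The martingale identity, tested on all sets of first coordinates, equates the integral of the
    conditional mean with that of [x] over each set. *)
Lemma klaw_mean pi k : martingale_coupling mu nu pi -> conditional_law mu pi k ->
  mu.-integrable setT (EFin \o id) -> nu.-integrable setT (EFin \o id) ->
  {ae mu, forall x, (klaw k x).-integrable setT (EFin \o id) /\ \int[klaw k x]_y y = x}.
Proof.
move=> hpi hk imu inu; have mQ := measurable_klaw_quantile hk.
have hF := conditional_law_cdf hk.
have mXQ := measurable_pair_quantile hF.
have piE C : measurable C -> pi C = (mu \x @unif R)%E ((fun w => (w.1, Q k w)) @^-1` C).
  by move=> mC; exact: law_cdf_quantile hF _ mC.
have iQ : (mu \x @unif R)%E.-integrable setT (EFin \o Q k).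
  have m2 : measurable_fun setT (EFin \o (fun w : R * R => w.2)) by apply/measurable_EFinP; exact: measurable_snd.
  have [_ pnu _ _] := hpi.
  have i2 : pi.-integrable setT (EFin \o (fun w : R * R => w.2)).
    apply: (fst (integrable_law (m := pi) (m' := nu) measurable_snd _ _)) inu; last by apply/measurable_EFinP; exact: measurable_id.
    by move=> A mA; exact/esym/pnu.
  exact: (fst (integrable_law (m := (mu \x @unif R)%E) (m' := pi) mXQ piE m2) i2).
have lawE x (f : R -> \bar R) : measurable_fun setT f ->
    (klaw k x).-integrable setT f <-> unif.-integrable setT (fun u => f (Q k (x, u))).
  move=> mf; apply: (integrable_law (m := unif) (m' := klaw k x)) => //.
    by apply: measurableT_comp mQ _; exact: measurable_fun_pair.
  by move=> A mA; exact: klaw_quantile.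
have intE x : \int[klaw k x]_y y = \int[unif]_u Q k (x, u).
  congr fine; apply: (integral_law (m := unif) (m' := klaw k x)) => //.
  - by apply: measurableT_comp mQ _; exact: measurable_fun_pair.
  - by move=> A mA; exact: klaw_quantile.
have ae1 := ae_integrable1 (m1 := mu) (m2 := @unif R) iQ.
have iF := integrable_fubini_F (m1 := mu) (m2 := @unif R) iQ.
have ae2 : ae_eq mu setT (fubini_F (@unif R) (EFin \o Q k)) (EFin \o id).
  have mi : measurable_fun [set: R] (EFin \o (@id R)) by apply/measurable_EFinP; exact: measurable_id.
  apply: (integral_ae_eq measurableT iF mi) => A _ mA.
  have mI : measurable_fun setT (fun w : R * R => \1_A w.1 : R).
    by apply: measurableT_comp; [exact: measurable_indic|exact: measurable_fst].
  have i1Q : (mu \x @unif R)%E.-integrable setT (EFin \o (fun w => \1_A w.1 * Q k w)).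
    apply: (le_integrable _ _ _ iQ) => //; first by apply/measurable_EFinP; exact: measurable_funM.
    by move=> w _; rewrite lee_fin normrM indicE; case: (_ \in _); rewrite ?normr1 ?mul1r ?normr0 ?mul0r.
  have [p1 _ _ _] := hpi.
  have e := martingale_coupling_test hpi mA.
  have m12 : measurable_fun setT (fun w : R * R => (\1_A w.1 * w.2)%:E).
    by apply/measurable_EFinP; apply: measurable_funM => //; exact: measurable_snd.
  rewrite (integral_law (m := (mu \x @unif R)%E) (m' := pi) mXQ piE m12) in e.
  transitivity (\int[mu]_x fubini_F (@unif R) (EFin \o (fun w : R * R => (\1_A w.1 * Q k w)%R)) x)%E.
    rewrite integral_mkcond; apply: eq_integral => x _; rewrite patchE /fubini_F /= indicE.
    case: (_ \in _); first by under [RHS]eq_integral do rewrite mul1r.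
    by under [RHS]eq_integral do rewrite mul0r; rewrite integral0.
  rewrite (integral12_prod_meas1 (m1 := mu) (m2 := @unif R) i1Q) [LHS]e.
  rewrite -(integral_law (m := pi) (m' := mu) measurable_fst (fun B mB => esym (p1 B mB)) (f := fun x => (\1_A x * x)%:E)).
    rewrite [RHS]integral_mkcond; apply: eq_integral => x _; rewrite patchE indicE /=.
    by case: (_ \in _); rewrite ?mul1r ?mul0r.
  by apply/measurable_EFinP; apply: measurable_funM => //; exact: measurable_indic.
apply: filterS2 ae1 ae2 => x i1 /(_ Logic.I); rewrite /fubini_F /= => e.
split; first by apply/lawE => //; apply/measurable_EFinP; exact: measurable_id.
by rewrite intE /Rintegral e.
Qed.

Definition half_mix d (T : measurableType d) (m0 m1 : probability T R) : probability T R :=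
  mnormalize (measure_add (mscale (2^-1)%:nng m0) (mscale (2^-1)%:nng m1)) m0.

Lemma half_mixP d (T : measurableType d) (m0 m1 : probability T R) :
  half_mixture m0 m1 (half_mix m0 m1).
Proof.
move=> A mA; have p1 (p : probability T R) : p setT = 1%E by exact: probability_setT.
have E B : measure_add (mscale (2^-1)%:nng m0) (mscale (2^-1)%:nng m1) B = (2^-1%:E * m0 B + 2^-1%:E * m1 B)%E.
  by rewrite measure_addE.
have ET : measure_add (mscale (2^-1)%:nng m0) (mscale (2^-1)%:nng m1) setT = 1%E.
  by rewrite E !p1 !mule1 -EFinD; congr EFin; lra.
have L (M : {measure set T -> \bar R}) : M setT = 1%E -> mnormalize M m0 A = M A.
  by move=> e; rewrite /mnormalize e onee_eq0/= invr1 mule1.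
exact: etrans (L _ ET) (E A).
Qed.

Lemma martingale_coupling_half pi0 pi1 : mu.-integrable setT (EFin \o id) ->
  nu.-integrable setT (EFin \o id) -> martingale_coupling mu nu pi0 ->
  martingale_coupling mu nu pi1 ->
  exists2 pih, martingale_coupling mu nu pih & half_mixture pi0 pi1 pih.
Proof.
move=> imu inu h0 h1; pose ph := half_mix pi0 pi1; have hm : half_mixture pi0 pi1 ph by exact: half_mixP.
have mid : measurable_fun setT (fun w : R * R => (w.1, w.2)).
  by apply: measurable_fun_pair; [exact: measurable_fst|exact: measurable_snd].
have half (x : \bar R) : (2^-1%:E * x + 2^-1%:E * x = x)%E.
  by rewrite -ge0_muleDl ?lee_fin ?invr_ge0// -EFinD (_ : 2^-1 + 2^-1 = 1 :> R) ?mul1e//; lra.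
have [p10 p20 i0 _] := h0; have [p11 p21 i1 _] := h1.
exists (law ph mid).
  apply: (martingale_coupling_law measurable_fst measurable_snd) => //.
  - move=> A mA; have mA' : measurable (fst @^-1` A : set (R * R)) by rewrite -[X in measurable X]setTI; exact: measurable_fst.
    by rewrite hm// p10// p11// half.
  - move=> A mA; have mA' : measurable (snd @^-1` A : set (R * R)) by rewrite -[X in measurable X]setTI; exact: measurable_snd.
    by rewrite hm// p20// p21// half.
  - move=> A mA.
    have mI : measurable_fun setT (fun w : R * R => \1_A w.1 : R).
      by apply: measurableT_comp; [exact: measurable_indic|exact: measurable_fst].
    have H (p : probability (R * R)%type R) (f : R * R -> R) : measurable_fun setT f -> p.-integrable setT (fun w : R * R => (`|w.1| + `|w.2|)%:E) ->
       (forall w, `|f w| <= `|w.1| + `|w.2|) -> p.-integrable setT (EFin \o f).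
      by move=> mf ip hf; exact: (@integrable_dom _ _ _ p f (fun w => `|w.1| + `|w.2|)).
    have b1 (w : R * R) : `|\1_A w.1 * w.2| <= `|w.1| + `|w.2|.
      by rewrite normrM indicE; case: (_ \in _); rewrite ?normr1 ?mul1r ?normr0 ?mul0r ?lerDr// addr_ge0.
    have b2 (w : R * R) : `|\1_A w.1 * w.1| <= `|w.1| + `|w.2|.
      by rewrite normrM indicE; case: (_ \in _); rewrite ?normr1 ?mul1r ?normr0 ?mul0r ?lerDl// addr_ge0.
    have m1 : measurable_fun setT (fun w : R * R => \1_A w.1 * w.2) by apply: measurable_funM => //; exact: measurable_snd.
    have m2 : measurable_fun setT (fun w : R * R => \1_A w.1 * w.1) by apply: measurable_funM => //; exact: measurable_fst.
    have [j1 e1] := half_mixture_integrable hm (H _ _ m1 i0 b1) (H _ _ m1 i1 b1).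
    have [j2 e2] := half_mixture_integrable hm (H _ _ m2 i0 b2) (H _ _ m2 i1 b2).
    have f1 := integrable_fin_num measurableT j1; have f2 := integrable_fin_num measurableT j2.
    apply: etrans (esym (fineK f1)) (etrans (congr1 EFin _) (fineK f2)).
    have t0 := martingale_coupling_test h0 mA; have t1 := martingale_coupling_test h1 mA.
    by move: e1 e2; rewrite /Rintegral t0 t1 => -> ->.
move=> C mC; apply: etrans (lawE ph mid C) _; rewrite (_ : _ @^-1` C = C); first exact: hm.
by apply/seteqP; split=> -[].
Qed.

(** Uniqueness of densities against [mu] at every rational level, followed by a countable
    intersection of full sets. *)
Lemma klaw_ae_mixture pi0 pi1 pih k0 k1 kh : half_mixture pi0 pi1 pih ->
  conditional_law mu pi0 k0 -> conditional_law mu pi1 k1 -> conditional_law mu pih kh ->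
  {ae mu, forall x, half_mixture (klaw k0 x) (klaw k1 x) (klaw kh x)}.
Proof.
move=> hm c0 c1 ch.
(* An enumeration of the rationals, with 0 for the numbers that code none. *)
pose r (n : nat) : R := if @unpickle rat n is Some q then ratr q else 0.
have ib (k : R.-pker R ~> R) y : mu.-integrable setT (EFin \o (fun x => fine (k x `]-oo, y]%classic : \bar R))).
  have mk := measurable_kernel k `]-oo, y]%classic (measurable_itv _).
  apply: (@integrable_bdd _ _ _ mu _ 1); first by apply: measurableT_comp => //; exact: mk.
  move=> x; have h0 : (0 <= k x `]-oo, y]%classic)%E by exact: measure_ge0.
  rewrite ger0_norm ?fine_ge0//.
  have : (klaw k x `]-oo, y]%classic <= 1)%E by exact: probability_le1.
  rewrite klawE; case: (k x _) h0 => //= z z0; by rewrite lee_fin.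
have fk (k : R.-pker R ~> R) x y : (fine (k x `]-oo, y]%classic))%:E = k x `]-oo, y]%classic.
  by rewrite -klawE fineK// fin_num_measure.
have E y : {ae mu, forall x, fine (kh x `]-oo, y]%classic) =
    2^-1 * fine (k0 x `]-oo, y]%classic) + 2^-1 * fine (k1 x `]-oo, y]%classic)}.
  have mk (k : R.-pker R ~> R) := measurable_kernel k `]-oo, y]%classic (measurable_itv _).
  have : ae_eq mu setT (EFin \o (fun x => fine (kh x `]-oo, y]%classic)))
     (EFin \o (fun x => 2^-1 * fine (k0 x `]-oo, y]%classic) + 2^-1 * fine (k1 x `]-oo, y]%classic))).
    apply: (integral_ae_eq measurableT (ib kh y)).
      by apply/measurable_EFinP; apply: measurable_funD; apply: measurable_funM => //; apply: measurableT_comp => //; exact: mk.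
    move=> A _ mA.
    have ibA (k : R.-pker R ~> R) : mu.-integrable A (EFin \o (fun x => fine (k x `]-oo, y]%classic : \bar R))).
      by apply: integrableS (ib k y).
    transitivity (pih (A `*` `]-oo, y]%classic)).
      by rewrite ch//; apply: eq_integral => x _; rewrite /= fk.
    rewrite hm; last exact: measurableX.
    rewrite c0// c1//.
    have -> : (\int[mu]_(x in A) k0 x `]-oo, y]%classic = \int[mu]_(x in A) (EFin \o (fun x => fine (k0 x `]-oo, y]%classic : \bar R))) x)%E.
      by apply: eq_integral => x _; rewrite /= fk.
    have -> : (\int[mu]_(x in A) k1 x `]-oo, y]%classic = \int[mu]_(x in A) (EFin \o (fun x => fine (k1 x `]-oo, y]%classic : \bar R))) x)%E.
      by apply: eq_integral => x _; rewrite /= fk.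
    rewrite -!integralZl// -integralD//; [exact: integrableZl|exact: integrableZl].
  by apply: filterS => x /(_ Logic.I) [].
have := ae_foralln (fun n => E (r n)).
apply: filterS => x hx.
have H : forall A, measurable A -> klaw kh x A = half_mix (klaw k0 x) (klaw k1 x) A.
  apply: measure_eq_rat_ray => q; rewrite half_mixP// !klawE.
  have := hx (pickle q); rewrite /r pickleK => e.
  apply: etrans (esym (fk kh x _)) _; rewrite e EFinD.
  by congr (_ + _)%E; rewrite EFinM; congr (_ * _)%E; exact: fk.
by move=> A mA; rewrite H// half_mixP.
Qed.

Lemma coupling_eq_of_klaw pi0 pi1 k0 k1 : conditional_law mu pi0 k0 -> conditional_law mu pi1 k1 ->
  {ae mu, forall x A, measurable A -> klaw k0 x A = klaw k1 x A} ->
  forall C, measurable C -> pi0 C = pi1 C.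
Proof.
move=> c0 c1 h; have l1 : (pi0 setT < +oo)%E by rewrite probability_setT ltry.
apply: (measure2_eq_rect l1).
move=> A B mA mB; apply: etrans (c0 A B mA mB) (etrans _ (esym (c1 A B mA mB))).
apply: ae_eq_integral => //.
- by apply: measurable_funTS; exact: measurable_kernel.
- by apply: measurable_funTS; exact: measurable_kernel.
- by apply: filterS h => x hx _; rewrite -!klawE; exact: hx.
Qed.

End kernel_laws.

(** * Singular clocks on the whole interval *)

Section locally_constant.
Context {R : realType}.

(** Induction on the exceptional points: the function is constant on both sides of a point, and
    continuity there joins the two values. *)
Lemma locally_constant_off_finite (rho : R -> R) (s : seq R) (a b : R) :
  (forall t, a < t < b -> {for t, continuous rho}) ->
  (forall t, a < t < b -> t \notin s ->
    exists2 e, 0 < e & forall u, `|u - t| < e -> rho u = rho t) ->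
  forall u v, a < u < b -> a < v < b -> rho u = rho v.
Proof.
elim: s a b => [|x s IH] a b cr lc u v.
  wlog uv : u v / u <= v.
    by move=> H hu hv; case/orP: (le_total u v) => h; [exact: H|exact/esym/H].
  move=> /andP[au ub] /andP[av vb].
  have d y : a < y < b -> is_derive y (1 : R) rho 0.
    move=> hy; have [e e0 he] := lc y hy isT.
    apply: near_eq_is_derive (is_derive_cst (rho y) y (1 : R)).
    apply/nbhs_ballP; exists e => // z; rewrite /ball/= distrC => /he ->.
    by [].
  have cw : {within `[u, v], continuous rho}.
    apply: derivable_within_continuous => y; rewrite in_itv/= => /andP[uy yv].
    have dy : is_derive y (1 : R) rho 0 by apply: d; rewrite (lt_le_trans au uy) (le_lt_trans yv vb).
    exact: (@ex_derive _ _ _ _ _ _ _ dy).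
  have dd y : y \in `]u, v[ -> is_derive y (1 : R) rho 0.
    by rewrite in_itv/= => /andP[uy yv]; apply: d; rewrite (lt_trans au uy) (lt_trans yv vb).
  have [y _] := MVT_segment uv dd cw.
  by rewrite mul0r => /eqP; rewrite subr_eq0 => /eqP ->.
have [xab|xab] := boolP (a < x < b); last first.
  apply: IH => // t ht ts; apply: lc => //; rewrite inE negb_or ts andbT.
  by apply: contraNneq xab => <-.
have /andP[ax xb] := xab.
have IHl : forall u v, a < u < x -> a < v < x -> rho u = rho v.
  apply: IH => t /andP[at' tx]; first by apply: cr; rewrite at' (lt_trans tx).
  move=> ts; apply: lc; first by rewrite at' (lt_trans tx).
  by rewrite inE negb_or ts andbT lt_eqF.
have IHr : forall u v, x < u < b -> x < v < b -> rho u = rho v.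
  apply: IH => t /andP[xt tb]; first by apply: cr; rewrite tb (lt_trans ax).
  move=> ts; apply: lc; first by rewrite tb (lt_trans ax).
  by rewrite inE negb_or ts andbT gt_eqF.
suff H w : a < w < b -> rho w = rho x by move=> /H -> /H ->.
move=> /andP[aw wb]; apply/eqP; rewrite -subr_eq0 -normr_eq0; apply/negPn/negP => n0.
have e0 : 0 < `|rho w - rho x| by rewrite lt_neqAle eq_sym n0 normr_ge0.
have /cvgrPdist_lt/(_ _ e0) /nbhs_ballP[r /= r0 hr] := cr x xab.
case: (ltgtP w x) => [wx|xw|wx]; last by rewrite wx subrr normr0 eqxx in n0.
- pose y := Num.max ((w + x) / 2) (x - r / 2).
  have y1 : w < y by rewrite /y lt_max; apply/orP; left; lra.
  have y2 : y < x by rewrite /y gt_max; apply/andP; split; lra.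
  have y3 : x - r / 2 <= y by rewrite /y le_max lexx orbT.
  have := hr y; rewrite /ball/= => /(_ ltac:(rewrite gtr0_norm; lra)).
  by rewrite (IHl y w) ?(lt_trans aw y1)// ?aw//= distrC ltxx.
- pose y := Num.min ((w + x) / 2) (x + r / 2).
  have y1 : y < w by rewrite /y gt_min; apply/orP; left; lra.
  have y2 : x < y by rewrite /y lt_min; apply/andP; split; lra.
  have y3 : y <= x + r / 2 by rewrite /y ge_min lexx orbT.
  have := hr y; rewrite /ball/= => /(_ ltac:(rewrite ltr0_norm; lra)).
  by rewrite (IHr y w) ?y2 ?(lt_trans y1 wb)// ?xw//= distrC ltxx.
Qed.

(** Continuity bounds the time derivative near [(t0, x)] by its value there plus 1; the mean value
    theorem in time at fixed [y] concludes. *)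
Lemma C1_on_lip (S : set (R * R)) (F : R * R -> R^o) (t0 x e0 : R) : C1_on S F -> 0 < e0 ->
  (forall t y, `|t - t0| < e0 -> S (t, y)) ->
  exists eta C, [/\ 0 < eta, 0 <= C & forall t t' y, `|t - t0| < eta -> `|t' - t0| < eta ->
    `|y - x| < eta -> `|F (t, y) - F (t', y)| <= C * `|t - t'|].
Proof.
move=> CF e00 hS.
have S0 : S (t0, x) by apply: hS; rewrite subrr normr0.
have [_ _ cD _] := CF _ S0.
have /cvgrPdist_lt/(_ _ (@ltr01 R))/nbhs_ballP[r /= r0 hr] := cD.
pose C := `|'D_(1, 0) F (t0, x)| + 1.
exists (Num.min e0 r), C; split.
- by rewrite lt_min e00.
- by rewrite addr_ge0.
move=> t t' y; rewrite !lt_min => /andP[t1 t2] /andP[t1' t2'] /andP[_ y2].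
pose g (u : R) : R := F (u, y).
have dg u : `|u - t0| < e0 -> is_derive u (1 : R) g ('D_(1, 0) F (u, y)).
  move=> hu; have [dF _ _ _] := CF _ (hS u y hu).
  have E : (fun h : R => h^-1 *: ((g \o shift u) (h *: (1 : R)) - g u)) =
      (fun h : R => h^-1 *: ((F \o shift (u, y)) (h *: ((1, 0) : R * R)) - F (u, y))).
    apply/funext => h; rewrite /g /=; congr (_ *: (F _ - _)).
    by rewrite /shift /=; congr pair; rewrite /= scaler0 add0r.
  by split; [rewrite /derivable E; exact: dF|rewrite /derive E].
have bD u : `|u - t0| < r -> `|'D_(1, 0) F (u, y)| <= C.
  move=> hu; have := hr (u, y); rewrite /ball/= /prod_ball /= /ball/=.
  move=> /(_ (conj _ _)); rewrite distrC hu distrC y2 => /(_ isT isT) h.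
  rewrite /C -lerBlDl; apply: le_trans (ltW h).
  by rewrite distrC; exact: lerB_dist.
wlog tt : t t' t1 t2 t1' t2' / t <= t'.
  move=> H; case/orP: (le_total t t') => h; first exact: H.
  by rewrite distrC (distrC t); exact: H.
have mid u : t <= u <= t' -> `|u - t0| < e0 /\ `|u - t0| < r.
  by move=> hu; split; [exact: open_ballU_itv t1 t1' hu|exact: open_ballU_itv t2 t2' hu].
have cw : {within `[t, t'], continuous g}.
  apply: derivable_within_continuous => u; rewrite in_itv/= => /mid[hu _].
  exact: (@ex_derive _ _ _ _ _ _ _ (dg u hu)).
have dd u : u \in `]t, t'[ -> is_derive u (1 : R) g ('D_(1, 0) F (u, y)).
  by rewrite in_itv/= => /andP[/ltW a1 /ltW a2]; apply: dg; case: (mid u); rewrite ?a1.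
have [u] := MVT_segment tt dd cw; rewrite in_itv/= => /mid[_ /bD hu] e.
by rewrite -[F (t, y)]/(g t) -[F (t', y)]/(g t') distrC e normrM (distrC t) ler_wpM2r.
Qed.

End locally_constant.

(** * Continuity of the tilt *)

Section recentring.
Context {R : realType}.

(* A continuous value of a function that increases strictly with its tilt
   forces the tilt to be continuous. *)
Lemma recentring (m : R -> R -> R) (b rho : R -> R) (t0 eta C D L : R) :
  let reg (t r : R) := `|t| <= `|- b t0| + 1 /\ rho t0 / 2 <= r <= 2 * rho t0 in
  {for t0, continuous rho} -> 0 < rho t0 -> 0 < eta -> 0 <= C -> 0 < D -> 0 < L ->
  (forall r u v, 0 < r -> u <= v -> m r u <= m r v) ->
  (forall t t' r, reg t r -> reg t' r -> t <= t' -> D * (t' - t) <= m r t' - m r t) ->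
  (forall t r t' r', reg t r -> reg t' r' -> `|m r t - m r' t'| <= L * (`|t - t'| + `|r - r'|)) ->
  (forall t, `|t - t0| < eta -> `|m (rho t) (- b t) - m (rho t0) (- b t0)| <= C * `|t - t0|) ->
  {for t0, continuous b}.
Proof.
rewrite /=; set th := - b t0 => crho r0 eta0 C0 D0 L0 mnd hD hL hl.
have rm0 : 0 < rho t0 / 2 by rewrite divr_gt0.
apply/cvgrPdist_le => e e0.
(* At most 1, so that [th + e1] and [th - e1] stay in the region where the bounds on [m] hold. *)
pose e1 := Num.min e 1.
have e10 : 0 < e1 by rewrite lt_min e0 ltr01.
have e1e : e1 <= e by rewrite /e1 ge_min lexx.
have e11 : e1 <= 1 by rewrite /e1 ge_min lexx orbT.
have De : 0 < D * e1 := mulr_gt0 D0 e10.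
have d1 : 0 < Num.min (rho t0 / 2) (D * e1 / (2 * L)).
  by rewrite lt_min rm0 divr_gt0// mulr_gt0.
have C1 : 0 < 2 * (C + 1) by rewrite mulr_gt0// ltr_wpDl.
have d2 : 0 < Num.min eta (D * e1 / (2 * (C + 1))) by rewrite lt_min eta0 divr_gt0.
near=> t.
have tr : `|rho t0 - rho t| < Num.min (rho t0 / 2) (D * e1 / (2 * L)).
  by near: t; move/cvgrPdist_lt : crho => /(_ _ d1).
have tt : `|t - t0| < Num.min eta (D * e1 / (2 * (C + 1))).
  by near: t; apply/nbhs_ballP; exists (Num.min eta (D * e1 / (2 * (C + 1)))) => // u; rewrite /ball/= distrC.
move: tr tt; rewrite !lt_min => /andP[tr1 tr2] /andP[tt1 tt2].
have rtp := half_ball (ltW tr1).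
have rt0 : 0 < rho t by have /andP[h _] := rtp; apply: lt_le_trans h; rewrite divr_gt0.
have rt0p : rho t0 / 2 <= rho t0 <= 2 * rho t0 by move: r0; clear => h; apply/andP; split; lra.
have hm := hl t tt1.
have b1 : C * `|t - t0| < D * e1 / 2.
  move: tt2; rewrite ltr_pdivlMr// => h.
  exact: lt_half_scaleS h.
have b2 : L * `|rho t - rho t0| < D * e1 / 2.
  move: tr2; rewrite distrC ltr_pdivlMr ?mulr_gt0// => h.
  exact: lt_half_scale h.
have nth x : `|x - th| <= e1 -> `|x| <= `|th| + 1.
  move=> h; have := ler_normD (x - th) th; rewrite subrK => h'.
  by apply: le_trans h' _; rewrite addrC lerD2l (le_trans h).
have thA : `|th| <= `|th| + 1 by rewrite lerDl.
have h0 := hL th (rho t) th (rho t0) (conj thA rtp) (conj thA rt0p).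
rewrite subrr normr0 add0r in h0.
move: hm h0; rewrite !ler_norml => /andP[hm1 hm2] /andP[h01 h02].
have nu : `|th + e1| <= `|th| + 1 by apply: nth; rewrite addrAC subrr add0r gtr0_norm.
have nl : `|th - e1| <= `|th| + 1 by apply: nth; rewrite addrAC subrr add0r normrN gtr0_norm.
have th1 : th <= th + e1 by rewrite lerDl ltW.
have th2 : th - e1 <= th by rewrite gerBl ltW.
have up := hD th (th + e1) (rho t) (conj thA rtp) (conj nu rtp) th1.
have lo := hD (th - e1) th (rho t) (conj nl rtp) (conj thA rtp) th2.
rewrite (addrAC th e1) subrr add0r in up; rewrite opprB addrC subrK in lo.
have u1 : - b t <= th + e1.
  rewrite leNgt; apply/negP => lt; have := mnd _ _ _ rt0 (ltW lt).
  by move: hm1 hm2 h01 h02 up b1 b2; clear; lra.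
have l1 : th - e1 <= - b t.
  rewrite leNgt; apply/negP => lt; have := mnd _ _ _ rt0 (ltW lt).
  by move: hm1 hm2 h01 h02 lo b1 b2; clear; lra.
by move: u1 l1 e1e; rewrite /th; clear => *; apply/andP; split; lra.
Unshelve. all: by end_near.
Qed.

End recentring.

Section tmean_continuity.
Context {R : realType} (k : probability R R).
Hypothesis nd : forall c, ~ {ae k, forall y, y = c}.

Lemma tmean_nd (r u v : R) : 0 < r -> u <= v -> tmean k r u <= tmean k r v.
Proof.
move=> r0 uv; have A0 : 0 <= Num.max `|u| `|v| by rewrite le_max normr_ge0.
have [D D0 h] := tmean_incr A0 r0 (lexx r) nd.
rewrite -subr_ge0; apply: le_trans (h u v r _ _ uv).
- by rewrite mulr_ge0 ?(ltW D0)// subr_ge0.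
- by rewrite le_max lexx lexx.
- by rewrite le_max !lexx orbT.
Qed.

(** The shift [b] contains the mean of the arcade process, whose continuity in time is not assumed.
    The regularity of the posterior mean supplies it. *)
Lemma tmean_recentring (b rho : R -> R) (t0 eta C : R) :
  {for t0, continuous rho} -> 0 < rho t0 -> 0 < eta -> 0 <= C ->
  (forall t, `|t - t0| < eta ->
    `|tmean k (rho t) (- b t) - tmean k (rho t0) (- b t0)| <= C * `|t - t0|) ->
  {for t0, continuous b}.
Proof.
move=> crho r0 eta0 C0 hl.
have A0 : 0 <= `|- b t0| + 1 by rewrite addr_ge0.
have rm0 : 0 < rho t0 / 2 by rewrite divr_gt0.
have rmp : rho t0 / 2 <= 2 * rho t0 by move: r0; generalize (rho t0) => r; lra.
have [D D0 hD] := tmean_incr A0 rm0 rmp nd.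
have [L L0 hL] := tmean_lip k A0 rm0 rmp.
exact: (recentring crho r0 eta0 C0 D0 L0 (fun r u v => @tmean_nd r u v) hD hL hl).
Qed.

End tmean_continuity.

Section singular_clock_global.
Context {R : realType} (T0 T1 : R) (k0 k1 kh : probability R R).
Hypothesis hT01 : T0 < T1.
Hypothesis hmix : half_mixture k0 k1 kh.
Hypothesis i0 : k0.-integrable setT (EFin \o id).
Hypothesis i1 : k1.-integrable setT (EFin \o id).
Hypothesis mean01 : \int[k0]_y y = \int[k1]_y y.
Variables (s b rho : R -> R) (N : set R).
Hypothesis finN : finite_set N.
Hypothesis s0 : forall t, T0 < t < T1 -> 0 < s t.
Hypothesis rho0 : forall t, T0 < t < T1 -> 0 < rho t.
Hypothesis cs : forall t, T0 < t < T1 -> {for t, continuous s}.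
Hypothesis crho : forall t, T0 < t < T1 -> {for t, continuous rho}.
Hypothesis rho_small : forall e, 0 < e -> exists2 t, T0 < t < T1 & rho t < e.
Hypothesis drho : {ae lebesgue_measure, forall t : R, T0 < t < T1 -> is_derive t (1 : R) rho 0}.
Hypothesis regular : forall k : probability R R, k = k0 \/ k = k1 \/ k = kh ->
  exists2 F : R * R -> R^o, C1_on ((`]T0, T1[ `\` N) `*` setT) F &
    forall t x, T0 < t < T1 -> F (t, x) = tmean k (rho t) (s t * x - b t).

Lemma singular_clock : forall A, measurable A -> k0 A = k1 A.
Proof.
apply: contrapT => k01.
have nearT t0 : T0 < t0 < T1 -> t0 \notin N -> exists2 e, 0 < e & forall t, `|t - t0| < e -> T0 < t < T1 /\ ~ N t.
  move=> ht0 nN; have cN : open (~` N) by apply: closed_openC; apply: (fst accessible_finite_set_closed _ _ finN); apply: hausdorff_accessible; exact: norm_hausdorff.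
  have : \forall t \near t0, T0 < t < T1 /\ ~ N t.
    near=> t; split.
      suff : t \in `]T0, T1[ by rewrite in_itv.
      near: t; apply: near_in_itvoo; by rewrite in_itv.
    near: t; apply: open_nbhs_nbhs; split => // /mem_set; exact/negP.
  move=> /nbhs_ballP[e /= e0 he]; exists e => // t ht; apply: he.
  by rewrite /ball/= distrC.
have lc t0 : T0 < t0 < T1 -> t0 \notin N ->
    exists2 e, 0 < e & forall t1, `|t1 - t0| < e -> rho t1 = rho t0.
  move=> ht0 nN; have [e e0 he] := nearT t0 ht0 nN.
  have drho' : {ae lebesgue_measure, forall t : R, `|t - t0| < e -> is_derive t (1 : R) rho 0}.
    by apply: ae_lebesgueS drho => t h /he[/h].
  have rl (k : probability R R) : k = k0 \/ k = k1 \/ k = kh -> forall x, exists eta C, [/\ 0 < eta, 0 <= C &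
      forall t t' y, `|t - t0| < eta -> `|t' - t0| < eta -> `|y - x| < eta ->
      `|tmean k (rho t) (s t * y - b t) - tmean k (rho t') (s t' * y - b t')| <= C * `|t - t'|].
    move=> /regular[F CF FE] x.
    have [|eta [C [eta0 C0 hl]]] := C1_on_lip (t0 := t0) x CF e0.
      by move=> t y /he[h1 h2]; split=> //=; split => //=; rewrite in_itv.
    exists (Num.min eta e), C; split; [by rewrite lt_min eta0|by []|].
    move=> t t' y; rewrite !lt_min => /andP[a1 a2] /andP[b1 b2] /andP[c1 _].
    have [h1 _] := he _ a2; have [h2 _] := he _ b2.
    by rewrite -(FE t y h1) -(FE t' y h2); exact: hl.
  have nd := mixture_not_dirac hmix i0 i1 mean01 k01.
  (* At observation 0 the tilt is [- b t], independently of the slope. *)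
  have cb : {for t0, continuous b}.
    by have [eta [C [eta0 C0 hl]]] := rl kh (or_intror (or_intror erefl)) 0; apply: (tmean_recentring nd (crho ht0) (rho0 ht0) eta0 C0) => t ht; have := hl t t0 0 ht; rewrite (subrr t0) (subrr 0) normr0 => /(_ eta0 eta0); rewrite (mulr0 (s t)) (mulr0 (s t0)) (sub0r (b t)) (sub0r (b t0)).
  exact: (singular_clock_local hmix i0 i1 mean01 k01 e0 (s0 ht0) (cs ht0) cb (crho ht0) (rho0 ht0) drho' rl).
have /finite_setP[n] := finN => _.
have [l lE] : exists l : seq R, N = [set` l] by have /finite_seqP := finN.
have rc := locally_constant_off_finite (s := l) crho.
pose m := (T0 + T1) / 2.
have hm : T0 < m < T1 by apply/andP; split; rewrite /m; have := hT01; lra.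
have [t ht tm] := rho_small (rho0 hm).
have : rho t = rho m.
  apply: rc => // u hu ul; apply: lc => //; apply: contra ul.
  by rewrite lE inE.
by move=> e; rewrite e ltxx in tm.
Unshelve. all: by end_near.
Qed.

End singular_clock_global.

(** * Conditional expectations and the Gaussian channel *)

Lemma max_sub_max {R : realType} (x : R) : x = Num.max x 0 - Num.max (- x) 0.
Proof.
have [h|h] := leP x 0; first by rewrite max_l ?oppr_ge0// sub0r opprK.
by rewrite max_r ?subr0// oppr_le0 ltW.
Qed.

Section conditional_pythagoras.
Context d d' {T : measurableType d} {T' : measurableType d'} {R : realType}.
Variables (P : probability T R) (V : T -> T') (Z : T -> R) (y : T' -> R).
Hypothesis mV : measurable_fun setT V.
Hypothesis my : measurable_fun setT y.
Hypothesis ce : is_cond_exp P (sigma_of V) Z (y \o V).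

Let iZ : P.-integrable setT (EFin \o Z). Proof. by case: ce. Qed.
Let iY : P.-integrable setT (EFin \o (y \o V)). Proof. by case: ce. Qed.
Let res w := Z w - y (V w).
Let ires : P.-integrable setT (EFin \o res).
Proof. by have := integrableB measurableT iZ iY; apply: eq_integrable. Qed.
Let mres : measurable_fun setT res.
Proof. by have /measurable_EFinP := measurable_int _ ires. Qed.
Let rp w := Num.max (res w) 0.
Let rn w := Num.max (- res w) 0.
Let mrp : measurable_fun setT rp.
Proof. by apply: measurable_maxr => //; exact: measurable_cst. Qed.
Let mrn : measurable_fun setT rn.
Proof. by apply: measurable_maxr; [exact: measurableT_comp|exact: measurable_cst]. Qed.
Let rp0 w : 0 <= rp w. Proof. by rewrite le_max lexx orbT. Qed.
Let rn0 w : 0 <= rn w. Proof. by rewrite le_max lexx orbT. Qed.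
Let rE w : res w = rp w - rn w.
Proof. exact: max_sub_max. Qed.
Let rpb w : rp w <= `|res w|.
Proof. by rewrite ge_max ler_norm normr_ge0. Qed.
Let rnb w : rn w <= `|res w|.
Proof. by rewrite ge_max normr_ge0 andbT -normrN ler_norm. Qed.

Let irp : P.-integrable setT (EFin \o rp).
Proof.
apply: (le_integrable _ _ _ ires) => //; first exact/measurable_EFinP.
by move=> w _; rewrite lee_fin (ger0_norm (rp0 w)).
Qed.
Let irn : P.-integrable setT (EFin \o rn).
Proof.
apply: (le_integrable _ _ _ ires) => //; first exact/measurable_EFinP.
by move=> w _; rewrite lee_fin (ger0_norm (rn0 w)).
Qed.

Let mpre (A : set T') : measurable A -> measurable (V @^-1` A).
Proof. by move=> mA; rewrite -[X in measurable X]setTI; exact: mV. Qed.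

(** The conditional expectation property of [y], read as an equality of two measures on the sets
    generated by [V]. *)
Let balance (A : set T') : measurable A ->
  mdensity P mrp rp0 (V @^-1` A) = mdensity P mrn rn0 (V @^-1` A).
Proof.
move=> mA; rewrite /mdensity.
have mB := mpre mA.
have [_ _ _ h] := ce.
have hB : sigma_of V (V @^-1` A) by exists A => //; rewrite setTI.
have iS (f : T -> R) : P.-integrable setT (EFin \o f) -> P.-integrable (V @^-1` A) (EFin \o f).
  by move=> i; apply: integrableS i.
have e : (\int[P]_(w in V @^-1` A) (rp w)%:E - \int[P]_(w in V @^-1` A) (rn w)%:E = 0)%E.
  rewrite -integralB//; [|exact: iS irp|exact: iS irn].
  transitivity (\int[P]_(w in V @^-1` A) ((EFin \o Z) w - (EFin \o (y \o V)) w))%E.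
    by apply: eq_integral => w _; rewrite /= -!EFinB -rE.
  rewrite integralB//; [|exact: iS iZ|exact: iS iY].
  rewrite /comp -(h _ hB) subee//.
  exact: (integrable_fin_num mB (iS _ iY)).
have fp := integrable_fin_num mB (iS _ irp); have fn := integrable_fin_num mB (iS _ irn).
move: e fp fn; rewrite /comp => e fp fn.
move: e; rewrite -(fineK fp) -(fineK fn) -EFinB => -[/eqP].
by rewrite subr_eq0 => /eqP ->.
Qed.

Let orth_ge0 (h : T' -> R) : measurable_fun setT h -> (forall v, 0 <= h v) ->
  (\int[P]_w (rp w * h (V w))%:E = \int[P]_w (rn w * h (V w))%:E)%E.
Proof.
move=> mh h0.
pose V' : {mfun T >-> T'} := HB.pack V (isMeasurableFun.Build _ _ _ _ _ mV).
have mhE : measurable_fun setT (EFin \o h) by exact/measurable_EFinP.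
have mhV : measurable_fun setT (fun w => (h (V w))%:E) by exact: measurableT_comp mhE mV.
have e1 := ge0_integral_law (m := mdensity P mrp rp0) (m' := pushforward (mdensity P mrp rp0) V') mV
  (fun A mA => erefl) mhE (fun v => h0 v).
have e2 := ge0_integral_law (m := mdensity P mrn rn0) (m' := pushforward (mdensity P mrp rp0) V') mV
  (fun A mA => balance mA) mhE (fun v => h0 v).
have := etrans (esym (e1 mV)) (e2 mV).
rewrite (ge0_integral_mdensity P mrp rp0 mhV (fun w => h0 _)) (ge0_integral_mdensity P mrn rn0 mhV (fun w => h0 _)).
by under eq_integral do rewrite -EFinM; under [RHS]eq_integral do rewrite -EFinM.
Qed.

(** The positive and the negative part of the residual are densities of two measures with the same
    image under [V], so nonnegative functions of [V] integrate equally; [h] is split into its parts.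
    No square integrability is needed at this stage. *)
Lemma cond_exp_orth (h : T' -> R) : measurable_fun setT h ->
  P.-integrable setT (EFin \o (fun w => res w * h (V w))) ->
  \int[P]_w (res w * h (V w)) = 0.
Proof.
move=> mh ih.
pose hp v := Num.max (h v) 0; pose hn v := Num.max (- h v) 0.
have mhp : measurable_fun setT hp by apply: measurable_maxr => //; exact: measurable_cst.
have mhn : measurable_fun setT hn by apply: measurable_maxr; [exact: measurableT_comp|exact: measurable_cst].
have hp0 v : 0 <= hp v by rewrite le_max lexx orbT.
have hn0 v : 0 <= hn v by rewrite le_max lexx orbT.
have hE v : h v = hp v - hn v by exact: max_sub_max.
have hpb v : hp v <= `|h v| by rewrite ge_max ler_norm normr_ge0.
have hnb v : hn v <= `|h v| by rewrite ge_max normr_ge0 andbT -normrN ler_norm.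
have I (f : T -> R) (g : T' -> R) : measurable_fun setT f -> measurable_fun setT g -> (forall w, 0 <= f w <= `|res w|) ->
    (forall v, 0 <= g v <= `|h v|) -> P.-integrable setT (EFin \o (fun w => f w * g (V w))).
  move=> mf mg fb gb; apply: (le_integrable _ _ _ ih) => //.
    by apply/measurable_EFinP; apply: measurable_funM => //; exact: measurableT_comp mg mV.
  move=> w _; have /andP[f0 f1] := fb w; have /andP[g0 g1] := gb (V w).
  by rewrite lee_fin ger0_norm ?mulr_ge0// normrM ler_pM.
have i1 := I rp hp mrp mhp (fun w => introT andP (conj (rp0 w) (rpb w))) (fun v => introT andP (conj (hp0 v) (hpb v))).
have i2 := I rn hp mrn mhp (fun w => introT andP (conj (rn0 w) (rnb w))) (fun v => introT andP (conj (hp0 v) (hpb v))).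
have i3 := I rp hn mrp mhn (fun w => introT andP (conj (rp0 w) (rpb w))) (fun v => introT andP (conj (hn0 v) (hnb v))).
have i4 := I rn hn mrn mhn (fun w => introT andP (conj (rn0 w) (rnb w))) (fun v => introT andP (conj (hn0 v) (hnb v))).
have e1 := orth_ge0 mhp hp0; have e2 := orth_ge0 mhn hn0.
transitivity (\int[P]_w ((rp w * hp (V w) - 1 * (rn w * hp (V w)) - 1 * (rp w * hn (V w))) - (- 1) * (rn w * hn (V w)) - 0 * 0)).
  by apply: eq_Rintegral => w _; rewrite rE hE; ring.
have i5 : P.-integrable setT (EFin \o (fun w => rp w * hp (V w) - 1 * (rn w * hp (V w)) - 1 * (rp w * hn (V w)))).
  by have := integrableB measurableT (integrableB measurableT i1 i2) i3; apply: eq_integrable => // w _ /=; rewrite !mul1r !EFinB.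
rewrite Rintegral_lin3//; last exact: sqint_integrable (sqint_cst P 0).
rewrite Rintegral_lin3// /Rintegral e1 e2; ring.
Qed.

Hypothesis sZ : sqint P Z.

(** For the truncation [yn n] of [y], orthogonality gives [E[Z * yn] = E[yn^2]]. Expanding the
    square of [Z - yn] yields [E[yn^2] <= E[Z^2]], and Fatou's lemma removes the truncation. *)
Lemma cond_exp_sqint : sqint P (y \o V).
Proof.
have myV : measurable_fun setT (y \o V) by exact: measurableT_comp.
have [mZ iZ2] := sZ.
pose yn n v := if `|y v| <= n%:R then y v else 0.
have myn n : measurable_fun setT (yn n).
  apply: measurable_fun_ifT => //.
  by apply: measurable_fun_ler; [exact: measurableT_comp|exact: measurable_cst].
have ynb n v : `|yn n v| <= n%:R by rewrite /yn; case: ifP => //; rewrite normr0.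
have ynE n v : yn n v * y v = yn n v ^+ 2 by rewrite /yn; case: ifP => _; rewrite ?expr2// !mul0r.
have mynV n : measurable_fun setT (yn n \o V) by exact: measurableT_comp.
have synV n : sqint P (yn n \o V).
  split=> //; apply: (@integrable_bdd _ _ _ P _ (n%:R ^+ 2)) => [|w]; first exact: measurable_funX.
  by rewrite normrX lerXn2r ?nnegrE//; exact: ynb.
have ih n : P.-integrable setT (EFin \o (fun w => res w * yn n (V w))).
  apply: (integrable_dom (g := fun w => n%:R * `|res w|)).
  - by apply: measurable_funM => //; exact: (mynV n).
  - by have := integrableZl measurableT n%:R (integrable_abse ires); apply: eq_integrable.
  - by move=> w; rewrite normrM mulrC ler_wpM2r.
have le2 n : \int[P]_w (yn n (V w) ^+ 2) <= \int[P]_w (Z w ^+ 2).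
  have [_ isq] := synV n.
  have e := cond_exp_orth (myn n) (ih n).
  have j := sqintM sZ (synV n).
  have : \int[P]_w (Z w * yn n (V w) - 1 * (yn n (V w) ^+ 2) - 0 * 0) = 0.
    apply: etrans (_ : _ = \int[P]_w (res w * yn n (V w))) e.
    by apply: eq_Rintegral => w _; rewrite /res mulrBl (mulrC (y (V w))) ynE mul1r mul0r subr0.
  rewrite Rintegral_lin3//; last exact: sqint_integrable (sqint_cst P 0).
  rewrite mul0r subr0 mul1r => e1.
  have : 0 <= \int[P]_w (Z w ^+ 2 - 2 * (Z w * yn n (V w)) - (-1) * (yn n (V w) ^+ 2)).
    apply: Rintegral_ge0 => // w _; have := sqr_ge0 (Z w - yn n (V w)).
    by rewrite sqrrB; lra.
  by rewrite Rintegral_lin3//; lra.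
split=> //; apply/integrableP; split; first by apply/measurable_EFinP; exact: measurable_funX.
under eq_integral do rewrite /= ger0_norm ?sqr_ge0//.
apply: (@le_lt_trans _ _ (\int[P]_w (Z w ^+ 2))%:E); last exact: ltry.
have lim w : limn_einf (fun n => (yn n (V w) ^+ 2)%:E) = (y (V w) ^+ 2)%:E.
  apply: (fst (cvg_limn_einf_sup _)); apply: cvg_near_cst.
  near=> n; rewrite /yn ifT//; near: n; exact: nbhs_infty_ger.
under eq_integral do rewrite -lim.
apply: le_trans (fatou P measurableT _ _) _.
- by move=> n; apply/measurable_EFinP; exact: measurable_funX (mynV n).
- by move=> n w _; rewrite lee_fin sqr_ge0.
rewrite limn_einf_lim; apply: lime_le; first exact: is_cvg_einfs.
apply: nearW => n; apply: (@le_trans _ _ (\int[P]_w (yn n (V w) ^+ 2)%:E)%E).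
  by apply: ereal_inf_lbound; exists n => /=.
have [_ isq] := synV n.
by rewrite -[leLHS]fineK ?lee_fin ?le2//; exact: (integrable_fin_num measurableT isq).
Unshelve. all: by end_near.
Qed.

Lemma cond_exp_pythagoras (phi : T' -> R) : measurable_fun setT phi -> sqint P (phi \o V) ->
  \int[P]_w (Z w - phi (V w)) ^+ 2 =
  \int[P]_w (Z w - y (V w)) ^+ 2 + \int[P]_w (y (V w) - phi (V w)) ^+ 2.
Proof.
move=> mphi sphi; have sy := cond_exp_sqint.
have s1 : sqint P res := sqintB sZ sy.
have s2 := sqintB sy sphi.
have e := cond_exp_orth (measurable_funB my mphi) (sqintM s1 s2).
have [_ i1] := s1; have [_ i2] := s2.
transitivity (\int[P]_w (res w ^+ 2 - (- 1) * (y (V w) - phi (V w)) ^+ 2 - (- 2) * (res w * (y (V w) - phi (V w))))).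
  by apply: eq_Rintegral => w _; rewrite /res; ring.
by rewrite Rintegral_lin3// ?e; [ring|exact: sqintM s1 s2].
Qed.

End conditional_pythagoras.

(** * Gaussian observation of a coupling *)

Section gaussian_channel.
Context d {Omega : measurableType d} {R : realType} (P : probability Omega R).
Variables (A : Omega -> R) (a f m s : R).
Hypothesis mA : measurable_fun setT A.
Hypothesis s0 : s != 0.
Hypothesis PA : forall B, measurable B -> P (A @^-1` B) = normal_prob m s B.

Definition channel (w : Omega * (R * R)) : R := a * w.2.1 + f * w.2.2 + A w.1.

Lemma measurable_channel : measurable_fun setT channel.
Proof.
apply: measurable_funD; last exact: measurableT_comp mA measurable_fst.
have m2 : measurable_fun setT (fun w : Omega * (R * R) => w.2) by exact: measurable_snd.
by apply: measurable_funD; apply: measurable_funM => //; [exact: measurableT_comp measurable_fst m2|exact: measurableT_comp measurable_snd m2].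
Qed.

Lemma ge0_integral_channel1 (h : R -> \bar R) (x : R * R) : measurable_fun setT h ->
  (forall z, 0 <= h z)%E ->
  (\int[P]_w h (channel (w, x)) =
   \int[lebesgue_measure]_z ((normal_pdf m s (z - (a * x.1 + f * x.2)))%:E * h z))%E.
Proof.
move=> mh h0; set c := a * x.1 + f * x.2.
have mc : measurable_fun setT (fun y : R => h (c + y)).
  by apply: measurableT_comp mh _; exact: measurable_funD.
have PA' (B : set R) : measurable B -> law P mA B = P (A @^-1` B) by [].
rewrite -(ge0_integral_law (m := P) (m' := law P mA) mA PA' (f := fun y => h (c + y)) mc)//.
apply: etrans (ge0_integral_normal (k := law P mA) PA mc (fun y => h0 _)) _.
have mg : measurable_fun setT (fun z : R => (normal_pdf m s (z - c)%R)%:E * h z)%E.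
  apply: emeasurable_funM => //; apply/measurable_EFinP.
  by apply: measurableT_comp; [exact: measurable_normal_pdf|exact: measurable_funB].
rewrite -(ge0_integral_shift c mg); last by move=> z; rewrite mule_ge0// lee_fin normal_pdf_ge0.
by apply: eq_integral => y _; rewrite addrK addrC.
Qed.

Variable pi : probability (R * R)%type R.

Lemma ge0_integral_sample (F : Omega * (R * R) -> \bar R) : measurable_fun setT F ->
  (forall w, 0 <= F w)%E ->
  (\int[(P \x pi)]_w F w = \int[pi]_x \int[P]_w F (w, x))%E.
Proof. by move=> mF F0; rewrite (fubini_tonelli2 (m1 := P) (m2 := pi) F mF F0). Qed.

Lemma ge0_integral_channel (F : (R * R) * R -> \bar R) : measurable_fun setT F ->
  (forall w, 0 <= F w)%E ->
  (\int[(P \x pi)]_w F (w.2, channel w) =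
   \int[pi]_x \int[lebesgue_measure]_z ((normal_pdf m s (z - (a * x.1 + f * x.2)))%:E * F (x, z)))%E.
Proof.
move=> mF F0; rewrite ge0_integral_sample//; last first.
  apply: measurableT_comp mF _; apply: measurable_fun_pair; [exact: measurable_snd|exact: measurable_channel].
apply: eq_integral => x _; rewrite -ge0_integral_channel1//.
by apply: measurableT_comp mF _; exact: measurable_fun_pair.
Qed.

Lemma ge0_integral_second (F : R * R -> \bar R) : measurable_fun setT F ->
  (forall w, 0 <= F w)%E -> (\int[(P \x pi)]_w F w.2 = \int[pi]_x F x)%E.
Proof.
move=> mF F0; rewrite ge0_integral_sample//; last exact: measurableT_comp mF measurable_snd.
apply: eq_integral => x _; transitivity (\int[P]_w cst (F x) w)%E => //.
rewrite integral_cst// -[RHS]mule1; congr (_ * _)%E.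
exact: probability_setT.
Qed.

Lemma sqint_second (g : R * R -> R) : sqint pi g -> sqint (P \x pi)%E (fun w => g w.2).
Proof.
move=> [mg ig]; split; first exact: measurableT_comp mg measurable_snd.
have mg2 : measurable_fun setT (fun x => g x ^+ 2) by exact: measurable_funX.
apply/integrableP; split.
  by apply/measurable_EFinP; exact: measurableT_comp mg2 measurable_snd.
have [_] := integrableP _ _ _ ig; congr (_ < _)%E.
pose G (x : R * R) : \bar R := (`|(g x ^+ 2)%:E|)%E.
have mG : measurable_fun setT G by apply: measurableT_comp => //; apply/measurable_EFinP.
exact: esym (ge0_integral_second mG (fun x => abse_ge0 _)).
Qed.

Lemma sqint_first (g : Omega -> R) : sqint P g -> sqint (P \x pi)%E (fun w => g w.1).
Proof.
move=> [mg ig]; split; first exact: measurableT_comp mg measurable_fst.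
have mg2 : measurable_fun setT (fun x => g x ^+ 2) by exact: measurable_funX.
apply/integrableP; split.
  by apply/measurable_EFinP; exact: measurableT_comp mg2 measurable_fst.
have [_] := integrableP _ _ _ ig; congr (_ < _)%E.
rewrite ge0_integral_sample//; last first.
  by apply: measurableT_comp => //; apply/measurable_EFinP; exact: measurableT_comp mg2 measurable_fst.
pose G : \bar R := (\int[P]_w (`|(g w ^+ 2)%:E|)%E)%E.
transitivity (\int[pi]_x cst G x)%E => //.
rewrite integral_cst//; apply: etrans (esym (mule1 G)) _; congr (_ * _)%E; apply/esym; exact: probability_setT.
Qed.

End gaussian_channel.

Section channel_continuity.
Context {R : realType} (a f m s : R) (phi : R * R -> R) (n : R).
Hypothesis s0 : s != 0.
Hypothesis mphi : measurable_fun setT phi.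
Hypothesis bphi : forall w, `|phi w| <= n.

Let pdf (x : R * R) (z : R) : R := normal_pdf m s (z - (a * x.1 + f * x.2)).

Let mpdf x : measurable_fun setT (pdf x).
Proof. by apply: measurableT_comp; [exact: measurable_normal_pdf|exact: measurable_funB]. Qed.

Let pdf0 x z : 0 <= pdf x z. Proof. exact: normal_pdf_ge0. Qed.

Let intpdf x : (\int[lebesgue_measure]_z (pdf x z)%:E = 1)%E.
Proof.
rewrite -(integral_normal_pdf m s).
rewrite -[RHS](ge0_integral_shift (f := fun z : R => (normal_pdf m s z)%:E) (- (a * x.1 + f * x.2)))//.
  by apply/measurable_EFinP; exact: measurable_normal_pdf.
by move=> z; rewrite lee_fin normal_pdf_ge0.
Qed.

Let ipdf x : lebesgue_measure.-integrable setT (EFin \o pdf x).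
Proof.
apply/integrableP; split; first by apply/measurable_EFinP; exact: mpdf.
under eq_integral do rewrite /= ger0_norm//.
by rewrite intpdf ltry.
Qed.

Let mean_of (g : R -> R) (x : R * R) := \int[lebesgue_measure]_z (g z * pdf x z).

Let igpdf (g : R -> R) (C : R) x : measurable_fun setT g -> (forall z, `|g z| <= C) ->
  lebesgue_measure.-integrable setT (EFin \o (fun z : R => g z * pdf x z)).
Proof.
move=> mg gC.
have iC := integrableZl measurableT C (ipdf x).
apply: (le_integrable _ _ _ iC) => //.
  by apply/measurable_EFinP; apply: measurable_funM => //; exact: mpdf.
move=> z _; rewrite lee_fin !normrM ler_pM//; apply: le_trans (gC z) _; exact: ler_norm.
Qed.

(** The function [g] is only measurable: continuity in [y] comes from the normal density, with
    varying bounds [C * pdf] of constant integral [C]. *)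
Let mean_of_cvg (g : R -> R) (C x0 : R) (y_ : nat -> R) (y : R) : measurable_fun setT g ->
  (forall z, `|g z| <= C) -> y_ j @[j --> \oo] --> y ->
  mean_of g (x0, y_ j) @[j --> \oo] --> mean_of g (x0, y).
Proof.
move=> mg gC cy.
have cpdf z : pdf (x0, y_ j) z @[j --> \oo] --> pdf (x0, y) z.
  apply: (@cvg_comp _ _ _ (fun j => z - (a * x0 + f * y_ j)) (normal_pdf m s)); last exact: (continuous_normal_pdf s0).
  apply: cvgB; first exact: cvg_cst.
  apply: cvgD; first exact: cvg_cst.
  by apply: cvgM => //; exact: cvg_cst.
have iC x : lebesgue_measure.-integrable setT (EFin \o (fun z : R => C * pdf x z)).
  by have := integrableZl measurableT C (ipdf x); apply: eq_integrable.
have IC x : \int[lebesgue_measure]_z (C * pdf x z) = C.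
  rewrite RintegralZl//.
  by rewrite /Rintegral intpdf mulr1.
apply: (pratt (m := lebesgue_measure) (g_ := fun j z => C * pdf (x0, y_ j) z) (g := fun z => C * pdf (x0, y) z)).
- by move=> j; apply: measurable_funM => //; exact: mpdf.
- by apply: measurable_funM => //; exact: mpdf.
- by move=> j; exact: iC.
- exact: iC.
- by move=> j z; rewrite normrM (ger0_norm (pdf0 _ _)) ler_wpM2r.
- by move=> z; rewrite normrM (ger0_norm (pdf0 _ _)) ler_wpM2r.
- by apply: aeW => z; apply: cvgM; [exact: cvg_cst|exact: cpdf].
- by apply: aeW => z; apply: cvgM; [exact: cvg_cst|exact: cpdf].
- by move=> j; rewrite !IC.
Qed.

(** The mean square error of the estimator [phi] when the pair [(X0, X1)] equals [x]. *)
Definition channel_loss (x : R * R) : R :=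
  \int[lebesgue_measure]_z ((x.2 - phi (x.1, z)) ^+ 2 * pdf x z).

Let mphi1 x0 : measurable_fun setT (fun z => phi (x0, z)).
Proof. by apply: measurableT_comp mphi _; exact: measurable_fun_pair. Qed.

Let n0 : 0 <= n. Proof. exact: le_trans (normr_ge0 _) (bphi (0, 0)). Qed.

Let bsq (x : R * R) z : `|(x.2 - phi (x.1, z)) ^+ 2| <= 2 * x.2 ^+ 2 + 2 * n ^+ 2.
Proof.
rewrite ger0_norm ?sqr_ge0//.
have h : phi (x.1, z) ^+ 2 <= n ^+ 2.
  by rewrite -(real_normK (num_real (phi _))) lerXn2r// nnegrE.
have := sqr_ge0 (x.2 + phi (x.1, z)); rewrite sqrrD sqrrB; lra.
Qed.

Let msq (x : R * R) : measurable_fun setT (fun z => (x.2 - phi (x.1, z)) ^+ 2).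
Proof. by apply: measurable_funX; apply: measurable_funB => //; exact: mphi1. Qed.

Lemma channel_lossE (x : R * R) :
  (channel_loss x)%:E = (\int[lebesgue_measure]_z ((pdf x z)%:E * ((x.2 - phi (x.1, z)) ^+ 2)%:E))%E.
Proof.
rewrite /channel_loss /Rintegral fineK.
  by apply: eq_integral => z _; rewrite -EFinM mulrC.
exact: (integrable_fin_num measurableT (igpdf x (msq x) (bsq x))).
Qed.

Lemma channel_loss_itv x : 0 <= channel_loss x <= 2 * x.2 ^+ 2 + 2 * n ^+ 2.
Proof.
apply/andP; split; first by apply: Rintegral_ge0 => // z _; rewrite mulr_ge0 ?sqr_ge0.
rewrite -lee_fin channel_lossE.
apply: (@le_trans _ _ (\int[lebesgue_measure]_z ((2 * x.2 ^+ 2 + 2 * n ^+ 2)%:E * (pdf x z)%:E))%E).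
  apply: ge0_le_integral => //.
  - by move=> z _; rewrite mule_ge0// lee_fin ?sqr_ge0.
  - by apply: emeasurable_funM; apply/measurable_EFinP; [exact: mpdf|exact: msq].
  - by apply: emeasurable_funM => //; apply/measurable_EFinP; exact: mpdf.
  - move=> z _; rewrite -!EFinM lee_fin mulrC ler_wpM2r//.
    by apply: le_trans (ler_norm _) (bsq x z).
rewrite ge0_integralZl//.
- by rewrite intpdf mule1.
- by apply/measurable_EFinP; exact: mpdf.
- by move=> z _; rewrite lee_fin.
- by rewrite lee_fin addr_ge0// mulr_ge0// sqr_ge0.
Qed.

(** After expanding the square, [phi] only enters through Gaussian means. Continuity holds in the
    second coordinate at fixed [x0], as [phi] is merely measurable in the first. *)
Lemma channel_loss_cvg (x0 : R) (y_ : nat -> R) (y : R) : y_ j @[j --> \oo] --> y ->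
  channel_loss (x0, y_ j) @[j --> \oo] --> channel_loss (x0, y).
Proof.
move=> cy.
have bphi2 z : `|phi (x0, z) ^+ 2| <= n ^+ 2 by rewrite normrX lerXn2r// nnegrE.
have mphi2 : measurable_fun setT (fun z => phi (x0, z) ^+ 2) by exact: measurable_funX.
have i1 x := igpdf x (mphi1 x0) (fun z => bphi (x0, z)).
have i2 x := igpdf x mphi2 bphi2.
have E v : channel_loss (x0, v) = v ^+ 2 - 2 * v * mean_of (fun z => phi (x0, z)) (x0, v) +
    mean_of (fun z => phi (x0, z) ^+ 2) (x0, v).
  rewrite /channel_loss /mean_of.
  have ip : lebesgue_measure.-integrable setT (EFin \o (fun z : R => v ^+ 2 * pdf (x0, v) z)).
    by have := integrableZl measurableT (v ^+ 2) (ipdf (x0, v)); apply: eq_integrable.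
  have i1' : lebesgue_measure.-integrable setT (EFin \o (fun z : R => 2 * v * (phi (x0, z) * pdf (x0, v) z))).
    by have := integrableZl measurableT (2 * v) (i1 (x0, v)); apply: eq_integrable.
  transitivity (\int[lebesgue_measure]_z (v ^+ 2 * pdf (x0, v) z - 2 * v * (phi (x0, z) * pdf (x0, v) z) +
     phi (x0, z) ^+ 2 * pdf (x0, v) z)).
    by apply: eq_Rintegral => z _; rewrite /=; ring.
  rewrite RintegralD//; last by have := integrableB measurableT ip i1'; apply: eq_integrable.
  rewrite RintegralB// RintegralZl// RintegralZl//.
  by congr (_ - _ + _); rewrite /Rintegral intpdf mulr1.
rewrite (_ : (fun j => channel_loss (x0, y_ j)) = (fun j => y_ j ^+ 2 - 2 * y_ j * mean_of (fun z => phi (x0, z)) (x0, y_ j) +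
    mean_of (fun z => phi (x0, z) ^+ 2) (x0, y_ j))); last by apply/funext => j; rewrite E.
have h1 := @mean_of_cvg _ _ x0 _ _ mphi2 bphi2 cy.
have h2 := @mean_of_cvg _ _ x0 _ _ (mphi1 x0) (fun z => bphi (x0, z)) cy.
rewrite (E y); apply: cvgD; last exact: h1.
apply: cvgB.
  by under eq_fun do rewrite expr2; rewrite expr2; exact: cvgM.
apply: cvgM; first by apply: cvgM => //; exact: cvg_cst.
exact: h2.
Qed.

End channel_continuity.

(** * Maximisers of the functional *)

Section null_sets.
Import HBNNSimple.
Context d {T : measurableType d} {R : realType} (m : {measure set T -> \bar R}).

(* No measurability: only the simple functions below [f] matter. *)
Lemma ge0_integral_ae_le (f g : T -> \bar R) : (forall x, 0 <= f x)%E -> (forall x, 0 <= g x)%E ->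
  {ae m, forall x, f x = g x} -> (\int[m]_x f x <= \int[m]_x g x)%E.
Proof.
move=> f0 g0 [N [mN N0 sub]].
rewrite ge0_integralTE// [leRHS]ge0_integralTE//.
apply: ge_ereal_sup => _ [h /= hf <-].
have mNC : measurable (~` N) by exact: measurableC.
pose h' := proj_nnsfun h mNC.
have -> : sintegral m h = sintegral m h'.
  rewrite -!integralT_nnsfun; apply: ae_eq_integral => //.
  - by apply/measurable_EFinP.
  - by apply/measurable_EFinP.
  - exists N; split => // x /= nx; apply: contrapT => nN; apply: nx => _.
    by rewrite /h' /= mindicE mem_set// mulr1.
apply: ereal_sup_ubound; exists h' => //= x; rewrite /h' /= mindicE.
have [xN|xN] := boolP (x \in ~` N); last by rewrite mulr0.
rewrite mulr1; apply: le_trans (hf x) _; rewrite le_eqVlt; apply/orP; left; apply/eqP.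
by apply: contrapT => nfg; move: xN; rewrite inE => xN; apply: xN; exact: sub.
Qed.

Lemma ge0_integral_ae_eq (f g : T -> \bar R) : (forall x, 0 <= f x)%E -> (forall x, 0 <= g x)%E ->
  {ae m, forall x, f x = g x} -> (\int[m]_x f x = \int[m]_x g x)%E.
Proof.
move=> f0 g0 fg; apply/le_anti/andP; split; apply: ge0_integral_ae_le => //.
by apply: filterS fg => x ->.
Qed.

End null_sets.

Section null_sections.
Context d1 d2 {T1 : measurableType d1} {T2 : measurableType d2} {R : realType}.
Variables (m1 : {sigma_finite_measure set T1 -> \bar R}) (m2 : {sigma_finite_measure set T2 -> \bar R}).

Lemma ae_sections (Q : T1 * T2 -> Prop) : {ae (m1 \x m2)%E, forall z, Q z} ->
  {ae m1, forall x, {ae m2, forall y, Q (x, y)}}.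
Proof.
move=> [N [mN N0 sub]].
have : {ae m1, forall x, m2 (xsection N x) = 0%E}.
  by apply: ge0_integral_eq0_ae => //; exact: measurable_fun_xsection.
apply: filterS => x hx; exists (xsection N x); split => //.
  exact: measurable_xsection.
by move=> y /= nQ; rewrite /xsection /= inE; apply: sub.
Qed.

End null_sections.

Section caratheodory_functions.
Context d {T : measurableType d} {R : realType}.

(** The function is the limit of its values at the grid times [floor ((n+1) t) / (n+1)], of which
    there are countably many. *)
Lemma measurable_caratheodory (X : R -> T -> R) : (forall w, continuous (X ^~ w)) ->
  (forall t, measurable_fun setT (X t)) -> measurable_fun setT (fun z : T * R => X z.2 z.1).
Proof.
move=> cX mX.
pose grid (n : nat) (t : R) : R := (Num.floor (n.+1%:R * t))%:~R / n.+1%:R.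
have mn n : measurable_fun setT (fun z : T * R => X (grid n z.2) z.1).
  move=> _ B mB; rewrite setTI.
  have -> : (fun z : T * R => X (grid n z.2) z.1) @^-1` B =
     \bigcup_(k : int) ((X (k%:~R / n.+1%:R) @^-1` B) `*`
        [set t : R | k%:~R <= n.+1%:R * t < (k + 1)%:~R]).
    apply/seteqP; split => [z /= Bz|z [k _ [/= Bz kz]]].
      exists (Num.floor (n.+1%:R * z.2)) => //=; split => //.
      by rewrite floor_le floorD1_gt.
    by rewrite /preimage /= /grid (floor_def kz).
  apply: countable_bigcupT_measurable => [|k]; first exact: countableP.
  apply: measurableX.
    by rewrite -[X in measurable X]setTI; exact: mX.
  have mf : measurable_fun setT (fun t : R => n.+1%:R * t) by exact: measurable_funM.
  have -> : [set t : R | k%:~R <= n.+1%:R * t < (k + 1)%:~R] =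
     (fun t : R => n.+1%:R * t) @^-1` `[k%:~R, (k + 1)%:~R[.
    by apply/seteqP; split => t /=; rewrite in_itv.
  by rewrite -[X in measurable X]setTI; apply: mf => //; exact: measurable_itv.
apply: (measurable_fun_cvg mn) => z _.
apply: (@cvg_comp _ _ _ (fun n => grid n z.2) (X ^~ z.1)); last exact: cX.
apply/cvgrPdist_le => e e0; near=> n.
have n0 : 0 < (n.+1%:R : R) by rewrite ltr0n.
have h1 : (Num.floor (n.+1%:R * z.2))%:~R <= n.+1%:R * z.2 by exact: floor_le.
have h2 : n.+1%:R * z.2 < (Num.floor (n.+1%:R * z.2) + 1)%:~R by exact: floorD1_gt.
have -> : z.2 - grid n z.2 = (n.+1%:R * z.2 - (Num.floor (n.+1%:R * z.2))%:~R) / n.+1%:R.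
  by rewrite mulrBl mulrAC mulfV ?gt_eqF// mul1r.
rewrite intrD in h2; have h3 : n.+1%:R^-1 <= e.
  by apply: ltW; near: n; exact: (near_infty_natSinv_lt (PosNum e0)).
rewrite ger0_norm ?divr_ge0 ?subr_ge0// ler_pdivrMr//.
apply: (@le_trans _ _ 1); first lra.
by move: h3; rewrite -[_^-1]mul1r ler_pdivrMr.
Unshelve. all: by end_near.
Qed.

End caratheodory_functions.

Section mixture_of_products.
Context d1 d2 {T1 : measurableType d1} {T2 : measurableType d2} {R : realType}.

Lemma half_mixture_prod (P : probability T1 R) (m0 m1 mh : probability T2 R) :
  half_mixture m0 m1 mh -> half_mixture (P \x m0)%E (P \x m1)%E (P \x mh)%E.
Proof.
move=> hm C mC.
have mI : measurable_fun setT (fun z : T1 * T2 => (\1_C z)%:E : \bar R).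
  by apply/measurable_EFinP; exact: measurable_indic.
have I0 z : (0 <= (\1_C z)%:E :> \bar R)%E by rewrite lee_fin.
have E (m : probability T2 R) : (P \x m)%E C = (\int[m]_x fubini_G P (fun z => (\1_C z)%:E) x)%E.
  by rewrite -(fubini_tonelli2 (m1 := P) (m2 := m) _ mI I0) integral_indic// setIT.
have := half_mixture_ge0_integral hm (f := fubini_G P (fun z => (\1_C z)%:E)).
move=> /(_ (measurable_fun_fubini_tonelli_G (m1 := P) _ mI I0)) e.
apply: etrans (E mh) (etrans (e _) _); first by move=> x; apply: integral_ge0.
by congr (_ * _ + _ * _)%E; exact/esym/E.
Qed.

End mixture_of_products.

Lemma le_half_sum {R : realFieldType} (x a b : R) : x <= a -> x <= b -> x <= (a + b) / 2.
Proof. by move=> xa xb; rewrite ler_pdivlMr// mulr_natr mulr2n; exact: lerD. Qed.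

Section liminf_bounds.
Context {R : realType}.

Lemma limn_einf_ge (u : nat -> R) (x : R) :
  (forall e, 0 < e -> \forall j \near \oo, x - e <= u j) ->
  (x%:E <= limn_einf (fun j => (u j)%:E))%E.
Proof.
move=> h; apply/lee_addgt0Pr => e e0; rewrite -leeBlDr// -EFinB limn_einf_lim.
apply: lime_ge; first exact: is_cvg_einfs.
have [N _ hN] := h e e0; exists N => // n /= Nn.
apply: le_ereal_inf_tmp => _ [k /= nk <-]; rewrite lee_fin; apply: hN => /=.
exact: leq_trans nk.
Qed.

Lemma limn_einf_le (u : nat -> \bar R) (x : R) :
  (forall e, 0 < e -> \forall j \near \oo, (u j <= (x + e)%:E)%E) ->
  (limn_einf u <= x%:E)%E.
Proof.
move=> h; apply/lee_addgt0Pr => e e0; rewrite -EFinD limn_einf_lim.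
apply: lime_le; first exact: is_cvg_einfs.
have [N _ hN] := h e e0; apply: nearW => n.
apply: (@le_trans _ _ (u (maxn n N))).
  by apply: ereal_inf_lbound; exists (maxn n N) => //=; exact: leq_maxl.
by apply: hN => /=; exact: leq_maxr.
Qed.

End liminf_bounds.

Lemma half_mixture_integrableV d (T : measurableType d) (R : realType)
  (m0 m1 mh : probability T R) (f : T -> R) : half_mixture m0 m1 mh ->
  mh.-integrable setT (EFin \o f) ->
  m0.-integrable setT (EFin \o f) /\ m1.-integrable setT (EFin \o f).
Proof.
move=> hm ih; have mf := measurable_int _ ih; have [_] := integrableP _ _ _ ih.
have mabs : measurable_fun setT (fun x => `|(EFin \o f) x|%E) by exact: measurableT_comp.
rewrite (half_mixture_ge0_integral hm mabs)//.
have n0 : (0 < (2^-1 : R)%:E)%E by rewrite lte_fin invr_gt0.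
have h0 (m : probability T R) : (0 <= \int[m]_x `|(EFin \o f) x|)%E by apply: integral_ge0.
have key (a b : \bar R) : (0 <= a)%E -> (0 <= b)%E -> (2^-1%:E * a + 2^-1%:E * b < +oo)%E -> (a < +oo)%E /\ (b < +oo)%E.
  move: a b => [a| |] [b| |] // _ _; rewrite ?ltry//= ?gt0_muley// ?addye ?addey//.
by move=> /(key _ _ (h0 m0) (h0 m1)) [l0 l1]; split; apply/integrableP.
Qed.

(** * The functional on martingale couplings *)

Section coupling_problem.
Context {R : realType} (T0 T1 : R) (hT01 : T0 < T1) (mu nu : probability R R).
Hypothesis hmu : finite_second_moment mu.
Hypothesis hnu : finite_second_moment nu.
Context (d : measure_display) (Omega : measurableType d) (P : probability Omega R).
Variables (D : R -> Omega -> R) (f0 f1 g0 g1 H1 H2 : R -> R) (fA : R -> R -> R).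
Variable M : probability (R * R)%type R -> R -> R -> R -> R.
Hypothesis hDcont : sample_continuous T0 T1 D.
Hypothesis hf : interpolating T0 T1 f0 f1.
Hypothesis hg : interpolating T0 T1 g0 g1.
Hypothesis ha : gauss_markov_driver P T0 T1 H1 H2 D.
Hypothesis hb : standard_coefficients T0 T1 H1 H2 f0 f1 g1.
Hypothesis hfA : forall t, T0 < t < T1 ->
  continuous_density P (arcade T0 T1 f0 f1 D t) (fA t).
Hypothesis hM : forall pi, martingale_coupling mu nu pi ->
  posterior_mean_version P T0 T1 (rap T0 T1 f0 f1 g0 g1 D) pi (M pi).

Let I := rap T0 T1 f0 f1 g0 g1 D.
Let c := bridge_det T0 T1 H1 H2.
Let A := arcade T0 T1 f0 f1 D.
Let am := arcade_mean T0 T1 P D f0 f1.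
Let sd := arcade_sd T0 T1 f0 f1 H1 H2.
Let MC := martingale_coupling mu nu.
Implicit Type pi : probability (R * R)%type R.

Definition observation t (w : Omega * (R * R)) : R * R := (w.2.1, I t w).
Let V := observation.

Definition post pi t (p : R * R) : R := M pi t p.1 p.2.

Let cl t : T0 < t < T1 -> T0 <= t <= T1. Proof. by case/andP => /ltW-> /ltW->. Qed.

Let mA t : T0 <= t <= T1 -> measurable_fun setT (A t).
Proof. by move=> tT; have [] := sqint_arcade hT01 f0 f1 ha tT. Qed.

Let m2 : measurable_fun setT (fun w : Omega * (R * R) => w.2).
Proof. exact: measurable_snd. Qed.
Let mX0 : measurable_fun setT (fun w : Omega * (R * R) => w.2.1).
Proof. exact: measurableT_comp measurable_fst m2. Qed.
Let mX1 : measurable_fun setT (fun w : Omega * (R * R) => w.2.2).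
Proof. exact: measurableT_comp measurable_snd m2. Qed.

Let mI t : T0 <= t <= T1 -> measurable_fun setT (I t).
Proof. by move=> tT; exact: measurable_channel (g0 t) (g1 t) (mA tT). Qed.

Lemma measurable_observation t : T0 <= t <= T1 -> measurable_fun setT (V t).
Proof. by move=> tT; apply: measurable_fun_pair; [exact: mX0|exact: mI]. Qed.

Lemma measurable_post pi t : MC pi -> measurable_fun setT (post pi t).
Proof.
move=> hpi; have [mM _] := hM hpi.
have mp : measurable_fun setT (fun p : R * R => (t, p)) by exact: measurable_fun_pair.
exact: measurableT_comp mM mp.
Qed.

Let ce pi t : MC pi -> T0 <= t <= T1 ->
  is_cond_exp (P \x pi)%E (sigma_of (V t)) (fun w => w.2.2) (post pi t \o V t).
Proof. by move=> hpi tT; have [_ h] := hM hpi; exact: h. Qed.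

Let second_moment (m m' : probability _ R) (mm' : R * R -> R) : measurable_fun setT mm' ->
  (forall B, measurable B -> m (mm' @^-1` B) = m' B) -> finite_second_moment m' ->
  sqint m mm' /\ \int[m]_x mm' x ^+ 2 = \int[m']_x x ^+ 2.
Proof.
move=> mm mE h2; have mE' B : measurable B -> m' B = m (mm' @^-1` B) by move=> /mE ->.
have ms : measurable_fun setT (fun x : R => (x ^+ 2)%:E).
  by apply/measurable_EFinP; exact: measurable_funX.
split; last by rewrite /Rintegral (integral_law (m := m) (m' := m') mm mE' ms).
by split=> //; exact: (fst (integrable_law (m := m) (m' := m') mm mE' ms) h2).
Qed.

Let sq_snd pi : MC pi -> sqint pi snd /\ \int[pi]_x x.2 ^+ 2 = \int[nu]_x x ^+ 2.
Proof. by move=> [_ h _ _]; apply: second_moment => //; exact: measurable_snd. Qed.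

Let sq_fst pi : MC pi -> sqint pi fst /\ \int[pi]_x x.1 ^+ 2 = \int[mu]_x x ^+ 2.
Proof. by move=> [h _ _ _]; apply: second_moment => //; exact: measurable_fst. Qed.

Lemma sqint_X1 pi : MC pi -> sqint (P \x pi)%E (fun w => w.2.2).
Proof. by move=> /sq_snd[s _]; exact: sqint_second. Qed.

Let sqint_X0 pi : MC pi -> sqint (P \x pi)%E (fun w => w.2.1).
Proof. by move=> /sq_fst[s _]; exact: sqint_second. Qed.

Let integral_second pi (g : R * R -> R) : sqint pi g ->
  \int[(P \x pi)%E]_w g w.2 ^+ 2 = \int[pi]_x g x ^+ 2.
Proof.
move=> [mg _]; congr fine; apply: (ge0_integral_second P pi (F := fun x => (g x ^+ 2)%:E)).
  by apply/measurable_EFinP; exact: measurable_funX.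
by move=> x; rewrite lee_fin sqr_ge0.
Qed.

Let integral_first pi (g : Omega -> R) : measurable_fun setT g ->
  \int[(P \x pi)%E]_w g w.1 ^+ 2 = \int[P]_x g x ^+ 2.
Proof.
move=> mg; congr fine.
have mg2 : measurable_fun setT (fun w : Omega * (R * R) => (g w.1 ^+ 2)%:E).
  by apply/measurable_EFinP; apply: measurable_funX; exact: measurableT_comp mg measurable_fst.
apply: etrans (@ge0_integral_sample _ Omega R P pi (fun w => (g w.1 ^+ 2)%:E) mg2 _) _.
  by move=> w; rewrite lee_fin sqr_ge0.
pose G : \bar R := (\int[P]_w (g w ^+ 2)%:E)%E.
transitivity (\int[pi]_x cst G x)%E => //.
rewrite integral_cst//; apply: etrans _ (mule1 G); congr (_ * _)%E; exact: probability_setT.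
Qed.

Definition mmse pi t : R := \int[(P \x pi)%E]_w (w.2.2 - post pi t (V t w)) ^+ 2.

Lemma mmse_ge0 pi t : 0 <= mmse pi t.
Proof. by apply: Rintegral_ge0 => // w _; exact: sqr_ge0. Qed.

Lemma sqint_post pi t : MC pi -> T0 <= t <= T1 -> sqint (P \x pi)%E (post pi t \o V t).
Proof.
move=> hpi tT; exact: cond_exp_sqint (measurable_observation tT) (measurable_post t hpi) (ce hpi tT) (sqint_X1 hpi).
Qed.

Lemma mmse_pythagoras pi t (phi : R * R -> R) : MC pi -> T0 <= t <= T1 ->
  measurable_fun setT phi -> sqint (P \x pi)%E (phi \o V t) ->
  \int[(P \x pi)%E]_w (w.2.2 - phi (V t w)) ^+ 2 =
  mmse pi t + \int[(P \x pi)%E]_w (post pi t (V t w) - phi (V t w)) ^+ 2.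
Proof.
move=> hpi tT mphi sphi.
exact: (cond_exp_pythagoras (measurable_observation tT) (measurable_post t hpi) (ce hpi tT) (sqint_X1 hpi) mphi sphi).
Qed.

Lemma mmse_le pi t (phi : R * R -> R) : MC pi -> T0 <= t <= T1 ->
  measurable_fun setT phi -> sqint (P \x pi)%E (phi \o V t) ->
  mmse pi t <= \int[(P \x pi)%E]_w (w.2.2 - phi (V t w)) ^+ 2.
Proof.
move=> hpi tT mphi sphi; rewrite mmse_pythagoras// lerDl.
by apply: Rintegral_ge0 => // w _; exact: sqr_ge0.
Qed.

(** A bound on the risk of the estimator [X0], the same for all couplings since it involves only the
    marginals. *)
Let S : R := 2 * \int[nu]_x x ^+ 2 + 2 * \int[mu]_x x ^+ 2.

Let mmse_le_S pi t : MC pi -> T0 <= t <= T1 -> mmse pi t <= S.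
Proof.
move=> hpi tT; have [s1 e1] := sq_snd hpi; have [s0 e0] := sq_fst hpi.
apply: le_trans (mmse_le (phi := fst) hpi tT measurable_fst (sqint_X0 hpi)) _.
have sB := sqintB (sqint_X1 hpi) (sqint_X0 hpi).
have [_ iB] := sB; have [_ i1] := sqint_X1 hpi; have [_ i0] := sqint_X0 hpi.
rewrite /S -e1 -e0 -(integral_second s1) -(integral_second s0).
have : 0 <= \int[(P \x pi)%E]_w ((w.2.2 - w.2.1) ^+ 2 - 2 * (w.2.2 ^+ 2) - 2 * (w.2.1 ^+ 2)) * (-1).
  rewrite -RintegralZr//.
    by apply: Rintegral_ge0 => // w _; have := sqr_ge0 (w.2.2 + w.2.1); rewrite sqrrD sqrrB; lra.
  have := integrableB measurableT (integrableB measurableT iB (integrableZl measurableT 2 i1)) (integrableZl measurableT 2 i0).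
  by apply: eq_integrable.
rewrite (Rintegral_lin3 2 2 iB i1 i0) /=; set a := \int[_]_w _; lra.
Qed.

(* The error of the linear estimator [(I t - g0 t * X0 - am t) / f1 t]. *)
Let mmse_le_linear pi t : MC pi -> T0 < t < T1 -> mmse pi t <= c * f0 t / f1 t.
Proof.
move=> hpi tT; have tT' := cl tT.
have [_ f10 _] := coefficients_gt0 hT01 hf ha hb hfA tT.
have f1n : f1 t != 0 by rewrite gt_eqF.
have [_ _ g1E] := hb tT'.
pose phi (p : R * R) := (f1 t)^-1 * (p.2 - g0 t * p.1 - am t).
have mphi : measurable_fun setT phi.
  by apply: measurable_funM => //; apply: measurable_funB => //; apply: measurable_funB => //; exact: measurable_funM.
have phiE w : phi (V t w) = w.2.2 + (f1 t)^-1 * (A t w.1 - am t).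
  rewrite /phi /V /observation /I /rap /= g1E -/(A t w.1).
  by move: (A t w.1) (am t) => x y; field.
have sA := sqint_arcade hT01 f0 f1 ha tT'.
have sA1 : sqint P (fun w => (f1 t)^-1 * (A t w - am t)).
  exact: sqintZ (sqintB sA (sqint_cst P (am t))).
have sphi : sqint (P \x pi)%E (phi \o V t).
  have := sqintD (sqint_X1 hpi) (sqint_first pi sA1).
  by congr sqint; apply/funext => w; rewrite /= phiE.
apply: le_trans (mmse_le hpi tT' mphi sphi) _.
have -> : \int[(P \x pi)%E]_w (w.2.2 - phi (V t w)) ^+ 2 = \int[(P \x pi)%E]_w ((f1 t)^-1 * (A t w.1 - am t)) ^+ 2.
  apply: eq_Rintegral => w _.
  by rewrite phiE opprD addNKr sqrrN.
rewrite (integral_first pi (g := fun w => (f1 t)^-1 * (A t w - am t))); last by case: sA1.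
under eq_Rintegral do rewrite exprMn.
have [_ iA] := sqintB sA (sqint_cst P (am t)).
rewrite RintegralZl// (arcade_variance hT01 hf ha hb tT').
by rewrite -/c le_eqVlt; apply/orP; left; apply/eqP; field.
Qed.

(** The estimator [X0] gives [mmse * f0 <= S * f0], the linear one [mmse * f1 <= c * f0]; the two
    are added. The bound vanishes with [f0] at [T1], which compensates the pole of the weight. *)
Lemma mmse_bound pi t : MC pi -> T0 < t < T1 ->
  mmse pi t <= (S + c) * (f0 t / (f0 t + f1 t)).
Proof.
move=> hpi tT; have [p0 p1 c0] := coefficients_gt0 hT01 hf ha hb hfA tT.
have h1 := mmse_le_S hpi (cl tT); have h2 := mmse_le_linear hpi tT.
rewrite mulrA ler_pdivlMr ?addr_gt0// mulrDr mulrDl.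
apply: lerD; first by rewrite ler_wpM2r// ltW.
by move: h2; rewrite ler_pdivlMr.
Qed.

Let Fc (f : R -> R) t := f (clamp T0 T1 t).

Variable om : R -> R.
Hypothesis mom : measurable_fun setT om.
Hypothesis om0 : forall t, 0 <= om t.
Hypothesis omE : {ae lebesgue_measure, forall t : R, T0 < t < T1 -> clock_weight T1 H1 H2 t = om t}.
Hypothesis iom : lebesgue_measure.-integrable `[T0, T1]
  (EFin \o (fun t => om t * (Fc f0 t / (Fc f0 t + Fc f1 t)))).

Let cont_meas (f : R -> R) : {within `[T0, T1], continuous f} -> measurable_fun setT (Fc f).
Proof. by move=> cf; apply: continuous_measurable_fun; exact: continuous_clamp (ltW hT01) cf. Qed.

Let clT t : T0 <= clamp T0 T1 t <= T1. Proof. by rewrite clamp_itv// ltW. Qed.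

Let measurable_rap : measurable_fun setT (fun z : Omega * (R * R) * R => I (clamp T0 T1 z.2) z.1).
Proof.
have [[mD _] _ _ _] := ha.
have [cf0 cf1 _ _] := hf; have [cg0 cg1 _ _] := hg.
have ms : measurable_fun setT (fun z : Omega * (R * R) * R => z.2) by exact: measurable_snd.
have mf : measurable_fun setT (fun z : Omega * (R * R) * R => z.1) by exact: measurable_fst.
have mc (f : R -> R) : {within `[T0, T1], continuous f} ->
    measurable_fun setT (fun z : Omega * (R * R) * R => f (clamp T0 T1 z.2)).
  by move=> /cont_meas h; exact: measurableT_comp h ms.
have mw : measurable_fun setT (fun z : Omega * (R * R) * R => z.1.1).
  exact: measurableT_comp measurable_fst mf.
have mx0 : measurable_fun setT (fun z : Omega * (R * R) * R => z.1.2.1) by exact: measurableT_comp mX0 mf.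
have mx1 : measurable_fun setT (fun z : Omega * (R * R) * R => z.1.2.2) by exact: measurableT_comp mX1 mf.
have mDc : measurable_fun setT (fun z : Omega * (R * R) * R => D (clamp T0 T1 z.2) z.1.1).
  have h : measurable_fun setT (fun z : Omega * R => D (clamp T0 T1 z.2) z.1).
    apply: (@measurable_caratheodory _ _ _ (fun t w => D (clamp T0 T1 t) w)) => [w|t].
      by apply: (@continuous_clamp R (fun t => D t w) T0 T1 (ltW hT01)); exact: hDcont.
    by apply: mD; exact: clT.
  have mp : measurable_fun setT (fun z : Omega * (R * R) * R => (z.1.1, z.2)) by exact: measurable_fun_pair.
  exact: measurableT_comp h mp.
have mD0 u : T0 <= u <= T1 -> measurable_fun setT (fun z : Omega * (R * R) * R => D u z.1.1).
  by move=> hu; exact: measurableT_comp (mD u hu) mw.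
apply: measurable_funD.
  by apply: measurable_funD; apply: measurable_funM => //; exact: mc.
apply: measurable_funB; first apply: measurable_funB => //.
  by apply: measurable_funM; [exact: mc|apply: mD0; rewrite lexx ltW].
by apply: measurable_funM; [exact: mc|apply: mD0; rewrite lexx ltW].
Qed.

Let prodP pi : probability (Omega * (R * R))%type R := (P \x pi)%E.

Let err pi (z : Omega * (R * R) * R) : R :=
  (z.1.2.2 - M pi z.2 z.1.2.1 (I (clamp T0 T1 z.2) z.1)) ^+ 2.

Let measurable_err pi : MC pi -> measurable_fun setT (err pi).
Proof.
move=> hpi; have [mM _] := hM hpi.
have mf : measurable_fun setT (fun z : Omega * (R * R) * R => z.1) by exact: measurable_fst.
have mx0 : measurable_fun setT (fun z : Omega * (R * R) * R => z.1.2.1) by exact: measurableT_comp mX0 mf.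
have mx1 : measurable_fun setT (fun z : Omega * (R * R) * R => z.1.2.2) by exact: measurableT_comp mX1 mf.
apply: measurable_funX; apply: measurable_funB => //.
have mp : measurable_fun setT (fun z : Omega * (R * R) * R => (z.2, (z.1.2.1, I (clamp T0 T1 z.2) z.1))).
  by apply: measurable_fun_pair; [exact: measurable_snd|apply: measurable_fun_pair; [exact: mx0|exact: measurable_rap]].
exact: measurableT_comp mM mp.
Qed.

Let errE pi t w : T0 <= t <= T1 -> err pi (w, t) = (w.2.2 - post pi t (V t w)) ^+ 2.
Proof. by move=> tT; rewrite /err /= clamp_id. Qed.

Let mmseE pi t : MC pi -> T0 <= t <= T1 ->
  (mmse pi t)%:E = (\int[(P \x pi)%E]_w (err pi (w, t))%:E)%E.
Proof.
move=> hpi tT; have [_ i] := sqintB (sqint_X1 hpi) (sqint_post hpi tT).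
have E : (\int[(P \x pi)%E]_w (err pi (w, t))%:E = \int[(P \x pi)%E]_w ((w.2.2 - post pi t (V t w)) ^+ 2)%:E)%E.
  by apply: eq_integral => w _; rewrite errE.
by rewrite E /mmse /Rintegral fineK//; exact: (integrable_fin_num measurableT i).
Qed.

Lemma measurable_mmse pi : MC pi -> measurable_fun `]T0, T1[ (mmse pi).
Proof.
move=> hpi.
have mE : measurable_fun setT (EFin \o err pi) by apply/measurable_EFinP; exact: measurable_err.
have mG := measurable_fun_fubini_tonelli_G (m1 := prodP pi) (EFin \o err pi) mE (fun z => sqr_ge0 _).
have mfG : measurable_fun setT (fun t => fine (fubini_G (P \x pi)%E (EFin \o err pi) t)) by exact: measurableT_comp.
apply: eq_measurable_fun (measurable_funTS mfG) => t; rewrite inE /= in_itv/= => tT.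
by rewrite /fubini_G -(mmseE hpi (cl tT)).
Qed.

Definition value pi : R := \int[lebesgue_measure]_(t in `]T0, T1[) (om t * mmse pi t).

Let bd (t : R) : R := (S + c) * (om t * (Fc f0 t / (Fc f0 t + Fc f1 t))).

Let ibd : lebesgue_measure.-integrable `]T0, T1[ (EFin \o bd).
Proof.
have mI1 : measurable (`]T0, T1[%classic : set (measurableTypeR R)) by exact: measurable_itv.
have mI2 : measurable (`[T0, T1]%classic : set (measurableTypeR R)) by exact: measurable_itv.
have := integrableZl mI2 (S + c) iom => i.
have := integrableS mI2 mI1 (subset_itvW _ _ (lexx _) (lexx _)) i.
by apply: eq_integrable.
Qed.

Let om_mmse_le pi t : MC pi -> T0 < t < T1 -> 0 <= om t * mmse pi t <= bd t.
Proof.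
move=> hpi tT; rewrite mulr_ge0 ?mmse_ge0//= /bd mulrCA ler_wpM2l//.
by rewrite /Fc !clamp_id ?cl//; exact: mmse_bound.
Qed.

Lemma integrable_om_mmse pi : MC pi ->
  lebesgue_measure.-integrable `]T0, T1[ (EFin \o (fun t => om t * mmse pi t)).
Proof.
move=> hpi; apply: (le_integrable _ _ _ ibd) => //.
  apply/measurable_EFinP; apply: measurable_funM; first exact: measurable_funTS.
  exact: measurable_mmse.
move=> t; rewrite /= in_itv/= => tT; have /andP[h0 h1] := om_mmse_le hpi tT.
by rewrite lee_fin (ger0_norm h0) (le_trans h1)// ler_norm.
Qed.

(** The weight is replaced by [om] on a full set of times inside the integral over sample points,
    through a comparison that asks no measurability. Tonelli then exchanges the integrals. *)
Lemma K_functionalE pi : MC pi -> K_functional P T0 T1 H1 H2 I (M pi) pi = (value pi)%:E.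
Proof.
move=> hpi.
pose G (z : Omega * (R * R) * R) : \bar R := (err pi z * (om z.2 * \1_(`]T0, T1[%classic) z.2))%:E.
have mG : measurable_fun setT G.
  apply/measurable_EFinP; apply: measurable_funM; first exact: measurable_err.
  have ms : measurable_fun setT (fun z : Omega * (R * R) * R => z.2) by exact: measurable_snd.
  have mi : measurable_fun setT (fun t : R => om t * \1_(`]T0, T1[%classic) t).
    by apply: measurable_funM => //; exact: measurable_indic.
  exact: measurableT_comp mi ms.
have G0 z : (0 <= G z)%E by rewrite lee_fin mulr_ge0 ?sqr_ge0// mulr_ge0.
have den t : T0 <= t <= T1 -> 0 <= H1 T1 * H2 t - H1 t * H2 T1.
  move=> tT; have [e _ _] := hb tT; have [h _ _] := coefficients_ge0 hT01 hf ha hb hfA tT.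
  have c0 := bridge_det_gt0 hT01 hf ha hb hfA.
  move: e; rewrite -/(bridge_det T0 T1 H1 H2) => e.
  have -> : H1 T1 * H2 t - H1 t * H2 T1 = bridge_det T0 T1 H1 H2 * f0 t by rewrite e mulrCA mulfV ?mulr1 ?gt_eqF.
  by rewrite mulr_ge0// ltW.
transitivity (\int[(P \x pi)%E]_w \int[lebesgue_measure]_t G (w, t))%E.
  apply: eq_integral => w _; rewrite integral_mkcond; apply: ge0_integral_ae_eq => //.
    move=> t; rewrite patchE; case: ifPn => // /[!inE]/= /[!in_itv]/= tT.
    by rewrite lee_fin mulr_ge0 ?invr_ge0 ?den// mulr_ge0 ?sqr_ge0// sqrtr_ge0.
  have := ae_lebesgueI (ae_lebesgueI (ae_lebesgue_neq T0) (ae_lebesgue_neq T1)) omE.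
  apply: ae_lebesgueS => t [[t0 t1] h]; rewrite patchE /G /= indicE.
  have -> : (t \in `[T0, T1]%classic) = (t \in `]T0, T1[%classic).
    have e : (T0 <= t <= T1) = (T0 < t < T1) by rewrite !le_eqVlt (eq_sym T0) (negbTE t0) (negbTE t1).
    by apply/idP/idP => /set_mem /=; rewrite in_itv/= => h'; apply/mem_set; rewrite /= in_itv/= ?e// -e.
  case: ifPn => [|_]; last by rewrite !mulr0.
  rewrite inE/= in_itv/= => tT; have tT' := cl tT.
  by rewrite mulr1 errE// -(h tT) /clock_weight mulrA.
rewrite (fubini_tonelli (m1 := prodP pi) (m2 := lebesgue_measure) G mG G0).
have mI1 : measurable (`]T0, T1[%classic : set (measurableTypeR R)) by exact: measurable_itv.
have fn := integrable_fin_num mI1 (integrable_om_mmse hpi).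
apply: etrans _ (esym (fineK fn)).
rewrite [RHS]integral_mkcond; apply: eq_integral => t _; rewrite patchE /G /= indicE.
case: ifPn => [|_]; last by rewrite integral0_eq// => w _; rewrite !mulr0.
rewrite inE/= in_itv/= => tT; rewrite mulr1 EFinM (mmseE hpi (cl tT)).
rewrite -ge0_integralZl//.
- by apply: eq_integral => w _; rewrite -EFinM mulrC.
- have mp : measurable_fun setT (fun w : Omega * (R * R) => (w, t)) by exact: measurable_fun_pair.
  by apply/measurable_EFinP; exact: measurableT_comp (measurable_err hpi) mp.
- by move=> w _; rewrite lee_fin sqr_ge0.
- by rewrite lee_fin.
Qed.

Lemma value_itv pi : MC pi ->
  0 <= value pi <= \int[lebesgue_measure]_(t in `]T0, T1[) bd t.
Proof.
move=> hpi; apply/andP; split.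
  by apply: Rintegral_ge0 => // t _; rewrite mulr_ge0// mmse_ge0.
apply: le_Rintegral => //; first exact: integrable_om_mmse.
by move=> t; rewrite /= in_itv/= => /(om_mmse_le hpi) /andP[].
Qed.

Let sd_neq0 t : T0 < t < T1 -> sd t != 0.
Proof.
by move=> tT; have [h _ _] := arcade_normal hT01 hf ha hb hfA tT; rewrite sqrtr_eq0 -ltNge.
Qed.

Let PA t : T0 < t < T1 -> forall B, measurable B -> P (A t @^-1` B) = normal_prob (am t) (sd t) B.
Proof. by move=> tT; have [_ h _] := arcade_normal hT01 hf ha hb hfA tT. Qed.

Let loss t phi : R * R -> R := channel_loss (g0 t) (g1 t) (am t) (sd t) phi.

Let pdf t (x : R * R) (z : R) : R := normal_pdf (am t) (sd t) (z - (g0 t * x.1 + g1 t * x.2)).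

Let measurable_pdf t : measurable_fun setT (fun q : R * R * R => pdf t q.1 q.2).
Proof.
have m1 : measurable_fun setT (fun q : R * R * R => q.1) by exact: measurable_fst.
have m11 : measurable_fun setT (fun q : R * R * R => q.1.1) by exact: measurableT_comp measurable_fst m1.
have m12 : measurable_fun setT (fun q : R * R * R => q.1.2) by exact: measurableT_comp measurable_snd m1.
apply: measurableT_comp; first exact: measurable_normal_pdf.
apply: measurable_funB; first exact: measurable_snd.
by apply: measurable_funD; exact: measurable_funM.
Qed.

Let integral_post pi t (F : R * R * R -> \bar R) : T0 < t < T1 -> measurable_fun setT F ->
  (forall q, 0 <= F q)%E ->
  (\int[(P \x pi)%E]_w F (w.2, I t w) =
   \int[pi]_x \int[lebesgue_measure]_z ((pdf t x z)%:E * F (x, z)))%E.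
Proof.
move=> tT mF F0; exact: (ge0_integral_channel (g0 t) (g1 t) (mA (cl tT)) (PA tT) pi mF F0).
Qed.

(** Conditionally on the pair [(X0, X1)] the observation is Gaussian, so the risk of a bounded
    estimator is the mean of [channel_loss] under [pi], here realised by [Q]. *)
Lemma loss_law pi (Q : R * R -> R) t (phi : R * R -> R) (n : R) : T0 < t < T1 ->
  measurable_fun setT Q ->
  (forall C, measurable C -> pi C = (mu \x @unif R)%E ((fun w => (w.1, Q w)) @^-1` C)) ->
  measurable_fun setT phi -> (forall x, `|phi x| <= n) ->
  measurable_fun setT (loss t phi) /\
  \int[(P \x pi)%E]_w (w.2.2 - phi (V t w)) ^+ 2 =
  \int[(mu \x @unif R)%E]_w loss t phi (w.1, Q w).
Proof.
move=> tT mQ piE mphi bphi.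
have m1 : measurable_fun setT (fun q : R * R * R => q.1) by exact: measurable_fst.
have m11 : measurable_fun setT (fun q : R * R * R => q.1.1) by exact: measurableT_comp measurable_fst m1.
have m12 : measurable_fun setT (fun q : R * R * R => q.1.2) by exact: measurableT_comp measurable_snd m1.
have mq : measurable_fun setT (fun q : R * R * R => (q.1.1, q.2)) by exact: measurable_fun_pair.
pose F (q : R * R * R) : \bar R := ((q.1.2 - phi (q.1.1, q.2)) ^+ 2)%:E.
have mF : measurable_fun setT F.
  apply/measurable_EFinP; apply: measurable_funX; apply: measurable_funB => //.
  exact: measurableT_comp mphi mq.
have F0 q : (0 <= F q)%E by rewrite lee_fin sqr_ge0.
have mpF : measurable_fun setT (fun q : R * R * R => (pdf t q.1 q.2)%:E * F q)%E.
  by apply: emeasurable_funM => //; apply/measurable_EFinP.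
have pF0 q : (0 <= (pdf t q.1 q.2)%:E * F q)%E by rewrite mule_ge0// lee_fin normal_pdf_ge0.
have lE x : (loss t phi x)%:E = (\int[lebesgue_measure]_z ((pdf t x z)%:E * F (x, z)))%E.
  exact: (channel_lossE (g0 t) (g1 t) (am t) (sd t) mphi bphi x).
have ml : measurable_fun setT (fun x => (loss t phi x)%:E).
  have := measurable_fun_fubini_tonelli_F (m2 := lebesgue_measure) _ mpF pF0.
  by congr measurable_fun; apply/funext => x; rewrite lE.
split; first exact/measurable_EFinP.
have mXQ : measurable_fun setT (fun w : R * R => (w.1, Q w)) by exact: measurable_fun_pair.
have l0 x : (0 <= (loss t phi x)%:E)%E by rewrite lee_fin; have /andP[] := channel_loss_itv (g0 t) (g1 t) (am t) (sd t) mphi bphi x.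
congr fine; apply: etrans (integral_post pi tT mF F0) _.
rewrite -(ge0_integral_law (m := (mu \x @unif R)%E) (m' := pi) mXQ piE ml)//.
by apply: eq_integral => x _; rewrite lE.
Qed.

(** * Upper semicontinuity along a convergent sequence *)

Section limit.
Variables (p : nat -> probability (R * R)%type R) (pstar : probability (R * R)%type R).
Variables (Q_ : nat -> R * R -> R) (Q : R * R -> R).
Hypothesis pM : forall j, MC (p j).
Hypothesis psM : MC pstar.
Hypothesis mQ_ : forall j, measurable_fun setT (Q_ j).
Hypothesis mQ : measurable_fun setT Q.
Hypothesis pE : forall j C, measurable C ->
  p j C = (mu \x @unif R)%E ((fun w => (w.1, Q_ j w)) @^-1` C).
Hypothesis psE : forall C, measurable C ->
  pstar C = (mu \x @unif R)%E ((fun w => (w.1, Q w)) @^-1` C).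
Hypothesis Qcvg : {ae (mu \x @unif R)%E, forall w, Q_ j w @[j --> \oo] --> Q w}.

Let sqQ pi (q : R * R -> R) : MC pi -> measurable_fun setT q ->
  (forall C, measurable C -> pi C = (mu \x @unif R)%E ((fun w => (w.1, q w)) @^-1` C)) ->
  (mu \x @unif R)%E.-integrable setT (EFin \o (fun w => q w ^+ 2)) /\
  \int[(mu \x @unif R)%E]_w q w ^+ 2 = \int[nu]_x x ^+ 2.
Proof.
move=> hpi mq qE; have [[ms js] e] := sq_snd hpi.
have mXq : measurable_fun setT (fun w : R * R => (w.1, q w)) by exact: measurable_fun_pair.
have m22 : measurable_fun setT (fun x : R * R => (x.2 ^+ 2)%:E).
  by apply/measurable_EFinP; apply: measurable_funX.
split; first exact: (fst (integrable_law (m := (mu \x @unif R)%E) (m' := pi) mXq qE m22) js).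
by rewrite -e /Rintegral (integral_law (m := (mu \x @unif R)%E) (m' := pi) mXq qE m22).
Qed.

(** The losses converge pointwise almost everywhere and are bounded by [2 * Q_ j ^+ 2 + 2 * n ^+ 2],
    whose integral does not depend on [j] because every [Q_ j] has law [nu]. *)
Lemma loss_cvg t (phi : R * R -> R) (n : R) : T0 < t < T1 ->
  measurable_fun setT phi -> (forall x, `|phi x| <= n) ->
  \int[(P \x p j)%E]_w (w.2.2 - phi (V t w)) ^+ 2 @[j --> \oo] -->
  \int[(P \x pstar)%E]_w (w.2.2 - phi (V t w)) ^+ 2.
Proof.
move=> tT mphi bphi.
have [ml eS] := loss_law tT mQ psE mphi bphi.
rewrite eS.
rewrite (_ : (fun j => \int[(P \x p j)%E]_w (w.2.2 - phi (V t w)) ^+ 2) =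
   (fun j => \int[(mu \x @unif R)%E]_w loss t phi (w.1, Q_ j w))); last first.
  by apply/funext => j; exact: (proj2 (loss_law tT (mQ_ j) (@pE j) mphi bphi)).
have mcomp q : measurable_fun setT q -> measurable_fun setT (fun w : R * R => loss t phi (w.1, q w)).
  move=> mq; have mXq : measurable_fun setT (fun w : R * R => (w.1, q w)) by exact: measurable_fun_pair.
  exact: measurableT_comp ml mXq.
have itv x := channel_loss_itv (g0 t) (g1 t) (am t) (sd t) mphi bphi x.
have ni : (mu \x @unif R)%E.-integrable setT (EFin \o cst (2 * n ^+ 2)).
  exact: sqint_integrable (sqint_cst (mu \x @unif R)%E _).
have ig pi q (hpi : MC pi) (mq : measurable_fun setT q) (qE : forall C, measurable C -> pi C = (mu \x @unif R)%E ((fun w => (w.1, q w)) @^-1` C)) :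
   (mu \x @unif R)%E.-integrable setT (EFin \o (fun w => 2 * q w ^+ 2 + 2 * n ^+ 2)) /\
   \int[(mu \x @unif R)%E]_w (2 * q w ^+ 2 + 2 * n ^+ 2) = 2 * \int[nu]_x x ^+ 2 + 2 * n ^+ 2.
  have [i e] := sqQ hpi mq qE.
  have i2 : (mu \x @unif R)%E.-integrable setT (EFin \o (fun w => 2 * q w ^+ 2)).
    by have := integrableZl measurableT 2 i; apply: eq_integrable.
  split; first by have := integrableD measurableT i2 ni; apply: eq_integrable.
  by rewrite RintegralD// RintegralZl// e Rintegral_prob_cst.
apply: (pratt (m := (mu \x @unif R)%E) (g_ := fun j w => 2 * Q_ j w ^+ 2 + 2 * n ^+ 2)
   (g := fun w => 2 * Q w ^+ 2 + 2 * n ^+ 2)).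
- by move=> j; exact: mcomp.
- exact: mcomp.
- by move=> j; have [] := ig _ _ (pM j) (mQ_ j) (@pE j).
- by have [] := ig _ _ psM mQ psE.
- by move=> j w; have /andP[l0 l1] := itv (w.1, Q_ j w); rewrite /loss ger0_norm.
- by move=> w; have /andP[l0 l1] := itv (w.1, Q w); rewrite /loss ger0_norm.
- apply: filterS Qcvg => w cw.
  exact: (@channel_loss_cvg R (g0 t) (g1 t) (am t) (sd t) phi n (sd_neq0 tT) mphi bphi w.1 _ _ cw).
- apply: filterS Qcvg => w cw; apply: cvgD; last exact: cvg_cst.
  apply: cvgM; first exact: cvg_cst.
  by under eq_fun do rewrite expr2; rewrite expr2; exact: cvgM.
- by move=> j; have [_ ->] := ig _ _ (pM j) (mQ_ j) (@pE j); have [_ ->] := ig _ _ psM mQ psE.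
Qed.

(** A truncation of the posterior mean of the limit is a bounded estimator for every [p j], so its
    risk dominates [mmse (p j) t] and converges. For the limit itself the truncation costs less than
    [e / 2], by the Pythagorean identity. *)
Lemma mmse_usc t e : T0 < t < T1 -> 0 < e ->
  \forall j \near \oo, mmse (p j) t <= mmse pstar t + e.
Proof.
move=> tT e0; have tT' := cl tT.
have mpost := measurable_post t psM; have sp := sqint_post psM tT'.
pose phi (n : nat) x := if `|post pstar t x| <= n%:R then post pstar t x else 0.
have mphi n : measurable_fun setT (phi n).
  apply: measurable_fun_ifT => //.
  by apply: measurable_fun_ler; [exact: measurableT_comp|exact: measurable_cst].
have bphi n x : `|phi n x| <= n%:R by rewrite /phi; case: ifP => //; rewrite normr0.
have mphiV n pi : measurable_fun setT (phi n \o V t) by exact: measurableT_comp (mphi n) (measurable_observation tT').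
have sphi n pi : sqint (P \x pi)%E (phi n \o V t).
  split; first exact: mphiV.
  apply: (@integrable_bdd _ _ _ (P \x pi)%E _ (n%:R ^+ 2)) => [|w]; first by apply: measurable_funX; exact: mphiV.
  by rewrite normrX lerXn2r ?nnegrE//; exact: bphi.
have [mpV ip] := sp.
have lim0 : \int[(P \x pstar)%E]_w (post pstar t (V t w) - phi n (V t w)) ^+ 2 @[n --> \oo] --> \int[(P \x pstar)%E]_w cst 0 w.
  apply: (pratt (m := (P \x pstar)%E) (g_ := fun _ w => post pstar t (V t w) ^+ 2) (g := fun w => post pstar t (V t w) ^+ 2)) => //.
  - by move=> n; apply: measurable_funX; apply: measurable_funB => //; exact: mphiV.
  - move=> n w; rewrite ger0_norm ?sqr_ge0// /phi; case: ifP => _; last by rewrite subr0.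
    by rewrite subrr expr0n/= sqr_ge0.
  - by move=> w; rewrite /= normr0 sqr_ge0.
  - apply: aeW => w; apply: cvg_near_cst; near=> n; rewrite /phi ifT ?subrr ?expr0n//.
    by near: n; exact: nbhs_infty_ger.
  - by apply: aeW => w; exact: cvg_cst.
have [n hn] : exists n, \int[(P \x pstar)%E]_w (post pstar t (V t w) - phi n (V t w)) ^+ 2 < e / 2.
  have h := Rintegral_prob_cst (P \x pstar)%E 0.
  move: lim0; rewrite h => /cvgrPdist_lt/(_ (e / 2) ltac:(lra)) [N _ hN].
  exists N; have := hN N (leqnn N); rewrite sub0r normrN; exact: le_lt_trans (ler_norm _).
have := loss_cvg tT (mphi n) (bphi n); move/cvgrPdist_lt/(_ (e / 2) ltac:(lra)).
apply: filterS => j; rewrite (mmse_pythagoras psM tT' (mphi n) (sphi n pstar)).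
have h := mmse_le (pM j) tT' (mphi n) (sphi n (p j)).
move: hn h; set a := \int[_]_w _; set b := \int[_]_w _; set m0 := mmse pstar t; set mj := mmse (p j) t.
by rewrite ltr_norml => hn h /andP[h1 h2]; lra.
Unshelve. all: by end_near.
Qed.

(** Fatou's lemma for the nonnegative functions [bd - om * mmse], with [bd] integrable and
    independent of the coupling. *)
Lemma value_usc (s : R) : (forall j, s - j.+1%:R^-1 <= value (p j)) -> s <= value pstar.
Proof.
move=> hs.
have mD : measurable (`]T0, T1[%classic : set (measurableTypeR R)) by exact: measurable_itv.
pose B pi (t : R) : R := bd t - om t * mmse pi t.
have iB pi : MC pi -> lebesgue_measure.-integrable `]T0, T1[ (EFin \o B pi).
  by move=> hpi; have := integrableB mD ibd (integrable_om_mmse hpi); apply: eq_integrable.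
have intB pi : MC pi -> \int[lebesgue_measure]_(t in `]T0, T1[) B pi t =
    \int[lebesgue_measure]_(t in `]T0, T1[) bd t - value pi.
  by move=> hpi; rewrite /B RintegralB//; exact: integrable_om_mmse.
pose Bp pi := (EFin \o B pi) \_ `]T0, T1[%classic.
have mBp pi : MC pi -> measurable_fun setT (Bp pi : measurableTypeR R -> \bar R).
  by move=> hpi; apply/(measurable_restrictT _ mD); exact: (measurable_int _ (iB pi hpi)).
have Bp0 pi t : MC pi -> (0 <= Bp pi t)%E.
  move=> hpi; rewrite /Bp patchE; case: ifPn => // /set_mem /=; rewrite in_itv/= => tT.
  by rewrite lee_fin subr_ge0; have /andP[] := om_mmse_le hpi tT.
have intBp pi : MC pi -> (\int[lebesgue_measure]_t Bp pi t =
    (\int[lebesgue_measure]_(t in `]T0, T1[) bd t - value pi)%:E)%E.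
  move=> hpi; rewrite /Bp -integral_mkcond -(intB pi hpi).
  by apply/esym; exact: fineK (integrable_fin_num mD (iB pi hpi)).
have le1 : (\int[lebesgue_measure]_t Bp pstar t <= \int[lebesgue_measure]_t limn_einf (fun j => Bp (p j) t))%E.
  apply: ge0_le_integral => //.
  - by move=> t _; exact: Bp0.
  - exact: mBp.
  - by apply: measurable_limn_einf => j; exact: mBp.
  move=> t _; rewrite /Bp patchE; case: ifPn => [tD|tD]; last first.
    rewrite (_ : (fun j => _) = (fun j => ((fun=> 0 : R) j)%:E)); last first.
      by apply/funext => j; rewrite patchE (negbTE tD).
    by apply: limn_einf_ge => e e0; apply: nearW => j; lra.
  rewrite (_ : (fun j => _) = (fun j => (B (p j) t)%:E)); last first.
    by apply/funext => j; rewrite patchE tD.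
  move: (set_mem tD); rewrite /= in_itv/= => tT.
  apply: limn_einf_ge => e e0.
  have o1 : 0 < om t + 1 by rewrite ltr_wpDl.
  have e1 : 0 < e / (om t + 1) by rewrite divr_gt0.
  have := mmse_usc tT e1; apply: filterS => j hj; rewrite /B.
  have := ler_wpM2l (om0 t) hj; rewrite mulrDr => h.
  have h' : om t * (e / (om t + 1)) <= e.
    rewrite mulrA ler_pdivrMr// [om t * e]mulrC; apply: ler_wpM2l; [exact: ltW|by rewrite lerDl].
  by move: h h'; set x := om t * (_ / _); lra.
have le2 := le_trans le1 (fatou lebesgue_measure measurableT (fun j => mBp _ (pM j)) (fun j t _ => Bp0 _ t (pM j))).
have le3 : (limn_einf (fun j => \int[lebesgue_measure]_t Bp (p j) t) <=
    (\int[lebesgue_measure]_(t in `]T0, T1[) bd t - s)%:E)%E.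
  apply: limn_einf_le => e e0; near=> j; rewrite intBp// lee_fin.
  have h : j.+1%:R^-1 <= e by apply: ltW; near: j; exact: (near_infty_natSinv_lt (PosNum e0)).
  by have := hs j; move: h; set x := _^-1; set a := \int[_]_(_ in _) _; lra.
have := le_trans le2 le3; rewrite intBp// lee_fin.
by set a := \int[_]_(_ in _) _; lra.
Unshelve. all: by end_near.
Qed.

End limit.

(** The risk of the estimator [post pih] is linear in the coupling. Under each component its excess
    over the optimal risk is the mean square distance to the posterior mean of that component. *)
Lemma mmse_mixture pi0 pi1 pih t : MC pi0 -> MC pi1 -> MC pih -> half_mixture pi0 pi1 pih ->
  T0 <= t <= T1 -> sqint (P \x pi0)%E (post pih t \o V t) /\ sqint (P \x pi1)%E (post pih t \o V t) /\
  mmse pih t = ((mmse pi0 t + \int[(P \x pi0)%E]_w (post pi0 t (V t w) - post pih t (V t w)) ^+ 2) +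
                (mmse pi1 t + \int[(P \x pi1)%E]_w (post pi1 t (V t w) - post pih t (V t w)) ^+ 2)) / 2.
Proof.
move=> h0 h1 hh hm tT; have hm2 := half_mixture_prod P hm.
have [mp ip] := sqint_post hh tT; have [ip0 ip1] := half_mixture_integrableV hm2 ip.
have s0 : sqint (P \x pi0)%E (post pih t \o V t) by split.
have s1 : sqint (P \x pi1)%E (post pih t \o V t) by split.
split=> //; split=> //.
have [_ i0] := sqintB (sqint_X1 h0) s0; have [_ i1] := sqintB (sqint_X1 h1) s1.
have [_ e] := half_mixture_integrable hm2 i0 i1.
rewrite /mmse; apply: etrans e _.
have mph := measurable_post t hh.
by congr ((_ + _) / 2); [exact: mmse_pythagoras h0 tT mph s0|exact: mmse_pythagoras h1 tT mph s1].
Qed.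

(** The noise variance is [c * f0 t * f1 t] and [X1] enters with coefficient [g1 t = f1 t]. In the
    exponent of the normal density, [y^2] thus has coefficient [- f1 / (2 c f0)], and the
    observation multiplies [y] by [1 / (c f0)]. *)
Let tilt_rate t : R := f1 t / (2 * c * f0 t).
Let tilt_slope t : R := (c * f0 t)^-1.
Let tilt_shift x t : R := tilt_slope t * (am t + g0 t * x).

Let pdf_tilt t x z : T0 < t < T1 -> exists2 C : R, 0 < C & forall y : R,
  pdf t (x, y) z = C * (expR ((tilt_slope t * z - tilt_shift x t) * y) * expR (- tilt_rate t * y ^+ 2)).
Proof.
move=> tT; have [p0 p1 c0] := coefficients_gt0 hT01 hf ha hb hfA tT.
have [_ _ g1E] := hb (cl tT).
have sn := sd_neq0 tT.
exists (normal_peak (sd t) * expR (- (z - g0 t * x - am t) ^+ 2 / (sd t ^+ 2 *+ 2))).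
  by rewrite mulr_gt0 ?expR_gt0// normal_peak_gt0.
move=> y; rewrite /pdf normal_pdfE// -mulrA; congr (_ * _).
rewrite /normal_fun -!expRD; congr expR.
have -> : sd t ^+ 2 = c * f0 t * f1 t by rewrite sqr_sqrtr// ltW// !mulr_gt0.
rewrite /tilt_shift /tilt_slope /tilt_rate /= g1E.
have cn : c != 0 by rewrite gt_eqF.
have := gt_eqF p0; have := gt_eqF p1; move: cn.
move: (f0 t) (f1 t) c (am t) (g0 t) => a0 a1 cc m gg cn /negbT an1 /negbT an0.
by field; rewrite an0 an1 cn.
Qed.

(** * Bayes' formula for the posterior mean *)

Section posterior_kernel.
Variables (pi : probability (R * R)%type R) (k : R.-pker R ~> R) (t : R).
Hypothesis hpi : MC pi.
Hypothesis hk : conditional_law mu pi k.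
Hypothesis tT : T0 < t < T1.

(** The unnormalised posterior expectation of [F] given [X0 = q.1] and observation [q.2]: the
    conditional law weighted by the likelihood. *)
Let ker (F : R * R * R -> \bar R) (q : R * R) : \bar R :=
  (\int[klaw k q.1]_y ((pdf t (q.1, y) q.2)%:E * F ((q.1, y), q.2)))%E.

Let mpdfF (F : R * R * R -> \bar R) : measurable_fun setT F ->
  measurable_fun setT (fun q => (pdf t q.1 q.2)%:E * F q)%E.
Proof. by move=> mF; apply: emeasurable_funM => //; exact/measurable_EFinP. Qed.

Let pdfF_ge0 (F : R * R * R -> \bar R) q : (forall q, 0 <= F q)%E ->
  (0 <= (pdf t q.1 q.2)%:E * F q)%E.
Proof. by move=> F0; rewrite mule_ge0// lee_fin normal_pdf_ge0. Qed.

Let measurable_ker (F : R * R * R -> \bar R) : measurable_fun setT F ->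
  (forall q, 0 <= F q)%E -> measurable_fun setT (ker F).
Proof.
move=> mF F0.
pose Q (w : R * R) := quantile (fun y => fine (k w.1 `]-oo, y]%classic)) w.2.
have mQ : measurable_fun setT Q := measurable_klaw_quantile hk.
have m1 : measurable_fun setT (fun w : R * R * R => w.1) by exact: measurable_fst.
have m2' : measurable_fun setT (fun w : R * R * R => w.2) by exact: measurable_snd.
have m11 : measurable_fun setT (fun w : R * R * R => w.1.1) by exact: measurableT_comp measurable_fst m1.
have m12 : measurable_fun setT (fun w : R * R * R => w.1.2) by exact: measurableT_comp measurable_snd m1.
have mc : measurable_fun setT (fun w : R * R * R => (w.1.1, w.2)) by exact: measurable_fun_pair.
have mQc : measurable_fun setT (fun w : R * R * R => Q (w.1.1, w.2)) by exact: measurableT_comp mQ mc.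
have mp : measurable_fun setT (fun w : R * R * R => ((w.1.1, Q (w.1.1, w.2)), w.1.2)).
  by apply: measurable_fun_pair => //; exact: measurable_fun_pair.
have mG := measurableT_comp (mpdfF mF) mp.
have := measurable_fun_fubini_tonelli_F (m2 := @unif R) _ mG (fun w => pdfF_ge0 _ F0).
congr measurable_fun; apply/funext => q; rewrite /fubini_F /ker /=; apply/esym.
have mq : measurable_fun setT (fun u => Q (q.1, u)).
  have mp1 : measurable_fun setT (fun u : R => (q.1, u)) by exact: measurable_fun_pair.
  exact: measurableT_comp mQ mp1.
have my : measurable_fun setT (fun y : R => ((q.1, y), q.2)).
  by apply: measurable_fun_pair => //; exact: measurable_fun_pair.
apply: (ge0_integral_law (m := @unif R) (m' := klaw k q.1) mq
  (fun A mA => klaw_quantile k q.1 mA) (f := fun y => (pdf t (q.1, y) q.2)%:E * F ((q.1, y), q.2))%E).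
  exact: measurableT_comp (mpdfF mF) my.
by move=> y; exact: (@pdfF_ge0 F ((q.1, y), q.2)).
Qed.

Let integral_ker (F : R * R * R -> \bar R) : measurable_fun setT F -> (forall q, 0 <= F q)%E ->
  (\int[(P \x pi)%E]_w F (w.2, I t w) = \int[(mu \x lebesgue_measure)%E]_q ker F q)%E.
Proof.
move=> mF F0; rewrite integral_post//.
have mG := measurable_fun_fubini_tonelli_F (m2 := lebesgue_measure) _ (mpdfF mF) (fun w => pdfF_ge0 w F0).
have G0 x : (0 <= \int[lebesgue_measure]_z ((pdf t x z)%:E * F (x, z)))%E.
  by apply: integral_ge0 => z _; exact: (@pdfF_ge0 F (x, z)).
rewrite (ge0_disintegration hk mG G0).
rewrite (fubini_tonelli1 (m1 := mu) (m2 := lebesgue_measure)); last 2 first.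
- exact: measurable_ker.
- by move=> q; apply: integral_ge0 => y _; exact: (@pdfF_ge0 F ((q.1, y), q.2)).
apply: eq_integral => x _; rewrite /fubini_F /ker /=.
apply: (fubini_tonelli (m1 := klaw k x) (m2 := lebesgue_measure)
  (fun w => (pdf t (x, w.1) w.2)%:E * F ((x, w.1), w.2))%E).
  have mxp : measurable_fun setT (fun w : R * R => ((x, w.1), w.2)).
    by apply: measurable_fun_pair => //; exact: measurable_fun_pair.
  exact: measurableT_comp (mpdfF mF) mxp.
by move=> w; exact: (@pdfF_ge0 F ((x, w.1), w.2)).
Qed.

Let ker_indic (F : R * R * R -> \bar R) (B : set (R * R)) q :
  ker (fun w => (F w * (\1_B (w.1.1, w.2))%:E)%E) q = if q \in B then ker F q else 0%E.
Proof.
rewrite /ker; case: ifPn => qB; [apply: eq_integral|apply: integral0_eq] => y _ /=;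
  by rewrite indicE -surjective_pairing ?qB ?(negbTE qB) ?mule1 ?mule0.
Qed.

Variable phi : R * R -> R.
Hypothesis mphi : measurable_fun setT phi.
Hypothesis sphi : sqint (P \x pi)%E (phi \o V t).
Hypothesis phiE : \int[(P \x pi)%E]_w (post pi t (V t w) - phi (V t w)) ^+ 2 = 0.

(** A splitting of [X1 - phi] into nonnegative functions, each of which Tonelli can handle
    separately. *)
Let up (w : R * R * R) : R := Num.max w.1.2 0 + Num.max (- phi (w.1.1, w.2)) 0.
Let un (w : R * R * R) : R := Num.max (- w.1.2) 0 + Num.max (phi (w.1.1, w.2)) 0.

Let upn w : up w - un w = w.1.2 - phi (w.1.1, w.2).
Proof.
rewrite /up /un [w.1.2 in RHS]max_sub_max [phi _ in RHS]max_sub_max.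
by move: (Num.max _ _) (Num.max _ _) (Num.max _ _) (Num.max _ _) => a b e f; lra.
Qed.

Let up0 w : 0 <= up w. Proof. by rewrite addr_ge0// le_max lexx orbT. Qed.
Let un0 w : 0 <= un w. Proof. by rewrite addr_ge0// le_max lexx orbT. Qed.

Let mphi3 : measurable_fun setT (fun w : R * R * R => phi (w.1.1, w.2)).
Proof.
have m1 : measurable_fun setT (fun w : R * R * R => w.1) by exact: measurable_fst.
have m11 : measurable_fun setT (fun w : R * R * R => w.1.1) by exact: measurableT_comp measurable_fst m1.
have mc : measurable_fun setT (fun w : R * R * R => (w.1.1, w.2)) by exact: measurable_fun_pair.
exact: measurableT_comp mphi mc.
Qed.

Let m12 : measurable_fun setT (fun w : R * R * R => w.1.2).
Proof.
have m1 : measurable_fun setT (fun w : R * R * R => w.1) by exact: measurable_fst.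
exact: measurableT_comp measurable_snd m1.
Qed.

Let mup : measurable_fun setT up.
Proof. by apply: measurable_funD; apply: measurable_maxr => //; exact: measurableT_comp. Qed.
Let mun : measurable_fun setT un.
Proof. by apply: measurable_funD; apply: measurable_maxr => //; exact: measurableT_comp. Qed.

Let mE (u : R * R * R -> R) : measurable_fun setT u -> measurable_fun setT (fun w => (u w)%:E).
Proof. by move=> mu'; exact/measurable_EFinP. Qed.

Let mVt (u : R * R * R -> R) : measurable_fun setT u -> measurable_fun setT (fun w => u (w.2, I t w)).
Proof.
move=> mu'; have mp : measurable_fun setT (fun w : Omega * (R * R) => (w.2, I t w)).
  by apply: measurable_fun_pair; [exact: m2|exact: mI (cl tT)].
exact: measurableT_comp mu' mp.
Qed.

Let ub u : u = up \/ u = un -> forall w, `|u w| <= `|w.1.2| + `|phi (w.1.1, w.2)|.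
Proof.
have mx (x : R) : Num.max x 0 <= `|x| by rewrite ge_max ler_norm normr_ge0.
move=> h w; rewrite ger0_norm; last by case: h => ->.
by case: h => ->; apply: lerD; rewrite // -?(normrN (phi _)) -?(normrN w.1.2).
Qed.

Let iu u : u = up \/ u = un -> measurable_fun setT u ->
  (P \x pi)%E.-integrable setT (EFin \o (fun w => u (w.2, I t w))).
Proof.
move=> h mu'.
have i1 := sqint_integrable (sqint_X1 hpi); have i2 := sqint_integrable sphi.
have := integrableD measurableT (integrable_abse i1) (integrable_abse i2) => i3.
apply: (@integrable_dom _ _ _ (P \x pi)%E _ (fun w => `|w.2.2| + `|phi (V t w)|)) => [||w].
- exact: mVt.
- by move: i3; apply: eq_integrable.
- exact: (ub h (w.2, I t w)).
Qed.

(** By [phiE], [phi] agrees almost everywhere with the posterior mean, so [X1 - phi] integrates to 0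
    over every set of observations. *)
Let balance (B : set (R * R)) : measurable B ->
  (\int[(mu \x lebesgue_measure)%E]_(q in B) ker (EFin \o up) q =
   \int[(mu \x lebesgue_measure)%E]_(q in B) ker (EFin \o un) q)%E.
Proof.
move=> mB; have tT' := cl tT.
have mB3 : measurable_fun setT (fun w : R * R * R => \1_B (w.1.1, w.2) : R).
  have m1 : measurable_fun setT (fun w : R * R * R => w.1) by exact: measurable_fst.
  have m11 : measurable_fun setT (fun w : R * R * R => w.1.1) by exact: measurableT_comp measurable_fst m1.
  have mc : measurable_fun setT (fun w : R * R * R => (w.1.1, w.2)) by exact: measurable_fun_pair.
  have mi : measurable_fun setT (\1_B : R * R -> R) by exact: measurable_indic.
  exact: measurableT_comp mi mc.
have red (u : R * R * R -> R) : measurable_fun setT u -> (forall w, 0 <= u w) ->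
    (\int[(mu \x lebesgue_measure)%E]_(q in B) ker (EFin \o u) q =
     \int[(P \x pi)%E]_w (u (w.2, I t w) * \1_B (V t w))%:E)%E.
  move=> mu' u0; rewrite integral_mkcond.
  have mF : measurable_fun setT (fun w : R * R * R => ((u w)%:E * (\1_B (w.1.1, w.2))%:E)%E).
    by apply: emeasurable_funM; apply/measurable_EFinP.
  have F0 w : (0 <= (u w)%:E * (\1_B (w.1.1, w.2))%:E)%E by rewrite mule_ge0// lee_fin.
  have e := integral_ker mF F0.
  transitivity (\int[(mu \x lebesgue_measure)%E]_q ker (fun w => ((u w)%:E * (\1_B (w.1.1, w.2))%:E)%E) q)%E.
    by apply: eq_integral => q _; rewrite (ker_indic (EFin \o u)) patchE.
  by rewrite -e; apply: eq_integral => w _; rewrite EFinM.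
rewrite (red _ mup up0) (red _ mun un0).
have mBV : measurable_fun setT (fun w => \1_B (V t w) : R).
  have mi : measurable_fun setT (\1_B : R * R -> R) by exact: measurable_indic.
  exact: measurableT_comp mi (measurable_observation tT').
have ib (u : R * R * R -> R) : measurable_fun setT u -> u = up \/ u = un ->
    (P \x pi)%E.-integrable setT (EFin \o (fun w => u (w.2, I t w) * \1_B (V t w))).
  move=> mu' h; have := integrable_abse (iu h mu') => ia.
  apply: (@integrable_dom _ _ _ (P \x pi)%E _ (fun w => `|u (w.2, I t w)|)) => [||w] //.
    by apply: measurable_funM => //; exact: mVt.
  by rewrite normrM ler_piMr// indicE; case: (_ \in _); rewrite ?normr1 ?normr0.
have ip := ib _ mup (or_introl erefl); have iq := ib _ mun (or_intror erefl).
have fp := integrable_fin_num measurableT ip; have fq := integrable_fin_num measurableT iq.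
apply: etrans (esym (fineK fp)) _; apply: etrans _ (fineK fq); congr EFin; apply/eqP.
rewrite -subr_eq0; apply/eqP.
have := RintegralB measurableT ip iq; rewrite /Rintegral => <-.
have m2phi : measurable_fun setT (fun w => (phi (V t w) - post pi t (V t w)) * \1_B (V t w)).
  apply: measurable_funM => //; apply: measurable_funB; first by case: sphi.
  by case: (sqint_post hpi tT').
have orth : \int[(P \x pi)%E]_w ((w.2.2 - post pi t (V t w)) * \1_B (V t w)) = 0.
  have mi : measurable_fun setT (\1_B : R * R -> R) by exact: measurable_indic.
  have sB := sqintB (sqint_X1 hpi) (sqint_post hpi tT').
  have ia := integrable_abse (sqint_integrable sB).
  have ih : (P \x pi)%E.-integrable setT (EFin \o (fun w => (w.2.2 - post pi t (V t w)) * \1_B (V t w))).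
    apply: (@integrable_dom _ _ _ (P \x pi)%E _ (fun w => `|w.2.2 - post pi t (V t w)|)) => [||w] //.
      by apply: measurable_funM => //; case: sB.
    by rewrite normrM ler_piMr// indicE; case: (_ \in _); rewrite ?normr1 ?normr0.
  exact: (cond_exp_orth (measurable_observation tT') (ce hpi tT') mi ih).
rewrite -[RHS]orth; congr fine.
have [msq isq] := sqintB (sqint_post hpi tT') sphi.
have ae0 : {ae (P \x pi)%E, forall w, ((post pi t (V t w) - phi (V t w)) ^+ 2)%:E = 0%E}.
  apply: ge0_integral_eq0_ae.
  - by apply/measurable_EFinP; exact: measurable_funX.
  - by move=> w; rewrite lee_fin sqr_ge0.
  - move: phiE; rewrite /Rintegral => e; rewrite -[LHS]fineK ?e//.
    exact: (integrable_fin_num measurableT isq).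
apply: ae_eq_integral => //.
- by apply/measurable_EFinP; apply: measurable_funB; apply: measurable_funM => //; exact: mVt.
- apply/measurable_EFinP; apply: measurable_funM => //.
  by case: (sqintB (sqint_X1 hpi) (sqint_post hpi tT')).
apply: filterS ae0 => w [/eqP]; rewrite sqrf_eq0 subr_eq0 => /eqP e _.
by rewrite -mulrBl upn e.
Qed.

(** The balance over all sets equates the unnormalised posterior expectations at almost every
    [(x, z)]. The factor [C] of the likelihood that does not involve [y] then cancels. *)
Lemma bayes_ae : {ae mu, forall x, {ae lebesgue_measure, forall z : R,
  tmom (klaw k x) (tilt_rate t) 1 (tilt_slope t * z - tilt_shift x t) =
  phi (x, z) * tmom (klaw k x) (tilt_rate t) 0 (tilt_slope t * z - tilt_shift x t)}}.
Proof.
have [p0 p1 c0] := coefficients_gt0 hT01 hf ha hb hfA tT.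
have r0 : 0 < tilt_rate t by rewrite divr_gt0// !mulr_gt0.
have k0 (u : R * R * R -> R) : (forall w, 0 <= u w) -> forall q, (0 <= ker (EFin \o u) q)%E.
  move=> u0 q; apply: integral_ge0 => y _.
  by apply: (@pdfF_ge0 (EFin \o u) ((q.1, y), q.2)) => w; rewrite lee_fin.
have ik (u : R * R * R -> R) : measurable_fun setT u -> (forall w, 0 <= u w) -> u = up \/ u = un ->
    (mu \x lebesgue_measure)%E.-integrable setT (ker (EFin \o u)).
  move=> mu' u0 h; apply/integrableP; split.
    by apply: measurable_ker => [|w]; [exact/measurable_EFinP|rewrite lee_fin].
  under eq_integral do rewrite gee0_abs ?k0//.
  rewrite -integral_ker; first last.
  - by move=> w; rewrite lee_fin.
  - exact/measurable_EFinP.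
  have /integrableP[_] := iu h mu'; under eq_integral do rewrite gee0_abs ?lee_fin//.
  exact.
have ip := ik _ mup up0 (or_introl erefl); have iq := ik _ mun un0 (or_intror erefl).
have := integral_ae_eq measurableT ip (measurable_int _ iq) (fun B _ mB => balance mB).
move=> h; have {h} : {ae (mu \x lebesgue_measure)%E, forall q, ker (EFin \o up) q = ker (EFin \o un) q}.
  by apply: filterS h => q; exact.
move=> /ae_sections; apply: filterS => x; apply: ae_lebesgueS => z.
have [C C0 pE] := pdf_tilt x z tT.
set tau := tilt_slope t * z - _ => e; set kx := klaw k x.
have tg := tail_gauss kx r0.
have iy n : kx.-integrable setT (EFin \o (fun y => C * (y ^+ n * expR (tau * y) * expR (- tilt_rate t * y ^+ 2)))).
  by have := integrableZl measurableT C (wmom_integrable n tau tg); apply: eq_integrable.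
have my : measurable_fun setT (fun y : R => ((x, y), z)).
  by apply: measurable_fun_pair => //; exact: measurable_fun_pair.
have ipd u : measurable_fun setT u -> u = up \/ u = un ->
    kx.-integrable setT (EFin \o (fun y => pdf t (x, y) z * u ((x, y), z))).
  move=> mu' h.
  have i1 := integrableD measurableT (integrable_abse (iy 1%N)) (integrableZl measurableT `|phi (x, z)| (iy 0%N)).
  apply: (@integrable_dom _ _ _ kx _ (fun y => `|C * (y ^+ 1 * expR (tau * y) * expR (- tilt_rate t * y ^+ 2))| +
     `|phi (x, z)| * (C * (y ^+ 0 * expR (tau * y) * expR (- tilt_rate t * y ^+ 2))))) => [||y].
  - by apply: measurable_funM; [exact: (measurableT_comp (measurable_pdf t) my)|exact: measurableT_comp mu' my].
  - by move: i1; apply: eq_integrable.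
  rewrite normrM pE; have := ub h ((x, y), z) => /= hu.
  rewrite -/tau -/(tilt_rate t) expr1 expr0 mul1r !normrM (gtr0_norm C0) !(gtr0_norm (expR_gt0 _)).
  move: hu (expR_ge0 (tau * y)) (expR_ge0 (- tilt_rate t * y ^+ 2)).
  move: (expR _) (expR _) `|u _| `|phi _| `|y| (ltW C0) => a e' v w' y' C0' hu a0 e0.
  have Cae : 0 <= C * (e' * a) by rewrite !mulr_ge0.
  by apply: le_trans (ler_wpM2l Cae hu) _; rewrite le_eqVlt; apply/orP; left; apply/eqP; ring.
have jp := ipd _ mup (or_introl erefl); have jq := ipd _ mun (or_intror erefl).
have e1 : \int[kx]_y (pdf t (x, y) z * up ((x, y), z)) = \int[kx]_y (pdf t (x, y) z * un ((x, y), z)).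
  by congr fine; exact: e.
have e2 := RintegralB measurableT jp jq.
have e3 : \int[kx]_y (C * (y ^+ 1 * expR (tau * y) * expR (- tilt_rate t * y ^+ 2)) -
    phi (x, z) * (C * (y ^+ 0 * expR (tau * y) * expR (- tilt_rate t * y ^+ 2)))) = 0.
  rewrite -[RHS](subrr (\int[kx]_y (pdf t (x, y) z * un ((x, y), z)))) -{1}e1 -e2.
  apply: eq_Rintegral => y _; rewrite -mulrBr upn pE /= -/tau.
  by move: (expR _) (expR _) (phi _) => a b p; ring.
move: e3; rewrite RintegralB//; last first.
  by have := integrableZl measurableT (phi (x, z)) (iy 0%N); apply: eq_integrable.
rewrite !RintegralZl//; first last.
- exact: wmom_integrable tg.
- exact: wmom_integrable tg.
rewrite -/(wmom kx _ 1 tau) -/(wmom kx _ 0 tau) -/(tmom kx _ 1 tau) -/(tmom kx _ 0 tau).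
move: (tmom _ _ 1 _) (tmom _ _ 0 _) (phi _) => a b p h.
have : C * (a - p * b) = 0 by rewrite -h; ring.
by move/eqP; rewrite mulf_eq0 gt_eqF//= subr_eq0 => /eqP.
Qed.

End posterior_kernel.

(** * Couplings with the same posterior mean *)

Section rigidity.
Variables (pi0 pi1 : probability (R * R)%type R) (k0 k1 : R.-pker R ~> R).
Hypotheses (h0 : MC pi0) (h1 : MC pi1).
Hypotheses (hk0 : conditional_law mu pi0 k0) (hk1 : conditional_law mu pi1 k1).

(** A common [phi] gives the cross-multiplied equality of tilted moments for almost every [z].
    Continuity extends it to all [z], and [z] reaches every tilt because the slope is positive. *)
Lemma posterior_rigidity t (phi : R * R -> R) : T0 < t < T1 -> measurable_fun setT phi ->
  sqint (P \x pi0)%E (phi \o V t) -> sqint (P \x pi1)%E (phi \o V t) ->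
  \int[(P \x pi0)%E]_w (post pi0 t (V t w) - phi (V t w)) ^+ 2 = 0 ->
  \int[(P \x pi1)%E]_w (post pi1 t (V t w) - phi (V t w)) ^+ 2 = 0 ->
  forall C, measurable C -> pi0 C = pi1 C.
Proof.
move=> tT mphi s0 s1 e0 e1; apply: (coupling_eq_of_klaw hk0 hk1).
have [p0 p1 c0] := coefficients_gt0 hT01 hf ha hb hfA tT.
have r0 : 0 < tilt_rate t by rewrite divr_gt0// !mulr_gt0.
have sl0 : 0 < tilt_slope t by rewrite invr_gt0 mulr_gt0.
have b0 := bayes_ae h0 hk0 tT mphi s0 e0; have b1 := bayes_ae h1 hk1 tT mphi s1 e1.
apply: filterS2 b0 b1 => x a0 a1; apply: (tmean_injective r0).
pose tau (z : R) := tilt_slope t * z - tilt_shift x t.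
have ctau : continuous tau.
  by move=> z; apply: cvgB; [apply: cvgM; [exact: cvg_cst|exact: cvg_id]|exact: cvg_cst].
have cm k n : continuous (fun z => tmom k (tilt_rate t) n (tau z)).
  move=> z; apply: (@continuous_comp _ _ _ tau (tmom k (tilt_rate t) n)); first exact: ctau.
  have [dm _] := is_derive_tmom k n (tau z) r0.
  by apply: differentiable_continuous; exact/derivable1_diffP.
have E : forall z, tmom (klaw k0 x) (tilt_rate t) 1 (tau z) * tmom (klaw k1 x) (tilt_rate t) 0 (tau z) =
    tmom (klaw k1 x) (tilt_rate t) 1 (tau z) * tmom (klaw k0 x) (tilt_rate t) 0 (tau z).
  apply: continuous_eq_of_ae.
  - by move=> z; apply: cvgM; exact: cm.
  - by move=> z; apply: cvgM; exact: cm.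
  - have := ae_lebesgueI a0 a1; apply: ae_lebesgueS => z [].
    by rewrite -/(tau z) => -> ->; rewrite mulrAC.
move=> u; have := E ((u + tilt_shift x t) / tilt_slope t).
rewrite (_ : tau _ = u)// /tau.
by move: (tilt_shift x t) (tilt_slope t) sl0 => a b b0'; field; rewrite gt_eqF.
Qed.

End rigidity.

(** The constant [C] of the likelihood cancels in the quotient, so the function of condition (d) is
    a tilted mean of the conditional law. *)
Let posterior_tmean k t x z : T0 < t < T1 ->
  rap_V g0 g1 fA k t z x / rap_K g0 g1 fA k t z x =
  tmean (klaw k x) (tilt_rate t) (tilt_slope t * z - tilt_shift x t).
Proof.
move=> tT; have [p0 p1 c0] := coefficients_gt0 hT01 hf ha hb hfA tT.
have r0 : 0 < tilt_rate t by rewrite divr_gt0// !mulr_gt0.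
have [_ _ fAE] := arcade_normal hT01 hf ha hb hfA tT.
have [C C0 pE] := pdf_tilt x z tT; set tau := tilt_slope t * z - _ in pE *.
have fE y : fA t (z - g0 t * x - g1 t * y) = C * (expR (tau * y) * expR (- tilt_rate t * y ^+ 2)).
  by rewrite -pE fAE /pdf /= opprD addrA.
have tg := tail_gauss (klaw k x) r0.
have iE n (f : R -> R) : (forall y, f y = C * (y ^+ n * expR (tau * y) * expR (- tilt_rate t * y ^+ 2))) ->
    \int[k x]_y f y = C * tmom (klaw k x) (tilt_rate t) n tau.
  move=> fE'; rewrite klaw_Rintegral -RintegralZl//; last exact: wmom_integrable tg.
  by apply: eq_Rintegral => y _.
rewrite /rap_V /rap_K (iE 1%N) => [|y]; last first.
  by rewrite fE expr1; move: (expR _) (expR _) => a b; ring.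
rewrite (iE 0%N) => [|y]; last by rewrite fE expr0 mul1r.
have := tmom0_gt0 (klaw k x) tau r0; rewrite /tmean.
move: (tmom _ _ 1 _) (tmom _ _ 0 _) => a b b0; field.
by rewrite !gt_eqF.
Qed.

(** At [T0] the arcade process vanishes and the randomised process equals [X0], an arbitrary real on
    the product space. *)
Let process_imageT : process_image T0 T1 I = setT.
Proof.
have [_ _ [g00 _] [g10 _]] := hg; have [_ _ [f00 _] [f10 _]] := hf.
have [w _] : [set: Omega] !=set0.
  apply/set0P/eqP => e; have := probability_setT P; rewrite e measure0 => /eqP.
  by rewrite eq_sym onee_eq0.
apply/seteqP; split=> // x _; exists T0, (w, (x, 0)); split; first by rewrite lexx ltW.
by rewrite /I /rap /arcade /= g00 g10 f00 f10; ring.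
Qed.

Let interior_continuous (f : R -> R) t : {within `[T0, T1], continuous f} -> T0 < t < T1 ->
  {for t, continuous f}.
Proof. by move=> /(continuous_within_itvP _ hT01)[cf _ _] tT; apply: cf; rewrite in_itv. Qed.

Lemma singular_rigidity pi0 pi1 pih : MC pi0 -> MC pi1 -> MC pih -> half_mixture pi0 pi1 pih ->
  (forall pi, pi = pi0 \/ pi = pi1 \/ pi = pih -> regular_posterior_mean T0 T1 g0 g1 fA I mu pi) ->
  {ae lebesgue_measure, forall t : R, T0 < t < T1 -> is_derive t (1 : R) tilt_rate 0} ->
  forall C, measurable C -> pi0 C = pi1 C.
Proof.
move=> h0 h1 hh hm reg drho.
have [k0 c0 [N0 [fN0 _ r0]]] := reg pi0 (or_introl erefl).
have [k1 c1 [N1 [fN1 _ r1]]] := reg pi1 (or_intror (or_introl erefl)).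
have [kh ch [Nh [fNh _ rh]]] := reg pih (or_intror (or_intror erefl)).
apply: (coupling_eq_of_klaw c0 c1).
have [imu inu] : mu.-integrable setT (EFin \o id) /\ nu.-integrable setT (EFin \o id).
  by split; apply: sqint_integrable; split=> //.
have e0 := klaw_mean h0 c0 imu inu; have e1 := klaw_mean h1 c1 imu inu.
have mx := klaw_ae_mixture hm c0 c1 ch.
have [cf0 cf1 [f00 _] [f10 _]] := hf.
have pos t : T0 < t < T1 -> [/\ 0 < f0 t, 0 < f1 t & 0 < c].
  by move=> tT; exact: (coefficients_gt0 hT01 hf ha hb hfA tT).
apply: filterS2 (filterI r0 r1) (filterI (filterI e0 e1) (filterI rh mx)).
move=> x [C0 C1] [[[i0 m0] [i1 m1]] [Ch mix]].
(* Enlarging the exceptional times to a common finite set gives the three regularity statements one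
   domain. *)
have C1sub (N N' : set R) (F : R * R -> R^o) : N `<=` N' ->
    C2_on ((`]T0, T1[ `\` N) `*` process_image T0 T1 I) F -> C1_on ((`]T0, T1[ `\` N') `*` setT) F.
  move=> NN' [hF _ _] p [[p1 pN] _]; apply: hF; rewrite process_imageT.
  by split=> //; split=> // /NN'.
apply: (@singular_clock R T0 T1 (klaw k0 x) (klaw k1 x) (klaw kh x) hT01 mix i0 i1 (etrans m0 (esym m1))
  tilt_slope (tilt_shift x) tilt_rate (N0 `|` N1 `|` Nh)).
- by rewrite !finite_setU.
- by move=> t tT; have [p0 p1 cp] := pos t tT; rewrite invr_gt0 mulr_gt0.
- by move=> t tT; have [p0 p1 cp] := pos t tT; rewrite divr_gt0// !mulr_gt0.
- move=> t tT; have [p0 p1 cp] := pos t tT; apply: cvgV; first by rewrite gt_eqF// mulr_gt0.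
  by apply: cvgM; [exact: cvg_cst|exact: interior_continuous].
- move=> t tT; have [p0 p1 cp] := pos t tT; apply: cvgM; first exact: interior_continuous.
  apply: cvgV; first by rewrite gt_eqF// !mulr_gt0.
  by apply: cvgM; [exact: cvg_cst|exact: interior_continuous].
- move=> e ep; have cp := bridge_det_gt0 hT01 hf ha hb hfA.
  move: cf0 cf1 => /(continuous_within_itvP _ hT01)[_ l0 _] /(continuous_within_itvP _ hT01)[_ l1 _].
  have lr : tilt_rate u @[u --> T0^'+] --> (0 : R).
    rewrite (_ : 0 = f1 T0 / (2 * c * f0 T0)); last by rewrite f10 mul0r.
    apply: cvgM; first exact: l1.
    apply: cvgV; first by rewrite f00 mulr1 gt_eqF// mulr_gt0.
    by apply: cvgM; [exact: cvg_cst|exact: l0].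
  move/cvgrPdist_lt: lr => /(_ e ep) lr.
  have ev : \forall u \near T0^'+, (T0 < u < T1) /\ tilt_rate u < e.
    near=> u; split.
      by apply/andP; split; near: u; [exact: nbhs_right_gt|exact: nbhs_right_lt].
    have : `|0 - tilt_rate u| < e by near: u.
    by rewrite sub0r normrN; apply: le_lt_trans (ler_norm _).
  by have [u [uT ue]] := filter_ex ev; exists u.
- exact: drho.
- have mk (k : R.-pker R ~> R) N : N `<=` N0 `|` N1 `|` Nh ->
     C2_on ((`]T0, T1[ `\` N) `*` process_image T0 T1 I)
       (fun p => rap_V g0 g1 fA k p.1 p.2 x / rap_K g0 g1 fA k p.1 p.2 x) ->
     exists2 F : R * R -> R^o, C1_on ((`]T0, T1[ `\` (N0 `|` N1 `|` Nh)) `*` setT) F &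
       forall t z, T0 < t < T1 -> F (t, z) = tmean (klaw k x) (tilt_rate t) (tilt_slope t * z - tilt_shift x t).
    move=> sN hC; exists (fun p => rap_V g0 g1 fA k p.1 p.2 x / rap_K g0 g1 fA k p.1 p.2 x).
      exact: C1sub sN hC.
    by move=> t z tT; exact: posterior_tmean.
  move=> k [->|[->|->]].
  + by apply: mk C0 => y Ny; left; left.
  + by apply: mk C1 => y Ny; left; right.
  + by apply: mk Ch => y Ny; right.
Unshelve. all: by end_near.
Qed.

Hypothesis hd : forall pi, MC pi -> regular_posterior_mean T0 T1 g0 g1 fA I mu pi.
Hypothesis domega : {ae lebesgue_measure, forall t : R, T0 < t < T1 -> om t = 0 ->
  is_derive t (1 : R) (fun t => f1 t / (2 * c * f0 t)) 0}.
Hypothesis hmunu : convex_order mu nu.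

Let mid pi0 pi1 t := (mmse pi0 t + mmse pi1 t) / 2.

Let mmse_mid pi0 pi1 pih t : MC pi0 -> MC pi1 -> MC pih -> half_mixture pi0 pi1 pih ->
  T0 <= t <= T1 -> mid pi0 pi1 t <= mmse pih t.
Proof.
move=> h0 h1 hh hm tT; have [_ [_ ->]] := mmse_mixture h0 h1 hh hm tT.
rewrite /mid ler_pM2r ?invr_gt0//; apply: lerD; rewrite lerDl;
  by apply: Rintegral_ge0 => // w _; exact: sqr_ge0.
Qed.

Let integrable_gap pi0 pi1 pih : MC pi0 -> MC pi1 -> MC pih ->
  lebesgue_measure.-integrable `]T0, T1[ (EFin \o (fun t => om t * (mmse pih t - mid pi0 pi1 t))) /\
  \int[lebesgue_measure]_(t in `]T0, T1[) (om t * (mmse pih t - mid pi0 pi1 t)) =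
  value pih - (value pi0 + value pi1) / 2.
Proof.
move=> h0 h1 hh.
have mD : measurable (`]T0, T1[%classic : set (measurableTypeR R)) by exact: measurable_itv.
have i0 := integrable_om_mmse h0; have i1 := integrable_om_mmse h1; have ih := integrable_om_mmse hh.
have i01 : lebesgue_measure.-integrable `]T0, T1[ (EFin \o (fun t => om t * mmse pi0 t + om t * mmse pi1 t)).
  by have := integrableD mD i0 i1; apply: eq_integrable.
have i2 : lebesgue_measure.-integrable `]T0, T1[ (EFin \o (fun t => 2^-1 * (om t * mmse pi0 t + om t * mmse pi1 t))).
  by have := integrableZl mD 2^-1 i01; apply: eq_integrable.
have E : (fun t => om t * (mmse pih t - mid pi0 pi1 t)) =
    (fun t => om t * mmse pih t - 2^-1 * (om t * mmse pi0 t + om t * mmse pi1 t)).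
  by apply/funext => t; rewrite /mid; move: (om t) (mmse _ _) (mmse _ _) (mmse _ _) => o x y z; field.
rewrite E; split; first by have := integrableB mD ih i2; apply: eq_integrable.
apply: etrans (RintegralB mD ih i2) _; congr (_ - _).
apply: etrans (RintegralZl 2^-1 mD i01) _; rewrite mulrC; congr (_ / _).
exact: RintegralD mD i0 i1.
Qed.

Lemma value_mid pi0 pi1 pih : MC pi0 -> MC pi1 -> MC pih -> half_mixture pi0 pi1 pih ->
  (value pi0 + value pi1) / 2 <= value pih.
Proof.
move=> h0 h1 hh hm; have [_ e] := integrable_gap h0 h1 hh.
rewrite -subr_ge0 -e; apply: Rintegral_ge0 => t; rewrite /= in_itv/= => tT.
by rewrite mulr_ge0// subr_ge0; apply: mmse_mid => //; exact: cl.
Qed.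

(** Equality makes the weighted gap vanish at almost every time. Either some time has both positive
    weight and zero gap, or the weight itself is zero almost everywhere and the clock is
    singular. *)
Lemma value_rigidity pi0 pi1 pih : MC pi0 -> MC pi1 -> MC pih -> half_mixture pi0 pi1 pih ->
  value pih = (value pi0 + value pi1) / 2 -> forall C, measurable C -> pi0 C = pi1 C.
Proof.
move=> h0 h1 hh hm hv.
have mD : measurable (`]T0, T1[%classic : set (measurableTypeR R)) by exact: measurable_itv.
have [ig e] := integrable_gap h0 h1 hh; rewrite hv subrr in e.
pose G := (EFin \o (fun t => om t * (mmse pih t - mid pi0 pi1 t))) \_ `]T0, T1[%classic.
have Gt t : T0 < t < T1 -> G t = (om t * (mmse pih t - mid pi0 pi1 t))%:E.
  by move=> tT; rewrite /G patchE mem_set//= in_itv.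
have ae0 : {ae lebesgue_measure, forall t : R, G t = 0%E}.
  apply: ge0_integral_eq0_ae.
  - by apply/(measurable_restrictT _ mD); exact: (measurable_int _ ig).
  - move=> t; rewrite /G patchE; case: ifPn => // /set_mem /=; rewrite in_itv/= => tT.
    by rewrite lee_fin mulr_ge0// subr_ge0; apply: mmse_mid => //; exact: cl.
  - rewrite /G -integral_mkcond; apply: etrans (esym (fineK _)) _.
      exact: (integrable_fin_num mD ig).
    by congr EFin.
have [[t [tT ot gt]]|noclock] := pselect (exists t, [/\ T0 < t < T1, om t != 0 & mmse pih t = mid pi0 pi1 t]).
  have [k0 c0 _] := hd h0; have [k1 c1 _] := hd h1.
  have [s0 [s1 eh]] := mmse_mixture h0 h1 hh hm (cl tT).
  have z0 : 0 <= \int[(P \x pi0)%E]_w (post pi0 t (V t w) - post pih t (V t w)) ^+ 2.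
    by apply: Rintegral_ge0 => // w _; exact: sqr_ge0.
  have z1 : 0 <= \int[(P \x pi1)%E]_w (post pi1 t (V t w) - post pih t (V t w)) ^+ 2.
    by apply: Rintegral_ge0 => // w _; exact: sqr_ge0.
  (* The gap is the average of the two nonnegative mean square distances to the posterior mean of
     the midpoint, so both are 0. *)
  have [q0 q1] : \int[(P \x pi0)%E]_w (post pi0 t (V t w) - post pih t (V t w)) ^+ 2 = 0 /\
     \int[(P \x pi1)%E]_w (post pi1 t (V t w) - post pih t (V t w)) ^+ 2 = 0.
    move: gt eh z0 z1; rewrite /mid => ->.
    move: (mmse pi0 t) (mmse pi1 t) (\int[_]_w _) (\int[_]_w _) => x y a b.
    have n2 : (2 : R)^-1 != 0 by rewrite invr_eq0 pnatr_eq0.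
    move=> /(mulIf n2); rewrite addrACA => /esym/eqP.
    by rewrite -[eqbRHS]addr0 (inj_eq (addrI _)) => h b0 a0; move: h; rewrite paddr_eq0// => /andP[/eqP-> /eqP->].
  exact: (posterior_rigidity h0 h1 c0 c1 tT (measurable_post t hh) s0 s1 q0 q1).
apply: (singular_rigidity h0 h1 hh hm) => [pi [->|[->|->]]|]; [exact: hd|exact: hd|exact: hd|].
have := ae_lebesgueI ae0 domega; apply: ae_lebesgueS => t [g0t dt] tT; apply: dt => //.
move: g0t; rewrite Gt// => -[/eqP]; rewrite mulf_eq0 subr_eq0 => /orP[/eqP//|/eqP gt].
by apply/eqP; apply: contrapT => /negP ot; apply: noclock; exists t.
Qed.

Let integrable_marginals : mu.-integrable setT (EFin \o id) /\ nu.-integrable setT (EFin \o id).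
Proof. by split; apply: sqint_integrable; split. Qed.

Lemma maximiser : exists ps : probability (R * R)%type R,
  [/\ MC ps, forall pi, MC pi -> value pi <= value ps &
      forall pi, MC pi -> value pi = value ps -> forall C, measurable C -> pi C = ps C].
Proof.
have [imu inu] := integrable_marginals.
have [p0 hp0] := strassen imu inu hmunu.
pose E := [set value pi | pi in MC].
have supE : has_sup E.
  split; first by exists (value p0), p0.
  exists (\int[lebesgue_measure]_(t in `]T0, T1[) bd t) => _ [pi hpi <-].
  by have /andP[] := value_itv hpi.
have leE pi : MC pi -> value pi <= sup E by move=> hpi; apply: ub_le_sup; [exact: (proj2 supE)|exists pi].
pose Sn n := [set pi : probability (R * R)%type R | MC pi /\ sup E - n.+1%:R^-1 <= value pi].
have [||||p [Q_ [Q [pS mQ_ pE Qcvg [mXQ psM]]]]] := @coupling_compactness R mu nu Sn imu inu.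
- move=> n p [hp _]; split=> //; have [k hk _] := hd hp.
  by eexists; exact: conditional_law_cdf hk.
- move=> n; have n0 : 0 < n.+1%:R^-1 :> R by rewrite invr_gt0.
  have [_ [pi hpi <-] /ltW h] := sup_adherent n0 supE; by exists pi.
- move=> i j ij p [hp h]; split=> //; apply: le_trans h; rewrite lerD2l lerN2.
  by rewrite lef_pV2 ?posrE// ler_nat.
- move=> n p q [hp vp] [hq vq].
  have [r hr hm] := martingale_coupling_half imu inu hp hq; exists r; last exact: hm.
  split; first exact: hr.
  apply: le_trans (value_mid hp hq hr hm).
  exact: le_half_sum vp vq.
have mQ : measurable_fun setT Q by exact: measurableT_comp measurable_snd mXQ.
have vs : sup E <= value (law (mu \x unif)%E mXQ).
  apply: (@value_usc p _ Q_ Q) => //.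
  - by move=> j; have [] := pS j.
  - by move=> j; have [] := pS j.
move: psM vs; move: (law _ mXQ) => ps psM vs.
exists ps; split; [exact: psM|by move=> pi hpi; exact: le_trans (leE _ hpi) vs|move=> pi hpi vE].
have [r hr hm] := martingale_coupling_half imu inu hpi psM.
apply: (value_rigidity hpi psM hr hm); apply/le_anti/andP; split; last exact: value_mid hpi psM hr hm.
by rewrite vE; apply: le_trans (leE _ hr) _; apply: le_half_sum.
Qed.

End coupling_problem.

Theorem proposition3p8 (R : realType)
    (T0 T1 : R) (hT0 : 0 <= T0) (hT01 : T0 < T1)
    (mu nu : probability R R)
    (hmu : finite_second_moment mu) (hnu : finite_second_moment nu)
    (hmunu : convex_order mu nu)
    (d : measure_display) (Omega : measurableType d) (P : probability Omega R)
    (D : R -> Omega -> R) (f0 f1 g0 g1 H1 H2 : R -> R)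
    (fA : R -> R -> R)
    (M : probability (R * R)%type R -> R -> R -> R -> R)
    (hDcont : sample_continuous T0 T1 D)
    (hDneq0 : forall t, T0 < t < T1 -> (P [set w | D t w = 0%R] < 1)%E)
    (hf : interpolating T0 T1 f0 f1) (hg : interpolating T0 T1 g0 g1)
    (ha : gauss_markov_driver P T0 T1 H1 H2 D)
    (hb : standard_coefficients T0 T1 H1 H2 f0 f1 g1)
    (hc : forall pi, martingale_coupling mu nu pi ->
      semimartingale (P \x pi)%E T0 T1 (rap T0 T1 f0 f1 g0 g1 D))
    (hfA : forall t, T0 < t < T1 ->
      continuous_density P (arcade T0 T1 f0 f1 D t) (fA t))
    (hd : forall pi, martingale_coupling mu nu pi ->
      regular_posterior_mean T0 T1 g0 g1 fA (rap T0 T1 f0 f1 g0 g1 D) mu pi)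
    (hM : forall pi, martingale_coupling mu nu pi ->
      posterior_mean_version P T0 T1 (rap T0 T1 f0 f1 g0 g1 D) pi (M pi)) :
  let I := rap T0 T1 f0 f1 g0 g1 D in
  let KI := fun pi => K_functional P T0 T1 H1 H2 I (M pi) pi in
  exists pistar : probability (R * R)%type R,
    [/\ martingale_coupling mu nu pistar,
        ereal_sup [set KI pi | pi in martingale_coupling mu nu] = KI pistar &
        forall pi, martingale_coupling mu nu pi ->
          KI pi = ereal_sup [set KI pi' | pi' in martingale_coupling mu nu] ->
          forall A, measurable A -> pi A = pistar A].
Proof.
move=> I KI.
have [om [mom om0 omE domega iom]] := clock_weight_measurable hT01 hf ha hb hfA.
have [ps [hps le_ps uniq_ps]] :=
  maximiser hT01 hmu hnu hDcont hf hg ha hb hfA hM mom om0 iom hd domega hmunu.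
have KE pi : martingale_coupling mu nu pi -> KI pi = (value T0 T1 P D f0 f1 g0 g1 M om pi)%:E.
  by move=> hpi; exact: (K_functionalE hT01 hmu hnu hDcont hf hg ha hb hfA hM mom om0 omE iom hpi).
have supE : ereal_sup [set KI pi | pi in martingale_coupling mu nu] = KI ps.
  apply/le_anti/andP; split; last by apply: ereal_sup_ubound; exists ps.
  by apply: ge_ereal_sup => _ [pi hpi <-]; rewrite (KE _ hpi) (KE _ hps) lee_fin; exact: le_ps.
exists ps; split; [exact: hps|exact: supE|move=> pi hpi vE].
have vE' : value T0 T1 P D f0 f1 g0 g1 M om pi = value T0 T1 P D f0 f1 g0 g1 M om ps.
  apply: EFin_inj; exact: etrans (esym (KE _ hpi)) (etrans vE (etrans supE (KE _ hps))).
exact: (uniq_ps pi hpi vE').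
Qed.
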